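(* Let $m\neq n$ be nonnegative integers, let $\mathcal H=\mathcal{SL}_{m|n}[[y_{ij},z_{ij}]]$ be the Hopf superalgebra of the graded real supergroup $SL(m|n,\mathbb C)^{\mathbb R}$, with its graded $\bigstar$-structure, Hopf ideals $I,J$, Lie superalgebra $\mathfrak d$ with scalar product $(\cdot,\cdot)_{\mathfrak d}$ and operator $R_{\mathfrak d}$ (all defined in the context). Let $(h_a)$ be a homogeneous basis of $\mathfrak d$, let $(\hat h_a)$ be the dual basis, i.e. $(h_a,\hat h_b)_{\mathfrak d}=\delta_{ab}$, and write $|a|=|h_a|$. Equip $\mathcal H$ with the superbracket $$\{f,g\}=\frac12\sum_{a,b}(-1)^{|f||a|}\,(R_{\mathfrak d}(\hat h_a),\hat h_b)_{\mathfrak d}\,\bigl[\nabla^L_{h_a}f\;\nabla^L_{h_b}g-\nabla^R_{h_a}f\;\nabla^R_{h_b}g\bigr],\qquad f,g\in\mathcal H ,$$ ($f$ homogeneous, extended bilinearly). Then: (i) $\{\cdot,\cdot\}$ is a Poisson-Lie superbracket on $\mathcal H$; (ii) $I$ and $J$ are Poisson ideals, i.e. $\{I,\mathcal H\}\subset I$ and $\{J,\mathcal H\}\subset J$; (iii) $\{f^\bigstar,g^\bigstar\}=\{f,g\}^\bigstar$ for all $f,g\in\mathcal H$, where $y_{ij}^\bigstar=(-1)^{(|i|+|j|)|j|}S(z_{ji})$ and $z_{ij}^\bigstar=(-1)^{(|i|+|j|)|j|}S(y_{ji})$.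
   Context: Parities: $|i|=0$ for $1\le i\le m$ and $|i|=1$ for $m+1\le i\le m+n$; $|f|\in\mathbb Z/2$ is the parity of a homogeneous element $f$. Sweedler notation $\Delta(f)=f'\otimes f''$. Tensor products of formal power series superalgebras are completed. $\mathbb C[[x_{ij}]]$ ($1\le i,j\le m+n$) is the supercommutative superalgebra of formal power series in generators $x_{ij}$ of parity $|i|+|j|$, a Hopf superalgebra with $\Delta(x_{ij})=1\otimes x_{ij}+x_{ij}\otimes1+\sum_k x_{ik}\otimes x_{kj}$, $\varepsilon(x_{ij})=0$, $S(x_{ij})=-\delta_{ij}+((1+X)^{-1})_{ij}$, where $X=(x_{ij})$ and $\Delta,\varepsilon,S$ are superalgebra morphisms. $\mathcal{SL}_{m|n}[[x_{ij}]]$ is its quotient by the Hopf ideal generated by $\mathrm{sdet}(1+X)-1$, where $\mathrm{sdet}\begin{pmatrix}A&B\\C&D\end{pmatrix}=\det(A-BD^{-1}C)/\det D$ ($A$ of size $m\times m$, $D$ of size $n\times n$). $\mathcal H=\mathcal{SL}_{m|n}[[y_{ij},z_{ij}]]=\mathcal{SL}_{m|n}[[y_{ij}]]\otimes\mathcal{SL}_{m|n}[[z_{ij}]]$. The map $\bigstar:\mathcal H\to\mathcal H$ is the even, antilinear, multiplicative map ($(fg)^\bigstar=f^\bigstar g^\bigstar$) given on generators by $y_{ij}^\bigstar=(-1)^{(|i|+|j|)|j|}S(z_{ji})$, $z_{ij}^\bigstar=(-1)^{(|i|+|j|)|j|}S(y_{ji})$; it satisfies $(f^\bigstar)^\bigstar=(-1)^{|f|}f$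 and is compatible with $\Delta,\varepsilon,S$ (with complex conjugation on $\mathbb C$). $I\subset\mathcal H$ is the Hopf ideal generated by $y_{ij}-z_{ij}$ for all $i,j$. $J\subset\mathcal H$ is the Hopf ideal generated by $y_{ji}$ and $z_{ij}$ for all $i>j$ and by $S(y_{ii})-z_{ii}$ for all $i$. An $\varepsilon$-derivation of a Hopf superalgebra $H$ is a linear map $\delta:H\to\mathbb C$ with $\delta(fg)=\varepsilon(f)\delta(g)+\delta(f)\varepsilon(g)$; it is even if it vanishes on $H_1$ and odd if it vanishes on $H_0$. The $\varepsilon$-derivations form the Lie superalgebra of $H$, with bracket $[\delta_1,\delta_2](f)=\delta_1(f')\delta_2(f'')-(-1)^{|\delta_1||\delta_2|}\delta_2(f')\delta_1(f'')$. $sl(m|n,\mathbb C)$ is the Lie superalgebra of complex $(m+n)\times(m+n)$ supermatrices $M=\begin{pmatrix}P&Q\\R&T\end{pmatrix}$ with $\mathrm{Str}M=\mathrm{tr}P-\mathrm{tr}T=0$ (even: $Q=R=0$; odd: $P=T=0$). The Lie superalgebra $\mathfrak d$ of $\mathcal H$ consists of the $\varepsilon$-derivations $\delta_{(A,B)}$, $A,B\in sl(m|n,\mathbb C)$, with $\delta_{(A,B)}(y_{ij})=A_{ij}$, $\delta_{(A,B)}(z_{ij})=B_{ij}$; it is identified with $sl(m|n,\mathbb C)\oplus sl(m|n,\mathbb C)$ via $\delta_{(A,B)}\leftrightarrow(A,B)$. Its scalar product is $((A,B),(C,D))_{\mathfrak d}=-\tfrac i2\mathrm{Str}(AC)+\tfrac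 i2\mathrm{Str}(BD)$. $\mathfrak g=\{(A,A)\}\subset\mathfrak d$, and $\mathfrak b=\{(A,B): A \text{ lower triangular},\ B\text{ upper triangular},\ \text{the diagonal parts satisfy } A_0+B_0=0\}\subset\mathfrak d$; these are the Lie superalgebras of $\mathcal H/I$ and $\mathcal H/J$. One has the vector space decomposition $\mathfrak d=\mathfrak g\dotplus\mathfrak b$; $P_{\mathfrak g},P_{\mathfrak b}$ are the corresponding projections, and $R_{\mathfrak d}=P_{\mathfrak b}-P_{\mathfrak g}$. For homogeneous $h\in\mathfrak d$, viewed as an $\varepsilon$-derivation $\delta_h$: $\nabla^R_h(f)=\delta_h(f')f''$ and $\nabla^L_h(f)=(-1)^{|h|(|f|+1)}f'\delta_h(f'')$. A Poisson-Lie superbracket on a supercommutative Hopf superalgebra $H$ is an even bilinear map $\{\cdot,\cdot\}:H\times H\to H$ such that for homogeneous $f,g,h$: (super-Jacobi) $(-1)^{|f||h|}\{f,\{g,h\}\}+(-1)^{|h||g|}\{h,\{f,g\}\}+(-1)^{|g||f|}\{g,\{h,f\}\}=0$; (super-antisymmetry) $\{f,g\}=-(-1)^{|f||g|}\{g,f\}$; (super-Leibniz) $\{f,gh\}=\{f,g\}h+(-1)^{|f||g|}g\{f,h\}$; (coproduct is Poisson) $\Delta\{f,g\}=\{\Delta(f),\Delta(g)\}$, where on $H\otimes H$ one puts $\{f_1\otimes f_2,g_1\otimes g_2\}=(-1)^{|g_1||f_2|}\{f_1,g_1\}\otimes f_2g_2+(-1)^{|g_1||f_2|}f_1g_1\otimes\{f_2,g_2\}$.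 *)

(* Defs.v *)
From HB Require Import structures.
From mathcomp Require Import fingroup perm.
From mathcomp Require Import all_boot all_order all_algebra.
From mathcomp Require Import complex ring zify.
From mathcomp Require Import boolp classical_sets functions reals.

Set Implicit Arguments.
Unset Strict Implicit.
Unset Printing Implicit Defensive.

Import Order.TTheory GRing.Theory Num.Theory.
Local Open Scope ring_scope.

(* Exponents of the monomials in the variables x_g, g in G, where x_g is odd
   iff p g.  The monomial x^mu is the product of the x_g ^+ mu g in the order
   of enum G; it is nonzero iff mu is admissible, and
   x^mu * x^nu = (-1)^(msign mu nu) x^(mu + nu). *)
Section Monomials.
Variables (G : finType) (p : G -> bool).

Definition mexp := {ffun G -> nat}.
Implicit Types mu nu : mexp.

Definition mdeg mu : nat := (\sum_g mu g)%N.
Definition mgen (g : G) : mexp := [ffun g' => (g' == g : nat)].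
Definition mpar mu : bool := odd (\sum_(g | p g) mu g)%N.
Definition admissible mu : bool := [forall g, p g ==> (mu g <= 1)%N].
Definition msign mu nu : bool :=
  odd (\sum_(s | p s) \sum_(t | p t && (enum_rank t < enum_rank s)%N)
         mu s * nu t)%N.
Definition mbox (k : nat) (a : {ffun G -> 'I_k}) : mexp := [ffun g => a g : nat].

Lemma leq_mdeg mu g : (mu g <= mdeg mu)%N.
Proof. by rewrite /mdeg (bigD1 g) //= leq_addr. Qed.

Lemma mdegD mu nu : mdeg (mu + nu) = (mdeg mu + mdeg nu)%N.
Proof.
by rewrite /mdeg -big_split; apply: eq_bigr => g _; rewrite ffunE.
Qed.

Lemma mboxP k mu : (mdeg mu < k)%N -> exists a : {ffun G -> 'I_k}, mbox a = mu.
Proof.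
move=> lt; have h g : (mu g < k)%N := leq_ltn_trans (leq_mdeg mu g) lt.
by exists [ffun g => Ordinal (h g)]; apply/ffunP=> g; rewrite !ffunE.
Qed.

Lemma mbox_inj k : injective (@mbox k).
Proof.
move=> a b /ffunP e; apply/ffunP=> g; apply: val_inj.
by have := e g; rewrite !ffunE.
Qed.

Lemma admissibleDl mu nu : admissible (mu + nu) -> admissible mu.
Proof.
move=> /forallP h; apply/forallP=> g; apply/implyP=> pg.
have := implyP (h g) pg; rewrite ffunE; exact: leq_trans (leq_addr _ _).
Qed.

Lemma admissibleDr mu nu : admissible (mu + nu) -> admissible nu.
Proof. by rewrite addrC; apply: admissibleDl. Qed.

Lemma msignDl mu mu' nu :
  msign (mu + mu') nu = msign mu nu (+) msign mu' nu.
Proof.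
rewrite /msign -oddD -big_split; congr odd; apply: eq_bigr => s _.
rewrite -big_split; apply: eq_bigr => t _; by rewrite ffunE mulnDl.
Qed.

Lemma msignDr mu nu nu' :
  msign mu (nu + nu') = msign mu nu (+) msign mu nu'.
Proof.
rewrite /msign -oddD -big_split; congr odd; apply: eq_bigr => s _.
rewrite -big_split; apply: eq_bigr => t _; by rewrite ffunE mulnDr.
Qed.

Lemma msign0m nu : msign 0 nu = false.
Proof.
by rewrite /msign big1 // => s _; rewrite big1 // => t _; rewrite ffunE mul0n.
Qed.

Lemma msignm0 mu : msign mu 0 = false.
Proof.
by rewrite /msign big1 // => s _; rewrite big1 // => t _; rewrite ffunE muln0.
Qed.

End Monomials.

(* sps K p is the supercommutative algebra of formal power series over K in
   the x_g; coef f mu is the coefficient of x^mu. *)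
Section SuperPowerSeries.
Variables (K : comNzRingType) (G : finType) (p : G -> bool).
Local Notation mexp := (mexp G).

Definition supported : {pred mexp -> K} :=
  fun f => `[< forall mu, ~~ admissible p mu -> f mu = 0 >].

Lemma supportedP f :
  reflect (forall mu, ~~ admissible p mu -> f mu = 0) (f \in supported).
Proof. exact: asboolP. Qed.

Lemma supported_zmod : zmod_closed supported.
Proof.
split=> [|f g /supportedP hf /supportedP hg]; apply/supportedP=> mu hmu //.
by rewrite !fctE hf // hg // subr0.
Qed.
HB.instance Definition _ :=
  GRing.isZmodClosed.Build (mexp -> K) supported supported_zmod.

Record sps := Sps { coef : mexp -> K; coef_supported : coef \in supported }.
HB.instance Definition _ := [isSub for coef].
HB.instance Definition _ := [Choice of sps by <:].
HB.instance Definition _ := [SubChoice_isSubZmodule of sps by <:].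

Lemma spsP (f g : sps) : (forall mu, coef f mu = coef g mu) <-> f = g.
Proof. by split=> [h|-> //]; apply: val_inj; apply/funext. Qed.

Lemma scoef_nadm (f : sps) mu : ~~ admissible p mu -> coef f mu = 0.
Proof. by move: (coef_supported f) => /supportedP; apply. Qed.

Fact series_key (c : mexp -> K) :
  (fun mu => if admissible p mu then c mu else 0) \in supported.
Proof. by apply/supportedP=> mu /negbTE ->. Qed.
Definition series c : sps := Sps (series_key c).
Arguments series : simpl never.

Lemma coef_series c mu :
  coef (series c) mu = if admissible p mu then c mu else 0.
Proof. by []. Qed.
Lemma coef_seriesE c mu : admissible p mu -> coef (series c) mu = c mu.
Proof. by rewrite coef_series => ->. Qed.

Lemma scoef0 mu : coef (0 : sps) mu = 0. Proof. by []. Qed.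
Lemma scoefD (f g : sps) mu : coef (f + g) mu = coef f mu + coef g mu.
Proof. by []. Qed.
Lemma scoefN (f : sps) mu : coef (- f) mu = - coef f mu.
Proof. by []. Qed.
Lemma scoef_sum I (r : seq I) (P : pred I) (F : I -> sps) mu :
  coef (\sum_(i <- r | P i) F i) mu = \sum_(i <- r | P i) coef (F i) mu.
Proof. by apply: (big_morph (fun f => coef f mu)). Qed.


Fact scale_key c (f : sps) : (fun mu => c * coef f mu) \in supported.
Proof. by apply/supportedP=> mu h; rewrite scoef_nadm ?mulr0. Qed.
Definition sps_scale c f : sps := Sps (scale_key c f).

Fact sps_scaleA c d f : sps_scale c (sps_scale d f) = sps_scale (c * d) f.
Proof. by apply/spsP=> mu; rewrite /= mulrA. Qed.
Fact sps_scale1 : left_id 1 sps_scale.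
Proof. by move=> f; apply/spsP=> mu; rewrite /= mul1r. Qed.
Fact sps_scaleDr : right_distributive sps_scale +%R.
Proof. by move=> c f g; apply/spsP=> mu; rewrite /= mulrDr. Qed.
Fact sps_scaleDl f : {morph sps_scale^~ f : c d / c + d}.
Proof. by move=> c d; apply/spsP=> mu; rewrite /= mulrDl. Qed.
HB.instance Definition _ :=
  GRing.Zmodule_isLmodule.Build K sps sps_scaleA sps_scale1 sps_scaleDr sps_scaleDl.

Lemma scoefZ c (f : sps) mu : coef (c *: f) mu = c * coef f mu.
Proof. by []. Qed.

Definition sps_mul_coef (k : nat) (f g : sps) (mu : mexp) : K :=
  \sum_(ab : {ffun G -> 'I_k} * {ffun G -> 'I_k} | mbox ab.1 + mbox ab.2 == mu)
    (-1) ^+ msign p (mbox ab.1) (mbox ab.2)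
      * coef f (mbox ab.1) * coef g (mbox ab.2).
Definition sps_mul (f g : sps) : sps :=
  series (fun mu => sps_mul_coef (mdeg mu).+1 f g mu).
Definition sps_one : sps := series (fun mu => (mu == 0)%:R).
Arguments sps_mul : simpl never.
Arguments sps_one : simpl never.
Arguments coef : simpl never.

Lemma sum_mbox1 k (F : mexp -> K) nu (P : pred mexp) :
    (P nu -> mdeg nu < k)%N ->
  \sum_(a : {ffun G -> 'I_k} | (nu == mbox a) && P (mbox a)) F (mbox a)
    = if P nu then F nu else 0.
Proof.
move=> lt; case: ifP => [/[dup] Pnu /lt /mboxP[a ea]|nP]; last first.
  by rewrite big_pred0 // => a; case: eqP => //= <-.
rewrite -ea (big_pred1 a) // => b /=; rewrite (inj_eq (@mbox_inj G k)) eq_sym.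
by case: eqP => //= ->; rewrite ea.
Qed.

Lemma sps_mul_coef_widen k k' f g mu :
  (mdeg mu < k <= k')%N -> sps_mul_coef k f g mu = sps_mul_coef k' f g mu.
Proof.
case/andP=> lt le; rewrite /sps_mul_coef.
have k0 : (0 < k)%N by apply: leq_trans lt.
pose w (a : {ffun G -> 'I_k}) : {ffun G -> 'I_k'} :=
  [ffun g => widen_ord le (a g)].
pose s (a : {ffun G -> 'I_k'}) : {ffun G -> 'I_k} :=
  [ffun g => insubd (Ordinal k0) (a g : nat)].
have bw a : mbox (w a) = mbox a by apply/ffunP=> x; rewrite !ffunE.
have sw a : s (w a) = a.
  by apply/ffunP=> x; rewrite !ffunE; apply: val_inj; rewrite val_insubd /= ltn_ord.
have ws a : (mdeg (mbox a) < k)%N -> w (s a) = a.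
  move=> la; apply/ffunP=> x; rewrite !ffunE; apply: val_inj => /=.
  rewrite val_insubd ifT //; apply: leq_ltn_trans la.
  by have := leq_mdeg (mbox a) x; rewrite ffunE.
rewrite [RHS](reindex_onto (fun ab => (w ab.1, w ab.2))
                           (fun ab => (s ab.1, s ab.2))) /=; last first.
  move=> [a b] /= /eqP e; have := mdegD (mbox a) (mbox b); rewrite e => d.
  by rewrite !ws //; apply: leq_ltn_trans lt; rewrite d ?leq_addr ?leq_addl.
by apply: eq_big => [[a b]|[a b] _] /=; rewrite !bw // !sw eqxx andbT.
Qed.

Lemma scoefM k f g mu : admissible p mu -> (mdeg mu < k)%N ->
  coef (sps_mul f g) mu = sps_mul_coef k f g mu.
Proof. by move=> am lt; rewrite coef_seriesE //; apply: sps_mul_coef_widen; rewrite leqnn. Qed.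

Fact sps_mulA : associative sps_mul.
Proof.
move=> f g h; apply/spsP=> mu.
have [am|nam] := boolP (admissible p mu); last by rewrite !scoef_nadm.
pose k := (mdeg mu).+1; rewrite !(@scoefM k) //.
pose X (a b c : mexp) : K := (-1) ^+ (msign p a b (+) msign p a c (+) msign p b c)
   * coef f a * coef g b * coef h c.
pose T := {ffun G -> 'I_k}.
transitivity (\sum_(a : T) \sum_(b : T) \sum_(c : T)
   if mbox a + mbox b + mbox c == mu then X (mbox a) (mbox b) (mbox c) else 0).
  rewrite /sps_mul_coef big_mkcond.
  rewrite -(pair_big xpredT xpredT (fun a b : T => if mbox a + mbox b == mu then
    (-1) ^+ msign p (mbox a) (mbox b) * coef f (mbox a) * coef (sps_mul g h) (mbox b) else 0)) /=.
  apply: eq_bigr => a _.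
  transitivity (\sum_(d : T) \sum_(b : T) \sum_(c : T)
     if (mbox b + mbox c == mbox d) && (mbox a + mbox d == mu) then X (mbox a) (mbox b) (mbox c) else 0).
    apply: eq_bigr => d _; case: eqP => [e|_]; last first.
      by rewrite big1 // => b _; rewrite big1 // => c _; rewrite andbF.
    have ad : admissible p (mbox d) by move: am; rewrite -e => /admissibleDr.
    have ld : (mdeg (mbox d) < k)%N by rewrite ltnS -e mdegD leq_addl.
    rewrite (scoefM _ _ ad ld) /sps_mul_coef big_mkcond.
    rewrite -(pair_big xpredT xpredT (fun b c : T => if mbox b + mbox c == mbox d then
      (-1) ^+ msign p (mbox b) (mbox c) * coef g (mbox b) * coef h (mbox c) else 0)) /=.
    rewrite mulr_sumr; apply: eq_bigr => b _; rewrite mulr_sumr.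
    apply: eq_bigr => c _; rewrite andbT; case: eqP => [e'|_]; last by rewrite mulr0.
    by rewrite /X -e' msignDr !signr_addb; ring.
  rewrite exchange_big; apply: eq_bigr => b _; rewrite exchange_big.
  apply: eq_bigr => c _; rewrite -big_mkcond.
  rewrite (@sum_mbox1 k (fun=> X (mbox a) (mbox b) (mbox c)) (mbox b + mbox c)
    (fun d => mbox a + d == mu)) ?addrA // => /eqP e.
  by rewrite ltnS -e -?addrA [leqRHS]mdegD leq_addl.
rewrite /sps_mul_coef [RHS]big_mkcond.
rewrite -(pair_big xpredT xpredT (fun d c : T => if mbox d + mbox c == mu then
  (-1) ^+ msign p (mbox d) (mbox c) * coef (sps_mul f g) (mbox d) * coef h (mbox c) else 0)) /=.
transitivity (\sum_(d : T) \sum_(c : T) \sum_(a : T) \sum_(b : T)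
   if (mbox a + mbox b == mbox d) && (mbox d + mbox c == mu) then X (mbox a) (mbox b) (mbox c) else 0);
  last first.
  apply: eq_bigr => d _; apply: eq_bigr => c _; case: eqP => [e|_]; last first.
    by rewrite big1 // => a _; rewrite big1 // => b _; rewrite andbF.
  have ad : admissible p (mbox d) by move: am; rewrite -e => /admissibleDl.
  have ld : (mdeg (mbox d) < k)%N by rewrite ltnS -e mdegD leq_addr.
  rewrite (scoefM _ _ ad ld) /sps_mul_coef [in RHS]big_mkcond.
  rewrite -(pair_big xpredT xpredT (fun a b : T => if mbox a + mbox b == mbox d then
    (-1) ^+ msign p (mbox a) (mbox b) * coef f (mbox a) * coef g (mbox b) else 0)) /=.
  rewrite mulr_sumr mulr_suml; apply: eq_bigr => a _; rewrite mulr_sumr mulr_suml.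
  apply: eq_bigr => b _; rewrite andbT; case: eqP => [e'|_]; last by rewrite mulr0 mul0r.
  by rewrite /X -e' msignDl !signr_addb; ring.
symmetry; under eq_bigr do rewrite exchange_big.
rewrite exchange_big; apply: eq_bigr => a _; under eq_bigr do rewrite exchange_big.
rewrite exchange_big; apply: eq_bigr => b _; rewrite exchange_big.
apply: eq_bigr => c _; rewrite -big_mkcond.
rewrite (@sum_mbox1 k (fun=> X (mbox a) (mbox b) (mbox c)) (mbox a + mbox b)
  (fun d => d + mbox c == mu)) // => /eqP e.
by rewrite ltnS -e [leqRHS]mdegD leq_addr.
Qed.

Fact sps_mulDl : left_distributive sps_mul +%R.
Proof.
move=> f g h; apply/spsP=> mu; rewrite scoefD.
have [am|nam] := boolP (admissible p mu); last by rewrite !scoef_nadm ?addr0.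
rewrite !coef_seriesE // -big_split; apply: eq_bigr => ab _.
by rewrite scoefD mulrDr mulrDl.
Qed.

Fact sps_mulDr : right_distributive sps_mul +%R.
Proof.
move=> f g h; apply/spsP=> mu; rewrite scoefD.
have [am|nam] := boolP (admissible p mu); last by rewrite !scoef_nadm ?addr0.
rewrite !coef_seriesE // -big_split; apply: eq_bigr => ab _.
by rewrite scoefD mulrDr.
Qed.

Lemma scoef1 mu : coef sps_one mu = (mu == 0)%:R.
Proof.
rewrite coef_series; case: ifP => //; case: eqP => // ->.
by move=> /negP[]; apply/forallP=> g; apply/implyP=> _; rewrite ffunE.
Qed.

Fact sps_mul1 : left_id sps_one sps_mul.
Proof.
move=> f; apply/spsP=> mu.
have [am|nam] := boolP (admissible p mu); last by rewrite !scoef_nadm.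
have [b eb] := @mboxP G (mdeg mu).+1 mu (leqnn _).
have [z ez] : exists a : {ffun G -> 'I_(mdeg mu).+1}, mbox a = 0.
  by exists [ffun=> ord0]; apply/ffunP=> x; rewrite !ffunE.
rewrite coef_seriesE // /sps_mul_coef (bigD1 (z, b)) /=; last by rewrite ez add0r eb.
rewrite scoef1 ez eqxx msign0m !mul1r eb big1 ?addr0 // => -[c d] /=.
case/andP=> /eqP e ne; rewrite scoef1; case: eqP => ec; last by rewrite mulr0 mul0r.
have /mbox_inj ed : mbox d = mbox b by move: e; rewrite ec add0r => ->.
by case/eqP: ne; rewrite ed; move: ec; rewrite -ez => /mbox_inj ->.
Qed.

Fact sps_mulr1 : right_id sps_one sps_mul.
Proof.
move=> f; apply/spsP=> mu.
have [am|nam] := boolP (admissible p mu); last by rewrite !scoef_nadm.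
have [b eb] := @mboxP G (mdeg mu).+1 mu (leqnn _).
have [z ez] : exists a : {ffun G -> 'I_(mdeg mu).+1}, mbox a = 0.
  by exists [ffun=> ord0]; apply/ffunP=> x; rewrite !ffunE.
rewrite coef_seriesE // /sps_mul_coef (bigD1 (b, z)) /=; last by rewrite ez addr0 eb.
rewrite scoef1 ez eqxx msignm0 mul1r mulr1 eb big1 ?addr0 // => -[d c] /=.
case/andP=> /eqP e ne; rewrite scoef1; case: eqP => ec; last by rewrite mulr0.
have /mbox_inj ed : mbox d = mbox b by move: e; rewrite ec addr0 => ->.
by case/eqP: ne; rewrite ed; move: ec; rewrite -ez => /mbox_inj ->.
Qed.

HB.instance Definition _ :=
  GRing.Zmodule_isPzRing.Build sps sps_mulA sps_mul1 sps_mulr1 sps_mulDl sps_mulDr.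

Lemma sps_scalerAl c (f g : sps) : c *: (f * g) = (c *: f) * g.
Proof.
apply/spsP=> mu; rewrite scoefZ !coef_series; case: ifP => _; last exact: mulr0.
by rewrite /sps_mul_coef mulr_sumr; apply: eq_bigr => ab _; rewrite scoefZ; ring.
Qed.

End SuperPowerSeries.

Arguments coef {K G p} _ _ : simpl never.
Arguments series {K G} p _ : simpl never.

Section SeriesOperations.
Variables (K : comNzRingType) (G : finType) (p : G -> bool).

Definition sgen (g : G) : sps K p := series p (fun mu => (mu == mgen g)%:R).
Definition spart (b : bool) (f : sps K p) : sps K p :=
  series p (fun mu => if mpar p mu == b then coef f mu else 0).
Definition smap (s : K -> K) (f : sps K p) : sps K p :=
  series p (fun mu => s (coef f mu)).

(* f has parity b *)
Definition shomog (b : bool) (f : sps K p) : Prop :=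
  forall mu, mpar p mu != b -> coef f mu = 0.
(* f lies in the k-th power of the maximal ideal *)
Definition sorder (k : nat) (f : sps K p) : Prop :=
  forall mu, (mdeg mu < k)%N -> coef f mu = 0.

(* The sum of the F k, provided F k has order at least k. *)
Definition ssum (F : nat -> sps K p) : sps K p :=
  series p (fun mu => \sum_(k < (mdeg mu).+1) coef (F k) mu).

End SeriesOperations.

Section Substitution.
Variables (K : comNzRingType).
Variables (G G' : finType) (p : G -> bool) (p' : G' -> bool).

(* The substitution x_g := phi g; meaningful when phi g has no constant term
   and the parity of g.  The product follows the order of the monomials. *)
Definition ssubst (phi : G -> sps K p') (f : sps K p) : sps K p' :=
  ssum (fun k => \sum_(a : {ffun G -> 'I_k.+1} | mdeg (mbox a) == k)
    coef f (mbox a) *: \prod_(g <- enum G) phi g ^+ a g).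

(* Inverse of a matrix congruent to 1 modulo the maximal ideal. *)
Definition sinvmx k (U : 'M[sps K p]_k) : 'M[sps K p]_k :=
  \matrix_(i, j) ssum (fun l => ((1%:M - U) ^+ l) i j).
Definition sinv (u : sps K p) : sps K p := sinvmx (u%:M : 'M_1) ord0 ord0.

Definition sdet m n (U : 'M[sps K p]_(m + n)) : sps K p :=
  \det (ulsubmx U - ursubmx U *m sinvmx (drsubmx U) *m dlsubmx U)
    * sinv (\det (drsubmx U)).

End Substitution.

Section LinearPart.
Variables (K : comNzRingType) (G : finType) (p : G -> bool).
Local Notation sps := (sps K p).
Implicit Types (f : sps) (g : G).

Lemma mdeg0 : @mdeg G 0 = 0%N.
Proof. by rewrite /mdeg big1 // => g _; rewrite ffunE. Qed.

Lemma mdeg_mgen g : mdeg (mgen g) = 1%N.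
Proof.
rewrite /mdeg (bigD1 g) //= ffunE eqxx big1 // => h /negbTE e.
by rewrite ffunE e.
Qed.

Lemma mgen_inj : injective (@mgen G).
Proof.
by move=> g h /ffunP/(_ g); rewrite !ffunE eqxx; case: eqP.
Qed.

Lemma mgen_neq0 g : mgen g != 0.
Proof. by apply/eqP=> e; move: (mdeg_mgen g); rewrite e mdeg0. Qed.

Lemma admissible0 : admissible p 0.
Proof. by apply/forallP=> h; apply/implyP=> _; rewrite ffunE. Qed.

Lemma admissible_mgen g : admissible p (mgen g).
Proof. by apply/forallP=> h; apply/implyP=> _; rewrite ffunE; case: eqP. Qed.

Lemma addm_eq0 (mu nu : mexp G) : mu + nu = 0 -> mu = 0 /\ nu = 0.
Proof.
move=> /ffunP e; split; apply/ffunP=> g; have := e g; rewrite !ffunE => /eqP;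
  by rewrite addn_eq0 => /andP[/eqP ? /eqP ?].
Qed.

Lemma addm_gen g (mu nu : mexp G) : mu + nu = mgen g ->
  (mu = 0 /\ nu = mgen g) \/ (mu = mgen g /\ nu = 0).
Proof.
move=> e; have z h : h != g -> mu h = 0%N /\ nu h = 0%N.
  move=> /negbTE ne; have /ffunP/(_ h) := e; rewrite !ffunE ne => /eqP.
  by rewrite addn_eq0 => /andP[/eqP ? /eqP ?].
have s1 : (mu g + nu g = 1)%N by have /ffunP/(_ g) := e; rewrite !ffunE eqxx.
case: (posnP (mu g)) => [e0|e0]; [left|right]; split; apply/ffunP=> h;
  rewrite !ffunE; case: (eqVneq h g) => [->|/z[]] //; lia.
Qed.

Lemma scoefM_0 (f f' : sps) : coef (f * f') 0 = coef f 0 * coef f' 0.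
Proof.
have [a ea] := @mboxP G 1 0 (eq_leq (congr1 S mdeg0)).
rewrite (@scoefM _ _ p 1) ?admissible0 ?mdeg0 // /sps_mul_coef.
rewrite (big_pred1 (a, a)) => [|[b c]] /=.
  by rewrite ea msign0m mul1r.
apply/eqP/eqP=> [/addm_eq0[]|[-> ->]]; last by rewrite ea addr0.
by rewrite -ea => /mbox_inj -> /mbox_inj ->.
Qed.

Lemma scoefM_mgen (f f' : sps) g : coef (f * f') (mgen g) =
  coef f 0 * coef f' (mgen g) + coef f (mgen g) * coef f' 0.
Proof.
have [z ez] := @mboxP G 2 0 (leqW (eq_leq (congr1 S mdeg0))).
have [a ea] := @mboxP G 2 (mgen g) (eq_leq (congr1 S (mdeg_mgen g))).
have ne : a != z by apply: contra (mgen_neq0 g) => /eqP e; rewrite -ea e ez.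
rewrite (@scoefM _ _ p 2) ?admissible_mgen ?mdeg_mgen // /sps_mul_coef.
rewrite (bigD1 (z, a)) /=; last by rewrite ez ea add0r.
rewrite (bigD1 (a, z)) /=; last by rewrite ez ea addr0 eqxx xpair_eqE (negbTE ne).
rewrite ez ea msign0m msignm0 !mul1r big1 ?addr0 // => -[b c] /=.
case/andP=> /andP[/eqP e n1 n2]; case: (addm_gen e) => -[];
  rewrite -ez -ea => /mbox_inj eb /mbox_inj ec.
- by rewrite eb ec eqxx in n1.
- by rewrite eb ec eqxx in n2.
Qed.

Lemma scoef1_0 : coef (1 : sps) 0 = 1.
Proof. by rewrite [LHS]scoef1 eqxx. Qed.
Lemma scoef1_mgen g : coef (1 : sps) (mgen g) = 0.
Proof. by rewrite [LHS]scoef1 (negbTE (mgen_neq0 g)). Qed.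
Lemma coef_sgen g mu : coef (sgen K p g) mu = (mu == mgen g)%:R.
Proof.
rewrite coef_series; case: ifP => //; case: eqP => // ->.
by rewrite admissible_mgen.
Qed.

Lemma scoef_prod_0 I (r : seq I) (F : I -> sps) :
  coef (\prod_(i <- r) F i) 0 = \prod_(i <- r) coef (F i) 0.
Proof. by elim: r => [|i r IH]; rewrite ?big_nil ?scoef1_0 // !big_cons scoefM_0 IH. Qed.

Lemma scoef_prod_mgen (I : eqType) (r : seq I) (F : I -> sps) g : uniq r ->
  coef (\prod_(i <- r) F i) (mgen g) =
  \sum_(i <- r) coef (F i) (mgen g) * \prod_(j <- r | j != i) coef (F j) 0.
Proof.
elim: r => [_|i r IH /= /andP[ni ur]]; first by rewrite !big_nil scoef1_mgen.
rewrite !big_cons scoefM_mgen IH // scoef_prod_0 eqxx /= addrC; congr (_ * _ + _).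
  rewrite big_seq [RHS]big_seq_cond; apply: eq_bigl => j.
  by case: eqVneq => [->|]; rewrite ?andbT // (negbTE ni).
rewrite mulr_sumr; apply: eq_big_seq => j jr.
rewrite big_cons ifT 1?mulrCA //.
by apply: contraNneq ni => ->.
Qed.

Lemma coef_signM (b : bool) f mu : coef ((-1) ^+ b * f) mu = (-1) ^+ b * coef f mu.
Proof. by case: b; rewrite ?expr0 ?expr1 ?mul1r // !mulN1r. Qed.

Lemma scoef_det k (U : 'M[sps]_k) : (forall i j, coef (U i j) 0 = (i == j)%:R) ->
  coef (\det U) 0 = 1 /\
  forall g, coef (\det U) (mgen g) = \sum_i coef (U i i) (mgen g).
Proof.
move=> hU; have u1 : uniq (index_enum 'I_k) by rewrite /index_enum -enumT enum_uniq.
have nfix (s : {perm 'I_k}) : s != 1%g -> forall i, exists2 j, j != i & s j != j.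
  move=> ns i; case: (eqVneq (s i) i) => [fi|nfi].
    case: (pickP (fun j => s j != j)) => [j nj|h].
      by exists j => //; apply: contraNneq nj => ->; rewrite fi.
    by case/eqP: ns; apply/perm.permP=> j; rewrite perm1; apply/eqP/negbFE/h.
  exists (s i) => //; by rewrite (inj_eq perm_inj).
rewrite /determinant; split=> [|g].
  rewrite scoef_sum (bigD1 1%g) //= odd_perm1 coef_signM scoef_prod_0 mul1r.
  rewrite big1 => [|i _]; last by rewrite perm1 hU eqxx.
  rewrite big1 ?addr0 // => s ns; rewrite coef_signM scoef_prod_0.
  have [j _ nj] : exists2 j, true & s j != j.
    case: (pickP (fun j => s j != j)) => [j nj|h]; first by exists j.
    by case/eqP: ns; apply/perm.permP=> j; rewrite perm1; apply/eqP/negbFE/h.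
  by rewrite (bigD1 j) //= hU eq_sym (negbTE nj) mul0r mulr0.
rewrite scoef_sum (bigD1 1%g) //= odd_perm1 coef_signM scoef_prod_mgen // mul1r.
rewrite [X in _ + X]big1 ?addr0 => [|s ns].
  apply: eq_bigr => i _; rewrite perm1 big1 ?mulr1 // => j _.
  by rewrite perm1 hU eqxx.
rewrite coef_signM scoef_prod_mgen // big1 ?mulr0 // => i _.
have [j ji nj] := nfix s ns i.
by rewrite (bigD1 j) //= hU eq_sym (negbTE nj) mul0r mulr0.
Qed.

Lemma coef_mulmx1 a b c (U : 'M[sps]_(a, b)) (W : 'M[sps]_(b, c)) g i j :
  (forall i j, coef (U i j) 0 = 0) -> (forall i j, coef (W i j) 0 = 0) ->
  coef ((U *m W) i j) 0 = 0 /\ coef ((U *m W) i j) (mgen g) = 0.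
Proof.
move=> hU hW; rewrite !mxE !scoef_sum; split; rewrite big1 // => l _.
  by rewrite scoefM_0 hU mul0r.
by rewrite scoefM_mgen hU hW mul0r mulr0 addr0.
Qed.

Lemma coef_ssum0 F : coef (ssum F : sps) 0 = coef (F 0%N) 0.
Proof.
by rewrite coef_seriesE ?admissible0 // mdeg0 big_ord_recl big_ord0 addr0.
Qed.
Lemma coef_ssum1 F g :
  coef (ssum F : sps) (mgen g) = coef (F 0%N) (mgen g) + coef (F 1%N) (mgen g).
Proof.
rewrite coef_seriesE ?admissible_mgen // mdeg_mgen.
by rewrite !big_ord_recl big_ord0 addr0.
Qed.

Lemma coef_sinv u : coef (sinv u : sps) 0 = 1 /\
  forall g, coef (sinv u) (mgen g) = - coef u (mgen g).
Proof.
rewrite /sinv mxE; split=> [|g].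
  by rewrite coef_ssum0 expr0 mxE eqxx scoef1_0.
by rewrite coef_ssum1 expr0 expr1 !mxE eqxx /= scoefD scoefN scoef1_mgen !add0r.
Qed.

Lemma coef_sdet m n (U : 'M[sps]_(m + n)) :
    (forall i j, coef (U i j) 0 = (i == j)%:R) ->
  coef (sdet U) 0 = 1 /\
  forall g, coef (sdet U) (mgen g) =
    \sum_(i < m) coef (U (lshift n i) (lshift n i)) (mgen g)
      - \sum_(i < n) coef (U (rshift m i) (rshift m i)) (mgen g).
Proof.
move=> hU.
have ur0 i j : coef (ursubmx U i j) 0 = 0 by rewrite !mxE hU eq_lrshift.
have dl0 i j : coef (dlsubmx U i j) 0 = 0 by rewrite !mxE hU eq_rlshift.
have urD0 i j : coef ((ursubmx U *m sinvmx (drsubmx U)) i j) 0 = 0.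
  by rewrite mxE scoef_sum big1 // => l _; rewrite scoefM_0 ur0 mul0r.
have e i j mu : coef ((ulsubmx U - ursubmx U *m sinvmx (drsubmx U) *m dlsubmx U) i j) mu
    = coef (ulsubmx U i j) mu - coef ((ursubmx U *m sinvmx (drsubmx U) *m dlsubmx U) i j) mu.
  have -> (V W : 'M[sps]_m) : (V - W) i j = V i j - W i j by rewrite !mxE.
  by rewrite scoefD scoefN.
pose A := ulsubmx U - ursubmx U *m sinvmx (drsubmx U) *m dlsubmx U.
have hA i j : coef (A i j) 0 = (i == j)%:R.
  rewrite e [ulsubmx _ _ _]mxE [usubmx _ _ _]mxE hU (inj_eq (@lshift_inj _ _)).
  rewrite mxE scoef_sum big1 ?subr0 // => l _.
  by rewrite scoefM_0 urD0 mul0r.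
have [a0 a1] := scoef_det hA.
have hD i j : coef (drsubmx U i j) 0 = (i == j)%:R.
  by rewrite !mxE hU (inj_eq (@rshift_inj _ _)).
have [d0 d1] := scoef_det hD.
have [v0 v1] := coef_sinv (\det (drsubmx U)).
rewrite /sdet; split=> [|g]; first by rewrite scoefM_0 -/A a0 v0 mulr1.
rewrite scoefM_mgen -/A a0 v0 v1 a1 d1 mul1r mulr1 addrC; congr (_ - _).
  apply: eq_bigr => i _; rewrite e [ulsubmx _ _ _]mxE [usubmx _ _ _]mxE.
  by have [_ ->] := coef_mulmx1 g i i urD0 dl0; rewrite subr0.
by apply: eq_bigr => i _; rewrite !mxE.
Qed.

End LinearPart.

(* In the Noetherian rings below every ideal is closed, so that no closure is
   taken; ideals generated by homogeneous elements are graded. *)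
Section Ideals.
Variable A : pzRingType.

Definition two_sided_ideal (S : A -> Prop) : Prop :=
  [/\ S 0, forall u v, S u -> S v -> S (u - v),
      forall a u, S u -> S (a * u) & forall a u, S u -> S (u * a)].

Definition ideal_gen (B : A -> Prop) (u : A) : Prop :=
  forall S, two_sided_ideal S -> (forall b, B b -> S b) -> S u.

Lemma ideal_genP B : two_sided_ideal (ideal_gen B).
Proof.
split=> [S [] //|u v hu hv S iS BS|a u hu S iS BS|a u hu S iS BS].
- by case: (iS) => _ h _ _; apply: h; [apply: hu|apply: hv].
- by case: (iS) => _ _ h _; apply: h; apply: hu.
- by case: (iS) => _ _ _ h; apply: h; apply: hu.
Qed.

End Ideals.

Section SpecialLinear.
Variables (K : comNzRingType) (m n : nat) (T : finType).

Definition ipar (i : 'I_(m + n)) : bool := (m <= i)%N.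
Definition gens : finType := (T * ('I_(m + n) * 'I_(m + n)))%type.
Definition gpar (g : gens) : bool := ipar g.2.1 (+) ipar g.2.2.
Definition fps := sps K gpar.
Definition xmx (t : T) : 'M[fps]_(m + n) := \matrix_(i, j) sgen K gpar (t, (i, j)).

Definition sl_ideal : {pred fps} := fun f =>
  `[< ideal_gen (fun g => exists t, g = sdet (1%:M + xmx t) - 1) f >].

Lemma coef_1xmx t i j mu : coef ((1%:M + xmx t) i j) mu =
  (i == j)%:R * (mu == 0)%:R + (mu == mgen (t, (i, j)))%:R.
Proof.
rewrite 3!mxE scoefD coef_sgen; congr (_ + _).
by case: eqP => _; rewrite ?mulr1n ?mulr0n ?mul1r ?mul0r // [LHS]scoef1.
Qed.

Lemma coef_sdet_xmx t : coef (sdet (1%:M + xmx t)) 0 = 1 /\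
  forall s i j, coef (sdet (1%:M + xmx t)) (mgen (s, (i, j))) =
    if (s == t) && (i == j) then (-1) ^+ ipar i else 0.
Proof.
have h0 i j : coef ((1%:M + xmx t) i j) 0 = (i == j)%:R.
  by rewrite coef_1xmx eqxx mulr1 [0 == _]eq_sym (negbTE (mgen_neq0 _)) addr0.
have [c0 c1] := coef_sdet h0; split=> // s i j; rewrite c1.
have e k : coef ((1%:M + xmx t) k k) (mgen (s, (i, j))) =
    [&& s == t, i == k & j == k]%:R.
  by rewrite coef_1xmx (negbTE (mgen_neq0 _)) mulr0 add0r (inj_eq (@mgen_inj _)) !xpair_eqE.
rewrite !(eq_bigr _ (fun k _ => e _)) {c0 c1 e h0}.
case: (eqVneq s t) => _ /=; last by rewrite !big1 ?subr0.
case: (eqVneq i j) => [->|ne] /=; last first.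
  rewrite !big1 ?subr0 // => k _; case: eqP => //= <-;
    by rewrite eq_sym (negbTE ne).
rewrite /ipar; case: (split_ordP j) => k -> /=.
  rewrite leqNgt ltn_ord (bigD1 k) //= eqxx big1 => [|l lk]; last first.
    by rewrite (inj_eq (@lshift_inj _ _)) eq_sym (negbTE lk).
  by rewrite big1 ?addr0 ?subr0 // => l _; rewrite eq_lrshift.
rewrite leq_addr (bigD1 k) //= eqxx big1 ?sub0r => [|l _]; last first.
  by rewrite eq_rlshift.
by rewrite big1 ?addr0 // => l lk; rewrite (inj_eq (@rshift_inj _ _)) eq_sym (negbTE lk).
Qed.

Lemma sl_idealP : two_sided_ideal (fun f => f \in sl_ideal).
Proof.
have [h0 hB hl hr] := @ideal_genP fps (fun g => exists t, g = sdet (1%:M + xmx t) - 1).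
split=> [|u v /asboolP hu /asboolP hv|a u /asboolP hu|a u /asboolP hu];
  apply/asboolP; [exact: h0|exact: hB|exact: hl|exact: hr].
Qed.

Fact sl_ideal_zmod : zmod_closed sl_ideal.
Proof. by case: sl_idealP. Qed.
HB.instance Definition _ := GRing.isZmodClosed.Build fps sl_ideal sl_ideal_zmod.

(* The completed tensor product of the copies of SL_{m|n}[[x_ij]] indexed by
   T: the variable (t, (i, j)) is the x_ij of the copy t. *)
Definition SL : Type := Quotient.quot sl_ideal.
HB.instance Definition _ := GRing.Zmodule.on SL.
Definition cls (f : fps) : SL := \pi_(Quotient.quot sl_ideal)%qT f.
Definition rep (u : SL) : fps := repr (u : Quotient.quot sl_ideal).

Lemma repK : cancel rep cls. Proof. exact: reprK. Qed.
Lemma clsP f g : cls f = cls g <-> f - g \in sl_ideal.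
Proof. by rewrite Quotient.idealrBE; split=> [/eqP|/eqP]. Qed.
Lemma clsD f g : cls (f + g) = cls f + cls g. Proof. exact: raddfD. Qed.
Lemma rep_cls f : rep (cls f) - f \in sl_ideal.
Proof. by apply/clsP; rewrite repK. Qed.

Definition sl_mul (u v : SL) : SL := cls (rep u * rep v).
Lemma clsM f g : cls (f * g) = sl_mul (cls f) (cls g).
Proof.
have [_ hB hl hr] := sl_idealP; apply/clsP.
rewrite -[_ - _]opprB rpredN.
have -> : rep (cls f) * rep (cls g) - f * g =
    rep (cls f) * (rep (cls g) - g) + (rep (cls f) - f) * g.
  by rewrite mulrBr mulrBl addrA subrK.
by rewrite rpredD //; [apply: hl|apply: hr]; apply: rep_cls.
Qed.

Fact sl_mulA : associative sl_mul.
Proof. by move=> u v w; rewrite -[u]repK -[v]repK -[w]repK -!clsM mulrA. Qed.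
Fact sl_mul1 : left_id (cls 1) sl_mul.
Proof. by move=> u; rewrite -[u]repK -!clsM mul1r. Qed.
Fact sl_mulr1 : right_id (cls 1) sl_mul.
Proof. by move=> u; rewrite -[u]repK -!clsM mulr1. Qed.
Fact sl_mulDl : left_distributive sl_mul +%R.
Proof.
by move=> u v w; rewrite -[u]repK -[v]repK -[w]repK -clsD -!clsM -clsD mulrDl.
Qed.
Fact sl_mulDr : right_distributive sl_mul +%R.
Proof.
by move=> u v w; rewrite -[u]repK -[v]repK -[w]repK -clsD -!clsM -clsD mulrDr.
Qed.
HB.instance Definition _ :=
  GRing.Zmodule_isPzRing.Build SL sl_mulA sl_mul1 sl_mulr1 sl_mulDl sl_mulDr.

Definition sl_scale c (u : SL) : SL := cls (c *: rep u).
Lemma clsZ c f : cls (c *: f) = sl_scale c (cls f).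
Proof.
have [_ _ hl _] := sl_idealP; apply/clsP; rewrite -scalerBr.
rewrite -[_ - _]mul1r sps_scalerAl; apply: hl.
by rewrite -opprB rpredN rep_cls.
Qed.
Fact sl_scaleA c d u : sl_scale c (sl_scale d u) = sl_scale (c * d) u.
Proof. by rewrite -[u]repK -!clsZ scalerA. Qed.
Fact sl_scale1 : left_id 1 sl_scale.
Proof. by move=> u; rewrite -[u]repK -!clsZ scale1r. Qed.
Fact sl_scaleDr : right_distributive sl_scale +%R.
Proof.
by move=> c u v; rewrite -[u]repK -[v]repK -clsD -!clsZ -clsD scalerDr.
Qed.
Fact sl_scaleDl u : {morph sl_scale^~ u : c d / c + d}.
Proof. by move=> c d; rewrite -[u]repK -!clsZ -clsD scalerDl. Qed.
HB.instance Definition _ :=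
  GRing.Zmodule_isLmodule.Build K SL sl_scaleA sl_scale1 sl_scaleDr sl_scaleDl.

Lemma clsME f g : cls (f * g) = cls f * cls g. Proof. exact: clsM. Qed.
Lemma clsZE c f : cls (c *: f) = c *: cls f. Proof. exact: clsZ. Qed.

End SpecialLinear.

(* SL K m n (T + T) is the completed tensor square of SL K m n T. *)
Section Coproduct.
Variables (K : comNzRingType) (m n : nat) (T : finType).
Local Notation fps T := (fps K m n T).
Local Notation SL T := (SL K m n T).
Local Notation x := (sgen K (@gpar m n _)).

Definition qmap T1 T2 (phi : fps T1 -> fps T2) (u : SL T1) : SL T2 :=
  cls (phi (rep u)).

Definition homog (b : bool) (u : SL T) : Prop :=
  exists2 f : fps T, shomog b f & u = cls f.
Definition part (b : bool) : SL T -> SL T := qmap (spart b).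
Definition order_ge T1 (k : nat) (u : SL T1) : Prop :=
  exists2 f : fps T1, sorder k f & u = cls f.

Definition santipode : fps T -> fps T :=
  ssubst (fun g => (sinvmx (1%:M + xmx K m n g.1) - 1%:M) g.2.1 g.2.2).
Definition antipode : SL T -> SL T := qmap santipode.

Definition coproduct : SL T -> SL (T + T)%type :=
  qmap (ssubst (fun g => let: (t, (i, j)) := g in
    x (inr t, (i, j)) + x (inl t, (i, j))
      + \sum_k x (inl t, (i, k)) * x (inr t, (k, j)))).

Definition tensl : SL T -> SL (T + T)%type :=
  qmap (ssubst (fun g => x (inl g.1, g.2))).
Definition tensr : SL T -> SL (T + T)%type :=
  qmap (ssubst (fun g => x (inr g.1, g.2))).
Definition tens (u v : SL T) : SL (T + T)%type := tensl u * tensr v.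

(* x^(mjoin mu nu) = x^mu (x) x^nu *)
Definition mjoin (mu nu : mexp (gens m n T)) : mexp (gens m n (T + T)%type) :=
  [ffun g => match g.1 with inl t => mu (t, g.2) | inr t => nu (t, g.2) end].

(* (l (x) id) F and (id (x) l) F: write F as the sum over nu of
   F_nu (x) x^nu (resp. over mu of x^mu (x) F_mu). *)
Definition contractl (l : SL T -> K) : SL (T + T)%type -> SL T :=
  qmap (fun F => series _ (fun nu =>
    l (cls (series _ (fun mu => coef F (mjoin mu nu)))))).
Definition contractr (l : SL T -> K) : SL (T + T)%type -> SL T :=
  qmap (fun F => series _ (fun mu =>
    l (cls (series _ (fun nu => coef F (mjoin mu nu)))))).

(* br2 is the bracket that br induces on the completed tensor square: the
   values on the f1 (x) f2 determine it by bilinearity and continuity. *)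
Definition tensor_bracket (br : SL T -> SL T -> SL T)
    (br2 : SL (T + T)%type -> SL (T + T)%type -> SL (T + T)%type) : Prop :=
  [/\ (forall c F G H, br2 (c *: F + G) H = c *: br2 F H + br2 G H) /\
      (forall c F G H, br2 F (c *: G + H) = c *: br2 F G + br2 F H),
      (forall F k, exists l, forall G, order_ge l G -> order_ge k (br2 F G)),
      (forall G k, exists l, forall F, order_ge l F -> order_ge k (br2 F G)) &
      (forall p q f1 f2 g1 g2, homog p f2 -> homog q g1 ->
         br2 (tens f1 f2) (tens g1 g2) =
           (-1) ^+ (q * p)%N *: tens (br f1 g1) (f2 * g2)
             + (-1) ^+ (q * p)%N *: tens (f1 * g1) (br f2 g2))].

End Coproduct.

Section PoissonLie.
Variables (K : comNzRingType) (m n : nat) (T : finType).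
Local Notation SL := (SL K m n T).

Record poisson_lie (br : SL -> SL -> SL) : Prop := PoissonLie {
  pl_linearl : forall c f g h, br (c *: f + g) h = c *: br f h + br g h;
  pl_linearr : forall c f g h, br f (c *: g + h) = c *: br f g + br f h;
  pl_even : forall p q f g,
    homog p f -> homog q g -> homog (p (+) q) (br f g);
  pl_jacobi : forall p q r f g h, homog p f -> homog q g -> homog r h ->
    (-1) ^+ (p * r)%N *: br f (br g h) + (-1) ^+ (r * q)%N *: br h (br f g)
      + (-1) ^+ (q * p)%N *: br g (br h f) = 0;
  pl_antisym : forall p q f g, homog p f -> homog q g ->
    br f g = - ((-1) ^+ (p * q)%N *: br g f);
  pl_leibniz : forall p q r f g h, homog p f -> homog q g -> homog r h ->
    br f (g * h) = br f g * h + (-1) ^+ (p * q)%N *: (g * br f h);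
  pl_coproduct : exists2 br2, tensor_bracket br br2 &
    forall f g, coproduct (br f g) = br2 (coproduct f) (coproduct g)
}.

Definition poisson_ideal (br : SL -> SL -> SL) (I : SL -> Prop) : Prop :=
  forall f g, I f -> I (br f g).

End PoissonLie.

(* H = SL K m n bool; the derivation delta_(A, B) is represented by (A, B). *)
Definition ycopy : bool := false.
Definition zcopy : bool := true.

Section Double.
Variables (K : numFieldType) (m n : nat).
Local Notation mx := 'M[K]_(m + n).
Local Notation H := (SL K m n bool).

Definition supertrace (M : mx) : K := \tr (ulsubmx M) - \tr (drsubmx M).

Definition mx_homog (b : bool) (M : mx) : Prop :=
  forall i j, ipar i (+) ipar j != b -> M i j = 0.

Definition gl2 : vectType K := (mx * mx)%type.
Definition gl2_homog (b : bool) (h : gl2) : Prop :=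
  mx_homog b h.1 /\ mx_homog b h.2.

Definition strictU (M : mx) : mx := \matrix_(i, j) if (i < j)%N then M i j else 0.
Definition strictL (M : mx) : mx := \matrix_(i, j) if (j < i)%N then M i j else 0.
Definition diagpart (M : mx) : mx := \matrix_(i, j) if i == j then M i j else 0.

Definition str2 (h : gl2) : (K^o * K^o)%type := (supertrace h.1, supertrace h.2).
Definition diff2 (h : gl2) : mx := h.1 - h.2.
Definition borel_defect (h : gl2) : (mx * mx * mx)%type :=
  (strictU h.1, strictL h.2, diagpart h.1 + diagpart h.2).

Definition dd : {vspace gl2} := lker (linfun str2).
Definition gg : {vspace gl2} := (dd :&: lker (linfun diff2))%VS.
Definition bb : {vspace gl2} := (dd :&: lker (linfun borel_defect))%VS.

Lemma supertraceP c (M M' : mx) :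
  supertrace (c *: M + M') = c * supertrace M + supertrace M'.
Proof.
rewrite /supertrace.
have -> : ulsubmx (c *: M + M') = c *: ulsubmx M + ulsubmx M'.
  by apply/matrixP=> i j; rewrite !mxE.
have -> : drsubmx (c *: M + M') = c *: drsubmx M + drsubmx M'.
  by apply/matrixP=> i j; rewrite !mxE.
by rewrite !mxtraceD !mxtraceZ opprD mulrBr addrACA.
Qed.

Fact str2_linear : linear str2.
Proof. by move=> c h k; congr pair; apply: supertraceP. Qed.
HB.instance Definition _ := GRing.isLinear.Build K gl2 (K^o * K^o)%type *:%R str2
  str2_linear.
Fact diff2_linear : linear diff2.
Proof. by move=> c h k; rewrite /diff2 /= opprD scalerBr addrACA. Qed.
HB.instance Definition _ := GRing.isLinear.Build K gl2 mx *:%R diff2 diff2_linear.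
Fact borel_defect_linear : linear borel_defect.
Proof.
move=> c h k; congr (_, _, _); apply/matrixP=> i j; rewrite !mxE;
  case: ifP => _; rewrite ?mxE ?mulr0 ?addr0 //; last by rewrite mulr0.
by rewrite mulrDr addrACA.
Qed.
HB.instance Definition _ := GRing.isLinear.Build K gl2 (mx * mx * mx)%type *:%R
  borel_defect borel_defect_linear.

Lemma mem_dd h : reflect (supertrace h.1 = 0 /\ supertrace h.2 = 0) (h \in dd).
Proof.
rewrite memv_ker lfunE /=; apply: (iffP eqP) => [[]|[e1 e2]] //.
by rewrite /str2 e1 e2.
Qed.

Lemma mem_gg h : reflect (h \in dd /\ h.1 = h.2) (h \in gg).
Proof.
rewrite memv_cap memv_ker lfunE /= subr_eq0.
by apply: (iffP andP) => [[? /eqP]|[? /eqP]].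
Qed.

Lemma mem_bb h :
  reflect [/\ h \in dd, forall i j : 'I_(m + n), (i < j)%N -> h.1 i j = 0,
              forall i j : 'I_(m + n), (j < i)%N -> h.2 i j = 0
            & forall i, h.1 i i + h.2 i i = 0] (h \in bb).
Proof.
rewrite memv_cap memv_ker lfunE /=.
apply: (iffP andP) => [[hd /eqP[/matrixP e1 /matrixP e2 /matrixP e3]]|[hd e1 e2 e3]].
  split=> // [i j lt|i j lt|i].
  - by have := e1 i j; rewrite !mxE lt.
  - by have := e2 i j; rewrite !mxE lt.
  - by have := e3 i i; rewrite !mxE eqxx.
split=> //; apply/eqP; congr (_, _, _); apply/matrixP=> i j; rewrite !mxE.
- by case: ifP => // /e1.
- by case: ifP => // /e2.
- by case: eqP => [<-|]; rewrite ?addr0.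
Qed.

Lemma gg_bb_direct : (gg :&: bb = 0)%VS.
Proof.
apply/eqP; rewrite -subv0; apply/subvP=> -[A B] /memv_capP[/mem_gg[_ /= <-]].
case/mem_bb=> /= _ hU hL hD; rewrite memv0; apply/eqP.
suff -> : A = 0 by [].
apply/matrixP=> i j; rewrite mxE; case: (ltngtP i j) => [/hU|/hL|/val_inj <-] //.
by have /eqP := hD i; rewrite -mulr2n mulrn_eq0 => /eqP.
Qed.

Lemma ggDbb : (gg + bb = dd)%VS.
Proof.
apply/eqP; rewrite eqEsubv subv_add !capvSl /=; apply/subvP=> -[A B] hd.
have /mem_dd[/= sA sB] := hd.
pose L : mx := \matrix_(i, j) if (i < j)%N then 0
  else if (j < i)%N then (A - B) i j else (A - B) i j / 2.
have hL i : L i i = (A i i - B i i) / 2 by rewrite !mxE ltnn.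
have sL : supertrace L = 0.
  have -> : supertrace L = (supertrace A - supertrace B) / 2.
    rewrite /supertrace /mxtrace.
    under eq_bigr do rewrite !mxE ltnn.
    under [X in _ - X]eq_bigr do rewrite !mxE ltnn.
    rewrite -!mulr_suml -mulrBl; congr (_ / _).
    rewrite !sumrB; under [in RHS]eq_bigr do rewrite !mxE.
    under [X in _ = _ - X - _]eq_bigr do rewrite !mxE.
    under [X in _ = _ - (X - _)]eq_bigr do rewrite !mxE.
    under [X in _ = _ - (_ - X)]eq_bigr do rewrite !mxE.
    by ring.
  by rewrite sA sB subrr mul0r.
have -> : (A, B) = (A - L, A - L) + (L, L - (A - B)).
  by congr pair; rewrite /= ?subrK // opprB addrA subrK addrC subrK.
have sB2 (M M' : mx) : supertrace (M - M') = supertrace M - supertrace M'.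
  by rewrite addrC -scaleN1r supertraceP mulN1r addrC.
apply: memv_add.
  by apply/mem_gg; split=> //; apply/mem_dd; rewrite /= !sB2 sA sL subr0.
apply/mem_bb; split=> [|i j lt|i j lt|i] /=.
- by apply/mem_dd; rewrite /= !sB2 sA sB sL !subr0.
- by rewrite mxE lt.
- by rewrite !mxE lt ltnNge ltnW //= subrr.
- by rewrite !mxE ltnn; field.
Qed.

Definition Rdd (h : gl2) : gl2 := daddv_pi bb gg h - daddv_pi gg bb h.

(* An epsilon-derivation kills the square of the maximal ideal, hence it is
   determined by its values on the generators; see delta_derivation. *)
Definition linear_part (h : gl2) (f : fps K m n bool) : K :=
  \sum_i \sum_j (h.1 i j * coef f (mgen (ycopy, (i, j)))
    + h.2 i j * coef f (mgen (zcopy, (i, j)))).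
Definition delta (h : gl2) (u : H) : K := linear_part h (rep u).

Lemma linear_partP h c f g :
  linear_part h (c *: f + g) = c * linear_part h f + linear_part h g.
Proof.
rewrite /linear_part mulr_sumr -big_split; apply: eq_bigr => i _.
rewrite mulr_sumr -big_split; apply: eq_bigr => j _.
by rewrite !scoefD !scoefZ /=; ring.
Qed.

Lemma linear_partM h f g : linear_part h (f * g) =
  coef f 0 * linear_part h g + linear_part h f * coef g 0.
Proof.
rewrite /linear_part mulr_sumr mulr_suml -big_split; apply: eq_bigr => i _.
rewrite mulr_sumr mulr_suml -big_split; apply: eq_bigr => j _.
by rewrite !scoefM_mgen /=; ring.
Qed.

Lemma linear_part_ideal h f : h \in dd -> f \in @sl_ideal K m n bool ->
  coef f 0 = 0 /\ linear_part h f = 0.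
Proof.
move=> /mem_dd[s1 s2] /asboolP hf.
apply: (hf (fun f => coef f 0 = 0 /\ linear_part h f = 0)); clear f hf.
  split=> [|u v [u0 u1] [v0 v1]|a u [u0 u1]|a u [u0 u1]].
  - split=> //; rewrite /linear_part big1 // => i _; rewrite big1 // => j _.
    by rewrite !scoef0 !mulr0 addr0.
  - rewrite scoefD scoefN u0 v0 subr0; split=> //.
    by rewrite addrC -scaleN1r linear_partP u1 v1 mulr0 addr0.
  - by rewrite scoefM_0 linear_partM u0 u1 !mulr0 addr0.
  - by rewrite scoefM_0 linear_partM u0 u1 !mul0r addr0.
move=> _ [t ->]; have [c0 c1] := coef_sdet_xmx K m n t.
rewrite scoefD scoefN c0 scoef1_0 subrr; split=> //.
have e s i j : coef (sdet (1%:M + xmx K m n t) - 1) (mgen (s, (i, j))) =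
    if (s == t) && (i == j) then (-1) ^+ ipar i else 0.
  by rewrite scoefD scoefN scoef1_mgen subr0 c1.
have st M : supertrace M = \sum_i M i i * (-1) ^+ @ipar m n i.
  rewrite big_split_ord /supertrace /mxtrace -sumrN; congr (_ + _);
    apply: eq_bigr => i _; rewrite !mxE /ipar /=.
    by rewrite leqNgt ltn_ord mulr1.
  by rewrite leq_addr mulrN1.
transitivity (\sum_i (if ycopy == t then h.1 i i * (-1) ^+ @ipar m n i else 0)
    + \sum_i (if zcopy == t then h.2 i i * (-1) ^+ @ipar m n i else 0)).
  rewrite /linear_part -big_split; apply: eq_bigr => i _.
  rewrite (bigD1 i) //= !e eqxx !andbT big1 ?addr0 => [|j ne].
    by case: ifP; case: ifP; rewrite ?mulr0.
  by rewrite !e [i == _]eq_sym (negbTE ne) !andbF !mulr0 addr0.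
case: t {c0 c1 e}; rewrite /ycopy /zcopy /=.
  by rewrite big1 // add0r -st.
by rewrite [X in _ + X]big1 // addr0 -st.
Qed.

Definition ygen i j : H := cls (sgen K _ (ycopy, (i, j))).
Definition zgen i j : H := cls (sgen K _ (zcopy, (i, j))).

Definition counit (u : H) : K := coef (rep u) 0.
Definition eps_derivation (d : H -> K) : Prop :=
  (forall c u v, d (c *: u + v) = c * d u + d v) /\
  (forall u v, d (u * v) = counit u * d v + d u * counit v).

Lemma delta_cls h f : h \in dd -> delta h (cls f) = linear_part h f.
Proof.
move=> hd; have [_] := linear_part_ideal hd (rep_cls f).
by rewrite addrC -scaleN1r linear_partP mulN1r addrC => /subr0_eq.
Qed.

Lemma delta_derivation h : h \in dd ->
  [/\ eps_derivation (delta h), forall i j, delta h (ygen i j) = h.1 i j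
    & forall i j, delta h (zgen i j) = h.2 i j].
Proof.
move=> hd.
have s t i j : linear_part h (sgen K _ (t, (i, j))) = (if t then h.2 else h.1) i j.
  rewrite /linear_part (bigD1 i) //= (bigD1 j) //= !coef_sgen !(inj_eq (@mgen_inj _)).
  rewrite !xpair_eqE !eqxx !andbT [X in _ + X + _]big1 => [|k /negbTE ne].
    rewrite [X in _ + X]big1 => [|k /negbTE ne].
      by case: t; rewrite /= mulr1 mulr0 ?addr0 ?add0r.
    rewrite big1 // => l _; rewrite !coef_sgen !(inj_eq (@mgen_inj _)).
    by rewrite !xpair_eqE ne !andbF !mulr0 addr0.
  by rewrite !coef_sgen !(inj_eq (@mgen_inj _)) !xpair_eqE ne !andbF !mulr0 addr0.
split=> [|i j|i j]; [|by rewrite delta_cls // s ..].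
split=> [c u v|u v].
  by rewrite -{1}[u]repK -{1}[v]repK -clsZE -clsD delta_cls // linear_partP.
by rewrite -{1}[u]repK -{1}[v]repK -clsME delta_cls // linear_partM.
Qed.

Definition nablaR (h : gl2) (f : H) : H := contractl (delta h) (coproduct f).
(* b is the parity of h; q runs over the parities of the components of f. *)
Definition nablaL (b : bool) (h : gl2) (f : H) : H :=
  \sum_(q : bool) (-1) ^+ (b * q.+1)%N *: contractr (delta h) (coproduct (part q f)).

Definition idealI : H -> Prop :=
  ideal_gen (fun u => exists i j, u = ygen i j - zgen i j).
Definition idealJ : H -> Prop :=
  ideal_gen (fun u =>
    [\/ exists i j : 'I_(m + n), (j < i)%N /\ u = ygen j i,
        exists i j : 'I_(m + n), (j < i)%N /\ u = zgen i j
      | exists i, u = antipode (ygen i i) - zgen i i]).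

End Double.

Section RealForm.
Variables (R : realType) (m n : nat).
Local Notation C := (R[i]).
Local Notation H := (SL C m n bool).
Local Notation V := (gl2 C m n).

Definition scal (h k : V) : C :=
  - ('i / 2) * supertrace (h.1 *m k.1) + ('i / 2) * supertrace (h.2 *m k.2).

(* par a is the parity of tnth h a; q runs over the parities of the components
   of f. *)
Definition bracket k (h hhat : k.-tuple V) (par : 'I_k -> bool) (f g : H) : H :=
  (2^-1 : C) *: \sum_(q : bool) \sum_(a < k) \sum_(b < k)
    ((-1) ^+ (q * par a)%N * scal (Rdd (tnth hhat a)) (tnth hhat b)) *:
      (nablaL (par a) (tnth h a) (part q f) * nablaL (par b) (tnth h b) g
       - nablaR (tnth h a) (part q f) * nablaR (tnth h b) g).

Definition star : H -> H :=
  qmap (fun f => ssubst (fun g => let: (t, (i, j)) := g in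
      (-1) ^+ ((ipar i + ipar j) * ipar j)%N *:
        santipode (sgen C _ (~~ t, (j, i))))
    (smap (fun c : C => c^*) f)).

End RealForm.

(* Main.v *)
(* Write e_ab for the matrix units of gl(m|n), one copy for y (s = 0) and one for
   z (s = 1).  The invariant vector fields along the e_ab are superderivations of the
   whole power series algebra, and sdet(1 + X) is an eigenvector of each of them; so
   those of supertrace zero descend to the quotient, and so does the bracket below,
   for which sdet(1 + X) is central.  By completeness of dual bases (this uses
   m <> n) the bracket of the theorem is
     sum w(s,t,a,b) (L_ab^s f  L_ba^t g - R_ab^s f  R_ba^t g),
     w(s,t,a,b) = i (-1)^|a| (sgn(b - a) + s - t),
   where L and R denote nabla^L and nabla^R.  It is a derivation in each argument,
   so identities need only be checked on the entries of 1 + X, where the bracket is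
   quadratic.  The Jacobi identity then amounts to a cyclic identity for
   sgn(b - a) + s - t, a Yang-Baxter equation.  Adding a multiple of the Casimir
   element of one copy to w does not change the bracket.  A suitable choice makes w
   independent of s, and then I is a Poisson ideal since L^0 + L^1 and R^0 + R^1
   preserve it; another choice leaves only vector fields in the first argument
   that preserve J.  For the coproduct, the terms in which the middle factors are
   differentiated cancel, since both are the same infinitesimal translation.  For
   the star map, w(1-s,1-t,b,a) = (-1)^(|a|+|b|) times the conjugate of w(s,t,a,b). *)

From HB Require Import structures.
Require Import Defs.
From mathcomp Require Import fingroup perm.
From mathcomp Require Import all_boot all_order all_algebra.
From mathcomp Require Import complex ring zify.
From mathcomp Require Import boolp reals.

Set Implicit Arguments.
Unset Strict Implicit.
Unset Printing Implicit Defensive.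

Import Order.TTheory GRing.Theory Num.Theory.
Local Open Scope ring_scope.

(** * Supercommutative power series *)

(** A single unit e_ab need not have supertrace zero, so its field does not act on [SL]; all
    identities are therefore proved on the free power series algebra and pushed down once the
    bracket is known to respect the ideal. The eigenvector property of sdet is visible on the block
    formula only for some of the fields. The others follow from a uniqueness principle: in
    characteristic zero a series with constant term 1 is determined by its eigenvalues along any
    family of superderivations dual to the generators at the origin. The same principle gives the
    multiplicativity of sdet and its behaviour under the antipode and the star map, without
    expanding a determinant. The sign sgn(b - a) records the action of R_d on triangular parts, s -
    t the mixing of the two copies by the projections onto g and b, and the factor i the inversion
    of the coefficients of the scalar product. Division by m - n occurs only when e_ab is projected
    to supertrace zero; the correction terms are products of Euler fields, for which left and right
    versions agree, so they drop out of the bracket. *)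

Section MonomialSigns.
Variables (G : finType) (p : G -> bool).
Implicit Types mu nu : mexp G.

Lemma mparD mu nu : mpar p (mu + nu) = mpar p mu (+) mpar p nu.
Proof.
by rewrite /mpar -oddD -big_split; congr odd; apply: eq_bigr => g _; rewrite ffunE.
Qed.

Lemma mpar0 : mpar p 0 = false.
Proof. by rewrite /mpar big1 // => g _; rewrite ffunE. Qed.

Lemma mpar_mgen g : mpar p (mgen g) = p g.
Proof.
rewrite /mpar big_mkcond (bigD1 g) //= ffunE eqxx big1 ?addn0 => [|h /negbTE ne].
  by case: (p g).
by rewrite ffunE ne; case: ifP.
Qed.

(** Together the two signs count the pairs formed by an odd variable of x^mu and one of x^nu: a pair
    of distinct variables is out of order in exactly one of the two products, and admissibility
    excludes equal ones. *)
Lemma msignC mu nu : admissible p (mu + nu) ->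
  msign p mu nu (+) msign p nu mu = mpar p mu && mpar p nu.
Proof.
move=> adm; rewrite /msign /mpar -oddM -oddD; congr odd.
rewrite big_distrl /=; under [RHS]eq_bigr do rewrite big_distrr /=.
have -> : (\sum_(s | p s) \sum_(t | p t && (enum_rank t < enum_rank s)) nu s * mu t
  = \sum_(t | p t) \sum_(s | p s && (enum_rank t < enum_rank s)) mu t * nu s)%N.
  rewrite (exchange_big_dep p) /=; last by move=> ? ? ? /andP[].
  by apply: eq_bigr => t pt; apply: eq_big => [s|s _]; rewrite ?pt // mulnC.
rewrite -big_split /=; apply: eq_bigr => s ps.
rewrite [RHS](bigID (fun t => enum_rank t < enum_rank s)%N) /=; congr (_ + _)%N.
rewrite [RHS](bigD1 s) /=; last by rewrite ps ltnn.
have := implyP (forallP adm s) ps; rewrite ffunE => le1.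
have -> : (mu s * nu s = 0)%N by move: le1; case: (mu s) => [|[|a]]; case: (nu s).
rewrite add0n; apply: eq_bigl => t; rewrite -leqNgt ltn_neqAle andbA andbAC.
congr (_ && _ && _); rewrite -(inj_eq enum_rank_inj); congr negb.
by apply/eqP/eqP => [/val_inj ->|->].
Qed.

Lemma mdeg_eq0 mu : (mdeg mu == 0%N) = (mu == 0).
Proof.
apply/eqP/eqP => [e|->]; last exact: mdeg0.
by apply/ffunP=> g; have := leq_mdeg mu g; rewrite e leqn0 ffunE => /eqP.
Qed.

Lemma mexp_ind (P : mexp G -> Prop) :
  P 0 -> (forall g mu, P mu -> P (mgen g + mu)) -> forall mu, P mu.
Proof.
move=> P0 PS mu; have [k] := ubnP (mdeg mu); elim: k mu => // k IH mu le.
have [/eqP|n0] := eqVneq (mdeg mu) 0%N; first by rewrite mdeg_eq0 => /eqP ->.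
have [g mg] : exists g, (0 < mu g)%N.
  apply/existsP; apply: contraNT n0; rewrite negb_exists => /forallP h.
  by rewrite /mdeg big1 // => g _; apply/eqP; rewrite -leqn0 leqNgt h.
pose nu : mexp G := [ffun h => mu h - mgen g h]%N.
have e : mu = mgen g + nu.
  apply/ffunP=> h; rewrite !ffunE; case: eqP => [->|_]; last by rewrite subn0.
  by change (mu g = 1 + (mu g - 1))%N; rewrite subnKC.
rewrite e; apply/PS/IH; move: le; rewrite e mdegD mdeg_mgen add1n; exact.
Qed.

End MonomialSigns.

(** * Monomials, order of vanishing, parity and supercommutation *)

Section SeriesBasis.
Variables (K : comNzRingType) (G : finType) (p : G -> bool).
Local Notation sps := (sps K p).
Implicit Types (f g : sps) (mu nu : mexp G).

Definition mon mu : sps := series p (fun nu => (nu == mu)%:R).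

Lemma coef_mon mu nu : admissible p mu -> coef (mon mu) nu = (nu == mu)%:R.
Proof. by move=> adm; rewrite coef_series; case: ifP => //; case: eqP => // ->; rewrite adm. Qed.

Lemma mon_nadm mu : ~~ admissible p mu -> mon mu = 0.
Proof.
move=> nadm; apply/spsP=> nu; rewrite coef_series scoef0; case: ifP => // adm.
by case: eqP => // e; rewrite e (negbTE nadm) in adm.
Qed.

Lemma mon0 : mon 0 = 1.
Proof. by apply/spsP=> nu; rewrite coef_mon ?admissible0 // [RHS]scoef1. Qed.

Lemma sgen_mon x : sgen K p x = mon (mgen x).
Proof. by []. Qed.

Lemma scoefME f g mu : admissible p mu -> coef (f * g) mu =
  \sum_(ab : {ffun G -> 'I_(mdeg mu).+1} * {ffun G -> 'I_(mdeg mu).+1}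
      | mbox ab.1 + mbox ab.2 == mu)
    (-1) ^+ msign p (mbox ab.1) (mbox ab.2)
      * coef f (mbox ab.1) * coef g (mbox ab.2).
Proof. by move=> adm; rewrite (@scoefM _ _ p (mdeg mu).+1). Qed.

(** Needs no admissibility: [mon] of an inadmissible exponent is 0, and so is a product in which an
    odd variable would occur twice. *)
Lemma monM mu nu : mon mu * mon nu = (-1) ^+ msign p mu nu *: mon (mu + nu).
Proof.
have [adm|nadm] := boolP (admissible p (mu + nu)); last first.
  rewrite (mon_nadm nadm) scaler0; apply/spsP=> lam; rewrite scoef0.
  have [al|nal] := boolP (admissible p lam); last by rewrite scoef_nadm.
  rewrite scoefME // big1 // => -[a b] /= /eqP e; rewrite !coef_series.
  case: ifP => // _; case: ifP => // _; rewrite ?mulr0 ?mul0r //.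
  case: eqP => [ea|_]; last by rewrite mulr0 mul0r.
  case: eqP => [eb|_]; last by rewrite mulr0.
  by case/negP: nadm; rewrite -ea -eb e.
have [am an] := (admissibleDl adm, admissibleDr adm).
apply/spsP=> lam; rewrite scoefZ.
have [al|nal] := boolP (admissible p lam); last by rewrite !scoef_nadm ?mulr0.
rewrite scoefME // coef_mon //; case: eqP => [e|ne]; last first.
  rewrite mulr0 big1 // => -[a b] /= /eqP e; rewrite !coef_mon //.
  case: eqP => [ea|_]; last by rewrite mulr0 mul0r.
  case: eqP => [eb|_]; last by rewrite mulr0.
  by case: ne; rewrite -ea -eb e.
have [a ea] := @mboxP G (mdeg lam).+1 mu ltac:(by rewrite ltnS e mdegD leq_addr).
have [b eb] := @mboxP G (mdeg lam).+1 nu ltac:(by rewrite ltnS e mdegD leq_addl).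
rewrite (bigD1 (a, b)) /= ?ea ?eb ?e // !coef_mon // !eqxx !mulr1.
rewrite big1 ?addr0 // => -[c d] /= /andP[_ ne]; rewrite !coef_mon //.
case: eqP => [ec|_]; last by rewrite mulr0 mul0r.
case: eqP => [ed|_]; last by rewrite mulr0.
by case/eqP: ne; congr pair; apply: mbox_inj; rewrite ?ec ?ed.
Qed.

Lemma sps_scalerAr c f g : c *: (f * g) = f * (c *: g).
Proof.
apply/spsP=> mu; have [am|nam] := boolP (admissible p mu); last by rewrite !scoef_nadm.
rewrite scoefZ !scoefME // mulr_sumr; apply: eq_bigr => ab _; rewrite scoefZ; ring.
Qed.

Lemma sorder0 k : sorder k (0 : sps). Proof. by []. Qed.
Lemma sorder_0 f : sorder 0 f. Proof. by []. Qed.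
Lemma sorderD k f g : sorder k f -> sorder k g -> sorder k (f + g).
Proof. by move=> hf hg mu le; rewrite scoefD hf ?hg ?addr0. Qed.
Lemma sorderN k f : sorder k f -> sorder k (- f).
Proof. by move=> hf mu le; rewrite scoefN hf ?oppr0. Qed.
Lemma sorderB k f g : sorder k f -> sorder k g -> sorder k (f - g).
Proof. by move=> hf hg; apply: sorderD => //; apply: sorderN. Qed.
Lemma sorderZ k c f : sorder k f -> sorder k (c *: f).
Proof. by move=> hf mu le; rewrite scoefZ hf ?mulr0. Qed.
Lemma sorder_sum k I (r : seq I) (P : pred I) (F : I -> sps) :
  (forall i, P i -> sorder k (F i)) -> sorder k (\sum_(i <- r | P i) F i).
Proof. by move=> h; apply: big_ind => //; apply: sorderD. Qed.
Lemma sorderW k l f : (l <= k)%N -> sorder k f -> sorder l f.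
Proof. by move=> le hf mu lt; apply: hf; apply: leq_trans le. Qed.
Lemma sorderM k l f g : sorder k f -> sorder l g -> sorder (k + l) (f * g).
Proof.
move=> hf hg mu lt; have [am|nam] := boolP (admissible p mu); last by rewrite scoef_nadm.
rewrite scoefME // big1 // => -[a b] /= /eqP e.
have [/hf ->|le] := ltnP (mdeg (mbox a)) k; first by rewrite mulr0 mul0r.
have d : mdeg mu = (mdeg (mbox a) + mdeg (mbox b))%N by rewrite -mdegD e.
by rewrite [coef g _]hg ?mulr0 //; lia.
Qed.
Lemma sorder_eq0 f : (forall k, sorder k f) -> f = 0.
Proof. by move=> h; apply/spsP=> mu; apply: (h (mdeg mu).+1). Qed.
Lemma sorder_mon mu : sorder (mdeg mu) (mon mu).
Proof.
move=> nu lt; rewrite coef_series; case: ifP => // _; case: eqP => // e.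
by rewrite e ltnn in lt.
Qed.
Lemma sorder_sgen x : sorder 1 (sgen K p x).
Proof. by rewrite -(mdeg_mgen x); apply: sorder_mon. Qed.

(** The box of exponents with entries below k contains every exponent of degree less than k, which
    keeps the sum finite. *)
Definition trunc k f : sps :=
  \sum_(a : {ffun G -> 'I_k} | (mdeg (mbox a) < k)%N) coef f (mbox a) *: mon (mbox a).

Lemma sorder_trunc k f : sorder k (f - trunc k f).
Proof.
move=> mu lt; rewrite scoefD scoefN scoef_sum; have [a ea] := mboxP lt.
have [am|nam] := boolP (admissible p mu); last first.
  rewrite scoef_nadm // big1 ?subr0 // => b _; by rewrite scoef_nadm.
rewrite (bigD1 a) /= ?ea // scoefZ coef_mon // eqxx mulr1 big1 ?addr0 ?subrr // => b.
case/andP=> _ nb; rewrite scoefZ coef_series am; case: eqP => [e|]; last by rewrite mulr0.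
by case/eqP: nb; apply: mbox_inj; rewrite ea -e.
Qed.

Lemma trunc_ind (S : sps -> Prop) k f : S 0 -> (forall f g, S f -> S g -> S (f + g)) ->
  (forall c mu, (mdeg mu < k)%N -> S (c *: mon mu)) -> S (trunc k f).
Proof. by move=> S0 SD Sm; apply: big_ind => // a; apply: Sm. Qed.

(** The last premise is closedness for the adic topology; truncations are built from 1 by the other
    rules and approximate every series. *)
Lemma sps_ind (S : sps -> Prop) :
  (forall f g, S f -> S g -> S (f + g)) -> (forall c f, S f -> S (c *: f)) ->
  S 1 -> (forall x f, S f -> S (sgen K p x * f)) ->
  (forall f, (forall k, exists2 g, S g & sorder k (f - g)) -> S f) -> forall f, S f.
Proof.
move=> SD SZ S1 Sg Sl f; have S0 : S 0 by rewrite -(scale0r (1 : sps)); apply: (SZ).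
apply: Sl => k; exists (trunc k f); last exact: sorder_trunc.
apply: trunc_ind => // c mu _; apply: (SZ); elim/mexp_ind: mu => [|x mu IH].
  by rewrite mon0.
have := SZ ((-1) ^+ msign p (mgen x) mu) _ (Sg x _ IH).
by rewrite sgen_mon monM scalerA -signr_addb addbb scale1r.
Qed.

Lemma shomog0 b : shomog b (0 : sps). Proof. by []. Qed.
Lemma shomogD b f g : shomog b f -> shomog b g -> shomog b (f + g).
Proof. by move=> hf hg mu le; rewrite scoefD hf ?hg ?addr0. Qed.
Lemma shomogN b f : shomog b f -> shomog b (- f).
Proof. by move=> hf mu le; rewrite scoefN hf ?oppr0. Qed.
Lemma shomogZ b c f : shomog b f -> shomog b (c *: f).
Proof. by move=> hf mu le; rewrite scoefZ hf ?mulr0. Qed.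
Lemma shomog_sum b I (r : seq I) (P : pred I) (F : I -> sps) :
  (forall i, P i -> shomog b (F i)) -> shomog b (\sum_(i <- r | P i) F i).
Proof. by move=> h; apply: big_ind => //; apply: shomogD. Qed.
Lemma shomog1 : shomog false (1 : sps).
Proof.
move=> mu ne; rewrite [LHS]scoef1; case: eqP => // e; by rewrite e mpar0 in ne.
Qed.
Lemma shomogM b c f g : shomog b f -> shomog c g -> shomog (b (+) c) (f * g).
Proof.
move=> hf hg mu ne; have [am|nam] := boolP (admissible p mu); last by rewrite scoef_nadm.
rewrite scoefME // big1 // => -[x y] /= /eqP e.
have [e1|/hf ->] := eqVneq (mpar p (mbox x)) b; last by rewrite mulr0 mul0r.
have [e2|/hg ->] := eqVneq (mpar p (mbox y)) c; last by rewrite mulr0.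
by have := mparD p (mbox x) (mbox y); rewrite e e1 e2 => h; rewrite h eqxx in ne.
Qed.
Lemma shomog_sgen x : shomog (p x) (sgen K p x).
Proof.
move=> mu ne; rewrite coef_sgen; case: eqP => // e; by rewrite e mpar_mgen eqxx in ne.
Qed.

Lemma shomog_mon mu : shomog (mpar p mu) (mon mu).
Proof.
move=> nu ne; rewrite coef_series; case: ifP => // _; case: eqP => // e.
by rewrite e eqxx in ne.
Qed.

(** [tw true] is the parity involution. Koszul signs written through it make sense for inhomogeneous
    series as well. *)
Definition tw (b : bool) f : sps := series p (fun mu => (-1) ^+ (b && mpar p mu) * coef f mu).

Lemma coef_tw b f mu : coef (tw b f) mu = (-1) ^+ (b && mpar p mu) * coef f mu.
Proof.
rewrite coef_series; case: ifP => // /negbT nadm; by rewrite scoef_nadm ?mulr0.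
Qed.
Lemma twD b f g : tw b (f + g) = tw b f + tw b g.
Proof. by apply/spsP=> mu; rewrite !(coef_tw, scoefD) mulrDr. Qed.
Lemma twZ b c f : tw b (c *: f) = c *: tw b f.
Proof. by apply/spsP=> mu; rewrite !(coef_tw, scoefZ) mulrCA. Qed.
Lemma twN b f : tw b (- f) = - tw b f.
Proof. by rewrite -!scaleN1r twZ. Qed.
Lemma tw0 b : tw b 0 = 0.
Proof. by apply/spsP=> mu; rewrite coef_tw scoef0 mulr0. Qed.
Lemma twB b f g : tw b (f - g) = tw b f - tw b g.
Proof. by rewrite twD twN. Qed.
Lemma tw_sum b I (r : seq I) (P : pred I) (F : I -> sps) :
  tw b (\sum_(i <- r | P i) F i) = \sum_(i <- r | P i) tw b (F i).
Proof. by apply: (big_morph _ (twD b) (tw0 b)). Qed.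
Lemma twF f : tw false f = f.
Proof. by apply/spsP=> mu; rewrite coef_tw mul1r. Qed.
Lemma tw_tw b c f : tw b (tw c f) = tw (b (+) c) f.
Proof.
by apply/spsP=> mu; rewrite !coef_tw mulrA -signr_addb andb_addl.
Qed.
Lemma twK b : involutive (tw b).
Proof. by move=> f; rewrite tw_tw addbb twF. Qed.
Lemma twM b f g : tw b (f * g) = tw b f * tw b g.
Proof.
apply/spsP=> mu; have [am|nam] := boolP (admissible p mu); last by rewrite !scoef_nadm.
rewrite coef_tw !scoefME // mulr_sumr; apply: eq_bigr => -[x y] /= /eqP e.
have h := mparD p (mbox x) (mbox y); rewrite e in h.
by rewrite !coef_tw h andb_addr signr_addb; ring.
Qed.
Lemma tw_homog b c f : shomog c f -> tw b f = (-1) ^+ (b && c) *: f.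
Proof.
move=> hf; apply/spsP=> mu; rewrite coef_tw scoefZ.
by have [->|/hf ->] := eqVneq (mpar p mu) c; rewrite ?mulr0.
Qed.
Lemma tw1 b : tw b 1 = 1.
Proof. by rewrite (tw_homog _ shomog1) andbF scale1r. Qed.
Lemma sorder_tw k b f : sorder k f -> sorder k (tw b f).
Proof. by move=> hf mu le; rewrite coef_tw hf ?mulr0. Qed.
Lemma shomog_tw c b f : shomog c f -> shomog c (tw b f).
Proof. by move=> hf; rewrite (tw_homog _ hf); apply: shomogZ. Qed.

Lemma supercomm q f g : shomog q g -> f * g = g * tw q f.
Proof.
move=> hg; apply/spsP=> mu.
have [am|nam] := boolP (admissible p mu); last by rewrite !scoef_nadm.
rewrite !scoefME //.
rewrite [RHS](reindex_inj (h := fun ab => (ab.2, ab.1))) /=; last by move=> [? ?] [? ?] [-> ->].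
apply: eq_big => [[a b]|[a b] /eqP /= e]; first by rewrite /= addrC.
have [e2|/hg ->] := eqVneq (mpar p (mbox b)) q; last by rewrite !(mulr0, mul0r).
have := @msignC _ p (mbox a) (mbox b); rewrite e => /(_ am); rewrite e2 => h.
rewrite coef_tw [q && _]andbC -h signr_addb; set x := (-1) ^+ _; set y := (-1) ^+ _.
rewrite -[X in X * _ * _]mul1r -(sqrr_sign K (msign p (mbox b) (mbox a))) -/y; ring.
Qed.

Lemma coef_spart b f mu : coef (spart b f) mu = if mpar p mu == b then coef f mu else 0.
Proof. by rewrite coef_series; case: ifP => // /negbT nadm; rewrite scoef_nadm ?if_same. Qed.
Lemma shomog_spart b f : shomog b (spart b f).
Proof. by move=> mu /negbTE ne; rewrite coef_spart ne. Qed.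
Arguments shomog_spart : clear implicits.
Lemma spart_split f : f = spart false f + spart true f.
Proof.
by apply/spsP=> mu; rewrite scoefD !coef_spart; case: (mpar p mu); rewrite ?add0r ?addr0.
Qed.
Lemma tw_spart b f : tw b f = spart false f + (-1) ^+ b *: spart true f.
Proof.
rewrite {1}[f]spart_split twD !(tw_homog _ (shomog_spart _ _)) andbF andbT scale1r //.
Qed.

End SeriesBasis.

Arguments shomog_spart {K G p} b f.
Arguments shomog_mon {K G p} mu.
Arguments shomog_sgen {K G p} x.
Arguments shomog0 {K G p} b.
Arguments shomog1 {K G p}.
Arguments sorder_sgen {K G p} x.
Arguments sorder0 {K G p} k.
Arguments sorder_0 {K G p} f.
Arguments mon {K G} p mu.

(** * Continuous morphisms and superderivations *)

Section SuperMaps.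
Variables (K : comNzRingType).

(** [sigma] accommodates the complex conjugation in the star map. [sm_order] is continuity, and
    [sm_tw] says that parity is respected without mentioning homogeneous elements. *)
Record smorph (G G' : finType) (p : G -> bool) (p' : G' -> bool)
    (sigma : K -> K) (E : sps K p -> sps K p') : Prop := SMorph {
  smD : {morph E : f g / f + g};
  smZ : forall c f, E (c *: f) = sigma c *: E f;
  smM : {morph E : f g / f * g};
  sm1 : E 1 = 1;
  sm_order : forall k f, sorder k f -> sorder k (E f);
  sm_tw : forall b f, E (tw b f) = tw b (E f) }.

(* The bound c on the loss of order makes D continuous, so that D is determined
   by its values on the generators. *)
Record sderiv (G G' : finType) (p : G -> bool) (p' : G' -> bool)
    (sigma : K -> K) (q : bool) (c : nat) (E D : sps K p -> sps K p') : Prop := SDeriv {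
  sdD : {morph D : f g / f + g};
  sdZ : forall a f, D (a *: f) = sigma a *: D f;
  sdM : forall f g, D (f * g) = D f * E g + tw q (E f) * D g;
  sd_order : forall k f, sorder (k + c) f -> sorder k (D f);
  sd_tw : forall b f, D (tw b f) = (-1) ^+ (b && q) *: tw b (D f) }.

Section Additive.
Variables (G G' : finType) (p : G -> bool) (p' : G' -> bool).
Variables (D : sps K p -> sps K p') (hD : {morph D : f g / f + g}).
Lemma addm0 : D 0 = 0.
Proof. by have := hD 0 0; rewrite addr0 => /esym/eqP; rewrite -subr_eq0 addrK => /eqP. Qed.
Lemma addmN : {morph D : f / - f}.
Proof. by move=> f; apply/eqP; rewrite -subr_eq0 opprK -hD addNr addm0. Qed.
Lemma addmB : {morph D : f g / f - g}.
Proof. by move=> f g; rewrite hD addmN. Qed.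
Lemma addm_sum I (r : seq I) (P : pred I) (F : I -> sps K p) :
  D (\sum_(i <- r | P i) F i) = \sum_(i <- r | P i) D (F i).
Proof. by apply: (big_morph _ hD addm0). Qed.
End Additive.

Lemma smorph_id (G : finType) (p : G -> bool) : smorph id (@id (sps K p)).
Proof. by split. Qed.

Lemma smorph_comp (G1 G2 G3 : finType) (p1 : G1 -> bool) (p2 : G2 -> bool)
    (p3 : G3 -> bool) s1 s2 (E1 : sps K p1 -> sps K p2) (E2 : sps K p2 -> sps K p3) :
  smorph s1 E1 -> smorph s2 E2 -> smorph (s2 \o s1) (E2 \o E1).
Proof.
case=> a1 b1 c1 d1 e1 f1 [a2 b2 c2 d2 e2 f2]; split=> /=.
- by move=> f g /=; rewrite a1 a2.
- by move=> c f; rewrite b1 b2.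
- by move=> f g /=; rewrite c1 c2.
- by rewrite d1 d2.
- by move=> k f /e1/e2.
- by move=> b f; rewrite f1 f2.
Qed.

Lemma smorph_deriv (G1 G2 G3 : finType) (p1 : G1 -> bool) (p2 : G2 -> bool)
    (p3 : G3 -> bool) s1 s2 q c (E1 D1 : sps K p1 -> sps K p2) (E2 : sps K p2 -> sps K p3) :
  s2 (-1) = -1 -> s2 1 = 1 ->
  sderiv s1 q c E1 D1 -> smorph s2 E2 -> sderiv (s2 \o s1) q c (E2 \o E1) (E2 \o D1).
Proof.
move=> sN s_1 [a1 b1 c1 d1 e1] [a2 b2 c2 d2 e2 f2]; split=> /=.
- by move=> f g /=; rewrite a1 a2.
- by move=> x f; rewrite b1 b2.
- by move=> f g /=; rewrite c1 a2 !c2 f2.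
- by move=> k f /d1/e2.
- by move=> b f; rewrite e1 b2 f2; case: (_ && _); rewrite ?expr0 ?expr1 ?sN ?s_1.
Qed.

Lemma sderiv_morph (G1 G2 G3 : finType) (p1 : G1 -> bool) (p2 : G2 -> bool)
    (p3 : G3 -> bool) s1 s2 q c (E1 : sps K p1 -> sps K p2) (E2 D2 : sps K p2 -> sps K p3) :
  smorph s1 E1 -> sderiv s2 q c E2 D2 -> sderiv (s2 \o s1) q c (E2 \o E1) (D2 \o E1).
Proof.
case=> a1 b1 c1 d1 e1 f1 [a2 b2 c2 d2 e2]; split=> /=.
- by move=> f g /=; rewrite a1 a2.
- by move=> x f; rewrite b1 b2.
- by move=> f g /=; rewrite c1 c2.
- by move=> k f /e1/d2.
- by move=> b f; rewrite f1 e2.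
Qed.

Section OneAlgebra.
Variables (G G' : finType) (p : G -> bool) (p' : G' -> bool).
Local Notation A := (sps K p).
Local Notation B := (sps K p').
Implicit Types (E D : A -> B).

Lemma sderiv_widen s q c c' (E D : A -> B) : (c <= c')%N ->
  sderiv s q c E D -> sderiv s q c' E D.
Proof.
move=> le [a b d e f]; split=> // k u hu; apply: e; apply: sorderW hu.
by rewrite leq_add2l.
Qed.

Lemma sderiv0 s q c E : sderiv s q c E (fun=> 0).
Proof.
split=> [f g|a f|f g|k f _|b f] //=; first by rewrite addr0.
- by rewrite scaler0.
- by rewrite mul0r mulr0 addr0.
- by rewrite tw0 scaler0.
Qed.

Lemma sderivD s q c E (D1 D2 : A -> B) : sderiv s q c E D1 -> sderiv s q c E D2 ->
  sderiv s q c E (fun f => D1 f + D2 f).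
Proof.
case=> a1 b1 c1 d1 e1 [a2 b2 c2 d2 e2]; split=> /=.
- by move=> f g /=; rewrite a1 a2 addrACA.
- by move=> x f; rewrite b1 b2 scalerDr.
- by move=> f g /=; rewrite c1 c2 mulrDl mulrDr addrACA.
- by move=> k f h; apply: sorderD; [apply: d1|apply: d2].
- by move=> b f; rewrite e1 e2 twD scalerDr.
Qed.

Lemma sderivZ s q c E D (x : K) : sderiv s q c E D -> sderiv s q c E (fun f => x *: D f).
Proof.
case=> a1 b1 c1 d1 e1; split=> /=.
- by move=> f g /=; rewrite a1 scalerDr.
- by move=> y f; rewrite b1 !scalerA mulrC.
- by move=> f g /=; rewrite c1 scalerDr sps_scalerAl sps_scalerAr.
- by move=> k f h; apply/sorderZ/d1.
- by move=> b f; rewrite e1 twZ !scalerA mulrC.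
Qed.

Lemma sderivN s q c E D : sderiv s q c E D -> sderiv s q c E (fun f => - D f).
Proof.
by move=> /(sderivZ (-1)) h; have -> : (fun f => - D f) = (fun f => -1 *: D f);
  [apply/funext=> f; rewrite scaleN1r|].
Qed.

Lemma sderivB s q c E (D1 D2 : A -> B) : sderiv s q c E D1 -> sderiv s q c E D2 ->
  sderiv s q c E (fun f => D1 f - D2 f).
Proof. by move=> h1 /sderivN; apply: sderivD. Qed.

Lemma sderiv_sum s q c (I : Type) (r : seq I) (P : pred I) E (D : I -> A -> B) :
  (forall i, P i -> sderiv s q c E (D i)) ->
  sderiv s q c E (fun f => \sum_(i <- r | P i) D i f).
Proof.
move=> h; elim: r => [|i r IH].
  rewrite (_ : (fun f => _) = fun=> 0); first exact: sderiv0.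
  by apply/funext=> f; rewrite big_nil.
rewrite (_ : (fun f => _) = fun f => (if P i then D i f else 0)
    + \sum_(i <- r | P i) D i f); last first.
  by apply/funext=> f; rewrite big_cons; case: ifP; rewrite ?add0r.
apply: sderivD IH; case: (P i) (h i) => [|_]; [exact|exact: sderiv0].
Qed.

(** A factor of order c' restores c' of the order lost by [D]; this is why the Euler field, made of
    generators times derivations of loss 1, loses no order at all. *)
Lemma sderivMl s q r c c' E D (u : B) : shomog r u -> sorder c' u -> (c' <= c)%N ->
  sderiv s q c E D -> sderiv s (r (+) q) (c - c') E (fun f => u * D f).
Proof.
move=> hu ou le [a1 b1 c1 d1 e1]; split=> /=.
- by move=> f g /=; rewrite a1 mulrDr.
- by move=> x f; rewrite b1 sps_scalerAr.
- move=> f g /=; rewrite c1 mulrDr !mulrA; congr (_ + _ * _).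
  by rewrite (supercomm _ hu) tw_tw addbA addbb addFb.
- move=> k f ho; have [le'|lt] := leqP c' k.
    rewrite -(subnKC le'); apply: sorderM => //; apply: d1.
    by apply: sorderW ho; lia.
  apply: (@sorderW _ _ _ (c' + 0)); first by rewrite addn0 ltnW.
  by apply: sorderM => //; apply: sorder_0.
- move=> b f; rewrite e1 twM -sps_scalerAr (tw_homog _ hu) -sps_scalerAl scalerA.
  by rewrite -signr_addb; congr (_ ^+ _ *: _); case: b; case: r {hu}; case: q {c1 e1}.
Qed.

Lemma sd1 s q c E D : smorph s E -> sderiv s q c E D -> D 1 = 0 :> B.
Proof.
case=> _ _ _ e1 _ _ hD; have := sdM hD 1 1; rewrite mulr1 e1 tw1 mulr1 mul1r.
by move=> /esym/eqP; rewrite -subr_eq0 addrK => /eqP.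
Qed.

Lemma order_ext c (E F : A -> B) : {morph E : f g / f + g} -> {morph F : f g / f + g} ->
  (forall k f, sorder (k + c) f -> sorder k (E f)) ->
  (forall k f, sorder (k + c) f -> sorder k (F f)) ->
  forall f, (forall k, exists2 g, E g = F g & sorder k (f - g)) -> E f = F f.
Proof.
move=> aE aF oE oF f h; apply/subr0_eq/sorder_eq0 => k; have [g e o] := h (k + c)%N.
have -> : E f - F f = E (f - g) - F (f - g).
  by rewrite (addmB aE) (addmB aF) e opprB addrA subrK.
by apply: sorderB; [apply: oE|apply: oF].
Qed.

Lemma mon_ext c s (E F : A -> B) : {morph E : f g / f + g} -> {morph F : f g / f + g} ->
  (forall a f, E (a *: f) = s a *: E f) -> (forall a f, F (a *: f) = s a *: F f) ->
  (forall k f, sorder (k + c) f -> sorder k (E f)) ->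
  (forall k f, sorder (k + c) f -> sorder k (F f)) ->
  (forall mu, E (mon p mu) = F (mon p mu)) -> E =1 F.
Proof.
move=> aE aF zE zF oE oF h f; refine (@order_ext c E F aE aF oE oF f _) => k.
exists (trunc k f); last exact: sorder_trunc.
apply: (@trunc_ind K G p (fun g => E g = F g)) => [|u v eu ev|a mu _].
  by rewrite (addm0 aE) (addm0 aF).
  by rewrite aE aF eu ev.
by rewrite zE zF h.
Qed.

Lemma smorph_ext s (E F : A -> B) : smorph s E -> smorph s F ->
  (forall x, E (sgen K p x) = F (sgen K p x)) -> E =1 F.
Proof.
case=> aE zE mE e1 oE _ [aF zF mF f1 oF _] h.
apply: (@mon_ext 0 s) => //; [by move=> k; rewrite addn0; apply: oE|
  by move=> k; rewrite addn0; apply: oF|].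
move=> mu; elim/mexp_ind: mu => [|x mu IH]; first by rewrite mon0 e1 f1.
have -> : mon p (mgen x + mu) = (-1) ^+ msign p (mgen x) mu *: (sgen K p x * mon p mu).
  by rewrite sgen_mon monM scalerA -signr_addb addbb scale1r.
by rewrite zE zF mE mF h IH.
Qed.

Lemma sderiv_ext s q c c' (E D D' : A -> B) : smorph s E -> sderiv s q c E D ->
  sderiv s q c' E D' -> (forall x, D (sgen K p x) = D' (sgen K p x)) -> D =1 D'.
Proof.
move=> hE hD hD' h.
have /(sderiv_widen (leq_maxl c c')) [aD zD mD oD _] := hD.
have /(sderiv_widen (leq_maxr c c')) [aF zF mF oF _] := hD'.
apply: (mon_ext aD aF zD zF oD oF) => mu.
elim/mexp_ind: mu => [|x mu IH]; first by rewrite mon0 (sd1 hE hD) (sd1 hE hD').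
have -> : mon p (mgen x + mu) = (-1) ^+ msign p (mgen x) mu *: (sgen K p x * mon p mu).
  by rewrite sgen_mon monM scalerA -signr_addb addbb scale1r.
by rewrite zD zF mD mF h IH.
Qed.

(** In the absence of 2-torsion, parity is the eigenvalue of [tw true], with which [E] commutes. *)
Lemma sm_homog s (E : A -> B) b f : (forall x : K, x + x = 0 -> x = 0) ->
  s (-1) = -1 -> s 1 = 1 -> smorph s E -> shomog b f -> shomog b (E f).
Proof.
move=> u2 sN s1 hE hf mu ne; have := sm_tw hE true f.
rewrite (tw_homog _ hf) (smZ hE) /= => e.
have {}e : (-1) ^+ b *: E f = tw true (E f) by rewrite -e; case: (b); rewrite ?sN ?s1.
have /spsP/(_ mu) := e; rewrite scoefZ coef_tw /= => {}e.
have nb : mpar p' mu = ~~ b by move: ne; case: (mpar p' mu); case: (b).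
move: e; rewrite nb; case: b {hf ne nb} => /=; rewrite ?expr0 ?expr1 !(mulN1r, mul1r) => e.
  by apply: u2; rewrite -{1}e addNr.
by apply: u2; rewrite {1}e addNr.
Qed.

Lemma sd_homog s q c (E D : A -> B) b f : (forall x : K, x + x = 0 -> x = 0) ->
  s (-1) = -1 -> s 1 = 1 -> sderiv s q c E D -> shomog b f -> shomog (b (+) q) (D f).
Proof.
move=> u2 sN s1 hD hf mu ne; have := sd_tw hD true f.
rewrite (tw_homog _ hf) (sdZ hD) /= => e.
have {}e : (-1) ^+ (b (+) q) *: D f = tw true (D f).
  rewrite signr_addb mulrC -scalerA.
  have -> : (-1) ^+ b *: D f = s ((-1) ^+ b) *: D f by case: (b); rewrite ?sN ?s1.
  by rewrite e scalerA -signr_addb addbb scale1r.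
have /spsP/(_ mu) := e; rewrite scoefZ coef_tw /= => {}e.
have nb : mpar p' mu = ~~ (b (+) q) by move: ne; case: (mpar p' mu); case: (_ (+) _).
move: e; rewrite nb; case: (b (+) q) => /=; rewrite ?expr0 ?expr1 !(mulN1r, mul1r) => e.
  by apply: u2; rewrite -{1}e addNr.
by apply: u2; rewrite {1}e addNr.
Qed.

End OneAlgebra.

Section Commutator.
Variables (G : finType) (p : G -> bool).
Local Notation A := (sps K p).

Lemma sderiv_comm q1 q2 c1 c2 (D1 D2 : A -> A) :
  sderiv id q1 c1 id D1 -> sderiv id q2 c2 id D2 ->
  sderiv id (q1 (+) q2) (c1 + c2) id
    (fun f => D1 (D2 f) - (-1) ^+ (q1 && q2) *: D2 (D1 f)).
Proof.
case=> a1 z1 m1 o1 t1 [a2 z2 m2 o2 t2]; split=> /=.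
- by move=> f g /=; rewrite !(a1, a2) scalerDr opprD addrACA.
- move=> x f; rewrite !(z1, z2) scalerBr !scalerA; congr (_ - _ *: _); exact: mulrC.
- move=> f g /=; rewrite !(m1, m2, a1, a2) !(t1, t2) !tw_tw.
  rewrite [q2 && q1]andbC; set s := (-1) ^+ _.
  rewrite [q2 (+) q1]addbC !mulrBl !mulrBr -!sps_scalerAl -!sps_scalerAr.
  rewrite !scalerDr !scalerA (_ : s * s = 1) ?scale1r; last by rewrite -expr2 sqrr_sign.
  set x1 := D1 (D2 f) * g; set x2 := tw q1 _ * D1 g; set x3 := s *: _; set x4 := tw _ f * _.
  set y1 := s *: (D2 (D1 f) * g); set y4 := s *: (tw _ f * _).
  rewrite !opprD !addrA; congr (_ - _).
  (* The terms in which one derivation hits [f] and the other hits [g] occur twice with opposite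
     signs. *)
  rewrite [LHS](ACl (1*5*4*(2*7)*(3*6)))%AC /= !subrr !addr0 //.
- by move=> k f h; apply: sorderB; [apply/o1/o2; rewrite -addnA|apply/sorderZ/o2/o1; rewrite -addnA [(c2 + c1)%N]addnC].
- move=> b f; rewrite t2 t1 z1 z2 t1 t2 twB twZ scalerBr !scalerA; congr (_ *: _ - _ *: _).
    by rewrite -signr_addb; congr (_ ^+ _); case: b; case: (q1); case: (q2).
  by rewrite -!signr_addb; congr (_ ^+ _); case: b; case: (q1); case: (q2).
Qed.

End Commutator.
End SuperMaps.

Section ListSums.

Lemma index_enum_rank (T : finType) (x : T) : index x (enum T) = enum_rank x.
Proof.
rewrite -{1}[x](nth_enum_rank x) index_uniq ?enum_uniq // -cardE; exact: ltn_ord.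
Qed.

Lemma sum_take_enum (T : finType) (x : T) (P : pred T) (F : T -> nat) :
  (\sum_(t <- take (enum_rank x) (enum T) | P t) F t
   = \sum_(t | P t && (enum_rank t < enum_rank x)) F t)%N.
Proof.
rewrite -big_filter big_uniq ?filter_uniq ?take_uniq ?enum_uniq //=.
apply: eq_bigl => t; rewrite mem_filter; congr (_ && _).
by rewrite in_take ?mem_enum // index_enum_rank.
Qed.

End ListSums.

(** * Substitution as a continuous morphism *)

Section Substitution.
Variables (K : comNzRingType) (K2 : forall x : K, x + x = 0 -> x = 0).
Variables (G G' : finType) (p : G -> bool) (p' : G' -> bool).
Variable phi : G -> sps K p'.
Hypotheses (phi_order : forall x, sorder 1 (phi x)) (phi_homog : forall x, shomog (p x) (phi x)).
Arguments phi_order : clear implicits.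
Arguments phi_homog : clear implicits.
Implicit Types (mu nu : mexp G).

Definition mprod (r : seq G) mu : sps K p' := \prod_(x <- r) phi x ^+ mu x.

Lemma sorderX k (f : sps K p') l : sorder k f -> sorder (k * l) (f ^+ l).
Proof.
move=> hf; elim: l => [|l IH]; first by rewrite muln0; apply: sorder_0.
by rewrite exprS mulnS; apply: sorderM.
Qed.

Lemma shomogX b (f : sps K p') l : shomog b f -> shomog (odd l && b) (f ^+ l).
Proof.
move=> hf; elim: l => [|l IH]; first by rewrite expr0; apply: shomog1.
rewrite exprS /=; have -> : ~~ odd l && b = b (+) (odd l && b) by case: (odd l); case: b {hf IH}.
exact: shomogM.
Qed.

Lemma sorder_mprod r mu : sorder (\sum_(x <- r) mu x) (mprod r mu).
Proof.
elim: r => [|x r IH]; first by rewrite big_nil; apply: sorder_0.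
rewrite big_cons /mprod big_cons; apply: sorderM IH.
by have := @sorderX 1 _ (mu x) (phi_order x); rewrite mul1n.
Qed.
Arguments sorder_mprod : clear implicits.

Lemma sorder_mprod_enum mu : sorder (mdeg mu) (mprod (enum G) mu).
Proof. by have := sorder_mprod (enum G) mu; rewrite big_enum. Qed.
Arguments sorder_mprod_enum : clear implicits.

Lemma shomog_mprod r mu : shomog (odd (\sum_(x <- r | p x) mu x)) (mprod r mu).
Proof.
elim: r => [|x r IH]; first by rewrite big_nil /mprod big_nil; apply: shomog1.
rewrite big_cons /mprod big_cons.
have := shomogM (@shomogX _ _ (mu x) (phi_homog x)) IH.
by case: (p x); rewrite ?andbT ?andbF ?oddD.
Qed.
Arguments shomog_mprod : clear implicits.

Lemma eq_mprod r mu nu : {in r, mu =1 nu} -> mprod r mu = mprod r nu.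
Proof. by move=> h; apply: eq_big_seq => x /h ->. Qed.

(** Moving [phi x] to its place in the ordered product crosses exactly the factors that precede x in
    [enum G], so the sign is the one of the monomials. *)
Lemma mprod_sgen x nu : phi x * mprod (enum G) nu =
  (-1) ^+ msign p (mgen x) nu *: mprod (enum G) (mgen x + nu).
Proof.
pose i := enum_rank x; pose r1 := take i (enum G); pose r2 := drop i.+1 (enum G).
have er : enum G = r1 ++ x :: r2.
  rewrite -[LHS](cat_take_drop i) (drop_nth x) ?nth_enum_rank //.
  by rewrite -cardE ltn_ord.
have := enum_uniq G; rewrite er cat_uniq /= negb_or => /and3P[_ /andP[x1 _] /andP[x2 _]].
have mE r mu y : mprod (y :: r) mu = phi y ^+ mu y * mprod r mu by rewrite /mprod big_cons.
have e1 : mprod r1 (mgen x + nu) = mprod r1 nu.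
  apply: eq_mprod => y yr; rewrite !ffunE; case: eqP => // e; by rewrite -e yr in x1.
have e2 : mprod r2 (mgen x + nu) = mprod r2 nu.
  apply: eq_mprod => y yr; rewrite !ffunE; case: eqP => // e; by rewrite -e yr in x2.
have mC r s mu : mprod (r ++ s) mu = mprod r mu * mprod s mu by rewrite /mprod big_cat.
rewrite !mC !mE e1 e2.
rewrite (_ : (mgen x + nu) x = (nu x).+1); last by rewrite !ffunE eqxx.
rewrite exprS !mulrA (supercomm (phi x) (shomog_mprod r1 nu)).
rewrite (tw_homog _ (phi_homog x)) -sps_scalerAr -!sps_scalerAl.
congr (_ ^+ _ *: _); rewrite /msign; congr nat_of_bool.
rewrite sum_take_enum [in RHS]big_mkcond [in RHS](bigD1 x) //= [X in _ = odd X]addnC [X in (X + _)%N]big1 => [|s /negbTE ne].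
  case: (p x); last by rewrite andbF.
  rewrite andbT add0n; congr odd.
  by apply: eq_bigr => t _; rewrite ffunE eqxx mul1n.
by case: ifP => // _; apply: big1 => t _; rewrite ffunE ne.
Qed.

(** An inadmissible exponent repeats an odd variable, and an odd series squares to zero because 2 is
    not a zero divisor. This is what makes substitution multiplicative on all monomials. *)
Lemma mprod_nadm mu : ~~ admissible p mu -> mprod (enum G) mu = 0.
Proof.
elim/mexp_ind: mu => [|x nu IH nadm]; first by rewrite admissible0.
have h : mprod (enum G) (mgen x + nu) =
    (-1) ^+ msign p (mgen x) nu *: (phi x * mprod (enum G) nu).
  by rewrite mprod_sgen scalerA -signr_addb addbb scale1r.
rewrite h; have [an|/IH ->] := boolP (admissible p nu); last by rewrite mulr0 scaler0.
have [px nx] : p x /\ (0 < nu x)%N.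
  move: nadm; rewrite negb_forall => /existsP[y]; rewrite negb_imply => /andP[py].
  have le := implyP (forallP an y) py; rewrite !ffunE; case: eqP => [e b|_].
    subst y; split=> //; rewrite lt0n; apply: contraNneq b => nx0.
    by change (1 + nu x <= 1)%N; rewrite nx0.
  by case/negP; exact: le.
pose lam : mexp G := [ffun y => nu y - mgen x y]%N.
have e : nu = mgen x + lam.
  apply/ffunP=> y; rewrite !ffunE; case: eqP => [->|_]; last by rewrite subn0.
  by change (nu x = 1 + (nu x - 1))%N; rewrite subnKC.
have -> : mprod (enum G) nu =
    (-1) ^+ msign p (mgen x) lam *: (phi x * mprod (enum G) lam).
  by rewrite mprod_sgen scalerA -signr_addb addbb scale1r -e.
rewrite -sps_scalerAr mulrA (_ : phi x * phi x = 0) ?mul0r ?scaler0 //.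
have := supercomm (phi x) (phi_homog x); rewrite (tw_homog _ (phi_homog x)) px expr1 scaleN1r mulrN => e0.
by apply/spsP=> mu; apply: K2; rewrite -scoefD {1}e0 addNr scoef0.
Qed.

Lemma coef_ssubst (f : sps K p) (mu : mexp G') : admissible p' mu -> coef (ssubst phi f) mu =
  \sum_(k < (mdeg mu).+1) \sum_(a : {ffun G -> 'I_k.+1} | mdeg (mbox a) == k)
     coef f (mbox a) * coef (mprod (enum G) (mbox a)) mu.
Proof.
move=> am; rewrite coef_seriesE //; apply: eq_bigr => k _; rewrite scoef_sum.
apply: eq_bigr => a _; rewrite scoefZ; congr (_ * coef _ _).
by apply: eq_bigr => x _; rewrite ffunE.
Qed.

Lemma ssubstD : {morph (@ssubst K G G' p p' phi) : f g / f + g}.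
Proof.
move=> f g; apply/spsP=> mu; rewrite scoefD.
have [am|nam] := boolP (admissible p' mu); last by rewrite !scoef_nadm ?addr0.
rewrite !coef_ssubst // -big_split; apply: eq_bigr => k _; rewrite -big_split.
by apply: eq_bigr => a _; rewrite scoefD mulrDl.
Qed.

Lemma ssubstZ c (f : sps K p) : ssubst phi (c *: f) = c *: ssubst phi f.
Proof.
apply/spsP=> mu; rewrite scoefZ.
have [am|nam] := boolP (admissible p' mu); last by rewrite !scoef_nadm ?mulr0.
rewrite !coef_ssubst // mulr_sumr; apply: eq_bigr => k _; rewrite mulr_sumr.
by apply: eq_bigr => a _; rewrite scoefZ mulrA.
Qed.

Lemma sorder_ssubst k (f : sps K p) : sorder k f -> sorder k (ssubst phi f).
Proof.
move=> hf mu lt; have [am|nam] := boolP (admissible p' mu); last by rewrite scoef_nadm.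
rewrite coef_ssubst // big1 // => l _; rewrite big1 // => a /eqP ea.
by rewrite hf ?mul0r // ea (leq_ltn_trans _ lt) // -ltnS.
Qed.

Lemma ssubst_mon mu : ssubst phi (mon p mu) = mprod (enum G) mu.
Proof.
have [adm|nadm] := boolP (admissible p mu); last first.
  by rewrite mprod_nadm // mon_nadm // (addm0 ssubstD).
apply/spsP=> nu.
have [am|nam] := boolP (admissible p' nu); last by rewrite !scoef_nadm.
rewrite coef_ssubst //; have [le|lt] := leqP (mdeg mu) (mdeg nu); last first.
  rewrite sorder_mprod_enum // big1 // => l _; rewrite big1 // => a /eqP ea.
  rewrite coef_mon //; case: eqP => [e|]; last by rewrite mul0r.
  by move: lt; rewrite -e ea ltnNge -ltnS ltn_ord.
rewrite (bigD1 (Ordinal (le : mdeg mu < (mdeg nu).+1)%N)) //= addrC big1 => [|l ne].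
  have [a ea] := mboxP (leqnn (mdeg mu).+1); rewrite add0r (bigD1 a) /= ?ea //.
  rewrite coef_mon // eqxx mul1r big1 ?addr0 // => b /andP[_ nb].
  rewrite coef_mon //; case: eqP => [e|_]; last by rewrite mul0r.
  by case/eqP: nb; apply: mbox_inj; rewrite ea e.
rewrite big1 // => a /eqP ea; rewrite coef_mon //; case: eqP => [e|_]; last by rewrite mul0r.
by case/eqP: ne; apply: val_inj; rewrite /= -ea e.
Qed.

Lemma ssubst_sgen x : ssubst phi (sgen K p x) = phi x.
Proof.
rewrite sgen_mon ssubst_mon -[mgen x]addr0.
have := mprod_sgen x 0; rewrite msignm0 scale1r => <-.
by rewrite /mprod big1 ?mulr1 // => y _; rewrite ffunE.
Qed.

Lemma ssubst1 : ssubst phi (1 : sps K p) = 1.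
Proof.
by rewrite -(mon0 K p) ssubst_mon /mprod big1 // => y _; rewrite ffunE.
Qed.

Lemma ssubst_sgenM x (f : sps K p) :
  ssubst phi (sgen K p x * f) = phi x * ssubst phi f.
Proof.
move: f; apply: (@mon_ext K G G' p p' 0 id) => [f g|f g|c f|c f|k f|k f|nu] /=.
- by rewrite mulrDr ssubstD.
- by rewrite ssubstD mulrDr.
- by rewrite -sps_scalerAr ssubstZ.
- by rewrite ssubstZ -sps_scalerAr.
- rewrite addn0 => h; apply/sorder_ssubst; rewrite -[k]add0n; apply: sorderM => //; exact: sorder_0.
- rewrite addn0 => h; rewrite -[k]add0n; apply: sorderM (sorder_ssubst h); exact: sorder_0.
by rewrite sgen_mon monM ssubstZ !ssubst_mon mprod_sgen.
Qed.

Lemma ssubstM : {morph (@ssubst K G G' p p' phi) : f g / f * g}.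
Proof.
move=> f g; move: f; apply: sps_ind => [f h|c f|||f h].
- by rewrite mulrDl !ssubstD mulrDl => -> ->.
- by rewrite -sps_scalerAl !ssubstZ -sps_scalerAl => ->.
- by rewrite mul1r ssubst1 mul1r.
- by move=> x f h; rewrite -mulrA !ssubst_sgenM -mulrA h.
apply: (@order_ext K G G' p p' 0 (fun f => ssubst phi (f * g))
   (fun f => ssubst phi f * ssubst phi g)) => //= [u v|u v|k u|k u].
- by rewrite mulrDl ssubstD.
- by rewrite ssubstD mulrDl.
- rewrite addn0 => o; apply/sorder_ssubst; rewrite -[k]addn0; apply: sorderM => //; exact: sorder_0.
- rewrite addn0 => o; rewrite -{1}[k]addn0; apply: sorderM (sorder_ssubst o) _; exact: sorder_0.
Qed.

Lemma ssubst_tw b (f : sps K p) : ssubst phi (tw b f) = tw b (ssubst phi f).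
Proof.
move: f; apply: sps_ind => [f h|c f|||f h].
- by rewrite twD !ssubstD twD => -> ->.
- by rewrite twZ !ssubstZ twZ => ->.
- by rewrite tw1 ssubst1 tw1.
- move=> x f h; rewrite twM !ssubstM h ssubst_sgen twM; congr (_ * _).
  by rewrite (tw_homog _ (phi_homog x)) (tw_homog _ (shomog_sgen x)) ssubstZ ssubst_sgen.
apply: (@order_ext K G G' p p' 0 (fun f => ssubst phi (tw b f))
   (fun f => tw b (ssubst phi f))) => //= [u v|u v|k u|k u].
- by rewrite twD ssubstD.
- by rewrite ssubstD twD.
- by rewrite addn0 => o; apply/sorder_ssubst/sorder_tw.
- by rewrite addn0 => o; apply/sorder_tw/sorder_ssubst.
Qed.

Lemma ssubst_smorph : smorph id (ssubst phi : sps K p -> sps K p').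
Proof.
by split; [exact: ssubstD|exact: ssubstZ|exact: ssubstM|exact: ssubst1
  |exact: sorder_ssubst|exact: ssubst_tw].
Qed.

End Substitution.

Section CoefficientMap.
Variables (K : comNzRingType) (G : finType) (p : G -> bool) (s : {rmorphism K -> K}).

Lemma coef_smap (f : sps K p) mu : coef (smap s f) mu = s (coef f mu).
Proof. by rewrite coef_series; case: ifP => // /negbT h; rewrite scoef_nadm ?rmorph0. Qed.

Lemma smap_smorph : smorph s (@smap K G p s).
Proof.
split=> [f g|c f|f g||k f h|b f].
- by apply/spsP=> mu; rewrite !(coef_smap, scoefD) rmorphD.
- by apply/spsP=> mu; rewrite !(coef_smap, scoefZ) rmorphM.
- apply/spsP=> mu; have [am|nam] := boolP (admissible p mu); last by rewrite !scoef_nadm.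
  rewrite coef_smap !scoefME // rmorph_sum; apply: eq_bigr => ab _.
  by rewrite !rmorphM rmorph_sign !coef_smap.
- apply/spsP=> mu; rewrite coef_smap ![coef 1 _]scoef1; by case: eqP; rewrite ?rmorph1 ?rmorph0.
- by move=> mu lt; rewrite coef_smap h ?rmorph0.
- by apply/spsP=> mu; rewrite !(coef_smap, coef_tw) rmorphM rmorph_sign.
Qed.

Lemma smap_sgen x : smap s (sgen K p x) = sgen K p x.
Proof.
by apply/spsP=> mu; rewrite coef_smap !coef_sgen; case: eqP; rewrite ?rmorph1 ?rmorph0.
Qed.

End CoefficientMap.

(** * Contraction of one tensor factor *)

Section Join.
Variables (m n : nat) (T : finType).
Local Notation gT := (gens m n T).
Local Notation g2 := (gens m n (T + T)%type).
Local Notation pT := (@gpar m n T).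
Local Notation p2 := (@gpar m n (T + T)%type).
Implicit Types (a b c d : mexp gT).

Definition lgen (g : gT) : g2 := (inl g.1, g.2).
Definition rgen (g : gT) : g2 := (inr g.1, g.2).
Definition lres (mu : mexp g2) : mexp gT := [ffun g => mu (lgen g)].
Definition rres (mu : mexp g2) : mexp gT := [ffun g => mu (rgen g)].

Lemma lgen_inj : injective lgen. Proof. by move=> [t x] [u y] [-> ->]. Qed.
Lemma rgen_inj : injective rgen. Proof. by move=> [t x] [u y] [-> ->]. Qed.

(** The order of the monomials puts the left copies first; hence the monomial of [mjoin a b] is the
    left monomial times the right one, with no extra sign. *)
Lemma enum_gens2 : enum g2 = map lgen (enum gT) ++ map rgen (enum gT).
Proof.
have h (A B : finType) : enum {: A * B} = [seq (x, y) | x <- enum A, y <- enum B].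
  by rewrite [LHS]enumT unlock.
have h2 (A : finType) : enum {: A + A} = map inl (enum A) ++ map inr (enum A).
  by rewrite !enumT [in LHS]unlock.
rewrite /gens !h h2 allpairs_cat; congr (_ ++ _);
  by rewrite map_allpairs allpairs_mapl.
Qed.

Lemma rank_lgen g h : (enum_rank (lgen g) < enum_rank (lgen h) = (enum_rank g < enum_rank h))%N.
Proof.
have e k : index (lgen k) (enum g2) = index k (enum gT).
  by rewrite enum_gens2 index_cat (mem_map lgen_inj) mem_enum (index_map lgen_inj).
by rewrite -!index_enum_rank !e.
Qed.

Lemma lr_notin g : rgen g \notin map lgen (enum gT).
Proof. by apply/negP=> /mapP[[t x] _]. Qed.

Lemma rank_rgen g h : (enum_rank (rgen g) < enum_rank (rgen h) = (enum_rank g < enum_rank h))%N.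
Proof.
rewrite -!index_enum_rank enum_gens2 !index_cat !(negbTE (lr_notin _)).
by rewrite !(index_map rgen_inj) ltn_add2l.
Qed.

Lemma rank_lrgen g h : (enum_rank (lgen g) < enum_rank (rgen h))%N.
Proof.
rewrite -!index_enum_rank enum_gens2 !index_cat !(negbTE (lr_notin _)).
rewrite (mem_map lgen_inj) mem_enum.
by rewrite (index_map lgen_inj) size_map ltn_addr // index_mem mem_enum.
Qed.

Lemma big_gens2 (R : Type) (idx : R) (op : Monoid.com_law idx) (F : g2 -> R) :
  \big[op/idx]_(g : g2) F g =
  op (\big[op/idx]_(g : gT) F (lgen g)) (\big[op/idx]_(g : gT) F (rgen g)).
Proof.
have e (A : finType) (H : A * ('I_(m + n) * 'I_(m + n)) -> R) :
    \big[op/idx]_g H g = \big[op/idx]_t \big[op/idx]_x H (t, x).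
  by rewrite pair_big; apply: eq_bigr => -[].
by rewrite !e big_sumType.
Qed.

Lemma mjoin_l a b g : mjoin a b (lgen g) = a g.
Proof. by rewrite ffunE; case: g. Qed.
Lemma mjoin_r a b g : mjoin a b (rgen g) = b g.
Proof. by rewrite ffunE; case: g. Qed.
Lemma lres_join a b : lres (mjoin a b) = a.
Proof. by apply/ffunP=> g; rewrite ffunE mjoin_l. Qed.
Lemma rres_join a b : rres (mjoin a b) = b.
Proof. by apply/ffunP=> g; rewrite ffunE mjoin_r. Qed.
Lemma join_res mu : mjoin (lres mu) (rres mu) = mu.
Proof. by apply/ffunP=> -[[t|t] x]; rewrite !ffunE /= ?ffunE. Qed.
Lemma mjoinD a b c d : mjoin a b + mjoin c d = mjoin (a + c) (b + d).
Proof. by apply/ffunP=> -[[t|t] x]; rewrite !ffunE /= ?ffunE. Qed.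
Lemma mjoin0 : mjoin 0 0 = 0 :> mexp g2.
Proof. by apply/ffunP=> -[[t|t] x]; rewrite !ffunE /= ?ffunE. Qed.
Lemma mgen_l g : mgen (lgen g) = mjoin (mgen g) 0.
Proof. by case: g => u y; apply/ffunP=> -[[t|t] x]; rewrite !ffunE /= ?ffunE ?xpair_eqE. Qed.
Lemma mgen_r g : mgen (rgen g) = mjoin 0 (mgen g).
Proof. by case: g => u y; apply/ffunP=> -[[t|t] x]; rewrite !ffunE /= ?ffunE ?xpair_eqE. Qed.

Lemma mdeg_join a b : mdeg (mjoin a b) = (mdeg a + mdeg b)%N.
Proof.
by rewrite /mdeg big_gens2; congr (_ + _)%N; apply: eq_bigr => g _; rewrite (mjoin_l, mjoin_r).
Qed.

Lemma mpar_join a b : mpar p2 (mjoin a b) = mpar pT a (+) mpar pT b.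
Proof.
rewrite /mpar -oddD; congr odd; rewrite big_mkcond big_gens2 /=.
by congr (_ + _)%N; rewrite [RHS]big_mkcond; apply: eq_bigr => g _; rewrite (mjoin_l, mjoin_r).
Qed.

Lemma admissible_join a b : admissible p2 (mjoin a b) = admissible pT a && admissible pT b.
Proof.
apply/forallP/andP => [h|[/forallP ha /forallP hb] [[t|t] x]].
- split; apply/forallP=> g; first by have := h (lgen g); rewrite mjoin_l.
  by have := h (rgen g); rewrite mjoin_r.
- by have := ha (t, x); rewrite -(mjoin_l a b).
- by have := hb (t, x); rewrite -(mjoin_r a b).
Qed.

(** The last summand is the Koszul sign of moving the left monomial x^c past the right monomial
    x^b. *)
Lemma msign_join a b c d : msign p2 (mjoin a b) (mjoin c d) =
  msign pT a c (+) msign pT b d (+) (mpar pT b && mpar pT c).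
Proof.
rewrite /msign /mpar -oddM -!oddD; congr odd.
rewrite big_mkcond big_gens2 /= -!big_mkcond /= -addnA; congr (_ + _)%N.
  apply: eq_bigr => g pg; rewrite big_mkcond big_gens2 /= -!big_mkcond /=.
  rewrite mjoin_l [X in (_ + X)%N]big1 ?addn0 => [|h].
    by apply: eq_big => [h|h _]; rewrite ?rank_lgen ?mjoin_l.
  by rewrite ltnNge ltnW ?rank_lrgen ?andbF.
rewrite big_distrl -big_split /=; apply: eq_bigr => g pg.
rewrite big_mkcond big_gens2 /= -!big_mkcond /= mjoin_r addnC; congr (_ + _)%N.
  by apply: eq_big => [h|h _]; rewrite ?rank_rgen ?mjoin_r.
by rewrite big_distrr /=; apply: eq_big => [h|h _]; rewrite ?rank_lrgen ?andbT ?mjoin_l ?mjoin_r.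
Qed.

End Join.

Section Contraction.
Variables (K : comNzRingType) (m n : nat) (T : finType).
Local Notation gT := (gens m n T).
Local Notation g2 := (gens m n (T + T)%type).
Local Notation pT := (@gpar m n T).
Local Notation p2 := (@gpar m n (T + T)%type).
Local Notation A := (sps K pT).
Local Notation A2 := (sps K p2).

(** For a = 0 this applies the counit to the left factor; for a generator it applies the
    corresponding dual vector of the tangent space at the identity. *)
Definition ctl (a : mexp gT) (F : A2) : A := series pT (fun nu => coef F (mjoin a nu)).
Definition ctr (a : mexp gT) (F : A2) : A := series pT (fun nu => coef F (mjoin nu a)).

Lemma coef_ctl a F nu : coef (ctl a F) nu = coef F (mjoin a nu).
Proof.
rewrite coef_series; case: ifP => // /negbT nadm; rewrite scoef_nadm //.
by rewrite admissible_join (negbTE nadm) andbF.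
Qed.
Lemma coef_ctr a F nu : coef (ctr a F) nu = coef F (mjoin nu a).
Proof.
rewrite coef_series; case: ifP => // /negbT nadm; rewrite scoef_nadm //.
by rewrite admissible_join (negbTE nadm).
Qed.

Lemma ctlD a : {morph ctl a : F H / F + H}.
Proof. by move=> F H; apply/spsP=> mu; rewrite !(coef_ctl, scoefD). Qed.
Lemma ctrD a : {morph ctr a : F H / F + H}.
Proof. by move=> F H; apply/spsP=> mu; rewrite !(coef_ctr, scoefD). Qed.
Lemma ctlZ a c F : ctl a (c *: F) = c *: ctl a F.
Proof. by apply/spsP=> mu; rewrite !(coef_ctl, scoefZ). Qed.
Lemma ctrZ a c F : ctr a (c *: F) = c *: ctr a F.
Proof. by apply/spsP=> mu; rewrite !(coef_ctr, scoefZ). Qed.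
Lemma sorder_ctl a k F : sorder (k + mdeg a) F -> sorder k (ctl a F).
Proof. by move=> h mu lt; rewrite coef_ctl h // mdeg_join addnC ltn_add2r. Qed.
Lemma sorder_ctr a k F : sorder (k + mdeg a) F -> sorder k (ctr a F).
Proof. by move=> h mu lt; rewrite coef_ctr h // mdeg_join ltn_add2r. Qed.
Lemma ctl_tw a b F : ctl a (tw b F) = (-1) ^+ (b && mpar pT a) *: tw b (ctl a F).
Proof.
apply/spsP=> mu; rewrite scoefZ coef_ctl !coef_tw coef_ctl mpar_join.
by rewrite andb_addr signr_addb mulrA.
Qed.
Lemma ctr_tw a b F : ctr a (tw b F) = (-1) ^+ (b && mpar pT a) *: tw b (ctr a F).
Proof.
apply/spsP=> mu; rewrite scoefZ coef_ctr !coef_tw coef_ctr mpar_join.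
by rewrite addbC andb_addr signr_addb mulrA.
Qed.

Lemma ctl_mon a b c : admissible pT a ->
  ctl a (mon p2 (mjoin b c)) = if b == a then mon pT c else 0.
Proof.
move=> ada; apply/spsP=> nu; rewrite coef_ctl coef_series admissible_join ada.
have e : (mjoin a nu == mjoin b c) = (b == a) && (nu == c).
  apply/eqP/andP => [e|[/eqP -> /eqP -> //]].
  have := congr1 (@lres m n T) e; have := congr1 (@rres m n T) e.
  by rewrite !lres_join !rres_join => -> ->.
rewrite e /=; case: eqP => _ /=; last by rewrite if_same.
by rewrite coef_series.
Qed.
Lemma ctr_mon a b c : admissible pT a ->
  ctr a (mon p2 (mjoin b c)) = if c == a then mon pT b else 0.
Proof.
move=> ada; apply/spsP=> nu; rewrite coef_ctr coef_series admissible_join ada andbT.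
have e : (mjoin nu a == mjoin b c) = (c == a) && (nu == b).
  apply/eqP/andP => [e|[/eqP -> /eqP -> //]].
  have := congr1 (@lres m n T) e; have := congr1 (@rres m n T) e.
  by rewrite !lres_join !rres_join => -> ->.
rewrite e /=; case: eqP => _ /=; last by rewrite if_same.
by rewrite coef_series.
Qed.

Lemma monjM a b c d : mon p2 (mjoin a b) * mon p2 (mjoin c d) =
  (-1) ^+ (msign pT a c (+) msign pT b d (+) (mpar pT b && mpar pT c))
    *: mon p2 (mjoin (a + c) (b + d)) :> A2.
Proof. by rewrite monM msign_join mjoinD. Qed.

Record clin (G G' : finType) (p : G -> bool) (p' : G' -> bool) (c : nat)
    (D : sps K p -> sps K p') : Prop := Clin {
  clD : {morph D : f g / f + g};
  clZ : forall a f, D (a *: f) = a *: D f;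
  cl_order : forall k f, sorder (k + c) f -> sorder k (D f) }.

Record cbilin (G G' : finType) (p : G -> bool) (p' : G' -> bool) (c : nat)
    (P : sps K p -> sps K p -> sps K p') : Prop := Cbilin {
  cbl : forall F, clin c (P F);
  cbr : forall H, clin c (P^~ H) }.

Lemma sorderMl (G : finType) (p : G -> bool) k (F H : sps K p) : sorder k F -> sorder k (F * H).
Proof. by move=> h; rewrite -[k]addn0; apply: sorderM => //; apply: sorder_0. Qed.
Lemma sorderMr (G : finType) (p : G -> bool) k (F H : sps K p) : sorder k H -> sorder k (F * H).
Proof. by move=> h; rewrite -[k]add0n; apply: sorderM => //; apply: sorder_0. Qed.

(** Both sides of a product rule are bilinear and continuous in each argument, so product rules need
    only be compared on monomials, where they are identities between signs. *)
Lemma cbilin_ext (G G' : finType) (p : G -> bool) (p' : G' -> bool) c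
    (P Q : sps K p -> sps K p -> sps K p') : cbilin c P -> cbilin c Q ->
  (forall mu nu, P (mon p mu) (mon p nu) = Q (mon p mu) (mon p nu)) ->
  forall F H, P F H = Q F H.
Proof.
move=> [lP rP] [lQ rQ] h F H; move: F.
have [a1 z1 o1] := rP H; have [a2 z2 o2] := rQ H.
apply: (mon_ext a1 a2 z1 z2 o1 o2) => mu; move: H {a1 z1 o1 a2 z2 o2}.
have [a1 z1 o1] := lP (mon p mu); have [a2 z2 o2] := lQ (mon p mu).
exact: (mon_ext a1 a2 z1 z2 o1 o2).
Qed.

Lemma cbilin_mul (G G' : finType) (p : G -> bool) (p' : G' -> bool) c
    (D : sps K p -> sps K p') : clin c D -> cbilin c (fun F H => D (F * H)).
Proof.
case=> a z o; split=> F; split.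
- by move=> f g /=; rewrite mulrDr a.
- by move=> x f /=; rewrite -sps_scalerAr z.
- by move=> k f h; apply/o/sorderMr.
- by move=> f g /=; rewrite mulrDl a.
- by move=> x f /=; rewrite -sps_scalerAl z.
- by move=> k f h; apply/o/sorderMl.
Qed.

Lemma cbilin_tensor (G G' : finType) (p : G -> bool) (p' : G' -> bool) c
    (D E : sps K p -> sps K p') : clin c D -> clin c E -> cbilin c (fun F H => D F * E H).
Proof.
case=> a z o [a' z' o']; split=> F; split.
- by move=> f g /=; rewrite a' mulrDr.
- by move=> x f /=; rewrite z' -sps_scalerAr.
- by move=> k f h; apply/sorderMr/o'.
- by move=> f g /=; rewrite a mulrDl.
- by move=> x f /=; rewrite z -sps_scalerAl.
- by move=> k f h; apply/sorderMl/o.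
Qed.

Lemma cbilinD (G G' : finType) (p : G -> bool) (p' : G' -> bool) c
    (P Q : sps K p -> sps K p -> sps K p') : cbilin c P -> cbilin c Q ->
  cbilin c (fun F H => P F H + Q F H).
Proof.
move=> [l r] [l' r']; split=> F.
  have [a z o] := l F; have [a' z' o'] := l' F; split.
  - by move=> f g /=; rewrite a a' addrACA.
  - by move=> x f /=; rewrite z z' scalerDr.
  - by move=> k f h; apply: sorderD; [apply: o|apply: o'].
have [a z o] := r F; have [a' z' o'] := r' F; split.
- by move=> f g /=; rewrite [P _ _]a [Q _ _]a' addrACA.
- by move=> x f /=; rewrite [P _ _]z [Q _ _]z' scalerDr.
- by move=> k f h; apply: sorderD; [apply: o|apply: o'].
Qed.

Lemma clin_widen (G G' : finType) (p : G -> bool) (p' : G' -> bool) c c'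
    (D : sps K p -> sps K p') : (c <= c')%N -> clin c D -> clin c' D.
Proof.
move=> le [a z o]; split=> // k f h; apply: o; apply: sorderW h; by rewrite leq_add2l.
Qed.

Lemma clin_ctl a : clin (mdeg a) (ctl a).
Proof. by split; [exact: ctlD|exact: ctlZ|exact: sorder_ctl]. Qed.
Lemma clin_ctr a : clin (mdeg a) (ctr a).
Proof. by split; [exact: ctrD|exact: ctrZ|exact: sorder_ctr]. Qed.
Lemma clin_ctlW a k : (mdeg a <= k)%N -> clin k (ctl a).
Proof. by move=> le; apply: clin_widen le (clin_ctl a). Qed.
Lemma clin_ctrW a k : (mdeg a <= k)%N -> clin k (ctr a).
Proof. by move=> le; apply: clin_widen le (clin_ctr a). Qed.
Lemma clin_tw (G G' : finType) (p : G -> bool) (p' : G' -> bool) c b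
    (D : sps K p -> sps K p') : clin c D -> clin c (fun f => tw b (D f)).
Proof.
case=> a z o; split=> [f g|x f|k f h] /=; first by rewrite a twD.
  by rewrite z twZ.
exact/sorder_tw/o.
Qed.

Lemma ctl1 a : ctl a 1 = (a == 0)%:R.
Proof.
rewrite -mon0; apply/spsP=> nu; rewrite coef_ctl coef_mon ?admissible0 //.
have -> : (mjoin a nu == 0 :> mexp g2) = (a == 0) && (nu == 0).
  apply/eqP/andP => [e|[/eqP -> /eqP ->]]; last by rewrite mjoin0.
  rewrite -(lres_join a nu) -[nu in X in _ /\ X](rres_join a nu) e.
  by split; apply/eqP/ffunP=> g; rewrite !ffunE.
by case: (a == 0); rewrite ?scoef0 //= [RHS]scoef1.
Qed.
Lemma ctr1 a : ctr a 1 = (a == 0)%:R.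
Proof.
rewrite -mon0; apply/spsP=> nu; rewrite coef_ctr coef_mon ?admissible0 //.
have -> : (mjoin nu a == 0 :> mexp g2) = (a == 0) && (nu == 0).
  apply/eqP/andP => [e|[/eqP -> /eqP ->]]; last by rewrite mjoin0.
  rewrite -(rres_join nu a) -[nu in X in _ /\ X](lres_join nu a) e.
  by split; apply/eqP/ffunP=> g; rewrite !ffunE.
by case: (a == 0); rewrite ?scoef0 //= [RHS]scoef1.
Qed.

Let am0 : admissible pT 0 := admissible0 pT.

Lemma ctl0_smorph : smorph id (ctl 0).
Proof.
split; [exact: ctlD|exact: ctlZ| |by rewrite ctl1 eqxx| |].
- apply: (@cbilin_ext _ _ _ _ 0); first by apply/cbilin_mul/clin_ctlW; rewrite mdeg0.
    by apply: cbilin_tensor; apply: clin_ctlW; rewrite mdeg0.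
  move=> mu nu; rewrite -[mu]join_res -[nu]join_res monjM ctlZ !ctl_mon //.
  have [->|n1] := eqVneq (lres mu) 0; last first.
    by rewrite mul0r; case: eqP => [/addm_eq0[/eqP]|]; rewrite ?(negbTE n1) ?scaler0.
  have [->|n2] := eqVneq (lres nu) 0; last first.
    by rewrite mulr0; case: eqP => [/addm_eq0[_ /eqP]|]; rewrite ?(negbTE n2) ?scaler0.
  by rewrite addr0 eqxx monM msign0m mpar0 andbF addbF.
- by move=> k f h; apply: sorder_ctl; rewrite mdeg0 addn0.
- by move=> b f; rewrite ctl_tw mpar0 andbF scale1r.
Qed.

Lemma ctr0_smorph : smorph id (ctr 0).
Proof.
split; [exact: ctrD|exact: ctrZ| |by rewrite ctr1 eqxx| |].
- apply: (@cbilin_ext _ _ _ _ 0); first by apply/cbilin_mul/clin_ctrW; rewrite mdeg0.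
    by apply: cbilin_tensor; apply: clin_ctrW; rewrite mdeg0.
  move=> mu nu; rewrite -[mu]join_res -[nu]join_res monjM ctrZ !ctr_mon //.
  have [->|n1] := eqVneq (rres mu) 0; last first.
    by rewrite mul0r; case: eqP => [/addm_eq0[/eqP]|]; rewrite ?(negbTE n1) ?scaler0.
  have [->|n2] := eqVneq (rres nu) 0; last first.
    by rewrite mulr0; case: eqP => [/addm_eq0[_ /eqP]|]; rewrite ?(negbTE n2) ?scaler0.
  by rewrite addr0 eqxx monM msign0m mpar0 andFb !addbF.
- by move=> k f h; apply: sorder_ctr; rewrite mdeg0 addn0.
- by move=> b f; rewrite ctr_tw mpar0 andbF scale1r.
Qed.

Lemma ctl_deriv g : sderiv id (gpar g) 1 (ctl 0) (ctl (mgen g)).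
Proof.
split; [exact: ctlD|exact: ctlZ| | |].
- apply: (@cbilin_ext _ _ _ _ 1).
  + by apply/cbilin_mul/clin_ctlW; rewrite mdeg_mgen.
  + by apply: cbilinD; apply: cbilin_tensor; try apply: clin_tw; apply: clin_ctlW;
      rewrite ?mdeg0 ?mdeg_mgen.
  have am := admissible_mgen pT g.
  move=> mu nu; rewrite -[mu]join_res -[nu]join_res monjM ctlZ !ctl_mon //.
  set a := lres mu; set b := rres mu; set c := lres nu; set d := rres nu.
  have [e|ne] := eqVneq (a + c) (mgen g).
    have [[-> ->]|[-> ->]] := addm_gen e.
      rewrite eq_sym (negbTE (mgen_neq0 g)) mul0r add0r !eqxx.
      rewrite msign0m mpar_mgen (tw_homog _ (shomog_mon b)) -?sps_scalerAl ?monM ?scalerA.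
      by rewrite -signr_addb addbC andbC.
    rewrite !eqxx (negbTE (mgen_neq0 g)) tw0 mul0r addr0 monM msignm0 mpar0 andbF addbF //.
  have n1 : ~~ ((a == mgen g) && (c == 0)).
    by apply: contra ne => /andP[/eqP -> /eqP ->]; rewrite addr0.
  have n2 : ~~ ((a == 0) && (c == mgen g)).
    by apply: contra ne => /andP[/eqP -> /eqP ->]; rewrite add0r.
  rewrite scaler0; move: n1 n2; case: (a == _); case: (c == _); case: (a == _);
    by case: (c == _) => //= _ _; rewrite ?(tw0, mul0r, mulr0, addr0).
- by move=> k f h; apply: sorder_ctl; rewrite mdeg_mgen.
- by move=> b f; rewrite ctl_tw mpar_mgen.
Qed.

(* Unlike ctl, a right derivation; the parity twist in Rop below turns it into a left one. *)
Lemma ctr_deriv g F H : ctr (mgen g) (F * H) =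
  ctr (mgen g) F * tw (gpar g) (ctr 0 H) + ctr 0 F * ctr (mgen g) H.
Proof.
move: F H; apply: (@cbilin_ext _ _ _ _ 1).
- by apply/cbilin_mul/clin_ctrW; rewrite mdeg_mgen.
- by apply: cbilinD; apply: cbilin_tensor; try apply: clin_tw; apply: clin_ctrW;
    rewrite ?mdeg0 ?mdeg_mgen.
have am := admissible_mgen pT g.
move=> mu nu; rewrite -[mu]join_res -[nu]join_res monjM ctrZ !ctr_mon //.
set a := lres mu; set b := rres mu; set c := lres nu; set d := rres nu.
have [e|ne] := eqVneq (b + d) (mgen g).
  have [[-> ->]|[-> ->]] := addm_gen e.
    rewrite eq_sym (negbTE (mgen_neq0 g)) mul0r add0r !eqxx.
    by rewrite msign0m mpar0 andFb !addbF monM.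
  rewrite !eqxx (negbTE (mgen_neq0 g)) mul0r addr0 msignm0 mpar_mgen addbF.
  rewrite (tw_homog _ (shomog_mon c)) -?sps_scalerAr ?monM ?scalerA.
  by rewrite -signr_addb addbC.
have n1 : ~~ ((b == mgen g) && (d == 0)).
  by apply: contra ne => /andP[/eqP -> /eqP ->]; rewrite addr0.
have n2 : ~~ ((b == 0) && (d == mgen g)).
  by apply: contra ne => /andP[/eqP -> /eqP ->]; rewrite add0r.
rewrite scaler0; move: n1 n2; case: (b == _); case: (d == _); case: (b == _);
  by case: (d == _) => //= _ _; rewrite ?(tw0, mul0r, mulr0, addr0).
Qed.

End Contraction.

(** * Invariant vector fields *)

(* The entries of 1 + X for the copy t. *)
HB.lock Definition xh (K : comNzRingType) (m n : nat) (T : finType)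
    (t : T) (i j : 'I_(m + n)) : fps K m n T :=
  (i == j)%:R + sgen K (@gpar m n T) (t, (i, j)).
Canonical xh_unlockable := Unlockable xh.unlock.

Section Hats.
Variables (K : comNzRingType) (m n : nat) (T : finType).
Local Notation A := (fps K m n T).
Local Notation ip := (@ipar m n).
Implicit Types (t : T) (i j a b : 'I_(m + n)).

Local Notation xh := (@xh K m n T).

Lemma xh_def t i j : xh t i j = (i == j)%:R + sgen K (@gpar m n T) (t, (i, j)).
Proof. by rewrite unlock. Qed.

Lemma xhE t i j : (1%:M + xmx K m n t) i j = xh t i j.
Proof. by rewrite xh_def !mxE. Qed.

Lemma shomog_xh t i j : shomog (ip i (+) ip j) (xh t i j).
Proof.
rewrite xh_def; apply: shomogD; last exact: shomog_sgen (t, (i, j)).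
by case: eqP => [->|_]; [rewrite addbb; apply: shomog1|apply: shomog0].
Qed.

Lemma tw_xh q t i j : tw q (xh t i j) = (-1) ^+ (q && (ip i (+) ip j)) *: xh t i j.
Proof. by rewrite (tw_homog _ (@shomog_xh t i j)). Qed.

Lemma sgen_xh t i j : sgen K (@gpar m n T) (t, (i, j)) = xh t i j - (i == j)%:R.
Proof. by rewrite xh_def addrAC subrr add0r. Qed.

Lemma smorph_nat (G : finType) (p : G -> bool) s (E : A -> sps K p) k :
  smorph s E -> E k%:R = k%:R.
Proof.
move=> hE; elim: k => [|k IH]; first by rewrite !mulr0n (addm0 (smD hE)).
by rewrite !mulrS (smD hE) IH (sm1 hE).
Qed.

Lemma sderiv_nat (G : finType) (p : G -> bool) s q c (E D : A -> sps K p) k :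
  smorph s E -> sderiv s q c E D -> D k%:R = 0.
Proof.
move=> hE hD; elim: k => [|k IH]; first by rewrite !mulr0n (addm0 (sdD hD)).
by rewrite !mulrS (sdD hD) IH (sd1 hE hD) addr0.
Qed.

Lemma smorph_ext_hat (G : finType) (p : G -> bool) s (E F : A -> sps K p) :
  smorph s E -> smorph s F ->
  (forall t i j, E (xh t i j) = F (xh t i j)) -> E =1 F.
Proof.
move=> hE hF h; apply: (smorph_ext hE hF) => -[t [i j]].
rewrite sgen_xh (addmB (smD hE)) (addmB (smD hF)) h.
by rewrite (smorph_nat _ hE) (smorph_nat _ hF).
Qed.

Lemma sderiv_ext_hat (G : finType) (p : G -> bool) s q c c' (E D D' : A -> sps K p) :
  smorph s E -> sderiv s q c E D -> sderiv s q c' E D' ->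
  (forall t i j, D (xh t i j) = D' (xh t i j)) -> D =1 D'.
Proof.
move=> hE hD hD' h; apply: (sderiv_ext hE hD hD') => -[t [i j]].
rewrite sgen_xh (addmB (sdD hD)) (addmB (sdD hD')) h.
by rewrite (sderiv_nat _ hE hD) (sderiv_nat _ hE hD').
Qed.

End Hats.

Definition cop (K : comNzRingType) (m n : nat) (T : finType) :
    fps K m n T -> fps K m n (T + T)%type :=
  ssubst (fun g => let: (t, (i, j)) := g in
    sgen K (@gpar m n _) (inr t, (i, j)) + sgen K (@gpar m n _) (inl t, (i, j))
      + \sum_k sgen K (@gpar m n _) (inl t, (i, k)) * sgen K (@gpar m n _) (inr t, (k, j))).
Definition tl (K : comNzRingType) (m n : nat) (T : finType) :
    fps K m n T -> fps K m n (T + T)%type :=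
  ssubst (fun g => sgen K (@gpar m n _) (inl g.1, g.2)).
Definition tr (K : comNzRingType) (m n : nat) (T : finType) :
    fps K m n T -> fps K m n (T + T)%type :=
  ssubst (fun g => sgen K (@gpar m n _) (inr g.1, g.2)).
Arguments cop {K m n T}.
Arguments tl {K m n T}.
Arguments tr {K m n T}.

(* For g = (t, (a, b)) these are nabla^R and nabla^L of the matrix unit e_ab in the
   copy t of gl(m|n), acting before passing to the quotient. *)
HB.lock Definition Lop (K : comNzRingType) (m n : nat) (T : finType)
  (g : gens m n T) (f : fps K m n T) : fps K m n T := ctl (mgen g) (cop f).
HB.lock Definition Rop (K : comNzRingType) (m n : nat) (T : finType)
  (g : gens m n T) (f : fps K m n T) : fps K m n T :=
  (-1) ^+ gpar g *: ctr (mgen g) (cop (tw (gpar g) f)).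
Canonical Lop_unlockable := Unlockable Lop.unlock.
Canonical Rop_unlockable := Unlockable Rop.unlock.
Arguments Lop {K m n T} g f.
Arguments Rop {K m n T} g f.

Section Translations.
Variables (K : comNzRingType) (K2 : forall x : K, x + x = 0 -> x = 0) (m n : nat).
Local Notation ip := (@ipar m n).
Local Notation fps T := (fps K m n T).
Local Notation x := (sgen K (@gpar m n _)).

Section OneT.
Variable T : finType.
Local Notation A := (fps T).
Local Notation A2 := (fps (T + T)%type).
Implicit Types (t s : T) (i j a b c d : 'I_(m + n)).

Lemma tl_smorph : smorph id (tl : A -> A2).
Proof.
apply: (ssubst_smorph K2) => g; first exact: sorder_sgen.
exact: (shomog_sgen (inl g.1 : (T + T)%type, g.2)).
Qed.
Lemma tr_smorph : smorph id (tr : A -> A2).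
Proof.
apply: (ssubst_smorph K2) => g; first exact: sorder_sgen.
exact: (shomog_sgen (inr g.1 : (T + T)%type, g.2)).
Qed.

Lemma cop_order (g : gens m n T) : sorder 1 (let: (t, (i, j)) := g in
    x (inr t, (i, j)) + x (inl t, (i, j))
      + \sum_k x (inl t, (i, k)) * x (inr t, (k, j)) : A2).
Proof.
case: g => t [i j]; apply: sorderD; first by apply: sorderD; apply: sorder_sgen.
by apply: sorder_sum => k _; apply/sorderMl/sorder_sgen.
Qed.

Lemma cop_homog (g : gens m n T) : shomog (gpar g) (let: (t, (i, j)) := g in
    x (inr t, (i, j)) + x (inl t, (i, j))
      + \sum_k x (inl t, (i, k)) * x (inr t, (k, j)) : A2).
Proof.
case: g => t [i j]; apply: shomogD; first apply: shomogD.
- exact: (shomog_sgen (inr t : (T + T)%type, (i, j))).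
- exact: (shomog_sgen (inl t : (T + T)%type, (i, j))).
apply: shomog_sum => k _.
have := shomogM (@shomog_sgen K _ (@gpar m n _) (inl t : (T + T)%type, (i, k)))
  (@shomog_sgen K _ (@gpar m n _) (inr t : (T + T)%type, (k, j))).
by rewrite /gpar /=; case: (ip i); case: (ip j); case: (ip k).
Qed.

Lemma cop_smorph : smorph id (cop : A -> A2).
Proof. exact: (ssubst_smorph K2 cop_order cop_homog). Qed.

Lemma tl_xh t i j : tl (xh K t i j) = xh K (inl t) i j.
Proof.
rewrite !xh_def (smD tl_smorph) (smorph_nat _ tl_smorph); congr (_ + _).
by rewrite /tl ssubst_sgen //= => g; [exact: sorder_sgen|exact: (shomog_sgen (inl g.1 : (T + T)%type, g.2))].
Qed.
Lemma tr_xh t i j : tr (xh K t i j) = xh K (inr t) i j.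
Proof.
rewrite !xh_def (smD tr_smorph) (smorph_nat _ tr_smorph); congr (_ + _).
by rewrite /tr ssubst_sgen //= => g; [exact: sorder_sgen|exact: (shomog_sgen (inr g.1 : (T + T)%type, g.2))].
Qed.
Lemma cop_xh t i j : cop (xh K t i j) = \sum_k xh K (inl t) i k * xh K (inr t) k j.
Proof.
rewrite [xh _ _ _ _ in LHS]xh_def (smD cop_smorph) (smorph_nat _ cop_smorph) /cop.
rewrite (ssubst_sgen K2 cop_order cop_homog).
under [RHS]eq_bigr do rewrite !xh_def mulrDl mulrDr [X in _ + X]mulrDr.
rewrite !big_split /= -!addrA.
have nM (b : bool) (u : A2) : b%:R * u = if b then u else 0.
  by case: b; rewrite ?mul1r ?mul0r.
have Mn (b : bool) (u : A2) : u * b%:R = if b then u else 0.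
  by case: b; rewrite ?mulr1 ?mulr0.
congr (_ + _).
  under eq_bigr do rewrite nM; rewrite (bigD1 i) //= eqxx big1 ?addr0 // => k /negbTE ne.
  by rewrite eq_sym ne.
congr (_ + _).
  under eq_bigr do rewrite nM; rewrite (bigD1 i) //= eqxx big1 ?addr0 // => k /negbTE ne.
  by rewrite eq_sym ne.
congr (_ + _).
by under eq_bigr do rewrite Mn; rewrite (bigD1 j) //= eqxx big1 ?addr0 // => k /negbTE ->.
Qed.

Lemma ctl_xhl (a : mexp (gens m n T)) t i j : ctl a (xh K (inl t) i j) =
  (a == 0)%:R * (i == j)%:R + (a == mgen (t, (i, j)))%:R.
Proof.
have z (c : mexp (gens m n T)) (k : nat) : ctl c (k%:R : A2) = k%:R * (c == 0)%:R.
  elim: k => [|k IH]; first by rewrite mul0r (addm0 (@ctlD _ _ _ _ c)).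
  by rewrite !mulrS ctlD IH ctl1 [RHS]mulrDl mul1r.
rewrite xh_def ctlD z sgen_mon (mgen_l (t, (i, j))).
have [ad|nad] := boolP (admissible (@gpar m n T) a).
  rewrite ctl_mon // mon0 [mgen _ == a]eq_sym.
  by congr (_ + _); [case: (_ == _); case: (_ == _); rewrite ?(mulr0, mul0r)|case: ifP].
have [e|_] := eqVneq a 0; first by rewrite e admissible0 in nad.
have [e|_] := eqVneq a (mgen (t, (i, j))); first by rewrite e admissible_mgen in nad.
rewrite mulr0 mul0r add0r addr0; apply/spsP=> mu; rewrite coef_ctl scoef_nadm //.
by rewrite admissible_join negb_and nad.
Qed.
Lemma ctl_xhr (a : mexp (gens m n T)) t i j : ctl a (xh K (inr t) i j) = if a == 0 then xh K t i j else 0.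
Proof.
have z (c : mexp (gens m n T)) (k : nat) : ctl c (k%:R : A2) = k%:R * (c == 0)%:R.
  elim: k => [|k IH]; first by rewrite mul0r (addm0 (@ctlD _ _ _ _ c)).
  by rewrite !mulrS ctlD IH ctl1 [RHS]mulrDl mul1r.
rewrite xh_def ctlD z sgen_mon (mgen_r (t, (i, j))).
have [ad|nad] := boolP (admissible (@gpar m n T) a).
  by rewrite ctl_mon // xh_def [0 == a]eq_sym; case: (a == 0); rewrite ?mulr1 ?mulr0 ?addr0.
have [e|_] := eqVneq a 0; first by rewrite e admissible0 in nad.
rewrite mulr0 add0r; apply/spsP=> mu; rewrite coef_ctl scoef_nadm //.
by rewrite admissible_join negb_and nad.
Qed.
Lemma ctr_xhr (a : mexp (gens m n T)) t i j : ctr a (xh K (inr t) i j) =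
  (a == 0)%:R * (i == j)%:R + (a == mgen (t, (i, j)))%:R.
Proof.
have z (c : mexp (gens m n T)) (k : nat) : ctr c (k%:R : A2) = k%:R * (c == 0)%:R.
  elim: k => [|k IH]; first by rewrite mul0r (addm0 (@ctrD _ _ _ _ c)).
  by rewrite !mulrS ctrD IH ctr1 [RHS]mulrDl mul1r.
rewrite xh_def ctrD z sgen_mon (mgen_r (t, (i, j))).
have [ad|nad] := boolP (admissible (@gpar m n T) a).
  rewrite ctr_mon // mon0 [mgen _ == a]eq_sym.
  by congr (_ + _); [case: (_ == _); case: (_ == _); rewrite ?(mulr0, mul0r)|case: ifP].
have [e|_] := eqVneq a 0; first by rewrite e admissible0 in nad.
have [e|_] := eqVneq a (mgen (t, (i, j))); first by rewrite e admissible_mgen in nad.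
rewrite mulr0 mul0r add0r addr0; apply/spsP=> mu; rewrite coef_ctr scoef_nadm //.
by rewrite admissible_join negb_and nad orbT.
Qed.
Lemma ctr_xhl (a : mexp (gens m n T)) t i j : ctr a (xh K (inl t) i j) = if a == 0 then xh K t i j else 0.
Proof.
have z (c : mexp (gens m n T)) (k : nat) : ctr c (k%:R : A2) = k%:R * (c == 0)%:R.
  elim: k => [|k IH]; first by rewrite mul0r (addm0 (@ctrD _ _ _ _ c)).
  by rewrite !mulrS ctrD IH ctr1 [RHS]mulrDl mul1r.
rewrite xh_def ctrD z sgen_mon (mgen_l (t, (i, j))).
have [ad|nad] := boolP (admissible (@gpar m n T) a).
  by rewrite ctr_mon // xh_def [0 == a]eq_sym; case: (a == 0); rewrite ?mulr1 ?mulr0 ?addr0.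
have [e|_] := eqVneq a 0; first by rewrite e admissible0 in nad.
rewrite mulr0 add0r; apply/spsP=> mu; rewrite coef_ctr scoef_nadm //.
by rewrite admissible_join negb_and nad orbT.
Qed.

Lemma ctl0_cop : ctl 0 \o cop =1 @id A.
Proof.
have h : smorph id (ctl 0 \o cop) := smorph_comp cop_smorph (ctl0_smorph K m n T).
apply: (smorph_ext_hat h (@smorph_id K _ (@gpar m n T))).
move=> t i j /=; rewrite cop_xh (addm_sum (@ctlD _ _ _ _ _)).
have e k : ctl 0 (xh K (inl t) i k * xh K (inr t) k j) =
    ((i == k)%:R + (0 == mgen (t, (i, k)) :> mexp (gens m n T))%:R) * xh K t k j.
  by rewrite (smM (ctl0_smorph K m n T)) ctl_xhl ctl_xhr eqxx mul1r.
rewrite (eq_bigr _ (fun k _ => e k)) (bigD1 i) //= eqxx [0 == _]eq_sym (negbTE (mgen_neq0 _)) addr0 mul1r big1 ?addr0 // => k /negbTE ne.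
by rewrite eq_sym ne [0 == _]eq_sym (negbTE (mgen_neq0 _)) addr0 mul0r.
Qed.
Lemma ctr0_cop : ctr 0 \o cop =1 @id A.
Proof.
have h : smorph id (ctr 0 \o cop) := smorph_comp cop_smorph (ctr0_smorph K m n T).
apply: (smorph_ext_hat h (@smorph_id K _ (@gpar m n T))).
move=> t i j /=; rewrite cop_xh (addm_sum (@ctrD _ _ _ _ _)).
have e k : ctr 0 (xh K (inl t) i k * xh K (inr t) k j) =
    xh K t i k * ((k == j)%:R + (0 == mgen (t, (k, j)) :> mexp (gens m n T))%:R).
  by rewrite (smM (ctr0_smorph K m n T)) ctr_xhl ctr_xhr eqxx mul1r.
rewrite (eq_bigr _ (fun k _ => e k)) (bigD1 j) //= eqxx [0 == _]eq_sym (negbTE (mgen_neq0 _)) addr0 mulr1 big1 ?addr0 // => k /negbTE ne.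
by rewrite ne [0 == _]eq_sym (negbTE (mgen_neq0 _)) addr0 mulr0.
Qed.

(** The contraction is a superderivation over [ctl 0]; by the counit axiom it becomes, after the
    coproduct, one over the identity. *)
Lemma Lop_deriv (g : gens m n T) : sderiv id (gpar g) 1 id (Lop g : A -> A).
Proof.
rewrite unlock; have := sderiv_morph cop_smorph (ctl_deriv K g).
by rewrite (_ : ctl 0 \o cop = id) //; apply/funext/ctl0_cop.
Qed.

Lemma Rop_deriv (g : gens m n T) : sderiv id (gpar g) 1 id (Rop g : A -> A).
Proof.
have hc := cop_smorph; rewrite unlock; split=> [f h|a f|f h|k f h|b f].
- by rewrite twD (smD hc) ctrD scalerDr.
- by rewrite twZ (smZ hc) ctrZ !scalerA mulrC.
- have e0 (u : A) : ctr 0 (cop u) = u by exact: ctr0_cop.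
  by rewrite twM (smM hc) ctr_deriv !e0 twK scalerDr -sps_scalerAl -sps_scalerAr.
- apply/sorderZ/sorder_ctr; rewrite mdeg_mgen; exact/(sm_order hc)/sorder_tw.
rewrite tw_tw addbC -tw_tw (sm_tw hc) ctr_tw mpar_mgen twZ !scalerA.
by rewrite mulrC.
Qed.

(** [Lop] acts on rows and [Rop] on columns of 1 + X. The letter refers to the tensor factor that is
    contracted, so it is opposite to the one in the names nabla^R and nabla^L. *)
Lemma Lop_xh t a b s i j :
  Lop (t, (a, b)) (xh K s i j) = if (s == t) && (i == a) then xh K t b j else 0.
Proof.
rewrite unlock cop_xh (addm_sum (@ctlD _ _ _ _ _)) (bigD1 b) //=.
rewrite (sdM (ctl_deriv K _)) !ctl_xhl !ctl_xhr eqxx (negbTE (mgen_neq0 _)) mul0r add0r mulr0 addr0.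
rewrite (inj_eq (@mgen_inj _)) !xpair_eqE eqxx andbT big1 ?addr0 => [|k /negbTE ne].
  rewrite [t == s]eq_sym [a == i]eq_sym; case: eqP => [->|]; case: eqP => _ /=; rewrite ?mul1r ?mul0r //.
rewrite (sdM (ctl_deriv K _)) !ctl_xhl !ctl_xhr (negbTE (mgen_neq0 _)) mul0r add0r mulr0 addr0.
by rewrite (inj_eq (@mgen_inj _)) !xpair_eqE [b == k]eq_sym ne !andbF mul0r.
Qed.

Lemma Rop_xh t a b s i j : Rop (t, (a, b)) (xh K s i j) =
  if (s == t) && (j == b)
  then (-1) ^+ ((ip a (+) ip b) && ~~ (ip i (+) ip j)) *: xh K t i a else 0.
Proof.
rewrite unlock tw_xh (smZ cop_smorph) ctrZ scalerA -signr_addb.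
rewrite cop_xh (addm_sum (@ctrD _ _ _ _ _)) (bigD1 a) //=.
rewrite ctr_deriv !ctr_xhl !ctr_xhr eqxx (negbTE (mgen_neq0 _)) !mul0r add0r add0r.
rewrite (inj_eq (@mgen_inj _)) !xpair_eqE eqxx /= big1 ?addr0 => [|k /negbTE ne].
  rewrite [t == s]eq_sym [b == j]eq_sym /gpar /=; case: eqP => [->|_] /=; last by rewrite mulr0 scaler0.
  case: eqP => _ /=; last by rewrite mulr0 scaler0.
  by rewrite mulr1; congr (_ ^+ _ *: _);
    case: (ip a); case: (ip b); case: (ip i); case: (ip j).
rewrite ctr_deriv !ctr_xhl !ctr_xhr (negbTE (mgen_neq0 _)) !mul0r !add0r.
by rewrite (inj_eq (@mgen_inj _)) !xpair_eqE [a == k]eq_sym ne !andbF mulr0.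
Qed.

(** Row operations commute with column operations; the supercommutator is a superderivation, so the
    entries decide. *)
Lemma LR_comm g h (f : A) :
  Lop g (Rop h f) = (-1) ^+ (gpar g && gpar h) *: Rop h (Lop g f).
Proof.
apply/subr0_eq; have d0 : sderiv id (gpar g (+) gpar h) 2 id (fun=> 0 : A) by apply: sderiv0.
refine (sderiv_ext_hat (@smorph_id K _ (@gpar m n T))
  (sderiv_comm (Lop_deriv g) (Rop_deriv h)) d0 _ f) => {f d0}.
case: g => t [a b]; case: h => u [c d] s i j; rewrite /= Lop_xh Rop_xh.
apply/eqP; rewrite subr_eq0; apply/eqP.
case: (eqVneq s u) => [->|nu] /=; last first.
  rewrite (addm0 (sdD (Lop_deriv _))); case: ifP => [/andP[/eqP e _]|_].
    by rewrite Rop_xh; case: eqP => [e'|]; [rewrite e e' eqxx in nu|rewrite scaler0].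
  by rewrite (addm0 (sdD (Rop_deriv _))) scaler0.
have [->|nj] := eqVneq j d; last first.
  rewrite (addm0 (sdD (Lop_deriv _))); case: ifP => _.
    by rewrite Rop_xh (negbTE nj) andbF scaler0.
  by rewrite (addm0 (sdD (Rop_deriv _))) scaler0.
rewrite (sdZ (Lop_deriv _)) Lop_xh; case: ifP => [/andP[/eqP <- /eqP ->]|_]; last first.
  by rewrite (addm0 (sdD (Rop_deriv _))) !scaler0.
rewrite Rop_xh !eqxx scalerA -signr_addb /gpar /=; congr (_ ^+ _ *: _).
by case: (ip a); case: (ip b); case: (ip c); case: (ip d).
Qed.

(** The relations of gl(m|n) for the opposite product of matrix units. *)
Lemma LL_comm t a b c d (f : A) :
  Lop (t, (a, b)) (Lop (t, (c, d)) f) =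
  (-1) ^+ ((ip a (+) ip b) && (ip c (+) ip d)) *: Lop (t, (c, d)) (Lop (t, (a, b)) f)
  + (a == d)%:R *: Lop (t, (c, b)) f
  - (-1) ^+ ((ip a (+) ip b) && (ip c (+) ip d)) *: ((c == b)%:R *: Lop (t, (a, d)) f).
Proof.
pose q := (ip a (+) ip b) (+) (ip c (+) ip d).
have d0 : sderiv id q 2 id (fun=> 0 : A) by apply: sderiv0.
(* The field along e_cb has parity q only when a = d, which the Kronecker factor enforces; otherwise
   the term is zero. The next term is treated likewise. *)
have d1 : sderiv id q 2 id (fun f : A => (a == d)%:R *: Lop (t, (c, b)) f).
  have [e|_] := eqVneq a d; last first.
    by rewrite (_ : (fun f : A => _ *: _ f) = fun=> 0) //; apply/funext=> u; rewrite mulr0n scale0r.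
  have -> : q = gpar (t, (c, b)).
    by rewrite /q e /gpar /=; case: (ip c); case: (ip b); case: (ip d).
  exact: sderiv_widen (leqnSn 1) (sderivZ _ (Lop_deriv _)).
have d2 : sderiv id q 2 id (fun f : A => (c == b)%:R *: Lop (t, (a, d)) f).
  have [e|_] := eqVneq c b; last first.
    by rewrite (_ : (fun f : A => _ *: _ f) = fun=> 0) //; apply/funext=> u; rewrite mulr0n scale0r.
  have -> : q = gpar (t, (a, d)).
    by rewrite /q e /gpar /=; case: (ip a); case: (ip b); case: (ip d).
  exact: sderiv_widen (leqnSn 1) (sderivZ _ (Lop_deriv _)).
rewrite -addrA; apply/eqP; rewrite addrC -subr_eq; apply/eqP.
refine (sderiv_ext_hat (@smorph_id K _ (@gpar m n T)) (sderiv_comm (Lop_deriv (t, (a, b)))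
  (Lop_deriv (t, (c, d)))) (sderivB d1 (sderivZ _ d2)) _ f) => {f} s i j.
rewrite !Lop_xh; have [_|ne] /= := eqVneq s t; last first.
  by rewrite !(addm0 (sdD (Lop_deriv _))) !scaler0 subrr.
rewrite /gpar /=; congr (_ - _ *: _).
  case: eqP => [_|_]; last by rewrite (addm0 (sdD (Lop_deriv _))) scaler0.
  by rewrite Lop_xh eqxx eq_sym /=; case: eqP; rewrite ?scale1r ?scale0r.
case: eqP => [_|_]; last by rewrite (addm0 (sdD (Lop_deriv _))) scaler0.
by rewrite Lop_xh eqxx eq_sym /=; case: eqP; rewrite ?scale1r ?scale0r.
Qed.

Lemma LL_comm_neq g h (f : A) : g.1 != h.1 ->
  Lop g (Lop h f) = (-1) ^+ (gpar g && gpar h) *: Lop h (Lop g f).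
Proof.
move=> ne; apply/subr0_eq.
have d0 : sderiv id (gpar g (+) gpar h) 2 id (fun=> 0 : A) by apply: sderiv0.
refine (sderiv_ext_hat (@smorph_id K _ (@gpar m n T))
  (sderiv_comm (Lop_deriv g) (Lop_deriv h)) d0 _ f) => {f d0}.
case: g ne => t [a b]; case: h => u [c d] /= ne s i j; rewrite !Lop_xh.
case: (eqVneq s u) => [->|_] /=; case: (eqVneq _ t) => [e|_] /=;
  rewrite ?(addm0 (sdD (Lop_deriv _))) ?scaler0 ?subr0 //.
- by rewrite e eqxx in ne.
- case: eqP => _; last by rewrite (addm0 (sdD (Lop_deriv _))).
  by rewrite Lop_xh eq_sym (negbTE ne).
- case: eqP => _; last by rewrite (addm0 (sdD (Lop_deriv _))) scaler0 subr0.
  by rewrite Lop_xh (negbTE ne) scaler0 subr0.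
Qed.

End OneT.

(** * Invariant fields under the coproduct and the two embeddings of a factor *)

Section Intertwining.
Variable T : finType.
Local Notation A := (fps T).
Local Notation A2 := (fps (T + T)%type).
Implicit Types (g : gens m n T) (f : A).

Lemma cop_Lop g f : cop (Lop g f) = Lop (lgen g) (cop f).
Proof.
have d1 : sderiv id (gpar g) 1 cop (cop \o Lop g) :=
  smorph_deriv erefl erefl (Lop_deriv g) (cop_smorph T).
have d2 : sderiv id (gpar g) 1 cop (Lop (lgen g) \o cop) :=
  sderiv_morph (cop_smorph T) (Lop_deriv (lgen g)).
refine (sderiv_ext_hat (cop_smorph T) d1 d2 _ f) => {f d1 d2}.
case: g => t [a b] s i j /=; rewrite Lop_xh cop_xh (addm_sum (sdD (Lop_deriv _))).
transitivity (\sum_k (if (s == t) && (i == a) then xh K (inl t : (T + T)%type) b k else 0)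
    * xh K (inr s : (T + T)%type) k j).
  case: ifP => [/andP[/eqP -> _]|_]; first by rewrite cop_xh.
  by rewrite (addm0 (smD (cop_smorph T))) big1 // => k _; rewrite mul0r.
apply: eq_bigr => k _; rewrite (sdM (Lop_deriv _)) /lgen /= !Lop_xh /= mulr0 addr0.
by [].
Qed.

Lemma cop_Rop g f : cop (Rop g f) = Rop (rgen g) (cop f).
Proof.
have d1 : sderiv id (gpar g) 1 cop (cop \o Rop g) :=
  smorph_deriv erefl erefl (Rop_deriv g) (cop_smorph T).
have d2 : sderiv id (gpar g) 1 cop (Rop (rgen g) \o cop) :=
  sderiv_morph (cop_smorph T) (Rop_deriv (rgen g)).
refine (sderiv_ext_hat (cop_smorph T) d1 d2 _ f) => {f d1 d2}.
case: g => t [a b] s i j /=; rewrite Rop_xh cop_xh (addm_sum (sdD (Rop_deriv _))).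
transitivity (\sum_k xh K (inl s : (T + T)%type) i k * (if (s == t) && (j == b) then
   (-1) ^+ ((ip a (+) ip b) && ~~ (ip i (+) ip j)) *: xh K (inr t : (T + T)%type) k a else 0)).
  case: ifP => [/andP[/eqP -> _]|_].
    rewrite (smZ (cop_smorph T)) cop_xh scaler_sumr; apply: eq_bigr => k _.
    by rewrite sps_scalerAr.
  by rewrite (addm0 (smD (cop_smorph T))) big1 // => k _; rewrite mulr0.
apply: eq_bigr => k _; rewrite (sdM (Rop_deriv _)) /rgen /= !Rop_xh /= mul0r add0r.
rewrite tw_xh -sps_scalerAl; change (inr s == inr t :> (T + T)%type) with (s == t).
case: ifP => [/andP[_ /eqP ->]|_]; last by rewrite !mulr0 scaler0.
rewrite -sps_scalerAr -sps_scalerAr scalerA -signr_addb /gpar /=; congr (_ ^+ _ *: _).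
by case: (ip a); case: (ip b); case: (ip i); case: (ip k).
Qed.

(** In a product of two matrices, a matrix unit inserted in the middle can be attached to the
    columns of the first or to the rows of the second. *)
Lemma Rop_Lop_cop g f : Rop (lgen g) (cop f) = Lop (rgen g) (cop f).
Proof.
have d1 : sderiv id (gpar g) 1 cop (Rop (lgen g) \o cop) :=
  sderiv_morph (cop_smorph T) (Rop_deriv (lgen g)).
have d2 : sderiv id (gpar g) 1 cop (Lop (rgen g) \o cop) :=
  sderiv_morph (cop_smorph T) (Lop_deriv (rgen g)).
refine (sderiv_ext_hat (cop_smorph T) d1 d2 _ f) => {f d1 d2}.
case: g => t [a b] s i j /=; rewrite cop_xh.
rewrite (addm_sum (sdD (Rop_deriv _))) (addm_sum (sdD (Lop_deriv _))) /lgen /rgen /=.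
rewrite (bigD1 b) //= big1 ?addr0 => [|k /negbTE nk]; last first.
  by rewrite (sdM (Rop_deriv _)) !Rop_xh nk andbF mul0r /= mulr0 addr0.
rewrite [RHS](bigD1 a) //= [X in _ = _ + X]big1 ?addr0 => [|k /negbTE nk]; last first.
  by rewrite (sdM (Lop_deriv _)) !Lop_xh nk andbF mulr0 mul0r add0r.
rewrite (sdM (Rop_deriv _)) (sdM (Lop_deriv _)) !Rop_xh !Lop_xh /= mulr0 mul0r addr0 add0r.
rewrite !eqxx !andbT; change (inl s == inl t :> (T + T)%type) with (s == t).
change (inr s == inr t :> (T + T)%type) with (s == t).
case: eqP => [->|_]; last by rewrite mul0r mulr0.
rewrite tw_xh -!sps_scalerAl; congr (_ ^+ _ *: _).
by rewrite /gpar /=; case: (ip a); case: (ip b); case: (ip i).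
Qed.

Lemma tl_Lop g f : Lop (lgen g) (tl f) = tl (Lop g f).
Proof.
have d1 : sderiv id (gpar g) 1 tl (tl \o Lop g) :=
  smorph_deriv erefl erefl (Lop_deriv g) (tl_smorph T).
have d2 : sderiv id (gpar g) 1 tl (Lop (lgen g) \o tl) :=
  sderiv_morph (tl_smorph T) (Lop_deriv (lgen g)).
refine (sderiv_ext_hat (tl_smorph T) d2 d1 _ f) => {f d1 d2}.
case: g => t [a b] s i j /=; rewrite Lop_xh tl_xh Lop_xh.
change (inl s == inl t :> (T + T)%type) with (s == t).
by case: ifP => _; rewrite ?tl_xh ?(addm0 (smD (tl_smorph T))).
Qed.
Lemma tr_Lop g f : Lop (rgen g) (tr f) = tr (Lop g f).
Proof.
have d1 : sderiv id (gpar g) 1 tr (tr \o Lop g) :=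
  smorph_deriv erefl erefl (Lop_deriv g) (tr_smorph T).
have d2 : sderiv id (gpar g) 1 tr (Lop (rgen g) \o tr) :=
  sderiv_morph (tr_smorph T) (Lop_deriv (rgen g)).
refine (sderiv_ext_hat (tr_smorph T) d2 d1 _ f) => {f d1 d2}.
case: g => t [a b] s i j /=; rewrite Lop_xh tr_xh Lop_xh.
change (inr s == inr t :> (T + T)%type) with (s == t).
by case: ifP => _; rewrite ?tr_xh ?(addm0 (smD (tr_smorph T))).
Qed.
Lemma tl_Rop g f : Rop (lgen g) (tl f) = tl (Rop g f).
Proof.
have d1 : sderiv id (gpar g) 1 tl (tl \o Rop g) :=
  smorph_deriv erefl erefl (Rop_deriv g) (tl_smorph T).
have d2 : sderiv id (gpar g) 1 tl (Rop (lgen g) \o tl) :=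
  sderiv_morph (tl_smorph T) (Rop_deriv (lgen g)).
refine (sderiv_ext_hat (tl_smorph T) d2 d1 _ f) => {f d1 d2}.
case: g => t [a b] s i j /=; rewrite Rop_xh tl_xh Rop_xh.
change (inl s == inl t :> (T + T)%type) with (s == t).
by case: ifP => _; rewrite ?(smZ (tl_smorph T)) ?tl_xh ?(addm0 (smD (tl_smorph T))).
Qed.
Lemma tr_Rop g f : Rop (rgen g) (tr f) = tr (Rop g f).
Proof.
have d1 : sderiv id (gpar g) 1 tr (tr \o Rop g) :=
  smorph_deriv erefl erefl (Rop_deriv g) (tr_smorph T).
have d2 : sderiv id (gpar g) 1 tr (Rop (rgen g) \o tr) :=
  sderiv_morph (tr_smorph T) (Rop_deriv (rgen g)).
refine (sderiv_ext_hat (tr_smorph T) d2 d1 _ f) => {f d1 d2}.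
case: g => t [a b] s i j /=; rewrite Rop_xh tr_xh Rop_xh.
change (inr s == inr t :> (T + T)%type) with (s == t).
by case: ifP => _; rewrite ?(smZ (tr_smorph T)) ?tr_xh ?(addm0 (smD (tr_smorph T))).
Qed.
Lemma tl_Lop0 g f : Lop (rgen g) (tl f) = 0.
Proof.
have d1 : sderiv id (gpar g) 1 tl (fun=> 0 : A2) by apply: sderiv0.
have d2 : sderiv id (gpar g) 1 tl (Lop (rgen g) \o tl) :=
  sderiv_morph (tl_smorph T) (Lop_deriv (rgen g)).
refine (sderiv_ext_hat (tl_smorph T) d2 d1 _ f) => {f d1 d2}.
by case: g => t [a b] s i j /=; rewrite tl_xh Lop_xh.
Qed.
Lemma tr_Lop0 g f : Lop (lgen g) (tr f) = 0.
Proof.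
have d1 : sderiv id (gpar g) 1 tr (fun=> 0 : A2) by apply: sderiv0.
have d2 : sderiv id (gpar g) 1 tr (Lop (lgen g) \o tr) :=
  sderiv_morph (tr_smorph T) (Lop_deriv (lgen g)).
refine (sderiv_ext_hat (tr_smorph T) d2 d1 _ f) => {f d1 d2}.
by case: g => t [a b] s i j /=; rewrite tr_xh Lop_xh.
Qed.
Lemma tl_Rop0 g f : Rop (rgen g) (tl f) = 0.
Proof.
have d1 : sderiv id (gpar g) 1 tl (fun=> 0 : A2) by apply: sderiv0.
have d2 : sderiv id (gpar g) 1 tl (Rop (rgen g) \o tl) :=
  sderiv_morph (tl_smorph T) (Rop_deriv (rgen g)).
refine (sderiv_ext_hat (tl_smorph T) d2 d1 _ f) => {f d1 d2}.
by case: g => t [a b] s i j /=; rewrite tl_xh Rop_xh.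
Qed.
Lemma tr_Rop0 g f : Rop (lgen g) (tr f) = 0.
Proof.
have d1 : sderiv id (gpar g) 1 tr (fun=> 0 : A2) by apply: sderiv0.
have d2 : sderiv id (gpar g) 1 tr (Rop (lgen g) \o tr) :=
  sderiv_morph (tr_smorph T) (Rop_deriv (lgen g)).
refine (sderiv_ext_hat (tr_smorph T) d2 d1 _ f) => {f d1 d2}.
by case: g => t [a b] s i j /=; rewrite tr_xh Rop_xh.
Qed.

End Intertwining.
End Translations.

(** * The Berezinian is a character *)

Section PowerSeriesInverse.
Variables (K : comNzRingType) (G : finType) (p : G -> bool).
Local Notation sps := (sps K p).

Lemma sorder_ssum (F : nat -> sps) L : (forall l, sorder l (F l)) ->
  sorder L (ssum F - \sum_(l < L) F l).
Proof.
move=> hF mu lt; rewrite scoefD scoefN scoef_sum.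
have [am|nam] := boolP (admissible p mu); last first.
  rewrite scoef_nadm // big1 ?subr0 // => l _; exact: scoef_nadm.
rewrite coef_seriesE // (big_ord_widen L (fun l => coef (F l) mu)) // big_mkcond /=.
rewrite -sumrB big1 // => l _; case: ifP => [_|/negbT le]; first exact: subrr.
by rewrite hF ?subr0 // ltnNge -ltnS.
Qed.

Lemma sorder_coef0 (f : sps) : coef f 0 = 0 <-> sorder 1 f.
Proof.
split=> [e mu|h]; last by apply: h; rewrite mdeg0.
by rewrite ltnS leqn0 mdeg_eq0 => /eqP ->.
Qed.

Section Matrix.
Variables (k : nat) (U : 'M[sps]_k).
Hypothesis hU : forall i j, coef (U i j) 0 = (i == j)%:R.
Let N : 'M[sps]_k := 1%:M - U.

Lemma sorder_onesub i j : sorder 1 (N i j).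
Proof.
apply/sorder_coef0; rewrite !mxE scoefD scoefN hU.
by case: eqP => _; rewrite ?scoef1_0 ?scoef0 subrr.
Qed.

Lemma sorder_pow l i j : sorder l ((N ^+ l) i j).
Proof.
elim: l i j => [|l IH] i j; first exact: sorder_0.
rewrite exprS !mxE; apply: sorder_sum => h _; rewrite -add1n.
exact: sorderM (sorder_onesub _ _) (IH _ _).
Qed.

Let P L : 'M[sps]_k := \sum_(l < L) N ^+ l.

Lemma sorder_sinvmx L i j : sorder L ((sinvmx U - P L) i j).
Proof.
have -> : (sinvmx U - P L) i j = ssum (fun l => (N ^+ l) i j) - \sum_(l < L) (N ^+ l) i j.
  by rewrite !mxE summxE.
by apply: sorder_ssum => l; apply: sorder_pow.
Qed.

Lemma mul_partial_inv L : U *m P L = 1%:M - N ^+ L /\ P L *m U = 1%:M - N ^+ L.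
Proof.
have -> : U = - (N - 1%:M) by rewrite /N addrAC subrr add0r opprK.
have e : (N - 1) * P L = N ^+ L - 1 by rewrite /P subrX1.
have e' : P L * (N - 1) = N ^+ L - 1.
  rewrite -e; apply/esym/commr_sum => l _; apply/commrX/commr_sym/commrB; first exact: commr_refl.
  exact: commr1.
by rewrite mulNmx mulmxN [_ *m _]e [_ *m _]e' opprB.
Qed.

(** Modulo order L the inverse is a partial geometric sum, and the defect is a power of 1 - U of
    order L. Both sides are proved because the entries do not commute. *)
Lemma mulmx_sinvmx : U *m sinvmx U = 1%:M /\ sinvmx U *m U = 1%:M.
Proof.
have z (W : 'M[sps]_k) : (forall L i j, sorder L (W i j)) -> W = 0.
  by move=> h; apply/matrixP=> i j; rewrite mxE; apply: sorder_eq0 => L; apply: h.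
split; apply/subr0_eq/z => L i j.
  have -> : U *m sinvmx U - 1%:M = U *m (sinvmx U - P L) - N ^+ L.
    by rewrite mulmxBr (mul_partial_inv L).1 opprB addrA [RHS]addrAC addrK.
  rewrite [_ i j]mxE [X in _ + X]mxE; apply: sorderB; last exact: sorder_pow.
  rewrite mxE; apply: sorder_sum => h _; exact/sorderMr/sorder_sinvmx.
have -> : sinvmx U *m U - 1%:M = (sinvmx U - P L) *m U - N ^+ L.
  by rewrite mulmxBl (mul_partial_inv L).2 opprB addrA [RHS]addrAC addrK.
rewrite [_ i j]mxE [X in _ + X]mxE; apply: sorderB; last exact: sorder_pow.
rewrite mxE; apply: sorder_sum => h _; exact/sorderMl/sorder_sinvmx.
Qed.

Lemma coef_sinvmx i j : coef (sinvmx U i j) 0 = (i == j)%:R.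
Proof.
have := @sorder_sinvmx 1 i j; rewrite -sorder_coef0 /P big_ord_recl big_ord0 addr0 expr0.
rewrite !mxE scoefD scoefN => /subr0_eq ->.
by case: eqP => _; rewrite ?scoef1_0 ?scoef0.
Qed.

End Matrix.

Lemma mul_sinv (u : sps) : coef u 0 = 1 -> u * sinv u = 1 /\ sinv u * u = 1.
Proof.
move=> hu; have hU (i j : 'I_1) : coef ((u%:M : 'M_1) i j) 0 = (i == j)%:R.
  by rewrite !ord1 mxE eqxx hu.
have [/matrixP/(_ ord0 ord0) e1 /matrixP/(_ ord0 ord0) e2] := mulmx_sinvmx hU.
have e (c : sps) : (c%:M : 'M_1) ord0 ord0 = c by rewrite mxE eqxx.
by move: e1 e2; rewrite [LHS]mxE [X in _ -> X = _ -> _]mxE !big_ord1 !e.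
Qed.

End PowerSeriesInverse.

(** * Series determined by their eigenvalues along a frame *)

Section Uniqueness.
Variables (K : numFieldType) (G : finType) (p : G -> bool).
Local Notation sps := (sps K p).

(** At the origin a superderivation sees only the linear part: the rest is constant or of order two,
    and one order is lost. *)
Lemma deriv_coef0 q (D : sps -> sps) g : sderiv id q 1 id D ->
  (forall x, coef (D (sgen K p x)) 0 = (x == g)%:R) ->
  forall f, coef (D f) 0 = coef f (mgen g).
Proof.
move=> hD h; apply: sps_ind => [f u|c f|||f].
- by rewrite (sdD hD) !scoefD => -> ->.
- by rewrite (sdZ hD) !scoefZ => ->.
- by rewrite (sd1 (smorph_id K p) hD) scoef1_mgen.
- move=> x f _; rewrite (sdM hD) scoefD !scoefM_0 h scoefM_mgen coef_tw !coef_sgen.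
  rewrite [0 == _]eq_sym (negbTE (mgen_neq0 _)) mulr0 !mul0r addr0 add0r.
  by rewrite (inj_eq (@mgen_inj _)) eq_sym.
move=> hl; have [u e o] := hl 2%N.
have -> : f = u + (f - u) by rewrite addrC subrK.
have o1 : coef (D (f - u)) 0 = 0 by rewrite (sd_order hD (k := 1)) ?mdeg0.
have o2 : coef (f - u) (mgen g) = 0 by rewrite o ?mdeg_mgen.
by rewrite (sdD hD) scoefD o1 e [RHS]scoefD o2.
Qed.

Variables (D : G -> sps -> sps).
Hypothesis hD : forall g, sderiv id (p g) 1 id (D g).
Hypothesis hD0 : forall g x, coef (D g (sgen K p x)) 0 = (g == x)%:R.

(** The [D g] are dual to the generators only at the origin, so this is the degree operator only
    modulo terms of higher order. *)
Definition euler (f : sps) : sps := \sum_g sgen K p g * D g f.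

Lemma euler_deriv : sderiv id false 0 id euler.
Proof.
apply: sderiv_sum => g _.
have := sderivMl (shomog_sgen g) (sorder_sgen g) (leqnn 1) (hD g).
by rewrite addbb subnn.
Qed.

Lemma euler_sgen x : sorder 2 (euler (sgen K p x) - sgen K p x).
Proof.
have e : sgen K p x = \sum_g sgen K p g * (g == x)%:R.
  rewrite (bigD1 x) //= eqxx mulr1 big1 ?addr0 // => g /negbTE ->; exact: mulr0.
rewrite {2}e {e} /euler.
rewrite -sumrB; apply: sorder_sum => g _; rewrite -mulrBr -[2%N]/(1 + 1)%N.
apply: sorderM; [exact: sorder_sgen|apply/sorder_coef0].
rewrite scoefD scoefN hD0; case: eqP => _; rewrite ?scoef1_0 ?scoef0 subrr //.
Qed.

Lemma euler_mon mu :
  sorder (mdeg mu).+1 (euler (mon p mu) - (mdeg mu)%:R *: mon p mu).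
Proof.
elim/mexp_ind: mu => [|x mu IH].
  rewrite mon0 mdeg0 scale0r subr0 (sd1 (smorph_id K p) euler_deriv); exact: sorder0.
have -> : mon p (mgen x + mu) = (-1) ^+ msign p (mgen x) mu *: (sgen K p x * mon p mu).
  by rewrite sgen_mon monM scalerA -signr_addb addbb scale1r.
rewrite (sdZ euler_deriv) (sdM euler_deriv) twF scalerA mulrC -scalerA -scalerBr.
apply: sorderZ; rewrite mdegD mdeg_mgen natrD scalerDl scale1r opprD addrACA -mulrBl.
apply: sorderD; first exact: (@sorderM _ _ _ 2 _ _ _ (euler_sgen x) (@sorder_mon _ _ _ mu)).
rewrite sps_scalerAr -mulrBr.
exact: (@sorderM _ _ _ 1 _ _ _ (sorder_sgen x) IH).
Qed.

Lemma coef_euler d f mu : sorder d f -> mdeg mu = d ->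
  coef (euler f) mu = d%:R * coef f mu.
Proof.
move=> of_ dmu; have lt : (mdeg mu < d.+1)%N by rewrite dmu.
have oE k u : sorder k u -> sorder k (euler u).
  by have := sd_order euler_deriv (k := k) (f := u); rewrite addn0.
have ot := @sorder_trunc _ _ _ d.+1 f.
have o1 : coef (euler (f - trunc d.+1 f)) mu = 0 by apply: (oE _ _ ot).
have o2 := ot mu lt.
have -> : f = trunc d.+1 f + (f - trunc d.+1 f) by rewrite addrC subrK.
rewrite (sdD euler_deriv) scoefD o1 [in RHS]scoefD o2 !addr0.
rewrite /trunc (addm_sum (sdD euler_deriv)) !scoef_sum mulr_sumr.
apply: eq_bigr => a la; rewrite (sdZ euler_deriv) !scoefZ.
have [da|/eqP nda] := eqVneq (mdeg (mbox a)) d; last first.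
  by rewrite of_ ?mul0r ?mulr0 //; move: la nda; rewrite ltnS leq_eqVlt; case: eqP.
have := @euler_mon (mbox a); rewrite da => /(_ mu lt).
by rewrite scoefD scoefN scoefZ => /subr0_eq ->; rewrite mulrCA.
Qed.

(** After removing the constant term, the lowest part, of degree d, is multiplied by d under
    [euler], which annihilates the series; in characteristic zero the order can thus be raised
    indefinitely. *)
Lemma deriv_const f : (forall g, D g f = 0) -> f = coef f 0 *: (1 : sps).
Proof.
move=> h; set c := coef f 0; pose f' : sps := f - c *: (1 : sps).
suff : f' = 0 by move/subr0_eq.
have D0 : euler f' = 0.
  rewrite (addmB (sdD euler_deriv)) (sdZ euler_deriv) (sd1 (smorph_id K p) euler_deriv).
  by rewrite scaler0 subr0 /euler big1 // => g _; rewrite h mulr0.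
apply: sorder_eq0; elim=> [|d IH]; first exact: sorder_0.
move=> mu; rewrite ltnS leq_eqVlt => /orP[/eqP e|]; last exact: IH.
have := coef_euler IH e; rewrite D0 scoef0 => /esym/eqP.
rewrite mulf_eq0 pnatr_eq0 => /orP[/eqP d0|/eqP //].
move: e; rewrite d0 => /eqP; rewrite mdeg_eq0 => /eqP ->.
by rewrite scoefD scoefN scoefZ scoef1_0 mulr1 subrr.
Qed.

(** The quotient of [u] by [s] is annihilated by the whole frame, hence constant. *)
Lemma deriv_prop (c : G -> K) (s u : sps) : coef s 0 = 1 ->
  (forall g, p g -> c g = 0) ->
  (forall g, D g s = c g *: s) -> (forall g, D g u = c g *: u) -> u = coef u 0 *: s.
Proof.
move=> s0 hc hs hu; have [e1 e2] := mul_sinv s0; set v := sinv s in e1 e2.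
have hv g : D g v = - c g *: v.
  have := sdM (hD g) s v; rewrite e1 (sd1 (smorph_id K p) (hD g)) hs => /esym e.
  have e3 : tw (p g) v * tw (p g) s = 1 by rewrite -twM e2 tw1.
  rewrite -[D g v]mul1r -e3 -mulrA.
  have -> : tw (p g) s * D g v = - c g *: (1 : sps).
    by apply/eqP; rewrite scaleNr -addr_eq0 addrC -e -sps_scalerAl e1.
  (* For odd g the inverse would come out twisted by parity, but then its eigenvalue is 0. *)
  rewrite -sps_scalerAr mulr1; case: (boolP (p g)) => [pg|_]; last by rewrite twF.
  by rewrite hc // oppr0 !scale0r.
have w0 g : D g (u * v) = 0.
  rewrite (sdM (hD g)) hu hv -sps_scalerAl -sps_scalerAr scaleNr.
  case: (boolP (p g)) => [/hc ->|_]; first by rewrite !scale0r subr0.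
  by rewrite twF subrr.
have := deriv_const w0; rewrite scoefM_0.
have -> : coef v 0 = 1 by have := congr1 (fun f => coef f 0) e1; rewrite /= scoefM_0 s0 mul1r scoef1_0.
rewrite mulr1 => /(congr1 (fun f => f * s)).
by rewrite -mulrA e2 mulr1 -sps_scalerAl mul1r.
Qed.

End Uniqueness.

Lemma num_tors (K : numFieldType) (x : K) : x + x = 0 -> x = 0.
Proof. by move/eqP; rewrite -mulr2n mulrn_eq0 => /eqP. Qed.

(** * Determinants over a supercommutative ring *)

Section DerivationsOfDeterminants.
Variables (K : numFieldType) (G : finType) (p : G -> bool).
Local Notation sps := (sps K p).

(** The entries need not commute: factors are ordered by rows, so a transposition of columns
    permutes the terms without reordering any factor, and the determinant equals its opposite. *)
Lemma det_eq_col k (M : 'M[sps]_k) a b : a != b -> (forall i, M i a = M i b) -> \det M = 0.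
Proof.
move=> ne h; have e : \det M = - \det M.
  rewrite {1}/determinant (reindex_inj (mulIg (tperm a b))) /= -sumrN.
  apply: eq_bigr => s _; rewrite odd_permM odd_tperm ne addbT signrN mulNr.
  congr (- (_ * _)); apply: eq_bigr => i _; rewrite permM.
  by case: tpermP => [->|->|//]; rewrite h.
by apply/spsP=> mu; apply: num_tors; rewrite {1}e scoefN addNr.
Qed.

Lemma tw_det q k (M : 'M[sps]_k) : (forall i j, tw q (M i j) = M i j) -> tw q (\det M) = \det M.
Proof.
move=> h; rewrite tw_sum; apply: eq_bigr => s _; rewrite twM; congr (_ * _).
  by case: (odd_perm s); rewrite ?expr0 ?expr1 ?twN tw1.
by rewrite (big_morph _ (twM q) (tw1 K p q)); apply: eq_bigr => i _.
Qed.

Section Killing.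
Variables (q : bool) (c : nat) (f : sps -> sps) (hf : sderiv id q c id f).

Lemma kill_mul u v : f u = 0 -> f v = 0 -> f (u * v) = 0.
Proof. by move=> fu fv; rewrite (sdM hf) fu fv mul0r mulr0 addr0. Qed.

Lemma kill_det k (M : 'M[sps]_k) : (forall i j, f (M i j) = 0) -> f (\det M) = 0.
Proof.
move=> h; have f1 := sd1 (smorph_id K p) hf.
rewrite (addm_sum (sdD hf)) big1 // => s _; apply: kill_mul.
  by case: (odd_perm s); rewrite ?expr0 ?expr1 ?(addmN (sdD hf)) f1 ?oppr0.
apply: (big_ind (fun u => f u = 0)) => // u v; exact: kill_mul.
Qed.

Lemma kill_inv u v : u * v = 1 -> v * u = 1 -> f u = 0 -> f v = 0.
Proof.
move=> uv vu fu; have := sdM hf u v.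
rewrite uv fu mul0r add0r (sd1 (smorph_id K p) hf) => /esym/(congr1 (fun w => tw q v * w)).
by rewrite mulrA -twM vu tw1 mul1r mulr0.
Qed.

Lemma kill_invmx k (U V : 'M[sps]_k) : U *m V = 1%:M -> V *m U = 1%:M ->
  (forall i j, f (U i j) = 0) -> forall i j, f (V i j) = 0.
Proof.
move=> UV VU fU; have f1 := sd1 (smorph_id K p) hf.
have e1 : map_mx (tw q) V *m map_mx (tw q) U = 1%:M.
  apply/matrixP=> i j; transitivity (tw q ((V *m U) i j)).
    by rewrite !mxE tw_sum; apply: eq_bigr => l _; rewrite !mxE twM.
  by rewrite VU mxE; case: eqP; rewrite ?tw1 ?tw0.
have e2 : map_mx (tw q) U *m map_mx f V = 0.
  apply/matrixP=> i j; transitivity (f ((U *m V) i j)).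
    rewrite !mxE (addm_sum (sdD hf)); apply: eq_bigr => l _.
    by rewrite !mxE (sdM hf) fU mul0r add0r.
  by rewrite UV !mxE; case: eqP; rewrite ?f1 // (addm0 (sdD hf)).
move=> i j; have /matrixP/(_ i j) : map_mx f V = 0.
  by rewrite -[map_mx f V]mul1mx -e1 -mulmxA e2 mulmx0.
by rewrite !mxE.
Qed.

End Killing.

Section EvenDeterminant.
Variables (c : nat) (f : sps -> sps) (hf : sderiv id false c id f).

(** Every ordered product contains one entry of column b, so Leibniz yields the determinant with
    column b replaced by column a; an even derivation produces no sign on the way. *)
Lemma deriv_det k (M : 'M[sps]_k) a b :
  (forall i j, f (M i j) = if j == b then M i a else 0) ->
  f (\det M) = if a == b then \det M else 0.
Proof.
move=> h; pose M' : 'M[sps]_k := \matrix_(i, j) if j == b then M i a else M i j.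
have eM' s i : M' i (s i) = if s i == b then M i a else M i (s i) by rewrite mxE.
transitivity (\det M'); last first.
  case: eqVneq => [e|ne]; last first.
    by apply: (det_eq_col ne) => i; rewrite !mxE eqxx (negbTE ne).
  by congr (\det _); apply/matrixP=> i j; rewrite !mxE e; case: eqP => // ->.
rewrite (addm_sum (sdD hf)); apply: eq_bigr => s _.
have -> w : f ((-1) ^+ s * w) = (-1) ^+ s * f w.
  by case: (odd_perm s); rewrite ?expr0 ?expr1 ?mul1r // !mulN1r (addmN (sdD hf)).
(* The only row whose factor, in the term of s, lies in column b. *)
congr (_ * _); pose i0 := (s^-1)%g b.
have si i : (s i == b) = (i == i0) by rewrite -(inj_eq (@perm_inj _ s^-1%g)) permK.
have ih r : uniq r -> f (\prod_(i <- r) M i (s i)) =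
    if i0 \in r then \prod_(i <- r) M' i (s i) else 0.
  elim: r => [_|i r IH /= /andP[ir ur]].
    by rewrite !big_nil (sd1 (smorph_id K p) hf).
  rewrite !big_cons (sdM hf) twF IH // h eM' si in_cons [i0 == i]eq_sym.
  case: (eqVneq i i0) => [e|ne] /=; last first.
    by rewrite mul0r add0r; case: ifP => _; rewrite ?mulr0.
  rewrite -e (negbTE ir) mulr0 addr0; congr (_ * _); apply: eq_big_seq => l lr.
  by rewrite eM' si -e; case: eqP => // el; rewrite -el lr in ir.
by rewrite ih ?mem_index_enum // /index_enum -enumT enum_uniq.
Qed.

End EvenDeterminant.
End DerivationsOfDeterminants.

(** * Row and column operations on the Schur complement *)

Section Blocks.
Variables (K : numFieldType) (G : finType) (p : G -> bool) (m n : nat).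
Local Notation sps := (sps K p).
Variables (A : 'M[sps]_m) (B : 'M[sps]_(m, n)) (C : 'M[sps]_(n, m)) (U V : 'M[sps]_n).
Hypotheses (UV : U *m V = 1%:M) (VU : V *m U = 1%:M).
Hypotheses (B_odd : forall i j, tw true (B i j) = - B i j)
  (U_even : forall i j, tw true (U i j) = U i j).
Let S := A - B *m V *m C.
Let W := B *m V.

Lemma schurE i j : S i j = A i j - \sum_l W i l * C l j.
Proof. by rewrite /S -/W mxE [X in _ + X]mxE mxE. Qed.

Lemma mulWU i j : \sum_l W i l * U l j = B i j.
Proof.
have -> : \sum_l W i l * U l j = (W *m U) i j by rewrite mxE.
by rewrite /W -mulmxA VU mulmx1.
Qed.

Lemma WE i j : W i j = \sum_l B i l * V l j.
Proof. by rewrite mxE. Qed.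

Lemma V_even i j : tw true (V i j) = V i j.
Proof.
suff /matrixP/(_ i j) : map_mx (tw true) V = V by rewrite mxE.
have e : U *m map_mx (tw true) V = 1%:M.
  apply/matrixP=> k l; transitivity (tw true ((U *m V) k l)).
    by rewrite !mxE tw_sum; apply: eq_bigr => h _; rewrite !mxE twM U_even.
  by rewrite UV mxE; case: eqP; rewrite ?tw1 ?tw0.
by rewrite -[LHS]mul1mx -VU -mulmxA e mulmx1.
Qed.

Lemma W_odd i j : tw true (W i j) = - W i j.
Proof.
by rewrite WE tw_sum -sumrN; apply: eq_bigr => l _; rewrite twM B_odd V_even mulNr.
Qed.

Section Act.
Variables (q : bool) (c : nat) (f : sps -> sps) (hf : sderiv id q c id f).

Lemma kill_W : (forall i j, f (B i j) = 0) -> (forall i j, f (U i j) = 0) ->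
  forall i j, f (W i j) = 0.
Proof.
move=> fB fU i j; rewrite WE (addm_sum (sdD hf)) big1 // => l _.
by apply: (kill_mul hf) => //; apply: (kill_invmx hf UV VU).
Qed.

(** An infinitesimal row operation from row b of the lower blocks to row a of the upper ones: the
    changes of A and of B U^-1 C cancel since U U^-1 = 1. *)
Lemma kill_schur_upper a b : (forall i j, f (C i j) = 0) -> (forall i j, f (U i j) = 0) ->
  (forall i j, f (A i j) = if i == a then C b j else 0) ->
  (forall i j, f (B i j) = if i == a then U b j else 0) -> forall i j, f (S i j) = 0.
Proof.
move=> fC fU fA fB i j; have fV := kill_invmx hf UV VU fU.
have fW k l : f (W k l) = if k == a then (b == l)%:R else 0.
  rewrite WE (addm_sum (sdD hf)).
  transitivity (\sum_h (if k == a then U b h else 0) * V h l).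
    by apply: eq_bigr => h _; rewrite (sdM hf) fB fV mulr0 addr0.
  case: ifP => _; last by rewrite big1 // => h _; rewrite mul0r.
  by have /matrixP/(_ b l) := UV; rewrite !mxE.
rewrite schurE (addmB (sdD hf)) fA (addm_sum (sdD hf)).
transitivity ((if i == a then C b j else 0) - \sum_l (if i == a then (b == l)%:R else 0) * C l j).
  by congr (_ - _); apply: eq_bigr => l _; rewrite (sdM hf) fW fC mulr0 addr0.
case: ifP => _; last by rewrite big1 ?subrr // => l _; rewrite mul0r.
rewrite (bigD1 b) //= eqxx mul1r big1 ?addr0 ?subrr // => l /negbTE ne.
by rewrite eq_sym ne mul0r.
Qed.

End Act.

(** The column analogue, from the right blocks to the left ones. The field is odd; the minus sign in
    front of B compensates the oddness of B U^-1. *)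
Lemma kill_schur_lower c f (hf : sderiv id true c id f) a b :
  (forall i j, f (B i j) = 0) -> (forall i j, f (U i j) = 0) ->
  (forall i j, f (A i j) = if j == b then - B i a else 0) ->
  (forall i j, f (C i j) = if j == b then U i a else 0) -> forall i j, f (S i j) = 0.
Proof.
move=> fB fU fA fC i j; have fW := kill_W hf fB fU.
rewrite schurE (addmB (sdD hf)) fA (addm_sum (sdD hf)).
transitivity ((if j == b then - B i a else 0) + \sum_l W i l * (if j == b then U l a else 0)).
  congr (_ + _); rewrite -sumrN; apply: eq_bigr => l _.
  by rewrite (sdM hf) fW mul0r add0r W_odd mulNr opprK fC.
case: ifP => _; first by rewrite mulWU addNr.
by rewrite add0r big1 // => l _; rewrite mulr0.
Qed.

Lemma deriv_schur_ul c f (hf : sderiv id false c id f) a b :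
  (forall i j, f (B i j) = 0) -> (forall i j, f (U i j) = 0) ->
  (forall i j, f (A i j) = if j == b then A i a else 0) ->
  (forall i j, f (C i j) = if j == b then C i a else 0) ->
  forall i j, f (S i j) = if j == b then S i a else 0.
Proof.
move=> fB fU fA fC i j; have fW := kill_W hf fB fU.
rewrite !schurE (addmB (sdD hf)) fA (addm_sum (sdD hf)).
transitivity ((if j == b then A i a else 0) - \sum_l W i l * (if j == b then C l a else 0)).
  by congr (_ - _); apply: eq_bigr => l _; rewrite (sdM hf) fW mul0r add0r twF fC.
case: ifP => _ //; rewrite big1 ?subrr // => l _; exact: mulr0.
Qed.

(** A column operation inside the right blocks multiplies B and U by the same factor on the right,
    which B U^-1 does not see. *)
Lemma kill_schur_dr c f (hf : sderiv id false c id f) a b :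
  (forall i j, f (A i j) = 0) -> (forall i j, f (C i j) = 0) ->
  (forall i j, f (B i j) = if j == b then B i a else 0) ->
  (forall i j, f (U i j) = if j == b then U i a else 0) -> forall i j, f (S i j) = 0.
Proof.
move=> fA fC fB fU i j.
have nM (x : bool) (u : sps) : (if x then u else 0) = x%:R * u.
  by case: x; rewrite ?mul1r ?mul0r.
(* Differentiating U V = 1 gives dV = - V (dU) V, and V U = 1 collapses V (dU). *)
have fV k l : f (V k l) = - (if k == a then V b l else 0).
  suff /matrixP/(_ k l) : map_mx f V = - (\matrix_(k, l) if k == a then V b l else 0).
    by rewrite !mxE.
  rewrite -[LHS]mul1mx -VU -mulmxA.
  have -> : U *m map_mx f V = - (\matrix_(i, j) (U i a * V b j)).
    apply/matrixP=> i1 j1; rewrite !mxE; apply/eqP; rewrite -addr_eq0 addrC.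
    have := congr1 f (congr1 (fun M : 'M_n => M i1 j1) UV).
    rewrite [in RHS]mxE !mxE (addm_sum (sdD hf)).
    have -> : f (1 *+ (i1 == j1)) = 0.
      by case: eqP; rewrite ?(addm0 (sdD hf)) ?(sd1 (smorph_id K p) hf).
    move=> e; rewrite -[X in _ == X]e (bigD1 b) //= [X in _ == X](bigD1 b) //=.
    rewrite (sdM hf) twF fU eqxx mxE addrA.
    apply/eqP; congr (_ + _); apply: eq_bigr => l1 /negbTE nb.
    by rewrite (sdM hf) twF fU nb mul0r add0r mxE.
  rewrite mulmxN; congr (- _); apply/matrixP=> i1 j1; rewrite !mxE.
  transitivity ((\sum_j V i1 j * U j a) * V b j1).
    by rewrite mulr_suml; apply: eq_bigr => l1 _; rewrite mxE mulrA.
  by have /matrixP/(_ i1 a) := VU; rewrite !mxE => ->; rewrite nM.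
have fW k l : f (W k l) = 0.
  rewrite WE (addm_sum (sdD hf)).
  transitivity (\sum_h ((if h == b then B k a else 0) * V h l
      - B k h * (if h == a then V b l else 0))).
    by apply: eq_bigr => h _; rewrite (sdM hf) twF fB fV mulrN.
  rewrite sumrB (bigD1 b) //= eqxx big1 ?addr0 => [|h /negbTE ->]; last exact: mul0r.
  rewrite (bigD1 a) //= eqxx big1 ?addr0 ?subrr // => h /negbTE ->; exact: mulr0.
rewrite schurE (addmB (sdD hf)) fA (addm_sum (sdD hf)) big1 ?subrr // => l _.
exact: (kill_mul hf).
Qed.

End Blocks.

HB.lock Definition sd (K : numFieldType) (m n : nat) (T : finType) (t : T) : fps K m n T :=
  sdet (1%:M + xmx K m n t).
Canonical sd_unlockable := Unlockable sd.unlock.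

(** * Eigenvalues of the Berezinian along the invariant fields *)

Section Berezinian.
Variables (K : numFieldType) (m n : nat) (T : finType).
Local Notation ip := (@ipar m n).
Local Notation A := (fps K m n T).
Local Notation K2 := (@num_tors K).
Local Notation sd := (@sd K m n T).
Local Notation p := (@gpar m n T).
Implicit Types (t u : T) (a b c d : 'I_(m + n)).

Lemma coef_xh0 t a b : coef (xh K t a b) 0 = (a == b)%:R.
Proof.
rewrite xh_def scoefD coef_sgen [0 == _]eq_sym (negbTE (mgen_neq0 _)) addr0.
by case: eqP => _; rewrite ?scoef1_0 ?scoef0.
Qed.

Section Fixed.
Variable t : T.
Let X := 1%:M + xmx K m n t.
Let U := drsubmx X.
Let V := sinvmx U.
Let S := ulsubmx X - ursubmx X *m V *m dlsubmx X.

Lemma ulE i j : ulsubmx X i j = xh K t (lshift n i) (lshift n j).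
Proof. by rewrite mxE mxE xhE. Qed.
Lemma urE i j : ursubmx X i j = xh K t (lshift n i) (rshift m j).
Proof. by rewrite mxE mxE xhE. Qed.
Lemma dlE i j : dlsubmx X i j = xh K t (rshift m i) (lshift n j).
Proof. by rewrite mxE mxE xhE. Qed.
Lemma drE i j : U i j = xh K t (rshift m i) (rshift m j).
Proof. by rewrite mxE mxE xhE. Qed.

Lemma ipl (i : 'I_m) : ip (lshift n i) = false.
Proof. by rewrite /ipar /= leqNgt ltn_ord. Qed.
Lemma ipr (i : 'I_n) : ip (rshift m i) = true.
Proof. by rewrite /ipar /= leq_addr. Qed.

Lemma coefU i j : coef (U i j) 0 = (i == j)%:R.
Proof. by rewrite drE coef_xh0 (inj_eq (@rshift_inj _ _)). Qed.
Lemma UV1 : U *m V = 1%:M. Proof. by case: (mulmx_sinvmx coefU). Qed.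
Lemma VU1 : V *m U = 1%:M. Proof. by case: (mulmx_sinvmx coefU). Qed.

Lemma sdE : sd t = \det S * sinv (\det U).
Proof. by rewrite unlock. Qed.

Lemma detU_inv : \det U * sinv (\det U) = 1 /\ sinv (\det U) * \det U = 1.
Proof. by apply: mul_sinv; case: (scoef_det coefU). Qed.

Lemma ur_odd i j : tw true (ursubmx X i j) = - ursubmx X i j.
Proof. by rewrite urE tw_xh ipl ipr expr1 scaleN1r. Qed.
Lemma dr_even i j : tw true (U i j) = U i j.
Proof. by rewrite drE tw_xh !ipr scale1r. Qed.

Lemma sd_kill q k (f : A -> A) : sderiv id q k id f -> (forall i j, f (S i j) = 0) ->
  (forall i j, f (U i j) = 0) -> f (sd t) = 0.
Proof.
move=> hf fS fU; rewrite sdE; apply: (kill_mul hf); first exact: (kill_det hf fS).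
by have [e1 e2] := detU_inv; apply: (kill_inv hf e1 e2); exact: (kill_det hf fU).
Qed.

Lemma S_kill q k (f : A -> A) : sderiv id q k id f ->
  (forall i j, f (xh K t i j) = 0) -> f (sd t) = 0.
Proof.
move=> hf h; have hU i j : f (U i j) = 0 by rewrite drE.
apply: (sd_kill hf) => // i j; rewrite schurE (addmB (sdD hf)) (addm_sum (sdD hf)) ulE h.
rewrite big1 ?subrr // => l _; apply: (kill_mul hf); last by rewrite dlE.
by apply: (kill_W UV1 VU1 hf) => // *; rewrite urE.
Qed.

Lemma even_S i j : tw true (S i j) = S i j.
Proof.
rewrite schurE twB tw_sum ulE tw_xh !ipl scale1r; congr (_ - _).
apply: eq_bigr => l _; rewrite twM (W_odd UV1 VU1 ur_odd dr_even) dlE tw_xh ipl ipr expr1.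
by rewrite scaleN1r mulrNN.
Qed.

Lemma tw_sd q : tw q (sd t) = sd t.
Proof.
case: q; last exact: twF.
rewrite sdE twM (tw_det even_S); congr (_ * _).
have [e1 e2] := detU_inv; have := congr1 (tw true) e1.
rewrite twM tw1 (tw_det dr_even) => e.
by rewrite -[LHS]mul1r -e2 -mulrA e mulr1.
Qed.

Lemma shift_eq (i j : 'I_m) : (lshift n i == lshift n j) = (i == j).
Proof. exact: inj_eq (@lshift_inj _ _) _ _. Qed.
Lemma rshift_eq (i j : 'I_n) : (rshift m i == rshift m j) = (i == j).
Proof. exact: inj_eq (@rshift_inj _ _) _ _. Qed.

(** Row operations from the odd to the even block fix both the Schur complement and the odd block U.
    The block formula hides the other odd row operations, which do change U. *)
Lemma sd_Lupper u a b : ip a = false -> ip b = true -> Lop (u, (a, b)) (sd t) = 0.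
Proof.
have hL := Lop_deriv K2 (u, (a, b)).
case: (eqVneq u t) hL => [->|ne] hL; last first.
  by move=> _ _; apply: (S_kill hL) => i j; rewrite (Lop_xh K2) // eq_sym (negbTE ne).
case: (split_ordP a) hL => a' ->; rewrite ?ipr //; case: (split_ordP b) => b' -> hL; rewrite ?ipl // => _ _.
have fU i j : Lop (t, (lshift n a', rshift m b')) (U i j) = 0.
  by rewrite drE (Lop_xh K2) // eq_rlshift andbF.
refine (sd_kill hL _ fU) => i j.
apply: (kill_schur_upper UV1 VU1 hL (a := a') (b := b')) => k l //.
- by rewrite dlE (Lop_xh K2) // eq_rlshift andbF.
- by rewrite ulE dlE (Lop_xh K2) // eqxx shift_eq.
- by rewrite urE drE (Lop_xh K2) // eqxx shift_eq.
Qed.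

Lemma sd_Rlower u a b : ip a = true -> ip b = false -> Rop (u, (a, b)) (sd t) = 0.
Proof.
have hR := Rop_deriv K2 (u, (a, b)).
case: (eqVneq u t) hR => [->|ne] hR; last first.
  by move=> _ _; apply: (S_kill hR) => i j; rewrite (Rop_xh K2) // eq_sym (negbTE ne).
case: (split_ordP a) hR => a' ->; rewrite ?ipl //; case: (split_ordP b) => b' -> hR; rewrite ?ipr // => _ _.
have fU i j : Rop (t, (rshift m a', lshift n b')) (U i j) = 0.
  by rewrite drE (Rop_xh K2) // eq_rlshift andbF.
rewrite /gpar /= ipl ipr in hR.
refine (sd_kill hR _ fU) => i j.
apply: (kill_schur_lower UV1 VU1 ur_odd dr_even hR (a := a') (b := b')) => k l //.
- by rewrite urE (Rop_xh K2) // eq_rlshift andbF.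
- by rewrite ulE urE (Rop_xh K2) // eqxx shift_eq !ipl !ipr expr1 scaleN1r.
- by rewrite dlE drE (Rop_xh K2) // eqxx shift_eq !ipl !ipr scale1r.
Qed.

(** Columns of the even block act on the determinant of the Schur complement, those of the odd block
    on the inverse of det U; this is where the sign of the supertrace comes from. *)
Lemma sd_Reven u a b : ip a = ip b ->
  Rop (u, (a, b)) (sd t) = (if (u == t) && (a == b) then (-1) ^+ ip a else 0) *: sd t.
Proof.
have hR := Rop_deriv K2 (u, (a, b)).
case: (eqVneq u t) hR => [->|ne] hR /=; last first.
  by move=> _; rewrite scale0r; apply: (S_kill hR) => i j; rewrite (Rop_xh K2) // eq_sym (negbTE ne).
case: (split_ordP a) hR => a' ->; case: (split_ordP b) => b' ->;
  rewrite ?ipl ?ipr // => hR _; rewrite /gpar /= ?ipl ?ipr in hR.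
  have fU i j : Rop (t, (lshift n a', lshift n b')) (U i j) = 0.
    by rewrite drE (Rop_xh K2) // eq_rlshift andbF.
  have fS := deriv_schur_ul UV1 VU1 hR (a := a') (b := b').
  rewrite shift_eq sdE (sdM hR) twF (kill_inv hR detU_inv.1 detU_inv.2) ?mulr0 ?addr0; last first.
    exact: (kill_det hR fU).
  rewrite (deriv_det hR (a := a') (b := b')); last first.
    apply: fS => // k l.
    - by rewrite urE (Rop_xh K2) // eq_rlshift andbF.
    - by rewrite !ulE (Rop_xh K2) // eqxx shift_eq !ipl scale1r.
    - by rewrite !dlE (Rop_xh K2) // eqxx shift_eq !ipl scale1r.
  by case: eqP => _; rewrite ?scale1r ?scale0r ?mul0r.
have fU i j : Rop (t, (rshift m a', rshift m b')) (U i j) = if j == b' then U i a' else 0.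
  by rewrite !drE (Rop_xh K2) // eqxx rshift_eq !ipr scale1r.
have fS := kill_schur_dr UV1 VU1 hR (a := a') (b := b').
rewrite rshift_eq sdE (sdM hR) twF (kill_det hR) ?mul0r ?add0r; last first.
  apply: fS => // k l.
  - by rewrite ulE (Rop_xh K2) // eq_lrshift andbF.
  - by rewrite dlE (Rop_xh K2) // eq_lrshift andbF.
  - by rewrite !urE (Rop_xh K2) // eqxx rshift_eq !ipr scale1r.
have [e1 e2] := detU_inv; have := sdM hR (\det U) (sinv (\det U)).
rewrite e1 (sd1 (smorph_id K p) hR) twF (deriv_det hR fU) => /esym/eqP.
rewrite addr_eq0 => /eqP/(congr1 (fun w => sinv (\det U) * w)).
rewrite mulrN [sinv _ * (\det U * _)]mulrA e2 mul1r.
move/(congr1 -%R); rewrite opprK => <-; case: (a' == b'); last first.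
  by rewrite scale0r mul0r mulr0 oppr0 mulr0.
by rewrite e1 mulr1 mulrN expr1 scaleN1r.
Qed.

End Fixed.

(** The supertrace of the component in the copy t of the matrix unit g. *)
Definition stw (g : gens m n T) t : K :=
  if (g.1 == t) && (g.2.1 == g.2.2) then (-1) ^+ ip g.2.1 else 0.

Lemma coef_Lop0 (g : gens m n T) (f : A) : coef (Lop g f) 0 = coef f (mgen g).
Proof.
apply: (deriv_coef0 (Lop_deriv K2 g)) => -[u [i j]]; case: g => t [a b].
rewrite sgen_xh (addmB (sdD (Lop_deriv K2 _))) (sderiv_nat _ (smorph_id K p) (Lop_deriv K2 _)) subr0.
rewrite (Lop_xh K2) // !xpair_eqE; case: (eqVneq u t) => _ //=; case: (eqVneq i a) => _ //=.
by rewrite coef_xh0 eq_sym.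
Qed.

Lemma coef_Rop0 (g : gens m n T) (f : A) : coef (Rop g f) 0 = coef f (mgen g).
Proof.
apply: (deriv_coef0 (Rop_deriv K2 g)) => -[u [i j]]; case: g => t [a b].
rewrite sgen_xh (addmB (sdD (Rop_deriv K2 _))) (sderiv_nat _ (smorph_id K p) (Rop_deriv K2 _)) subr0.
rewrite (Rop_xh K2) // !xpair_eqE; case: (eqVneq u t) => _ //=.
case: (eqVneq j b) => [->|_] /=; last by rewrite andbF scoef0.
rewrite scoefZ coef_xh0 andbT; case: eqP => [->|_]; last by rewrite mulr0.
by rewrite mulr1; case: (ip a); case: (ip b).
Qed.

(** One field per generator, chosen among those for which the block formula gives the eigenvalue
    directly. At the origin all of them are dual to the generators, so they form a frame for
    [deriv_prop]. *)
Definition mixed (g : gens m n T) : A -> A :=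
  if ~~ ip g.2.1 && ip g.2.2 then Lop g else Rop g.

Lemma mixed_deriv g : sderiv id (p g) 1 id (mixed g).
Proof. by rewrite /mixed; case: ifP => _; [apply: Lop_deriv|apply: Rop_deriv]; apply: K2. Qed.
Lemma mixed0 g x : coef (mixed g (sgen K p x)) 0 = (g == x)%:R.
Proof.
by rewrite /mixed; case: ifP => _; rewrite ?coef_Lop0 ?coef_Rop0 coef_sgen (inj_eq (@mgen_inj _)).
Qed.

Lemma coef_sd0 t : coef (sd t) 0 = 1.
Proof. by rewrite unlock; case: (coef_sdet_xmx K m n t). Qed.
Lemma coef_sd1 t (g : gens m n T) : coef (sd t) (mgen g) = stw g t.
Proof. by rewrite unlock; case: g => u [i j]; case: (coef_sdet_xmx K m n t) => _ ->. Qed.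

Lemma stw_odd g t : p g -> stw g t = 0.
Proof.
rewrite /stw /gpar; case: ifP => // /andP[_ /eqP ->]; by rewrite addbb.
Qed.

Lemma sd_mixed g t : mixed g (sd t) = stw g t *: sd t.
Proof.
case: g => u [a b]; rewrite /mixed /stw /=; case: (boolP (ip a)) => ha; case: (boolP (ip b)) => hb /=.
- by rewrite sd_Reven ?ha ?hb.
- rewrite sd_Rlower ?(negbTE hb) //; case: (eqVneq a b) => [e|_]; last by rewrite andbF scale0r.
  by rewrite -e ha in hb.
- rewrite sd_Lupper ?(negbTE ha) //; case: (eqVneq a b) => [e|_]; last by rewrite andbF scale0r.
  by rewrite e hb in ha.
- by rewrite sd_Reven ?(negbTE ha) ?(negbTE hb).
Qed.

(** The field commutes with the right fields of the frame, and its commutators with the upper left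
    ones are again upper and annihilate sd. So its value on sd has the eigenvalues of sd, and
    uniqueness makes it a multiple. *)
Lemma sd_Leven u a b t : ip a = ip b -> Lop (u, (a, b)) (sd t) = stw (u, (a, b)) t *: sd t.
Proof.
move=> ab; rewrite -coef_sd1 -coef_Lop0.
apply: (deriv_prop mixed_deriv mixed0 (coef_sd0 t)) => [g pg|g|g]; first exact: stw_odd t pg.
  exact: sd_mixed.
have g0 : gpar (u, (a, b)) = false by rewrite /gpar /= ab addbb.
rewrite /mixed; case: ifP => [|hg]; last first.
  have := LR_comm K2 (u, (a, b)) g (sd t); rewrite g0 scale1r => <-.
  have := sd_mixed g t; rewrite /mixed hg => ->; exact: (sdZ (Lop_deriv K2 _)).
case: g => v [c d] /= /andP[/negbTE hc hd].
have -> : stw (v, (c, d)) t = 0 by rewrite stw_odd // /gpar /= hc hd.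
rewrite scale0r; have [e|ne] := eqVneq v u; last first.
  by rewrite (LL_comm_neq K2) // sd_Lupper // (addm0 (sdD (Lop_deriv K2 _))) scaler0.
rewrite e (LL_comm K2) sd_Lupper // (addm0 (sdD (Lop_deriv K2 _))) scaler0 add0r.
have e1 : (c == b)%:R *: Lop (u, (a, d)) (sd t) = 0.
  case: eqP => [ecb|_]; last by rewrite scale0r.
  by rewrite sd_Lupper ?scaler0 // ab -ecb.
have e2 : (a == d)%:R *: Lop (u, (c, b)) (sd t) = 0.
  case: eqP => [ead|_]; last by rewrite scale0r.
  by rewrite sd_Lupper ?scaler0 // -ab ead.
by rewrite e1 e2 scaler0 subr0.
Qed.

Lemma sd_L g t : Lop g (sd t) = stw g t *: sd t.
Proof.
case: g => u [a b]; case ha: (ip a); case hb: (ip b).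
- by rewrite sd_Leven ?ha ?hb.
- rewrite -coef_sd1 -coef_Lop0.
  apply: (deriv_prop mixed_deriv mixed0 (coef_sd0 t)) => [g pg|g|g]; first exact: stw_odd t pg.
    exact: sd_mixed.
  have g1 : gpar (u, (a, b)) by rewrite /gpar /= ha hb.
  rewrite /mixed; case: ifP => [|hg]; last first.
    have := LR_comm K2 (u, (a, b)) g (sd t).
    have := sd_mixed g t; rewrite /mixed hg => -> /esym; rewrite (sdZ (Lop_deriv K2 _)) g1 /=.
    case pg: (gpar g); last by rewrite scale1r.
    by rewrite stw_odd // !scale0r => /eqP; rewrite expr1 scaleN1r oppr_eq0 => /eqP.
  case: g => v [c d] /= /andP[/negbTE hc hd].
  have -> : stw (v, (c, d)) t = 0 by rewrite stw_odd // /gpar /= hc hd.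
  rewrite scale0r; have [e|ne] := eqVneq v u; last first.
    by rewrite (LL_comm_neq K2) // sd_Lupper // (addm0 (sdD (Lop_deriv K2 _))) scaler0.
  rewrite e (LL_comm K2) sd_Lupper // (addm0 (sdD (Lop_deriv K2 _))) scaler0 add0r.
  rewrite ha hb hc hd /= expr1 scaleN1r opprK !sd_Leven ?ha ?hb ?hc ?hd //.
  (* For two opposite odd units the supercommutator involves e_cb and e_ad; when both act
     diagonally, their eigenvalues 1 and -1 cancel. *)
  rewrite !scalerA -scalerDl /stw /= [c == b]eq_sym.
  case: (u == t); rewrite ?mulr0 ?addr0 ?scale0r //=.
  case: (eqVneq b c) => [_|_]; case: (eqVneq a d) => [_|_];
    by rewrite ?mul1r ?mul0r ?mulr0 ?addr0 ?scale0r // ha hc expr1 expr0 addNr scale0r.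
- rewrite sd_Lupper // stw_odd ?scale0r // /gpar /= ha hb //.
- by rewrite sd_Leven ?ha ?hb.
Qed.

(** Now the left fields serve as the frame; since they supercommute with [Rop g], its value on sd is
    again an eigenvector. Its constant term gives the factor. *)
Lemma sd_R g t : Rop g (sd t) = stw g t *: sd t.
Proof.
rewrite -coef_sd1 -coef_Rop0.
have L0 (h x : gens m n T) : coef (Lop h (sgen K p x)) 0 = (h == x)%:R.
  by rewrite coef_Lop0 coef_sgen (inj_eq (@mgen_inj _)).
apply: (@deriv_prop K _ p Lop (@Lop_deriv K K2 m n T) L0 (stw^~ t) _ _ (coef_sd0 t)) => [h ph|h|h].
- exact: stw_odd t ph.
-
  exact: sd_L.
rewrite (LR_comm K2) sd_L (sdZ (Rop_deriv K2 _)) scalerA; congr (_ *: _).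
by case ph: (gpar h); rewrite ?mul1r //= stw_odd // mulr0.
Qed.

End Berezinian.

HB.lock Definition vh (K : numFieldType) (m n : nat) (T : finType) (t : T)
  (i j : 'I_(m + n)) : fps K m n T := sinvmx (1%:M + xmx K m n t) i j.

Canonical vh_unlockable := Unlockable vh.unlock.

(** * Maps that preserve the ideal of the special linear quotient *)

Section IdealPreservation.
Variables (K : numFieldType) (m n : nat).
Local Notation K2 := (@num_tors K).
Local Notation ip := (@ipar m n).
Local Notation fps T := (fps K m n T).
Local Notation sl T := (@sl_ideal K m n T).

Lemma sl_ideal_ind (T : finType) (S : fps T -> Prop) : two_sided_ideal S ->
  (forall t, S (sd K m n t - 1)) -> forall f, f \in sl T -> S f.
Proof. by rewrite unlock => hS h f /asboolP; apply=> // _ [t ->]; apply: h. Qed.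

Lemma sd_in (T : finType) (t : T) : sd K m n t - 1 \in sl T.
Proof. by rewrite unlock; apply/asboolP => S hS; apply; exists t. Qed.

Lemma sl_mull (T : finType) (a f : fps T) : f \in sl T -> a * f \in sl T.
Proof. by case: (sl_idealP K m n T) => _ _ h _; apply: h. Qed.
Lemma sl_mulr (T : finType) (a f : fps T) : f \in sl T -> f * a \in sl T.
Proof. by case: (sl_idealP K m n T) => _ _ _; apply. Qed.
Lemma slZ (T : finType) c (f : fps T) : f \in sl T -> c *: f \in sl T.
Proof. by move=> h; rewrite -[f]mul1r sps_scalerAl; apply: sl_mull. Qed.

Lemma smorph_ideal (T T' : finType) s (E : fps T -> fps T') : smorph s E ->
  (forall t, E (sd K m n t - 1) \in sl T') -> forall f, f \in sl T -> E f \in sl T'.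
Proof.
move=> hE h; apply: (sl_ideal_ind (S := fun f => E f \in sl T')) h; split.
- by rewrite (addm0 (smD hE)) rpred0.
- by move=> u v hu hv; rewrite (addmB (smD hE)) rpredB.
- by move=> a u hu; rewrite (smM hE); apply: sl_mull.
- by move=> a u hu; rewrite (smM hE); apply: sl_mulr.
Qed.

Lemma tw_smorph (T : finType) b : smorph id (tw b : fps T -> fps T).
Proof.
split=> [f g|c f|f g||k f|c f]; [exact: twD|exact: twZ|exact: twM|exact: tw1|exact: sorder_tw|].
by rewrite !tw_tw addbC.
Qed.

Lemma tw_ideal (T : finType) b (f : fps T) : f \in sl T -> tw b f \in sl T.
Proof.
move: f; apply: (smorph_ideal (tw_smorph T b)) => t.
by rewrite twB tw_sd tw1; apply: sd_in.
Qed.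

Lemma sderiv_ideal (T : finType) q c (D : fps T -> fps T) : sderiv id q c id D ->
  (forall t, D (sd K m n t) \in sl T) -> forall f, f \in sl T -> D f \in sl T.
Proof.
move=> hD h f hf; suff [] : f \in sl T /\ D f \in sl T by [].
move: f hf; apply: sl_ideal_ind => [|t]; last first.
  split; first exact: sd_in.
  by rewrite (addmB (sdD hD)) (sd1 (smorph_id K _) hD) subr0.
split=> [|u v [u0 u1] [v0 v1]|a u [u0 u1]|a u [u0 u1]].
- by rewrite (addm0 (sdD hD)) rpred0.
- by rewrite (addmB (sdD hD)) !rpredB.
- rewrite (sdM hD); split; [exact: sl_mull|rewrite rpredD //]; exact: sl_mull.
- rewrite (sdM hD); split; [exact: sl_mulr|rewrite rpredD //].
    exact: sl_mulr.
  exact/sl_mulr/tw_ideal.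
Qed.

Lemma smorph_coef0 (G G' : finType) (p : G -> bool) (p' : G' -> bool) s
    (E : sps K p -> sps K p') : smorph s E -> forall f, coef (E f) 0 = s (coef f 0).
Proof.
move=> hE f; have o : sorder 1 (f - coef f 0 *: (1 : sps K p)).
  by apply/sorder_coef0; rewrite scoefD scoefN scoefZ scoef1_0 mulr1 subrr.
have /sorder_coef0 := sm_order hE o.
rewrite (addmB (smD hE)) (smZ hE) (sm1 hE) scoefD scoefN scoefZ scoef1_0 mulr1.
by move/subr0_eq.
Qed.

Section Coproduct.
Variable T : finType.
Implicit Types (t : T) (g : gens m n T).

Lemma stw_l g t : stw K (lgen g) (inl t : (T + T)%type) = stw K g t.
Proof. by []. Qed.
Lemma stw_r g t : stw K (rgen g) (inr t : (T + T)%type) = stw K g t.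
Proof. by []. Qed.
Lemma stw_rl g t : stw K (rgen g) (inl t : (T + T)%type) = 0 :> K.
Proof. by []. Qed.
Lemma stw_lr g t : stw K (lgen g) (inr t : (T + T)%type) = 0 :> K.
Proof. by []. Qed.

Lemma gens2P (P : gens m n (T + T)%type -> Prop) :
  (forall g, P (lgen g)) -> (forall g, P (rgen g)) -> forall y, P y.
Proof. by move=> hl hr [[t|t] x]; [apply: (hl (t, x))|apply: (hr (t, x))]. Qed.

Lemma coefL0 (T' : finType) (h x : gens m n T') : coef (Lop h (sgen K (@gpar m n T') x)) 0 = (h == x)%:R.
Proof. by rewrite coef_Lop0 coef_sgen (inj_eq (@mgen_inj _)). Qed.

(** By uniqueness rather than by substitution into the block formula: both sides have the same
    eigenvalues and constant term 1. *)
Lemma tl_sd t : tl (sd K m n t) = sd K m n (inl t : (T + T)%type).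
Proof.
have h := @deriv_prop K _ (@gpar m n _) Lop (@Lop_deriv K K2 m n (T + T)%type) (@coefL0 _)
  (fun y => stw K y (inl t)) _ (tl (sd K m n t)) (coef_sd0 K m n (inl t : (T + T)%type)).
rewrite h ?(smorph_coef0 (tl_smorph K2 m n T)) /= ?coef_sd0 ?scale1r //.
- by move=> g pg; apply: stw_odd.
- by move=> g; apply: sd_L.
- apply: gens2P => g.
    by rewrite (tl_Lop K2) sd_L (smZ (tl_smorph K2 m n T)).
  by rewrite (tl_Lop0 K2) stw_rl scale0r.
Qed.

Lemma tr_sd t : tr (sd K m n t) = sd K m n (inr t : (T + T)%type).
Proof.
have h := @deriv_prop K _ (@gpar m n _) Lop (@Lop_deriv K K2 m n (T + T)%type) (@coefL0 _)
  (fun y => stw K y (inr t)) _ (tr (sd K m n t)) (coef_sd0 K m n (inr t : (T + T)%type)).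
rewrite h ?(smorph_coef0 (tr_smorph K2 m n T)) /= ?coef_sd0 ?scale1r //.
- by move=> g pg; apply: stw_odd.
- by move=> g; apply: sd_L.
- apply: gens2P => g.
    by rewrite (tr_Lop0 K2) stw_lr scale0r.
  by rewrite (tr_Lop K2) sd_L (smZ (tr_smorph K2 m n T)).
Qed.

(** Left fields on left copies and right fields on right copies are those that come from fields
    before the coproduct, by [cop_Lop] and [cop_Rop]. *)
Definition LRop (g : gens m n (T + T)%type) : fps (T + T)%type -> fps (T + T)%type :=
  if g.1 is inl _ then Lop g else Rop g.

(** Multiplicativity of the Berezinian, read off the eigenvalues along the frame [LRop]. *)
Lemma cop_sd t : cop (sd K m n t) =
  sd K m n (inl t : (T + T)%type) * sd K m n (inr t : (T + T)%type).
Proof.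
have hD (g : gens m n (T + T)%type) : sderiv id (gpar g) 1 id (LRop g).
  by rewrite /LRop; case: g.1 => _; [apply: Lop_deriv|apply: Rop_deriv]; exact: K2.
have h0 (g x : gens m n (T + T)%type) : coef (LRop g (sgen K (@gpar m n (T + T)%type) x)) 0 = (g == x)%:R.
  by rewrite /LRop; case: g.1 => _; rewrite ?coef_Lop0 ?coef_Rop0 coef_sgen (inj_eq (@mgen_inj _)).
have s0 : coef (sd K m n (inl t : (T + T)%type) * sd K m n (inr t : (T + T)%type)) 0 = 1.
  by rewrite scoefM_0 !coef_sd0 mulr1.
have h := @deriv_prop K _ (@gpar m n _) LRop hD h0
  (fun y => stw K y (inl t) + stw K y (inr t)) _ (cop (sd K m n t)) s0.
rewrite h ?(smorph_coef0 (cop_smorph K2 m n T)) /= ?coef_sd0 ?scale1r //.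
- by move=> g pg; rewrite !stw_odd ?addr0.
- move=> g; rewrite /LRop; case: g => -[] u x /=.
    by rewrite (sdM (Lop_deriv K2 _)) !sd_L tw_sd -sps_scalerAl -sps_scalerAr -scalerDl.
  by rewrite (sdM (Rop_deriv K2 _)) !sd_R tw_sd -sps_scalerAl -sps_scalerAr -scalerDl.
- apply: gens2P => g; rewrite /LRop /=.
    by rewrite -(cop_Lop K2) sd_L (smZ (cop_smorph K2 m n T)) stw_l stw_lr addr0.
  by rewrite -(cop_Rop K2) sd_R (smZ (cop_smorph K2 m n T)) stw_r stw_rl add0r.
Qed.

Lemma tl_ideal f : f \in sl T -> tl f \in sl (T + T)%type.
Proof.
move: f; apply: (smorph_ideal (tl_smorph K2 m n T)) => t.
by rewrite (addmB (smD (tl_smorph K2 m n T))) (sm1 (tl_smorph K2 m n T)) tl_sd; apply: sd_in.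
Qed.
Lemma tr_ideal f : f \in sl T -> tr f \in sl (T + T)%type.
Proof.
move: f; apply: (smorph_ideal (tr_smorph K2 m n T)) => t.
by rewrite (addmB (smD (tr_smorph K2 m n T))) (sm1 (tr_smorph K2 m n T)) tr_sd; apply: sd_in.
Qed.
Lemma cop_ideal f : f \in sl T -> cop f \in sl (T + T)%type.
Proof.
move: f; apply: (smorph_ideal (cop_smorph K2 m n T)) => t.
rewrite (addmB (smD (cop_smorph K2 m n T))) (sm1 (cop_smorph K2 m n T)) cop_sd.
set a := sd _ _ _ _; set b := sd _ _ _ _.
have -> : a * b - 1 = (a - 1) * b + (b - 1) by rewrite mulrBl mul1r addrA subrK.
by rewrite rpredD //; [apply/sl_mulr|]; apply: sd_in.
Qed.

End Coproduct.

(** * The antipode and the inverse matrix *)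

Section Antipode.
Variable T : finType.
Implicit Types (t s : T) (i j a b : 'I_(m + n)).

Lemma coef_hat t i j : coef ((1%:M + xmx K m n t) i j) 0 = (i == j)%:R.
Proof. by rewrite xhE coef_xh0. Qed.

Lemma vhE t i j : sinvmx (1%:M + xmx K m n t) i j = vh K t i j.
Proof. by rewrite unlock. Qed.

Lemma xh_vh t i j : \sum_k xh K t i k * vh K t k j = (i == j)%:R.
Proof.
have [/matrixP/(_ i j) e _] := mulmx_sinvmx (coef_hat t); 
transitivity ((1%:M : 'M[fps T]_(m + n)) i j); last by rewrite mxE.
rewrite -e mxE.
by apply: eq_bigr => k _; rewrite xhE vhE.
Qed.
Lemma vh_xh t i j : \sum_k vh K t i k * xh K t k j = (i == j)%:R.
Proof.
have [_ /matrixP/(_ i j) e] := mulmx_sinvmx (coef_hat t); 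
transitivity ((1%:M : 'M[fps T]_(m + n)) i j); last by rewrite mxE.
rewrite -e mxE.
by apply: eq_bigr => k _; rewrite xhE vhE.
Qed.

Lemma coef_vh0 t i j : coef (vh K t i j) 0 = (i == j)%:R.
Proof. by rewrite -vhE (coef_sinvmx (coef_hat t)). Qed.

Lemma vh_solve t (w y : 'I_(m + n) -> fps T) :
  (forall i, \sum_k xh K t i k * w k = y i) -> forall i, w i = \sum_k vh K t i k * y k.
Proof.
move=> h i; under eq_bigr => k _ do rewrite -h mulr_sumr.
rewrite exchange_big /=; under eq_bigr => k _ do under eq_bigr => l _ do rewrite mulrA.
under eq_bigr => k _ do rewrite -mulr_suml vh_xh.
by rewrite (bigD1 i) //= eqxx mul1r big1 ?addr0 // => k /negbTE; rewrite eq_sym => ->; rewrite mul0r.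
Qed.

Lemma tw_vh q t i j : tw q (vh K t i j) = (-1) ^+ (q && (ip i (+) ip j)) *: vh K t i j.
Proof.
(* The twisted column, with its expected sign undone; it solves the same linear system as the column
   of the inverse. *)
pose w k := (-1) ^+ (q && (ip k (+) ip j)) *: tw q (vh K t k j).
suff e : w i = vh K t i j.
  by rewrite -[in RHS]e /w scalerA -signr_addb addbb scale1r.
have h k : \sum_l xh K t k l * w l = (k == j)%:R.
  transitivity ((-1) ^+ (q && (ip k (+) ip j)) *: tw q (\sum_l xh K t k l * vh K t l j)).
    rewrite tw_sum scaler_sumr; apply: eq_bigr => l _.
    rewrite twM tw_xh -sps_scalerAl -sps_scalerAr !scalerA -signr_addb; congr (_ ^+ _ *: _).
    by case: q {w}; case: (ip k); case: (ip l); case: (ip j).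
  rewrite xh_vh; case: eqP => [->|_]; last by rewrite tw0 scaler0.
  by rewrite addbb andbF tw1 scale1r.
rewrite (vh_solve h) (bigD1 j) //= eqxx mulr1 big1 ?addr0 // => k /negbTE ->.
exact: mulr0.
Qed.

Lemma tw_shomog (q : bool) (f : fps T) : tw true f = (-1) ^+ q *: f -> shomog q f.
Proof.
move=> /spsP e mu ne; have := e mu; rewrite coef_tw scoefZ /=.
have -> : mpar (@gpar m n T) mu = ~~ q by move: ne; case: (mpar _ _); case: q {e}.
case: q {e ne}; rewrite /= ?expr0 ?expr1 !(mul1r, mulN1r) => h; apply: num_tors.
  by rewrite {1}h addNr.
by rewrite -{1}h addNr.
Qed.

Lemma shomog_vh t i j : shomog (ip i (+) ip j) (vh K t i j).
Proof. by apply: tw_shomog; rewrite tw_vh. Qed.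

Local Notation S0 := (@santipode K m n T).

Lemma antipode_gen (g : gens m n T) :
  (sinvmx (1%:M + xmx K m n g.1) - 1%:M) g.2.1 g.2.2
  = vh K g.1 g.2.1 g.2.2 - (g.2.1 == g.2.2)%:R.
Proof. by rewrite mxE vhE !mxE. Qed.

Lemma antipode_order (g : gens m n T) :
  sorder 1 ((sinvmx (1%:M + xmx K m n g.1) - 1%:M) g.2.1 g.2.2).
Proof.
rewrite antipode_gen; apply/sorder_coef0; rewrite scoefD scoefN coef_vh0.
by case: eqP => _; rewrite ?scoef1_0 ?scoef0 subrr.
Qed.
Lemma antipode_homog (g : gens m n T) :
  shomog (gpar g) ((sinvmx (1%:M + xmx K m n g.1) - 1%:M) g.2.1 g.2.2).
Proof.
rewrite antipode_gen; apply: shomogD; first exact: shomog_vh.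
apply: shomogN; rewrite /gpar; case: eqP => [->|_]; last exact: shomog0.
rewrite addbb; exact: shomog1.
Qed.

Lemma S0_smorph : smorph id S0.
Proof. exact: (ssubst_smorph K2 antipode_order antipode_homog). Qed.

Lemma S0_xh t i j : S0 (xh K t i j) = vh K t i j.
Proof.
rewrite xh_def (smD S0_smorph) (smorph_nat _ S0_smorph) /santipode.
rewrite (ssubst_sgen K2 antipode_order antipode_homog) antipode_gen /=.
by rewrite addrC subrK.
Qed.

(** Differentiating (1 + X) V = 1 gives a linear system for the derivatives of a column of V, which
    [vh_solve] inverts. *)
Lemma Lop_vh t a b s i j : Lop (t, (a, b)) (vh K s i j) =
  if (s == t) && (j == b)
  then - ((-1) ^+ ((ip a (+) ip b) && (ip i (+) ip a)) *: vh K s i a) else 0.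
Proof.
have hL := Lop_deriv K2 (t, (a, b)); rewrite /gpar /= in hL.
pose q := ip a (+) ip b.
have h k : \sum_l xh K s k l * ((-1) ^+ (q && (ip k (+) ip l)) *: Lop (t, (a, b)) (vh K s l j)) =
    - (if (s == t) && (k == a) then (b == j)%:R else 0).
  apply/eqP; rewrite -addr_eq0 addrC; apply/eqP.
  have := congr1 (Lop (t, (a, b))) (xh_vh s k j).
  rewrite (addm_sum (sdD hL)) (sderiv_nat _ (smorph_id K _) hL) => e; rewrite -[RHS]e.
  under [RHS]eq_bigr => l _ do rewrite (sdM hL) (Lop_xh K2) tw_xh -sps_scalerAl sps_scalerAr.
  rewrite big_split /=; congr (_ + _).
  case: ifP => [/andP[/eqP -> _]|_]; first by rewrite xh_vh.
  by rewrite big1 // => l _; rewrite mul0r.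
(* The sign depends on k through the row parity, which is constant on the support of the right side. *)
pose y : sps K (@gpar m n T) := - ((-1) ^+ (q && ip a) *: ((b == j)%:R : sps K (@gpar m n T))).
have h' k : \sum_l xh K s k l * ((-1) ^+ (q && ip l) *: Lop (t, (a, b)) (vh K s l j)) =
    (if (s == t) && (k == a) then y else 0).
  transitivity ((-1) ^+ (q && ip k) *: (\sum_l xh K s k l *
      ((-1) ^+ (q && (ip k (+) ip l)) *: Lop (t, (a, b)) (vh K s l j)))).
    rewrite scaler_sumr; apply: eq_bigr => l _; rewrite -!sps_scalerAr scalerA -signr_addb.
    by congr (_ ^+ _ *: _); case: (q); case: (ip k); case: (ip l).
  rewrite h scalerN /y; case: (s == t) => /=; last by rewrite scaler0 oppr0.
  by case: eqP => [->|_]; rewrite ?scaler0 ?oppr0.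
have := vh_solve h' i => /(congr1 (fun w => (-1) ^+ (q && ip i) *: w)).
rewrite scalerA -signr_addb addbb scale1r => ->.
have [_|_] /= := eqVneq s t; last first.
  by rewrite big1 ?scaler0 // => k _; rewrite mulr0.
rewrite (bigD1 a) //= eqxx big1 ?addr0 => [|k /negbTE ->]; last by rewrite mulr0.
rewrite /y [b == j]eq_sym; case: eqP => _; last by rewrite scaler0 oppr0 mulr0 scaler0.
rewrite mulrN -sps_scalerAr mulr1 scalerN scalerA -signr_addb; congr (- (_ ^+ _ *: _)).
by rewrite /q; case: (ip a); case: (ip b); case: (ip i).
Qed.

Lemma Rop_vh t a b s i j : Rop (t, (a, b)) (vh K s i j) =
  if (s == t) && (i == a) then - vh K s b j else 0.
Proof.
have hR := Rop_deriv K2 (t, (a, b)); rewrite /gpar /= in hR.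
pose q := ip a (+) ip b.
have h k : \sum_l Rop (t, (a, b)) (vh K s i l) * xh K s l k =
    - (if (s == t) && (k == b) then (i == a)%:R else 0).
  apply/eqP; rewrite -addr_eq0; apply/eqP.
  have := congr1 (Rop (t, (a, b))) (vh_xh s i k).
  rewrite (addm_sum (sdD hR)) (sderiv_nat _ (smorph_id K _) hR) => e; rewrite -[RHS]e.
  under [RHS]eq_bigr => l _ do rewrite (sdM hR) (Rop_xh K2).
  rewrite big_split /=; congr (_ + _).
  case: ifP => [/andP[/eqP -> /eqP ->]|_]; last by rewrite big1 // => l _; rewrite mulr0.
  transitivity (\sum_l (-1) ^+ (q && (ip i (+) ip a)) *: (vh K t i l * xh K t l a)).
    rewrite -scaler_sumr vh_xh; case: eqP => [->|_]; last by rewrite scaler0.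
    by rewrite addbb andbF scale1r.
  apply: eq_bigr => l _; rewrite tw_vh -sps_scalerAl -sps_scalerAr scalerA -signr_addb.
  congr (_ ^+ _ *: _); rewrite /q.
  by case: (ip a); case: (ip b); case: (ip i); case: (ip l).
have e l : Rop (t, (a, b)) (vh K s i l) =
    \sum_k (\sum_l' Rop (t, (a, b)) (vh K s i l') * xh K s l' k) * vh K s k l.
  under eq_bigr => k _ do rewrite mulr_suml.
  rewrite exchange_big /=; under eq_bigr => l' _ do under eq_bigr => k _ do rewrite -mulrA.
  under eq_bigr => l' _ do rewrite -mulr_sumr xh_vh.
  rewrite (bigD1 l) //= eqxx mulr1 big1 ?addr0 // => k /negbTE ->; exact: mulr0.
rewrite e; under eq_bigr => k _ do rewrite h.
have [_|_] /= := eqVneq s t; last by rewrite big1 // => k _; rewrite oppr0 mul0r.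
rewrite (bigD1 b) //= eqxx big1 ?addr0 => [|k /negbTE ->]; last by rewrite oppr0 mul0r.
by case: eqP => _; rewrite ?oppr0 ?mul0r // mulNr mul1r.
Qed.

(** Inversion on the group exchanges left and right translations and reverses their direction. *)
Lemma Lop_S0 g f : Lop g (S0 f) = - S0 (Rop g f).
Proof.
have d1 : sderiv id (gpar g) 1 S0 (fun f => - S0 (Rop g f)) :=
  sderivN (smorph_deriv erefl erefl (Rop_deriv K2 g) S0_smorph).
have d2 : sderiv id (gpar g) 1 S0 (Lop g \o S0) := sderiv_morph S0_smorph (Lop_deriv K2 g).
refine (sderiv_ext_hat S0_smorph d2 d1 _ f) => {f d1 d2}.
case: g => t [a b] s i j /=; rewrite S0_xh Lop_vh (Rop_xh K2).
case: ifP => [/andP[/eqP -> /eqP ->]|_]; last by rewrite (addm0 (smD S0_smorph)) oppr0.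
rewrite (smZ S0_smorph) S0_xh; congr (- (_ ^+ _ *: _)).
by case: (ip a); case: (ip b); case: (ip i).
Qed.

(** The left fields have opposite eigenvalues on the two factors, so the product is constant. *)
Lemma S0_sd t : S0 (sd K m n t) * sd K m n t = 1.
Proof.
have := @deriv_const K _ (@gpar m n T) Lop (@Lop_deriv K K2 m n T) (@coefL0 _)
  (S0 (sd K m n t) * sd K m n t).
rewrite scoefM_0 (smorph_coef0 S0_smorph) /= !coef_sd0 mulr1 scale1r; apply=> g.
rewrite (sdM (Lop_deriv K2 g)) Lop_S0 sd_R sd_L (smZ S0_smorph).
rewrite -(sm_tw S0_smorph) tw_sd -scaleNr -sps_scalerAl -sps_scalerAr -scalerDl.
by rewrite addNr scale0r.
Qed.

Lemma S0_ideal f : f \in sl T -> S0 f \in sl T.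
Proof.
move: f; apply: (smorph_ideal S0_smorph) => t.
rewrite (addmB (smD S0_smorph)) (sm1 S0_smorph) -(S0_sd t) -[X in X - _]mulr1 -mulrBr.
by apply: sl_mull; rewrite -opprB rpredN sd_in.
Qed.

End Antipode.
End IdealPreservation.

(** * The star map *)

Section Star.
Variables (K : numClosedFieldType) (m n : nat).
Local Notation K2 := (@num_tors K).
Local Notation ip := (@ipar m n).
Local Notation A := (fps K m n bool).
Local Notation p := (@gpar m n bool).
Local Notation sl := (@sl_ideal K m n bool).
Local Notation cj := (fun c : K => c^*).
Implicit Types (t s : bool) (a b i j : 'I_(m + n)) (g : gens m n bool).

Lemma neg_eq t s : (~~ t == s) = (t == ~~ s).
Proof. by case: t; case: s. Qed.

Definition star_gen g : A := let: (t, (i, j)) := g in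
  (-1) ^+ ((ip i + ip j) * ip j)%N *: santipode (sgen K p (~~ t, (j, i))).

Definition star0 (f : A) : A := ssubst star_gen (smap cj f).

Lemma sign_nat (x y z : bool) : (-1) ^+ ((x + y) * z)%N = (-1) ^+ ((x (+) y) && z) :> K.
Proof. by rewrite -[LHS]signr_odd oddM oddD !oddb. Qed.

Lemma star_order g : sorder 1 (star_gen g).
Proof.
case: g => t [i j]; apply/sorderZ; apply: (sm_order (S0_smorph K m n bool)).
exact: sorder_sgen.
Qed.

Lemma star_homog g : shomog (p g) (star_gen g).
Proof.
case: g => t [i j]; apply: shomogZ.
have h := shomog_sgen (K := K) (p := p) (~~ t, (j, i)).
have := sm_homog K2 erefl erefl (S0_smorph K m n bool) h.
by rewrite /gpar /= addbC.
Qed.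

Lemma star_smorph : smorph cj star0.
Proof. exact: smorph_comp (smap_smorph _ Num.conj) (ssubst_smorph K2 star_order star_homog). Qed.

Lemma star_xh t i j :
  star0 (xh K t i j) = (-1) ^+ ((ip i (+) ip j) && ip j) *: vh K (~~ t) j i.
Proof.
rewrite xh_def (smD star_smorph) (smorph_nat _ star_smorph) /star0 (smap_sgen _ Num.conj).
rewrite (ssubst_sgen K2 star_order star_homog) /star_gen sign_nat.
rewrite sgen_xh (addmB (smD (S0_smorph K m n bool))) (smorph_nat _ (S0_smorph K m n bool)) S0_xh.
rewrite scalerBr [j == i]eq_sym; case: eqP => [->|_]; last by rewrite scaler0 subr0 add0r.
by rewrite addbb !scale1r addrC subrK.
Qed.

Lemma conj_sign (q : bool) : ((-1) ^+ q)^* = (-1) ^+ q :> K.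
Proof. by rewrite rmorph_sign. Qed.

(** The star map inverts and transposes, and each of the two exchanges rows with columns; hence a
    left field stays a left field, in the other copy and along the transposed unit. *)
Lemma Lop_star t a b f : Lop (t, (a, b)) (star0 f) =
  - ((-1) ^+ ((ip a (+) ip b) && ip a) *: star0 (Lop (~~ t, (b, a)) f)).
Proof.
have sN : cj (-1) = -1 by rewrite rmorphN1.
have s1 : cj 1 = 1 by rewrite rmorph1.
have gE : gpar (~~ t, (b, a)) = ip a (+) ip b by rewrite /gpar addbC.
have d1 : sderiv cj (ip a (+) ip b) 1 star0
    (fun f => - ((-1) ^+ ((ip a (+) ip b) && ip a) *: star0 (Lop (~~ t, (b, a)) f))).
  by have := smorph_deriv sN s1 (Lop_deriv K2 (~~ t, (b, a))) star_smorph; rewrite gE => h; apply/sderivN/sderivZ.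
have d2 : sderiv cj (ip a (+) ip b) 1 star0 (Lop (t, (a, b)) \o star0) :=
  sderiv_morph star_smorph (Lop_deriv K2 (t, (a, b))).
refine (sderiv_ext_hat star_smorph d2 d1 _ f) => {f d1 d2} s i j /=.
rewrite star_xh (sdZ (Lop_deriv K2 _)) Lop_vh (Lop_xh K2).
rewrite neg_eq.
case: ifP => [/andP[/eqP -> /eqP ->]|_]; last by rewrite (addm0 (smD star_smorph)) !scaler0 oppr0.
rewrite star_xh scalerN !scalerA -!signr_addb negbK; congr (- (_ ^+ _ *: _)).
by case: (ip a); case: (ip b); case: (ip j).
Qed.

Lemma Rop_star t a b f : Rop (t, (a, b)) (star0 f) =
  - ((-1) ^+ ((ip a (+) ip b) && ip a) *: star0 (Rop (~~ t, (b, a)) f)).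
Proof.
have sN : cj (-1) = -1 by rewrite rmorphN1.
have s1 : cj 1 = 1 by rewrite rmorph1.
have gE : gpar (~~ t, (b, a)) = ip a (+) ip b by rewrite /gpar addbC.
have d1 : sderiv cj (ip a (+) ip b) 1 star0
    (fun f => - ((-1) ^+ ((ip a (+) ip b) && ip a) *: star0 (Rop (~~ t, (b, a)) f))).
  by have := smorph_deriv sN s1 (Rop_deriv K2 (~~ t, (b, a))) star_smorph; rewrite gE => h; apply/sderivN/sderivZ.
have d2 : sderiv cj (ip a (+) ip b) 1 star0 (Rop (t, (a, b)) \o star0) :=
  sderiv_morph star_smorph (Rop_deriv K2 (t, (a, b))).
refine (sderiv_ext_hat star_smorph d2 d1 _ f) => {f d1 d2} s i j /=.
rewrite star_xh (sdZ (Rop_deriv K2 _)) Rop_vh (Rop_xh K2).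
rewrite neg_eq.
case: ifP => [/andP[/eqP -> /eqP ->]|_]; last by rewrite (addm0 (smD star_smorph)) !scaler0 oppr0.
rewrite (smZ star_smorph) conj_sign star_xh scalerN !scalerA -!signr_addb negbK; congr (- (_ ^+ _ *: _)).
by case: (ip a); case: (ip b); case: (ip i).
Qed.

Lemma star_sd t : star0 (sd K m n t) * sd K m n (~~ t) = 1.
Proof.
have := @deriv_const K _ p Lop (@Lop_deriv K K2 m n bool) (@coefL0 K m n _)
  (star0 (sd K m n t) * sd K m n (~~ t)).
rewrite scoefM_0 (smorph_coef0 star_smorph) /= !coef_sd0 rmorph1 mulr1 scale1r; apply=> -[u [a b]].
rewrite (sdM (Lop_deriv K2 _)) Lop_star !sd_L (smZ star_smorph).
rewrite -(sm_tw star_smorph) tw_sd -scaleNr -!sps_scalerAl -sps_scalerAr scalerA -scalerDl.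
rewrite /stw /= [b == a]eq_sym; rewrite neg_eq.
case: (u == ~~ t); last by rewrite rmorph0 mulr0 addr0 scale0r.
case: eqP => [->|_]; last by rewrite rmorph0 mulr0 addr0 scale0r.
by rewrite addbb /= mulN1r conj_sign addNr scale0r.
Qed.

Lemma star_ideal f : f \in sl -> star0 f \in sl.
Proof.
move: f; apply: (smorph_ideal star_smorph) => t.
rewrite (addmB (smD star_smorph)) (sm1 star_smorph) -(star_sd t) -[X in X - _]mulr1 -mulrBr.
by apply: sl_mull; rewrite -opprB rpredN sd_in.
Qed.

End Star.

(** * Quadratic brackets and the Jacobi identity *)

Arguments shomog_xh {K m n T} t i j.

(* W s t a b is the coefficient of the product of the derivatives along e_ab in
   the copy s and along e_ba in the copy t. *)
Definition weight (K : numFieldType) (m n : nat) (T : finType) :=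
  T -> T -> 'I_(m + n) -> 'I_(m + n) -> K.

Definition ab_par (m n : nat) (a b : 'I_(m + n)) := ipar a (+) ipar b.

(** The twist of [f] carries the sign (-1)^(|f||a|) of the bracket, so that [f] may be
    inhomogeneous. *)
Definition brO (K : numFieldType) (m n : nat) (T : finType)
    (O : gens m n T -> fps K m n T -> fps K m n T) (W : weight K m n T)
    (f g : fps K m n T) : fps K m n T := \sum_s \sum_t \sum_a \sum_b
  W s t a b *: (O (s, (a, b)) (tw (ab_par a b) f) * O (t, (b, a)) g).

HB.lock Definition brW (K : numFieldType) (m n : nat) (T : finType) (W : weight K m n T)
  (f g : fps K m n T) : fps K m n T := brO Rop W f g - brO Lop W f g.

Section Brackets.
Variables (K : numFieldType) (m n : nat) (T : finType).
Local Notation K2 := (@num_tors K).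
Local Notation ip := (@ipar m n).
Local Notation A := (fps K m n T).
Local Notation p := (@gpar m n T).
Local Notation I := 'I_(m + n).
Implicit Types (s t : T) (a b i j k l : I) (f g h u : A) (q r : bool).

Implicit Types W : weight K m n T.

Section OneFamily.
Variable O : gens m n T -> A -> A.
Hypothesis hO : forall x, sderiv id (p x) 1 id (O x).

Local Notation brO := (brO O).

Let hO1 s a b : sderiv id (ab_par a b) 1 id (O (s, (a, b))).
Proof. exact: hO (s, (a, b)). Qed.
Let hO2 s a b : sderiv id (ab_par a b) 1 id (O (s, (b, a))).
Proof. by have := hO (s, (b, a)); rewrite /gpar /= addbC. Qed.

Lemma brO_linl W c f g h : brO W (c *: f + g) h = c *: brO W f h + brO W g h.
Proof.
rewrite /brO; do 4 (rewrite scaler_sumr -big_split; apply: eq_bigr => ? _).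
by rewrite twD twZ (sdD (hO1 _ _ _)) (sdZ (hO1 _ _ _)) mulrDl -sps_scalerAl scalerDr !scalerA mulrC.
Qed.

Lemma brO_linr W c f g h : brO W h (c *: f + g) = c *: brO W h f + brO W h g.
Proof.
rewrite /brO; do 4 (rewrite scaler_sumr -big_split; apply: eq_bigr => ? _).
by rewrite (sdD (hO _)) (sdZ (hO _)) mulrDr -sps_scalerAr scalerDr !scalerA mulrC.
Qed.

Lemma term_deriv q f s t a b : shomog q f ->
  sderiv id q 1 id (fun g => O (s, (a, b)) (tw (ab_par a b) f) * O (t, (b, a)) g).
Proof.
move=> hf; set v := O _ _.
have hv : shomog (q (+) ab_par a b) v.
  exact: (sd_homog K2 erefl erefl (hO1 s a b) (shomog_tw (ab_par a b) hf)).
have := sderivMl hv (@sorder_0 _ _ _ v) (leq0n 1) (hO2 t a b).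
by rewrite -addbA addbb addbF subn0.
Qed.

Lemma brO_deriv W q f : shomog q f -> sderiv id q 1 id (brO W f).
Proof.
move=> hf; rewrite /brO; do 4 (apply: sderiv_sum => ? _); apply: sderivZ; exact: term_deriv.
Qed.

Lemma brO_orderl W (k : nat) f g : sorder k.+1 f -> sorder k (brO W f g).
Proof.
move=> hf; rewrite /brO; do 4 (apply: sorder_sum => ? _); apply/sorderZ/sorderMl.
by apply: (sd_order (hO _)); rewrite addn1; apply: sorder_tw.
Qed.

Lemma brO_orderr W (k : nat) f g : sorder k.+1 g -> sorder k (brO W f g).
Proof.
move=> hf; rewrite /brO; do 4 (apply: sorder_sum => ? _); apply/sorderZ/sorderMr.
by apply: (sd_order (hO _)); rewrite addn1.
Qed.

Lemma brO_tw W q f g : brO W (tw q f) (tw q g) = tw q (brO W f g).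
Proof.
rewrite /brO tw_sum; apply: eq_bigr => s _; rewrite tw_sum; apply: eq_bigr => t _.
rewrite tw_sum; apply: eq_bigr => a _; rewrite tw_sum; apply: eq_bigr => b _.
rewrite twZ twM tw_tw addbC -tw_tw (sd_tw (hO1 s a b)) (sd_tw (hO2 t a b)).
by rewrite -sps_scalerAl -sps_scalerAr !scalerA -signr_addb addbb mulr1.
Qed.

Lemma brO_sym W (e : bool) q r f g :
  (forall s t a b, W t s b a = (-1) ^+ (e (+) ab_par a b) * W s t a b) ->
  shomog q f -> shomog r g -> brO W f g = (-1) ^+ (e (+) (q && r)) *: brO W g f.
Proof.
move=> hW hf hg; rewrite /brO [in RHS]exchange_big /= scaler_sumr; apply: eq_bigr => s _.
rewrite scaler_sumr; apply: eq_bigr => t _; rewrite [in RHS]exchange_big /= scaler_sumr.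
apply: eq_bigr => a _; rewrite scaler_sumr; apply: eq_bigr => b _; rewrite hW.
have ef : shomog (q (+) ab_par a b) (O (s, (a, b)) f) := sd_homog K2 erefl erefl (hO1 s a b) hf.
have eg : shomog (r (+) ab_par a b) (O (t, (b, a)) g) := sd_homog K2 erefl erefl (hO2 t a b) hg.
rewrite (tw_homog _ hf) (tw_homog _ hg) (sdZ (hO1 s a b)) (sdZ (hO2 t a b)).
rewrite (supercomm _ eg) twZ (tw_homog _ ef) -!sps_scalerAl -!sps_scalerAr !scalerA.
congr (_ *: _); rewrite -!mulrA !(mulrCA _ (W t s b a)) -!signr_addb; congr (_ * _ ^+ _).
rewrite [ab_par b a]addbC -/(ab_par a b).
by case: q r e {hf hg hW ef eg} => -[] []; case: (ab_par a b).
Qed.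

Lemma brO_mull W u f g : brO W (u * f) g = u * brO W f g +
  \sum_s \sum_t \sum_a \sum_b W s t a b *:
    (O (s, (a, b)) (tw (ab_par a b) u) * tw (ab_par a b) f * O (t, (b, a)) g).
Proof.
rewrite /brO mulr_sumr -big_split; apply: eq_bigr => s _ /=.
rewrite mulr_sumr -big_split; apply: eq_bigr => t _ /=.
rewrite mulr_sumr -big_split; apply: eq_bigr => a _ /=.
rewrite mulr_sumr -big_split; apply: eq_bigr => b _ /=.
rewrite twM (sdM (hO1 s a b)) tw_tw addbb twF mulrDl scalerDr addrC -!mulrA; congr (_ + _).
exact: sps_scalerAr.
Qed.

End OneFamily.

Lemma brWE W f g : brW W f g = brO Rop W f g - brO Lop W f g.
Proof. by rewrite brW.unlock. Qed.

Let hR (x : gens m n T) : sderiv id (p x) 1 id (Rop x) := Rop_deriv K2 x.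
Let hL (x : gens m n T) : sderiv id (p x) 1 id (Lop x) := Lop_deriv K2 x.

Lemma brW_linl W c f g h : brW W (c *: f + g) h = c *: brW W f h + brW W g h.
Proof. by rewrite !brWE !brO_linl // opprD scalerBr addrACA. Qed.
Lemma brW_linr W c f g h : brW W h (c *: f + g) = c *: brW W h f + brW W h g.
Proof. by rewrite !brWE !brO_linr // opprD scalerBr addrACA. Qed.
Lemma brW_Dl W f g h : brW W (f + g) h = brW W f h + brW W g h.
Proof. by have := brW_linl W 1 f g h; rewrite !scale1r. Qed.
Lemma brW_Dr W f g h : brW W h (f + g) = brW W h f + brW W h g.
Proof. by have := brW_linr W 1 f g h; rewrite !scale1r. Qed.
Lemma brW_0l W h : brW W 0 h = 0.
Proof. by apply: (addm0 (D := brW W ^~ h)) => f g; apply: brW_Dl. Qed.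
Lemma brW_0r W h : brW W h 0 = 0.
Proof. by apply: (addm0 (D := brW W h)) => f g; apply: brW_Dr. Qed.
Lemma brW_Zl W c f h : brW W (c *: f) h = c *: brW W f h.
Proof. by have := brW_linl W c f 0 h; rewrite brW_0l !addr0. Qed.
Lemma brW_Zr W c f h : brW W h (c *: f) = c *: brW W h f.
Proof. by have := brW_linr W c f 0 h; rewrite brW_0r !addr0. Qed.
Lemma brW_Nl W f h : brW W (- f) h = - brW W f h.
Proof. by rewrite -!scaleN1r brW_Zl. Qed.
Lemma brW_Nr W f h : brW W h (- f) = - brW W h f.
Proof. by rewrite -!scaleN1r brW_Zr. Qed.

Lemma brW_deriv W q f : shomog q f -> sderiv id q 1 id (brW W f).
Proof. by move=> hf; rewrite brW.unlock; apply: sderivB; apply: brO_deriv. Qed.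

Lemma brW_orderl W (k : nat) f g : sorder k.+1 f -> sorder k (brW W f g).
Proof. by move=> hf; rewrite brWE; apply: sorderB; apply: brO_orderl. Qed.
Lemma brW_orderr W (k : nat) f g : sorder k.+1 g -> sorder k (brW W f g).
Proof. by move=> hf; rewrite brWE; apply: sorderB; apply: brO_orderr. Qed.

Lemma brW_tw W q f g : brW W (tw q f) (tw q g) = tw q (brW W f g).
Proof. by rewrite !brWE !brO_tw // twB. Qed.

Lemma brW_homog W q r f g : shomog q f -> shomog r g -> shomog (q (+) r) (brW W f g).
Proof.
by move=> hf hg; rewrite addbC; apply: (sd_homog K2 erefl erefl (brW_deriv W hf) hg).
Qed.

(** With e true the bracket is super-antisymmetric, with e false supersymmetric; the second case
    serves for the Casimir elements. *)
Definition wsym W e := forall s t a b, W t s b a = (-1) ^+ (e (+) ab_par a b) * W s t a b.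

Lemma brW_sym W e q r f g : wsym W e ->
  shomog q f -> shomog r g -> brW W f g = (-1) ^+ (e (+) (q && r)) *: brW W g f.
Proof. by move=> hW hf hg; rewrite !brWE !(brO_sym _ hW hf hg) // scalerBr. Qed.

Lemma brW_eq0 W e : wsym W e ->
  (forall s t i j k l, brW W (xh K s i j) (xh K t k l) = 0) -> forall f g, brW W f g = 0.
Proof.
move=> hW h0; have z q : sderiv id q 1 id (fun=> 0 : A) by apply: sderiv0.
have h1 s i j g : brW W (xh K s i j) g = 0.
  exact: (sderiv_ext_hat (smorph_id K p) (brW_deriv W (shomog_xh s i j)) (z _)
    (fun t k l => h0 s t i j k l) g).
have h2 q f : shomog q f -> forall g, brW W f g = 0.
  move=> hf g; refine (sderiv_ext_hat (smorph_id K p) (brW_deriv W hf) (z _) _ g) => s i j.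
  by rewrite (brW_sym hW hf (shomog_xh s i j)) h1 scaler0.
move=> f g; rewrite [f]spart_split brW_Dl !(h2 _ _ (shomog_spart _ f)) addr0 //.
Qed.

Lemma brW_add W W' f g :
  brW (fun s t a b => W s t a b + W' s t a b) f g = brW W f g + brW W' f g.
Proof.
rewrite !brWE addrACA -opprD; congr (_ - _); rewrite /brO -big_split /=;
  by apply: eq_bigr => s _; rewrite -big_split; apply: eq_bigr => t _; rewrite -big_split;
     apply: eq_bigr => a _; rewrite -big_split; apply: eq_bigr => b _; rewrite /= scalerDl.
Qed.

Lemma brW_scale W c f g : brW (fun s t a b => c * W s t a b) f g = c *: brW W f g.
Proof.
rewrite !brWE scalerBr; congr (_ - _); rewrite /brO scaler_sumr;
  by apply: eq_bigr => s _; rewrite scaler_sumr; apply: eq_bigr => t _; rewrite scaler_sumr;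
     apply: eq_bigr => a _; rewrite scaler_sumr; apply: eq_bigr => b _; rewrite /= scalerA.
Qed.

Lemma eq_brW W W' f g : (forall s t a b, W s t a b = W' s t a b) -> brW W f g = brW W' f g.
Proof.
move=> h; rewrite !brWE; congr (_ - _); rewrite /brO; apply: eq_bigr => s _;
  by apply: eq_bigr => t _; apply: eq_bigr => a _; apply: eq_bigr => b _; rewrite h.
Qed.

Lemma sum_delta (J : finType) (y : J) (F : J -> A) :
  \sum_x (if y == x then F x else 0) = F y.
Proof. by rewrite -big_mkcond (big_pred1 y) // => x; rewrite eq_sym. Qed.

(** The Sklyanin form: the weight exchanges the two column indices in the first term, the two row
    indices in the second. *)
Lemma brW_xh W s t i j k l : brW W (xh K s i j) (xh K t k l) =
  ((-1) ^+ (ab_par l j && ab_par k l) * W s t l j) *: (xh K s i l * xh K t k j)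
  - ((-1) ^+ (ab_par i k && ab_par i j) * W s t i k) *: (xh K s k j * xh K t i l).
Proof.
(* Each fourfold sum has a single nonzero term, fixed by the copies and by the indices that are
   exchanged. *)
have e4 (F : T -> T -> I -> I -> A) s0 t0 a0 b0 :
    \sum_s' \sum_t' \sum_a \sum_b (if s0 == s' then if t0 == t' then
      if a0 == a then if b0 == b then F s' t' a b else 0 else 0 else 0 else 0) = F s0 t0 a0 b0.
  rewrite -[RHS](sum_delta s0 (fun s' => F s' t0 a0 b0)); apply: eq_bigr => s' _.
  case: ifP => _; last by do 3 (rewrite big1 // => ? _).
  rewrite -[RHS](sum_delta t0 (fun t' => F s' t' a0 b0)); apply: eq_bigr => t' _.
  case: ifP => _; last by do 2 (rewrite big1 // => ? _).
  rewrite -[RHS](sum_delta a0 (fun a => F s' t' a b0)); apply: eq_bigr => a _.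
  case: ifP => _; last by rewrite big1.
  by rewrite sum_delta.
rewrite !brWE; congr (_ - _).
  rewrite -[RHS](e4 (fun s t l j => ((-1) ^+ (ab_par l j && ab_par k l) * W s t l j)
    *: (xh K s i l * xh K t k j))).
  apply: eq_bigr => s' _; apply: eq_bigr => t' _; apply: eq_bigr => a _; apply: eq_bigr => b _.
  rewrite tw_xh (sdZ (hR _)) !(Rop_xh K2).
  case: (eqVneq s s') => _ /=; last by rewrite scaler0 mul0r scaler0.
  case: (eqVneq t t') => _ /=; last by rewrite mulr0 scaler0.
  case: (eqVneq l a) => [->|_] /=; last by rewrite mulr0 scaler0.
  case: (eqVneq j b) => [->|_]; last by rewrite scaler0 mul0r scaler0.
  rewrite -sps_scalerAr -!sps_scalerAl !scalerA; congr (_ *: _).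
  rewrite -?mulrA -!signr_addb mulrC; congr (_ ^+ _ * _); rewrite /ab_par.
  by case: (ip a); case: (ip b); case: (ip i); case: (ip k).
rewrite -[RHS](e4 (fun s t i0 k0 => ((-1) ^+ (ab_par i0 k0 && ab_par i0 j) * W s t i0 k0)
    *: (xh K s k0 j * xh K t i0 l))).
apply: eq_bigr => s' _; apply: eq_bigr => t' _; apply: eq_bigr => a _; apply: eq_bigr => b _.
rewrite tw_xh (sdZ (hL _)) !(Lop_xh K2).
case: (eqVneq s s') => _ /=; last by rewrite scaler0 mul0r scaler0.
case: (eqVneq t t') => _ /=; last by rewrite mulr0 scaler0.
case: (eqVneq i a) => [->|_] /=; last by rewrite scaler0 mul0r scaler0.
case: (eqVneq k b) => _; last by rewrite mulr0 scaler0.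
rewrite -!sps_scalerAl !scalerA; congr (_ *: _); rewrite mulrC; congr (_ * _).
Qed.

End Brackets.

(** * Reduction of the Jacobi identity to matrix entries *)

Section Jacobi.
Variables (K : numFieldType) (m n : nat) (T : finType).
Local Notation K2 := (@num_tors K).
Local Notation ip := (@ipar m n).
Local Notation A := (fps K m n T).
Local Notation p := (@gpar m n T).
Local Notation I := 'I_(m + n).
Implicit Types (s t : T) (a b c d i j k l : I) (f g h u : A) (q r : bool).

Section Reduction.
Variable W : weight K m n T.
Hypothesis hW : wsym W true.
Local Notation br := (brW W).

Lemma br_anti q r f g : shomog q f -> shomog r g -> br f g = - ((-1) ^+ (q && r) *: br g f).
Proof.
by move=> hf hg; rewrite (brW_sym hW hf hg) signr_addb expr1 mulN1r scaleNr.
Qed.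

(* The Jacobi identity in derivation form, f and g having parities q and r. *)
Definition jac q f r g h := br f (br g h) - (-1) ^+ (q && r) *: br g (br f h) - br (br f g) h.

Lemma jac_ext q f r g : shomog q f -> shomog r g ->
  (forall t i j, jac q f r g (xh K t i j) = 0) -> forall h, jac q f r g h = 0.
Proof.
move=> hf hg h0; have d1 := sderiv_comm (brW_deriv W hf) (brW_deriv W hg).
have d2 := sderiv_widen (leqnSn 1) (brW_deriv W (brW_homog W hf hg)).
have z : sderiv id (q (+) r) 2 id (fun=> 0 : A) by apply: sderiv0.
exact: (sderiv_ext_hat (smorph_id K p) (sderivB d1 d2) z h0).
Qed.

(** [jac] is a superderivation only in its last argument. The two swaps bring every argument there
    in turn, so all three can be reduced to entries. *)
Lemma jac_swap12 q f r g h : shomog q f -> shomog r g ->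
  jac q f r g h = 0 -> jac r g q f h = 0.
Proof.
move=> hf hg e.
have e2 : br (br g f) h = - ((-1) ^+ (q && r) *: br (br f g) h).
  by rewrite (br_anti hg hf) brW_Nl brW_Zl andbC.
have -> : jac r g q f h = - ((-1) ^+ (q && r) *: jac q f r g h).
  rewrite /jac e2 [r && q]andbC !scalerBr !scalerA -signr_addb addbb scale1r.
  by rewrite !opprB opprK addrC.
by rewrite e scaler0 oppr0.
Qed.

Lemma jac_swap23 q f r g e h : shomog q f -> shomog r g -> shomog e h ->
  jac q f r g h = 0 -> jac q f e h g = 0.
Proof.
move=> hf hg hh E; have hfg := brW_homog W hf hg; have hfh := brW_homog W hf hh.
have e1 : br f (br h g) = - ((-1) ^+ (e && r) *: br f (br g h)).
  by rewrite (br_anti hh hg) brW_Nr brW_Zr.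
have e2 : br h (br f g) = - ((-1) ^+ (e && (q (+) r)) *: br (br f g) h) := br_anti hh hfg.
have e3 : br (br f h) g = - ((-1) ^+ ((q (+) e) && r) *: br g (br f h)) := br_anti hfh hg.
have -> : jac q f e h g = - ((-1) ^+ (e && r) *: jac q f r g h).
  rewrite /jac e1 e2 e3 !scalerBr !scalerN !scalerA -!signr_addb !opprB !opprK.
  rewrite -!addrA [in RHS]addrC -!addrA [RHS]addrC -!addrA; congr (_ + (_ ^+ _ *: _ + _ ^+ _ *: _)).
    by case: (q); case: (e); case: (r).
  by case: (q); case: (e); case: (r).
by rewrite E scaler0 oppr0.
Qed.

Hypothesis h0 : forall s t v i j k l a b,
  jac (ip i (+) ip j) (xh K s i j) (ip k (+) ip l) (xh K t k l) (xh K v a b) = 0.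

Lemma jacobi q f r g h : shomog q f -> shomog r g -> jac q f r g h = 0.
Proof.
have s1 s i j t k l h1 : jac (ip i (+) ip j) (xh K s i j) (ip k (+) ip l) (xh K t k l) h1 = 0.
  by apply: jac_ext; [exact: shomog_xh|exact: shomog_xh|move=> v a b; apply: h0].
have s2 s i j r1 g1 h1 : shomog r1 g1 -> jac (ip i (+) ip j) (xh K s i j) r1 g1 h1 = 0.
  move=> hg1; apply: jac_ext => // [|t k l]; first exact: shomog_xh.
  by apply: (jac_swap23 (shomog_xh s i j) (shomog_xh t k l) hg1); apply: s1.
move=> hf hg; apply: jac_ext => // t k l.
apply: (jac_swap23 hf (shomog_xh t k l) hg).
by apply: (jac_swap12 (shomog_xh t k l) hf); apply: s2.
Qed.

Lemma jac_cyclic q f r g e h : shomog q f -> shomog r g -> shomog e h ->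
  (-1) ^+ (q && e) *: br f (br g h) + (-1) ^+ (e && r) *: br h (br f g)
    + (-1) ^+ (r && q) *: br g (br h f) = (-1) ^+ (q && e) *: jac q f r g h.
Proof.
move=> hf hg hh; have hfg := brW_homog W hf hg.
rewrite (br_anti hh hfg) (br_anti hh hf) brW_Nr brW_Zr /jac !scalerBr !scalerN !scalerA -!signr_addb.
rewrite -!addrA; congr (_ + _); rewrite addrC; congr (- (_ *: _) + - (_ *: _)).
  by congr (_ ^+ _); case: (q); case: (e); case: (r).
by congr (_ ^+ _); case: (q); case: (e); case: (r).
Qed.

End Reduction.

Lemma xh_comm s t a b c d : xh K s a b * xh K t c d =
  (-1) ^+ ((ip a (+) ip b) && (ip c (+) ip d)) *: (xh K t c d * xh K s a b).
Proof.
by rewrite (supercomm _ (shomog_xh t c d)) tw_xh -sps_scalerAr andbC.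
Qed.

Section Generators.
Variable om : T -> T -> I -> I -> K.
Hypothesis om_anti : forall s t a b, om t s b a = - om s t a b.
Let w : weight K m n T := fun s t a b => (-1) ^+ ip a * om s t a b.

Lemma w_sym : wsym w true.
Proof.
move=> s t a b; rewrite /w om_anti /ab_par mulrA -signr_addb mulrN -mulNr; congr (_ * _).
by case: (ip a); case: (ip b); rewrite /= ?expr0 ?expr1 ?opprK.
Qed.

Variables (s1 s2 s3 : T) (mu : mexp (gens m n T)).

(** Taking one coefficient of the triple products makes them scalars of the commutative field, so
    that identities between double brackets are within reach of [ring]. *)
Definition m3 t1 t2 t3 (i1 j1 i2 j2 i3 j3 : I) :=
  coef (xh K t1 i1 j1 * (xh K t2 i2 j2 * xh K t3 i3 j3)) mu.

Lemma m3_rot t1 t2 t3 (i1 j1 i2 j2 i3 j3 : I) : m3 t2 t3 t1 i2 j2 i3 j3 i1 j1 =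
  (-1) ^+ ((ip i1 (+) ip j1) && (ip i2 (+) ip j2 (+) (ip i3 (+) ip j3)))
    * m3 t1 t2 t3 i1 j1 i2 j2 i3 j3.
Proof.
rewrite /m3 -scoefZ; congr (coef _ mu).
rewrite mulrA [in RHS](supercomm _ (shomogM (shomog_xh t2 i2 j2) (shomog_xh t3 i3 j3))).
by rewrite tw_xh -sps_scalerAr scalerA -signr_addb andbC addbb scale1r.
Qed.

Definition cR s t l j k := (-1) ^+ (ab_par l j && ab_par k l) * w s t l j.
Definition cL s t i k j := (-1) ^+ (ab_par i k && ab_par i j) * w s t i k.

Lemma br_prod_coef t1 t2 t3 i j c d (e f : I) :
  coef (brW w (xh K t1 i j) (xh K t2 c d * xh K t3 e f)) mu =
  cR t1 t2 d j c * m3 t1 t2 t3 i d c j e f - cL t1 t2 i c j * m3 t1 t2 t3 c j i d e f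
  + (-1) ^+ ((ip i (+) ip j) && (ip c (+) ip d)) *
    (cR t1 t3 f j e * (-1) ^+ ((ip c (+) ip d) && (ip i (+) ip f)) * m3 t1 t2 t3 i f c d e j
     - cL t1 t3 i e j * (-1) ^+ ((ip c (+) ip d) && (ip e (+) ip j)) * m3 t1 t2 t3 e j c d i f).
Proof.
have h := brW_deriv w (shomog_xh t1 i j).
rewrite (sdM h) tw_xh !(brW_xh w t1) -/(cR t1 t2 d j c) -/(cL t1 t2 i c j).
rewrite -/(cR t1 t3 f j e) -/(cL t1 t3 i e j) /m3.
move: (cR _ _ _ _ _) (cL _ _ _ _ _) (cR _ _ _ _ _) (cL _ _ _ _ _) => u1 u2 u3 u4.
rewrite mulrBl mulrBr -!sps_scalerAl -!sps_scalerAr -!mulrA.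
have sw (a b u v : I) (z : A) : xh K t2 a b * (xh K t1 u v * z) =
    (-1) ^+ ((ip a (+) ip b) && (ip u (+) ip v)) *: (xh K t1 u v * (xh K t2 a b * z)).
  by rewrite !mulrA (xh_comm t2 t1) -sps_scalerAl.
rewrite !sw !(scoefD, scoefN, scoefZ). ring.
Qed.

Lemma br_br_coef t1 t2 t3 i j k l a b :
  coef (brW w (xh K t1 i j) (brW w (xh K t2 k l) (xh K t3 a b))) mu =
  cR t2 t3 b l a * coef (brW w (xh K t1 i j) (xh K t2 k b * xh K t3 a l)) mu
  - cL t2 t3 k a l * coef (brW w (xh K t1 i j) (xh K t2 a l * xh K t3 k b)) mu.
Proof.
have h := brW_deriv w (shomog_xh t1 i j).
by rewrite (brW_xh w t2) (addmB (sdD h)) !(sdZ h) scoefD scoefN !scoefZ.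
Qed.

Let o12 := om s1 s2.
Let o23 := om s2 s3.
Let o31 := om s3 s1.

(* In the six double brackets the terms that mix right and left derivatives
   cancel pairwise; the others are the four cyclic sums below. *)
Lemma jac_coef i j k l a b :
  (-1) ^+ ((ip i (+) ip j) && (ip a (+) ip b)) *
    coef (brW w (xh K s1 i j) (brW w (xh K s2 k l) (xh K s3 a b))) mu +
  (-1) ^+ ((ip a (+) ip b) && (ip k (+) ip l)) *
    coef (brW w (xh K s3 a b) (brW w (xh K s1 i j) (xh K s2 k l))) mu +
  (-1) ^+ ((ip k (+) ip l) && (ip i (+) ip j)) *
    coef (brW w (xh K s2 k l) (brW w (xh K s3 a b) (xh K s1 i j))) mu =
  (-1) ^+ ((ip l && ip b) (+) (ip a && ip b) (+) (ip a && ip l) (+) (ip a && ip j)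
      (+) (ip k && ip b) (+) (ip k && ip j) (+) (ip i && ip b) (+) (ip i && ip a)) *
    (o12 l j * o31 l b + o12 b j * o23 b l + o23 j l * o31 j b)
    * m3 s1 s2 s3 i b k j a l +
  (-1) ^+ (true (+) (ip j && ip l) (+) (ip a && ip b) (+) (ip k && ip l) (+) (ip k && ip j)
      (+) (ip i && ip b) (+) (ip i && ip a)) *
    (o12 l j * o23 b j + o12 l b * o31 j b + o23 b l * o31 j l)
    * m3 s1 s2 s3 i l k b a j +
  (-1) ^+ ((ip j && ip b) (+) (ip a && ip l) (+) (ip k && ip l) (+) (ip k && ip a)
      (+) (ip i && ip b) (+) (ip i && ip j)) *
    (o12 i k * o31 a k + o12 i a * o23 k a + o23 k i * o31 a i)
    * m3 s1 s2 s3 a j i l k b +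
  (-1) ^+ (true (+) (ip j && ip b) (+) (ip a && ip l) (+) (ip a && ip j) (+) (ip k && ip j)
      (+) (ip i && ip b) (+) (ip i && ip l) (+) (ip i && ip j) (+) (ip i && ip k)) *
    (o12 i k * o23 i a + o12 a k * o31 a i + o23 k a * o31 k i)
    * m3 s1 s2 s3 k j a l i b.
Proof.
rewrite !br_br_coef !br_prod_coef !(m3_rot s2 s3 s1) !(m3_rot s1 s2 s3).
rewrite /cR /cL /w /ab_par !(om_anti s1 s2) !(om_anti s2 s3) !(om_anti s3 s1).
rewrite -/o12 -/o23 -/o31.
move: (m3 s1 s2 s3) o12 o23 o31 => M p12 p23 p31.
case: (ip i); case: (ip j); case: (ip k); case: (ip l); case: (ip a); case: (ip b);
  rewrite /= ?expr0 ?expr1; ring.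
Qed.

End Generators.

Definition index_sign (a b : I) : K := (a < b)%N%:R - (b < a)%N%:R.

Lemma isg_anti a b : index_sign b a = - index_sign a b. Proof. by rewrite opprB. Qed.

End Jacobi.

(** * The standard weight and its Yang-Baxter identities *)

Section Standard.
Variables (K : numFieldType) (m n : nat).
Local Notation K2 := (@num_tors K).
Local Notation ip := (@ipar m n).
Local Notation A := (fps K m n bool).
Local Notation p := (@gpar m n bool).
Local Notation I := 'I_(m + n).
Local Notation isg := (@index_sign K m n).
Implicit Types (s t : bool) (a b c d i j k l : I) (f g h u : A) (q r : bool).
Variable ka : K.

(** The scalar stays free because only the star map constrains it, to be imaginary; its value in the
    bracket of the theorem is i. *)
Definition om0 s t a b : K := ka * (isg a b + s%:R - t%:R).
Definition w0 : weight K m n bool := fun s t a b => (-1) ^+ ip a * om0 s t a b.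

Lemma om0_anti s t a b : om0 t s b a = - om0 s t a b.
Proof. by rewrite /om0 isg_anti; ring. Qed.

Lemma w0_sym : wsym w0 true.
Proof. exact: (w_sym om0_anti). Qed.

(** A modified Yang-Baxter equation: the right side is a defect, not zero. Its index part cancels
    within the two column terms, or within the two row terms, of the Jacobi sum; its copy part
    cancels only between columns and rows. *)
Lemma om0_cyc1 s1 s2 s3 (x y z : I) :
  om0 s1 s2 x y * om0 s3 s1 x z + om0 s1 s2 z y * om0 s2 s3 z x + om0 s2 s3 y x * om0 s3 s1 y z
  = ka ^+ 2 * (((s1 == s2) && (s2 == s3))%:R - ((x == y) && (y == z))%:R).
Proof.
rewrite /om0 /index_sign -!(inj_eq val_inj) /=.
case: (ltngtP x y) => h1; case: (ltngtP y z) => h2; case: (ltngtP x z) => h3; try lia;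
case: s1; case: s2; case: s3; rewrite /=; ring.
Qed.

Lemma om0_cyc2 s1 s2 s3 (x y z : I) :
  om0 s1 s2 x y * om0 s2 s3 z y + om0 s1 s2 x z * om0 s3 s1 y z + om0 s2 s3 z x * om0 s3 s1 y x
  = ka ^+ 2 * (((s1 == s2) && (s2 == s3))%:R - ((x == y) && (y == z))%:R).
Proof.
rewrite /om0 /index_sign -!(inj_eq val_inj) /=.
case: (ltngtP x y) => h1; case: (ltngtP y z) => h2; case: (ltngtP x z) => h3; try lia;
case: s1; case: s2; case: s3; rewrite /=; ring.
Qed.

Lemma jac_xh s1 s2 s3 i j k l a b :
  jac w0 (ip i (+) ip j) (xh K s1 i j) (ip k (+) ip l) (xh K s2 k l) (xh K s3 a b) = 0.
Proof.
have sg2 (e : bool) : (-1) ^+ e * (-1) ^+ e = 1 :> K by rewrite -signr_addb addbb.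
rewrite -[LHS]scale1r -(sg2 ((ip i (+) ip j) && (ip a (+) ip b))) -scalerA.
rewrite -(jac_cyclic w0_sym (shomog_xh s1 i j) (shomog_xh s2 k l) (shomog_xh s3 a b)).
apply/spsP=> mu; rewrite scoefZ !scoefD !scoefZ (jac_coef om0_anti) scoef0.
rewrite om0_cyc1 om0_cyc2.
have -> : om0 s1 s2 i k * om0 s3 s1 a k + om0 s1 s2 i a * om0 s2 s3 k a
    + om0 s2 s3 k i * om0 s3 s1 a i
    = ka ^+ 2 * (((s1 == s2) && (s2 == s3))%:R - ((i == a) && (a == k))%:R).
  by rewrite -om0_cyc2; ring.
have -> : om0 s1 s2 i k * om0 s2 s3 i a + om0 s1 s2 a k * om0 s3 s1 a i
    + om0 s2 s3 k a * om0 s3 s1 k i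
    = ka ^+ 2 * (((s1 == s2) && (s2 == s3))%:R - ((a == k) && (k == i))%:R).
  by rewrite -om0_cyc1; ring.
have eR : (a == k) && (k == i) = (i == a) && (a == k).
  by case: (eqVneq a k) => [->|_]; rewrite ?andbF // andbT eq_sym.
rewrite eR {eR}; set n0 := (-1) ^+ _.
set n1 := (-1) ^+ _; set n2 := (-1) ^+ _; set n3 := (-1) ^+ _; set n4 := (-1) ^+ _.
set x1 := m3 _ _ _ _ _ _ _ _ _ _ _; set x2 := m3 _ _ _ _ _ _ _ _ _ _ _.
set x3 := m3 _ _ _ _ _ _ _ _ _ _ _; set x4 := m3 _ _ _ _ _ _ _ _ _ _ _.
(* On the support of the column defect, the two column products coincide and carry opposite signs;
   [hR] is the same for rows. *)
have hC : (l == j) && (j == b) -> n1 * x1 + n2 * x2 = 0.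
  move=> /andP[/eqP e1 /eqP e2]; rewrite /n1 /n2 /x1 /x2 e1 e2 -mulrDl.
  by case: (ip b); case: (ip i); case: (ip k); case: (ip a); rewrite /= ?expr0 ?expr1 ?subrr ?addNr mul0r.
have hR : (i == a) && (a == k) -> n3 * x3 + n4 * x4 = 0.
  move=> /andP[/eqP e1 /eqP e2]; rewrite /n3 /n4 /x3 /x4 e1 e2 -mulrDl.
  by case: (ip k); case: (ip j); case: (ip l); case: (ip b); rewrite /= ?expr0 ?expr1 ?subrr ?addNr mul0r.
(* Within one copy, a cyclic rotation of the factors turns the row products into the column
   products. *)
have hE : (s1 == s2) && (s2 == s3) -> n1 * x1 + n2 * x2 + (n3 * x3 + n4 * x4) = 0.
  move=> /andP[/eqP e1 /eqP e2]; rewrite /n1 /n2 /n3 /n4 /x1 /x2 /x3 /x4 {x1 x2 x3 x4 hC hR} e1 e2.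
  rewrite [m3 _ _ _ _ _ i l _ _ _ _](m3_rot _ mu s3 s3 s3 a j) [m3 _ _ _ _ _ k j _ _ _ _](m3_rot _ mu s3 s3 s3 i b).
  move: (m3 _ _ _ _ _ _ _ _ _ _ _) (m3 _ _ _ _ _ _ _ _ _ _ _) => y1 y2.
  by case: (ip i); case: (ip j); case: (ip k); case: (ip l); case: (ip a); case: (ip b);
    rewrite /= ?expr0 ?expr1; ring.
move: (_ && _) (_ && _) (_ && _) hE hC hR => e1 e2 e3.
move=> hE hC hR.
transitivity (n0 * ka ^+ 2 * (e3%:R * (n1 * x1 + n2 * x2 + (n3 * x3 + n4 * x4))
   - e2%:R * (n1 * x1 + n2 * x2) - e1%:R * (n3 * x3 + n4 * x4))); first by ring.
have z (e : bool) (x : K) : (e -> x = 0) -> e%:R * x = 0.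
  by case: e => [/(_ isT)->|_]; rewrite ?mulr0 ?mul0r.
by rewrite (z _ _ hE) (z _ _ hC) (z _ _ hR) !subr0 mulr0.
Qed.

Lemma w0_jacobi q f r g e h : shomog q f -> shomog r g -> shomog e h ->
  (-1) ^+ (q && e) *: brW w0 f (brW w0 g h) + (-1) ^+ (e && r) *: brW w0 h (brW w0 f g)
    + (-1) ^+ (r && q) *: brW w0 g (brW w0 h f) = 0.
Proof.
move=> hf hg hh; rewrite (jac_cyclic w0_sym) //.
by rewrite (jacobi w0_sym (fun s t v i j k l a b => jac_xh s t v i j k l a b)) // scaler0.
Qed.

End Standard.

(** * Casimir elements, the centre and the quotient *)

Section CasimirAndCentre.
Variables (K : numFieldType) (m n : nat) (T : finType).
Local Notation K2 := (@num_tors K).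
Local Notation ip := (@ipar m n).
Local Notation A := (fps K m n T).
Local Notation p := (@gpar m n T).
Local Notation I := 'I_(m + n).
Local Notation sl := (@sl_ideal K m n T).
Implicit Types (s t : T) (a b i j k l : I) (f g h u : A) (q r : bool) (W : weight K m n T).

Definition casimir t0 : weight K m n T :=
  fun s t a b => if (s == t0) && (t == t0) then (-1) ^+ ip a else 0.

(** The Casimir element is invariant, so its left and right terms coincide; on entries this is just
    supercommutativity. *)
Lemma brW_casimir t0 f g : brW (casimir t0) f g = 0.
Proof.
apply: (@brW_eq0 _ _ _ _ _ false) => [s t a b|s t i j k l].
  rewrite /casimir andbC; case: ifP => _; last by rewrite mulr0.
  by rewrite -signr_addb /ab_par; congr (_ ^+ _); case: (ip a); case: (ip b).
rewrite brW_xh /casimir; case: ifP => [/andP[/eqP-> /eqP->]|_]; last by rewrite !mulr0 !scale0r subrr.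
rewrite [X in _ - X](_ : _ = ((-1) ^+ (ab_par i k && ab_par i j) * (-1) ^+ ip i) *:
  ((-1) ^+ ((ip k (+) ip j) && (ip i (+) ip l)) *: (xh K t0 i l * xh K t0 k j))); last first.
  by congr (_ *: _); exact: xh_comm.
rewrite scalerA -scalerBl -!signr_addb /ab_par.
case: (ip i); case: (ip j); case: (ip k); case: (ip l); by rewrite /= ?expr0 ?expr1 subrr scale0r.
Qed.

(* Both sides are the Euler field of the copy t. *)
Lemma euler_LR t g : \sum_a Rop (t, (a, a)) g = \sum_a Lop (t, (a, a)) g.
Proof.
have p0 a : p (t, (a, a)) = false by rewrite /gpar /= addbb.
have d1 : sderiv id false 1 id (fun f : A => \sum_a Rop (t, (a, a)) f).
  by apply: sderiv_sum => a _; have := Rop_deriv K2 (t, (a, a)); rewrite p0.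
have d2 : sderiv id false 1 id (fun f : A => \sum_a Lop (t, (a, a)) f).
  by apply: sderiv_sum => a _; have := Lop_deriv K2 (t, (a, a)); rewrite p0.
refine (sderiv_ext_hat (smorph_id K p) d1 d2 _ g) => {g} s i j.
rewrite (bigD1 j) //= [RHS](bigD1 i) //= !big1 => [|a|a]; last first.
- by rewrite (Rop_xh K2) [j == a]eq_sym => /negbTE->; rewrite andbF.
- by rewrite (Lop_xh K2) [i == a]eq_sym => /negbTE->; rewrite andbF.
rewrite (Rop_xh K2) (Lop_xh K2) !eqxx !andbT !addr0 addbb expr0 scale1r.
by [].
Qed.

(** On sd only the diagonal units act, with eigenvalue (-1)^|a|; this factor of the weight cancels
    that sign and leaves an unsigned sum over a, the Euler field. *)
Definition wcentral (W : weight K m n T) :=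
  exists ka : T -> T -> K, forall s t a, W s t a a = (-1) ^+ ip a * ka s t.

(** Either family contributes a combination of Euler fields applied to [g], and these agree by
    [euler_LR]. *)
Lemma brW_sd W (u : T) g : wcentral W -> brW W (sd K m n u) g = 0.
Proof.
move=> [ka hW].
have e (O : gens m n T -> A -> A) : (forall x, O x (sd K m n u) = stw K x u *: sd K m n u) ->
    brO O W (sd K m n u) g = \sum_t ka u t *: (sd K m n u * \sum_a O (t, (a, a)) g).
  move=> hO; rewrite /brO exchange_big; apply: eq_bigr => t _ /=.
  rewrite (bigD1 u) //= [X in _ + X]big1 ?addr0 => [|s /negbTE ne]; last first.
    by rewrite big1 // => a _; rewrite big1 // => b _; rewrite tw_sd hO /stw /= ne scale0r mul0r scaler0.
  rewrite mulr_sumr scaler_sumr; apply: eq_bigr => a _.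
  rewrite (bigD1 a) //= big1 ?addr0 => [|b ne]; last first.
    by rewrite tw_sd hO /stw /= eqxx eq_sym (negbTE ne) scale0r mul0r scaler0.
  rewrite tw_sd hO /stw /= !eqxx hW -sps_scalerAl !scalerA; congr (_ *: _).
  by rewrite mulrAC -signr_addb addbb mul1r.
rewrite brWE (e _ (fun x => sd_R K x u)) (e _ (fun x => sd_L K x u)).
by apply/eqP; rewrite subr_eq0; apply/eqP/eq_bigr => t _; rewrite euler_LR.
Qed.

Lemma spart_tw (b : bool) f : spart b f = 2^-1 *: (f + (-1) ^+ b *: tw true f).
Proof.
rewrite tw_spart {2}(spart_split f) expr1 scaleN1r.
have two : 2^-1 *: (spart b f + spart b f) = spart b f.
  by rewrite -[spart b f + _]mulr2n -scaler_nat scalerA mulVf ?scale1r // pnatr_eq0.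
case: b two => {1}<-; congr (_ *: _); rewrite ?expr0 ?expr1 ?scale1r ?scaleN1r.
  by rewrite opprB [spart false f + _]addrC addrACA subrr addr0.
by rewrite addrACA subrr addr0.
Qed.

Lemma spart_ideal (b : bool) f : f \in sl -> spart b f \in sl.
Proof. by move=> hf; rewrite spart_tw; apply/slZ/rpredD => //; apply/slZ/tw_ideal. Qed.

Lemma brW_idealr W e f g : wsym W e -> wcentral W -> g \in sl -> brW W f g \in sl.
Proof.
move=> hs hW hg; rewrite (spart_split f) brW_Dl.
have h (b : bool) : brW W (spart b f) g \in sl.
  apply: (sderiv_ideal (brW_deriv W (shomog_spart b f))) hg => t.
  have ht : shomog false (sd K m n t) by apply: tw_shomog; rewrite tw_sd expr0 scale1r.
  by rewrite (brW_sym hs (shomog_spart b f) ht) brW_sd // scaler0 rpred0.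
by apply: rpredD; apply: h.
Qed.

Lemma brW_ideall W e f g : wsym W e -> wcentral W -> f \in sl -> brW W f g \in sl.
Proof.
move=> hs hW hf; rewrite (spart_split f) (spart_split g) brW_Dl !brW_Dr.
have h (b c : bool) : brW W (spart b f) (spart c g) \in sl.
  rewrite (brW_sym hs (shomog_spart b f) (shomog_spart c g)); apply: slZ.
  by apply: (brW_idealr _ hs hW); apply: spart_ideal.
by do 2 (apply: rpredD); apply: h.
Qed.

(** Reduces stability of an ideal under the bracket to its generators. Stability under parity is
    needed because the Leibniz rule twists the factor in Q. *)
Lemma brW_closure W (Q : A -> Prop) : two_sided_ideal Q ->
  (forall q u, Q u -> Q (tw q u)) -> two_sided_ideal (fun f => Q f /\ forall g, Q (brW W f g)).
Proof.
move=> hQ Qt; have [Q0 QB Ql Qr] := hQ.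
have QD u v : Q u -> Q v -> Q (u + v).
  by move=> hu hv; rewrite -[v]opprK -[- v]sub0r; apply/QB/QB.
have QZ c u : Q u -> Q (c *: u) by move=> hu; rewrite -[u]mul1r sps_scalerAl; apply: Ql.
have hl (a u : A) : Q u -> (forall g, Q (brW W u g)) -> forall g, Q (brW W (a * u) g).
  move=> hu hv g; rewrite brWE (brO_mull (fun x => Rop_deriv K2 x)) (brO_mull (fun x => Lop_deriv K2 x)).
  rewrite opprD addrACA -mulrBr -brWE; apply/QD; first exact/Ql/hv.
  by apply: QB; do 4 (apply: big_ind => // ? _); apply/QZ/Qr/Ql/Qt.
have ht (q : bool) u : (forall g, Q (brW W u g)) -> forall g, Q (brW W (tw q u) g).
  by move=> hu g; rewrite -[g](twK q) brW_tw; apply/Qt/hu.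
have hB u v : (forall g, Q (brW W u g)) -> (forall g, Q (brW W v g)) -> forall g, Q (brW W (u - v) g).
  by move=> hu hv g; rewrite brW_Dl brW_Nl; apply: QB.
have hD u v : (forall g, Q (brW W u g)) -> (forall g, Q (brW W v g)) -> forall g, Q (brW W (u + v) g).
  by move=> hu hv g; rewrite brW_Dl; apply: QD.
split=> [|u v [u0 u1] [v0 v1]|a u [u0 u1]|a u [u0 u1]].
- by split=> // g; rewrite brW_0l.
- by split; [exact: QB|exact: hB].
- by split; [exact: Ql|exact: hl].
split; first exact: Qr.
(* Right multiples become left multiples, one parity component at a time. *)
have e (b : bool) : u * spart b a = spart b a * tw b u := supercomm u (shomog_spart b a).
by rewrite (spart_split a) mulrDr !e; apply: hD; apply: hl; [exact: Qt|exact: ht|exact: Qt|exact: ht].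
Qed.

End CasimirAndCentre.

(** * Descent of the bracket and of Poisson ideals to the quotient *)

Section QuotientMaps.
Variables (K : numFieldType) (m n : nat).
Local Notation fps T := (fps K m n T).
Local Notation SL T := (SL K m n T).
Local Notation sl T := (@sl_ideal K m n T).

Lemma cls0 (T : finType) : cls (0 : fps T) = 0. Proof. exact: raddf0. Qed.
Lemma clsN (T : finType) (f : fps T) : cls (- f) = - cls f. Proof. exact: raddfN. Qed.
Lemma clsB (T : finType) (f g : fps T) : cls (f - g) = cls f - cls g. Proof. exact: raddfB. Qed.
Lemma cls_sum (T : finType) I (r : seq I) (P : pred I) (F : I -> fps T) :
  cls (\sum_(i <- r | P i) F i) = \sum_(i <- r | P i) cls (F i).
Proof. exact: raddf_sum. Qed.

Lemma cls_eq0 (T : finType) (f : fps T) : f \in sl T -> cls f = 0.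
Proof. by move=> h; rewrite -(cls0 T); apply/clsP; rewrite subr0. Qed.

Lemma qmap_cls (T T' : finType) (E : fps T -> fps T') : {morph E : f g / f + g} ->
  (forall f, f \in sl T -> E f \in sl T') -> forall f, qmap E (cls f) = cls (E f).
Proof.
by move=> hD hE f; apply/clsP; rewrite -(addmB hD); apply/hE/rep_cls.
Qed.

Variable T : finType.

Lemma part_cls (b : bool) (f : fps T) : part b (cls f) = cls (spart b f).
Proof.
apply: qmap_cls => [g h|g]; last exact: spart_ideal.
by apply/spsP=> mu; rewrite !(scoefD, coef_spart); case: ifP; rewrite ?addr0.
Qed.

Definition brS (W : weight K m n T) (u v : SL T) : SL T := cls (brW W (rep u) (rep v)).

(** Independence of the representatives: changing either one alters the bracket by an element of the
    ideal. *)
Lemma brS_cls W e f g : wsym W e -> wcentral W ->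
  brS W (cls f) (cls g) = cls (brW W f g).
Proof.
move=> hs hc; apply/clsP.
have -> : brW W (rep (cls f)) (rep (cls g)) - brW W f g =
    brW W (rep (cls f)) (rep (cls g) - g) + brW W (rep (cls f) - f) g.
  by rewrite brW_Dr brW_Dl brW_Nr brW_Nl addrA subrK.
by apply: rpredD; [apply: (brW_idealr _ hs hc)|apply: (brW_ideall _ hs hc)]; apply: rep_cls.
Qed.

Section PoissonIdeals.
Variables (W : weight K m n T) (e : bool) (hs : wsym W e) (hc : wcentral W) (B : SL T -> Prop).
Hypothesis hB : forall b, B b -> exists q f,
  [/\ shomog q f, b = cls f & forall g, ideal_gen B (cls (brW W f g))].

Let Q (f : fps T) := ideal_gen B (cls f).

Lemma ideal_gen_cls : two_sided_ideal Q.
Proof.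
have [Q0 QB Ql Qr] := ideal_genP B; split=> [|u v hu hv|a u hu|a u hu]; rewrite /Q.
- by rewrite cls0.
- by rewrite clsB; apply: QB.
- by rewrite clsME; apply: Ql.
- by rewrite clsME; apply: Qr.
Qed.

(** Induction over a generated ideal of the quotient, carried out on power series; containing the
    kernel makes [S] independent of representatives. *)
Lemma ideal_gen_lift (S : fps T -> Prop) : two_sided_ideal S -> (forall f, f \in sl T -> S f) ->
  (forall b, B b -> exists2 f, b = cls f & S f) -> forall f, Q f -> S f.
Proof.
move=> [S0 SB Sl Sr] Ssl SB0 f /(_ (fun u => S (rep u))).
have SD u v : S u -> S v -> S (u + v).
  by move=> hu hv; rewrite -[v]opprK -[- v]sub0r; apply/SB/SB.
have mv u v : cls u = cls v -> S v -> S u.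
  by move=> /clsP/Ssl h hv; rewrite -[u](subrK v); apply: SD.
move=> h; apply: (mv _ (rep (cls f))); first by rewrite repK.
apply: h => [|b /SB0[g -> hg]]; last by apply: mv hg; rewrite repK.
split=> [|u v hu hv|a u hu|a u hu].
- by apply: mv S0; rewrite repK cls0.
- by apply: mv (SB _ _ hu hv); rewrite clsB !repK.
- by apply: mv (Sl (rep a) _ hu); rewrite clsME !repK.
- by apply: mv (Sr (rep a) _ hu); rewrite clsME !repK.
Qed.

Lemma ideal_gen_sl f : f \in sl T -> Q f.
Proof. by move=> hf; rewrite /Q cls_eq0 //; case: (ideal_genP B). Qed.

Lemma ideal_gen_tw q f : Q f -> Q (tw q f).
Proof.
have [Q0 QB Ql Qr] := ideal_gen_cls.
apply: (@ideal_gen_lift (fun f => Q (tw q f))) => {f} [|f hf|b hb].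
- split=> [|u v hu hv|a u hu|a u hu].
  + by rewrite tw0.
  + by rewrite twB; apply: QB.
  + by rewrite twM; apply: Ql.
  + by rewrite twM; apply: Qr.
- by apply: ideal_gen_sl; apply: tw_ideal.
have [r [f [hf eb _]]] := hB hb; exists f => //.
rewrite (tw_homog _ hf) -[f]mul1r sps_scalerAl; apply: Ql.
by rewrite /Q -eb => S hS; apply.
Qed.

Lemma poisson_ideal_gen : poisson_ideal (brS W) (ideal_gen B).
Proof.
move=> u v hu; rewrite -[u]repK in hu *; rewrite -[v]repK (brS_cls _ _ hs hc).
suff [_] : Q (rep u) /\ forall g, Q (brW W (rep u) g) by apply.
move: hu; apply: (@ideal_gen_lift (fun f => Q f /\ forall g, Q (brW W f g))).
- exact: (brW_closure W ideal_gen_cls ideal_gen_tw).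
- move=> f hf; split=> [|g]; apply: ideal_gen_sl => //; exact: (brW_ideall _ hs hc).
move=> b hb; have [q [f [hf eb hg]]] := hB hb; exists f => //; split=> //.
by rewrite /Q -eb => S hS; apply.
Qed.

End PoissonIdeals.
End QuotientMaps.

(** * The Poisson ideals I and J *)

Section BoolIdeals.
Variables (K : numFieldType) (m n : nat).
Local Notation K2 := (@num_tors K).
Local Notation ip := (@ipar m n).
Local Notation A := (fps K m n bool).
Local Notation p := (@gpar m n bool).
Local Notation I := 'I_(m + n).
Local Notation isg := (@index_sign K m n).
Implicit Types (s t : bool) (a b i j k l : I) (f g h u v : A) (q r : bool) (W : weight K m n bool).

Lemma idealZ (Q : A -> Prop) : two_sided_ideal Q -> forall (c : K) u, Q u -> Q (c *: u).
Proof. by move=> [_ _ Ql _] c u hu; rewrite -[u]mul1r sps_scalerAl; apply: Ql. Qed.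

Lemma idealD (Q : A -> Prop) : two_sided_ideal Q -> forall u v, Q u -> Q v -> Q (u + v).
Proof.
by move=> [Q0 QB _ _] u v hu hv; rewrite -[v]opprK -[- v]sub0r; apply/QB/QB.
Qed.

(** The derivative of [g] does not involve the copy s, so the terms of both copies share it as right
    factor and only their weighted sum has to lie in Q. *)
Lemma brO_bool_ideal (O : gens m n bool -> A -> A) (Q : A -> Prop) W q f :
  (forall x, sderiv id (p x) 1 id (O x)) -> two_sided_ideal Q -> shomog q f ->
  (forall t a b, Q (W true t a b *: O (true, (a, b)) f + W false t a b *: O (false, (a, b)) f)) ->
  forall g, Q (brO O W f g).
Proof.
move=> hO hQ hf h g; have [Q0 QB Ql Qr] := hQ.
rewrite /brO exchange_big /=; apply: (big_ind Q) => // [|t _]; first exact: idealD.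
rewrite big_bool -big_split; apply: (big_ind Q) => // [|a _]; first exact: idealD.
rewrite -big_split; apply: (big_ind Q) => // [|b _]; first exact: idealD.
rewrite /= (tw_homog _ hf) !(sdZ (hO _)) -!sps_scalerAl !scalerA ![_ * (-1) ^+ _]mulrC -!scalerA.
by rewrite -scalerDr !sps_scalerAl -mulrDl; apply: (idealZ hQ); apply: Qr; apply: h.
Qed.

Lemma brW_bool_ideal (Q : A -> Prop) W q f : two_sided_ideal Q -> shomog q f ->
  (forall t a b, Q (W true t a b *: Rop (true, (a, b)) f + W false t a b *: Rop (false, (a, b)) f)) ->
  (forall t a b, Q (W true t a b *: Lop (true, (a, b)) f + W false t a b *: Lop (false, (a, b)) f)) ->
  forall g, Q (brW W f g).
Proof.
move=> hQ hf hr hl g; rewrite brWE; case: (hQ) => _ QB _ _; apply: QB.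
  by apply: (brO_bool_ideal (fun x => Rop_deriv K2 x) hQ hf).
by apply: (brO_bool_ideal (fun x => Lop_deriv K2 x) hQ hf).
Qed.

Variable ka : K.
Local Notation w0 := (@w0 K m n ka).

Lemma w0_central : wcentral w0.
Proof.
exists (fun s t => ka * (s%:R - t%:R)) => s t a.
by rewrite /w0 /om0 /index_sign subrr add0r.
Qed.

(* w0 up to Casimir elements, which have zero bracket; for c = 1 the weight no
   longer depends on s, and for c = -1 it no longer depends on t. *)
Definition w1 (c : K) : weight K m n bool := fun s t a b =>
  (-1) ^+ ip a * (ka * (isg a b + s%:R - t%:R + c * (s == t)%:R * (-1) ^+ s)).

Lemma brW_w1 c f g : brW (w1 c) f g = brW w0 f g.
Proof.
have e : forall s t a b, w1 c s t a b = (w0 s t a b + ka * c * casimir K false s t a b)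
    + (- (ka * c)) * casimir K true s t a b.
  by move=> s t a b; rewrite /w1 /w0 /om0 /casimir; case: s; case: t; rewrite /= ?expr0 ?expr1; ring.
by rewrite (eq_brW _ _ e) !brW_add !brW_scale !brW_casimir !scaler0 !addr0.
Qed.

Lemma cls_sgen t i j : cls (sgen K p (t, (i, j))) = cls (xh K t i j) - cls (i == j)%:R.
Proof. by rewrite sgen_xh clsB. Qed.

Lemma poisson_idealI : poisson_ideal (brS w0) (@idealI K m n).
Proof.
apply: (poisson_ideal_gen (w0_sym ka) w0_central) => _ [i [j ->]].
have e k l : ygen K k l - zgen K k l = cls (xh K false k l - xh K true k l).
  by rewrite /ygen /zgen !cls_sgen clsB opprB addrA subrK.
have hQ := ideal_gen_cls (K := K) (fun u : SL K m n bool => exists i j, u = ygen K i j - zgen K i j).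
have [Q0 QB Ql Qr] := hQ.
have hx k l : ideal_gen (fun u : SL K m n bool => exists i j, u = ygen K i j - zgen K i j)
   (cls (xh K false k l - xh K true k l)) by rewrite -e => S hS; apply; exists k, l.
exists (ip i (+) ip j), (xh K false i j - xh K true i j); split; [|exact: e|].
  by apply: shomogD; [|apply: shomogN]; apply: shomog_xh.
move=> g; rewrite -(brW_w1 1).
apply: (brW_bool_ideal (Q := fun f => ideal_gen _ (cls f)) (W := w1 1) hQ) => [|t a b|t a b].
- by apply: shomogD; [|apply: shomogN]; apply: shomog_xh.
- have -> : w1 1 true t a b = w1 1 false t a b.
    by rewrite /w1; case: t; rewrite /= ?expr0 ?expr1; ring.
  rewrite -scalerDr !(addmB (sdD (Rop_deriv K2 _))) !(Rop_xh K2) /=.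
  apply: (idealZ hQ); rewrite subr0 sub0r; case: eqP => _; last by rewrite oppr0 addr0.
  by rewrite addrC -scalerBr; apply: (idealZ hQ).
- have -> : w1 1 true t a b = w1 1 false t a b.
    by rewrite /w1; case: t; rewrite /= ?expr0 ?expr1; ring.
  rewrite -scalerDr !(addmB (sdD (Lop_deriv K2 _))) !(Lop_xh K2) /=.
  apply: (idealZ hQ); rewrite subr0 sub0r; case: eqP => _; last by rewrite oppr0 addr0.
  by rewrite addrC.
Qed.

Lemma w1N s t a b : w1 (-1) s t a b = (-1) ^+ ip a * (ka * (isg a b + s%:R *+ 2 - 1)).
Proof. by rewrite /w1; case: s; case: t; rewrite /= ?expr0 ?expr1; congr (_ * (_ * _)); ring. Qed.

(** With c = -1 the nonzero weights select upper units in the z copy, lower units in the y copy and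
    differences of diagonal units: the shape of b, whose translations preserve J. *)
Lemma w1N_ideal (Q : A -> Prop) t a b u v : two_sided_ideal Q ->
  ((a < b)%N -> Q u) -> ((b < a)%N -> Q v) -> (a = b -> Q (u - v)) ->
  Q (w1 (-1) true t a b *: u + w1 (-1) false t a b *: v).
Proof.
move=> hQ hu hv huv; rewrite !w1N /index_sign.
case: (ltngtP a b) => [lt|lt|/val_inj e]; rewrite /= ?mulr1n ?mulr0n.
- rewrite [X in _ + X](_ : _ = 0) ?addr0; first by apply: (idealZ hQ); apply: hu.
  by rewrite subr0 mul0rn addr0 subrr !mulr0 scale0r.
- rewrite [X in X + _](_ : _ = 0) ?add0r; first by apply: (idealZ hQ); apply: hv.
  rewrite (_ : _ * _ = 0) ?scale0r //; ring.
have -> : (-1) ^+ ip a * (ka * (0 - 0 + 1 *+ 2 - 1)) = (-1) ^+ ip a * ka :> K by ring.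
have -> : (-1) ^+ ip a * (ka * (0 - 0 + 0 *+ 2 - 1)) = - ((-1) ^+ ip a * ka) :> K by ring.
by rewrite scaleNr -scalerBr; apply: (idealZ hQ); apply: huv.
Qed.

Section BorelIdeal.
Let B (u : SL K m n bool) :=
    [\/ exists i j : 'I_(m + n), (j < i)%N /\ u = ygen K j i,
        exists i j : 'I_(m + n), (j < i)%N /\ u = zgen K i j
      | exists i, u = antipode (ygen K i i) - zgen K i i].
Let Q (f : A) := ideal_gen B (cls f).
Let hQ : two_sided_ideal Q := ideal_gen_cls B.

Lemma borel_y a b : (a < b)%N -> Q (xh K false a b).
Proof.
move=> lt S hS; apply; apply: Or31; exists b, a; split => //.
by rewrite /ygen cls_sgen -(inj_eq val_inj) /= (ltn_eqF lt) cls0 subr0.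
Qed.

Lemma borel_z a b : (b < a)%N -> Q (xh K true a b).
Proof.
move=> lt S hS; apply; apply: Or32; exists a, b; split => //.
by rewrite /zgen cls_sgen -(inj_eq val_inj) /= (gtn_eqF lt) cls0 subr0.
Qed.

Lemma borel_gen_diag i : antipode (ygen K i i) - zgen K i i = cls (vh K false i i - xh K true i i).
Proof.
have hS := S0_smorph K m n bool.
rewrite /antipode (qmap_cls (smD hS)); last by move=> f; apply: S0_ideal.
rewrite /zgen cls_sgen sgen_xh (addmB (smD hS)) S0_xh (smorph_nat _ hS) !clsB eqxx.
by rewrite opprB addrA subrK.
Qed.

Lemma borel_diag i : Q (vh K false i i - xh K true i i).
Proof.
by move=> S hS; apply; apply: Or33; exists i; rewrite borel_gen_diag.
Qed.

(** The inverse of a matrix that is lower triangular modulo J is so too: row a of (1 + Y) V = 1 is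
    solved by induction on a, the diagonal entry being invertible. *)
Lemma borel_v a b : (a < b)%N -> Q (vh K false a b).
Proof.
have [Q0 QB Ql Qr] := hQ; case: a; elim/ltn_ind => a0 IH ha; set a := Ordinal ha => lt.
have [_ h1] : xh K false a a * sinv (xh K false a a) = 1 /\ sinv (xh K false a a) * xh K false a a = 1.
  by apply: mul_sinv; rewrite coef_xh0 eqxx.
rewrite -[vh _ _ _ _]mul1r -h1 -mulrA; apply: (Ql).
have := xh_vh K false a b; rewrite (bigD1 a) //= -(inj_eq val_inj) (ltn_eqF lt).
move/(canRL (addrK _)) => ->; apply: (QB); first exact: Q0.
apply: (big_ind Q) => // [|k ne]; first exact: (idealD hQ).
case: (ltngtP k a) => [lk|lk|/val_inj ek]; last by rewrite ek eqxx in ne.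
  by case: k lk {ne} => k hk lk; apply: (Ql); apply: IH => //; apply: ltn_trans lt.
by apply: (Qr); apply: borel_y.
Qed.

Lemma poisson_idealJ : poisson_ideal (brS w0) (@idealJ K m n).
Proof.
have [Q0 QB Ql Qr] := hQ.
apply: (poisson_ideal_gen (w0_sym ka) w0_central) => u0 [[i [j [lt ->]]]|[i [j [lt ->]]]|[i ->]].
- exists (ip j (+) ip i), (xh K false j i); split; first exact: shomog_xh.
    by rewrite /ygen cls_sgen -(inj_eq val_inj) /= (ltn_eqF lt) cls0 subr0.
  move=> g; rewrite -(brW_w1 (-1)).
  apply: (brW_bool_ideal (Q := Q) hQ (shomog_xh false j i)) => t a b; apply: (w1N_ideal _ hQ) => h;
    rewrite ?(Rop_xh K2) ?(Lop_xh K2) /=.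
  + exact: Q0.
  + case: eqP => [e|_] //; apply: (idealZ hQ); apply: borel_y.
    by rewrite e in lt; apply: ltn_trans h.
  + rewrite h sub0r -[X in Q X]mulN1r; apply: (Ql); case: eqP => // e.
    by apply: (idealZ hQ); rewrite -e; apply: borel_y.
  + exact: Q0.
  + case: eqP => [e|_] //; apply: borel_y; rewrite e in lt; exact: ltn_trans lt.
  + rewrite h sub0r -[X in Q X]mulN1r; apply: (Ql); case: eqP => // e.
    by rewrite -e; apply: borel_y.
- exists (ip i (+) ip j), (xh K true i j); split; first exact: shomog_xh.
    by rewrite /zgen cls_sgen -(inj_eq val_inj) /= (gtn_eqF lt) cls0 subr0.
  move=> g; rewrite -(brW_w1 (-1)).
  apply: (brW_bool_ideal (Q := Q) hQ (shomog_xh true i j)) => t a b; apply: (w1N_ideal _ hQ) => h;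
    rewrite ?(Rop_xh K2) ?(Lop_xh K2) /=.
  + case: eqP => [e|_] //; apply: (idealZ hQ); apply: borel_z.
    by rewrite e in lt; apply: ltn_trans lt.
  + exact: Q0.
  + rewrite h subr0; case: eqP => // e.
    by apply: (idealZ hQ); rewrite -e; apply: borel_z.
  + case: eqP => [e|_] //; apply: borel_z; rewrite e in lt; exact: ltn_trans h.
  + exact: Q0.
  + rewrite h subr0; case: eqP => // e.
    by rewrite -e; apply: borel_z.
have hf : shomog false (vh K false i i - xh K true i i : A).
  apply: shomogD; last apply: shomogN.
    by have := @shomog_vh K m n bool false i i; rewrite addbb.
  by have := @shomog_xh K m n bool true i i; rewrite addbb.
exists false, (vh K false i i - xh K true i i); split; [exact: hf|exact: borel_gen_diag|].
move=> g; rewrite -(brW_w1 (-1)).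
apply: (brW_bool_ideal (Q := Q) hQ hf) => t a b; apply: (w1N_ideal _ hQ) => h;
  rewrite ?(addmB (sdD (Rop_deriv K2 _))) ?(addmB (sdD (Lop_deriv K2 _)))
    ?(Rop_xh K2) ?(Lop_xh K2) ?Rop_vh ?Lop_vh /=.
+ rewrite sub0r -[X in Q X]mulN1r; apply: (Ql); case: eqP => // e.
  by apply: (idealZ hQ); rewrite e; apply: borel_z.
+ rewrite subr0; case: eqP => // e; rewrite -[X in Q X]mulN1r; apply: (Ql).
  by rewrite e; apply: borel_v.
+ rewrite h subr0 sub0r; case: eqP => [e|_]; last by rewrite subr0 oppr0.
  by rewrite !addbb /= expr0 scale1r e opprK addrC; apply: borel_diag.
+ rewrite sub0r -[X in Q X]mulN1r; apply: (Ql); case: eqP => // e.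
  by rewrite e; apply: borel_z.
+ rewrite subr0; case: eqP => // e; rewrite -[X in Q X]mulN1r; apply: (Ql).
  by apply: (idealZ hQ); rewrite e; apply: borel_v.
rewrite h subr0 sub0r; case: eqP => [e|_]; last by rewrite subr0 oppr0.
by rewrite !addbb /= expr0 scale1r e opprK addrC; apply: borel_diag.
Qed.

End BorelIdeal.
End BoolIdeals.

(** * Compatibility with the coproduct *)

Section TensorSquare.
Variables (K : numFieldType) (m n : nat) (T : finType).
Local Notation K2 := (@num_tors K).
Local Notation ip := (@ipar m n).
Local Notation A := (fps K m n T).
Local Notation A2 := (fps K m n (T + T)%type).
Local Notation p := (@gpar m n T).
Local Notation I := 'I_(m + n).
Implicit Types (s t : T) (a b i j k l : I) (f g h : A) (F G : A2) (q r : bool).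
Variable W : weight K m n T.

(** The tensor square is handled as the same kind of bracket on doubled copies, with no interaction
    between left and right. *)
Definition wsum : weight K m n (T + T)%type := fun x y a b =>
  match x, y with
  | inl s, inl t => W s t a b
  | inr s, inr t => W s t a b
  | _, _ => 0
  end.

Lemma wsum_sym e : wsym W e -> wsym wsum e.
Proof. by move=> h [] s [] t a b; rewrite /= ?mulr0 //; apply: h. Qed.

Lemma wsum_central : wcentral W -> wcentral wsum.
Proof.
move=> [ka h]; exists (fun x y => match x, y with
  | inl s, inl t => ka s t | inr s, inr t => ka s t | _, _ => 0 end).
by move=> [] s [] t a; rewrite /= ?mulr0 //; apply: h.
Qed.

(** The fields are indexed by the copies T but act on series in copies T', so that the bracket on
    the tensor square splits according to the factor differentiated. *)
Definition pairing (T' : finType) (O : gens m n T -> fps K m n T' -> fps K m n T')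
    (F G : fps K m n T') := \sum_s \sum_t \sum_a \sum_b
  W s t a b *: (O (s, (a, b)) (tw (ab_par a b) F) * O (t, (b, a)) G).

Lemma brO_wsum (O : gens m n (T + T)%type -> A2 -> A2) F G :
  brO O wsum F G = pairing (fun x => O (lgen x)) F G + pairing (fun x => O (rgen x)) F G.
Proof.
rewrite /brO big_sumType /=; congr (_ + _); apply: eq_bigr => s _; rewrite big_sumType /=.
  rewrite [X in _ + X]big1 ?addr0 // => t _.
  by rewrite big1 // => a _; rewrite big1 // => b _; rewrite scale0r.
rewrite [X in X + _]big1 ?add0r // => t _.
by rewrite big1 // => a _; rewrite big1 // => b _; rewrite scale0r.
Qed.

Lemma eq_pairing (T' : finType) (O O' : gens m n T -> fps K m n T' -> fps K m n T')
    (F G F' G' : fps K m n T') :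
  (forall s t a b, O (s, (a, b)) (tw (ab_par a b) F) * O (t, (b, a)) G
    = O' (s, (a, b)) (tw (ab_par a b) F') * O' (t, (b, a)) G') -> pairing O F G = pairing O' F' G'.
Proof.
by move=> h; do 4 (apply: eq_bigr => ? _); rewrite h.
Qed.

Lemma pairing_morph (T' T'' : finType) (E : fps K m n T' -> fps K m n T'')
    (O : gens m n T -> fps K m n T' -> fps K m n T')
    (O' : gens m n T -> fps K m n T'' -> fps K m n T'')
    (F G : fps K m n T') (F' G' : fps K m n T'') :
  {morph E : u v / u + v} -> (forall c u, E (c *: u) = c *: E u) ->
  (forall s t a b, E (O (s, (a, b)) (tw (ab_par a b) F) * O (t, (b, a)) G)
    = O' (s, (a, b)) (tw (ab_par a b) F') * O' (t, (b, a)) G') ->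
  E (pairing O F G) = pairing O' F' G'.
Proof.
move=> hD hZ h; do 4 (rewrite (addm_sum hD); apply: eq_bigr => ? _).
by rewrite hZ h.
Qed.

Lemma cop_brW f g : cop (brW W f g) = brW wsum (cop f) (cop g).
Proof.
have hc := cop_smorph K2 m n T.
rewrite !brWE !brO_wsum (addmB (smD hc)).
have -> : cop (brO Rop W f g) = pairing (fun x => Rop (rgen x)) (cop f) (cop g).
  apply: (pairing_morph (smD hc) (smZ hc)) => s t a b.
  by rewrite (smM hc) !(cop_Rop K2) (sm_tw hc).
have -> : cop (brO Lop W f g) = pairing (fun x => Lop (lgen x)) (cop f) (cop g).
  apply: (pairing_morph (smD hc) (smZ hc)) => s t a b.
  by rewrite (smM hc) !(cop_Lop K2) (sm_tw hc).
have -> : pairing (fun x => Rop (lgen x)) (cop f) (cop g)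
    = pairing (fun x => Lop (rgen x)) (cop f) (cop g).
  by apply: eq_pairing => s t a b; rewrite -!(sm_tw hc) !(Rop_Lop_cop K2).
by rewrite opprD addrACA [RHS]addrC addrA subrK.
Qed.

Section TensorOne.
Variables (O : gens m n T -> A -> A) (O2 : gens m n (T + T)%type -> A2 -> A2).
Variables (El Er : A -> A2).
Hypotheses (hl : smorph id El) (hr : smorph id Er).
Hypothesis hO : forall x, sderiv id (gpar x) 1 id (O x).
Hypothesis hO2 : forall x, sderiv id (gpar x) 1 id (O2 x).
Hypothesis ll : forall x u, O2 (lgen x) (El u) = El (O x u).
Hypothesis rr : forall x u, O2 (rgen x) (Er u) = Er (O x u).
Hypothesis rl : forall x u, O2 (rgen x) (El u) = 0.
Hypothesis lr : forall x u, O2 (lgen x) (Er u) = 0.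

(** Stated for one abstract family that preserves each factor and annihilates the other, so as to
    apply to left and right fields alike. *)
Lemma tens_brO (q r : bool) f1 f2 g1 g2 : shomog q f2 -> shomog r g1 ->
  brO O2 wsum (El f1 * Er f2) (El g1 * Er g2) =
    (-1) ^+ (r && q) *: (El (brO O W f1 g1) * Er (f2 * g2))
    + (-1) ^+ (r && q) *: (El (f1 * g1) * Er (brO O W f2 g2)).
Proof.
move=> hf hg; rewrite brO_wsum; congr (_ + _); symmetry.
  apply: (pairing_morph (E := fun u => (-1) ^+ (r && q) *: (El u * Er (f2 * g2)))
      (F := f1) (G := g1) (O := O)) => [u v|c u|s t a b].
  + by rewrite (smD hl) mulrDl scalerDr.
  + by rewrite (smZ hl) -sps_scalerAl !scalerA mulrC.
  rewrite twM (sdM (hO2 _)) -!(sm_tw hl) -!(sm_tw hr) !ll !lr mulr0 addr0.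
  rewrite (sdM (hO2 _)) ll lr mulr0 addr0.
  have h1 : shomog (r (+) ab_par a b) (O (t, (b, a)) g1).
    by have := sd_homog K2 erefl erefl (hO (t, (b, a))) hg; rewrite /gpar /= [ipar b (+) _]addbC.
  have h2 : shomog (r (+) ab_par a b) (El (O (t, (b, a)) g1)) := sm_homog K2 erefl erefl hl h1.
  rewrite -!mulrA [Er _ * (_ * _)]mulrA (supercomm _ h2) -(sm_tw hr) tw_tw.
  rewrite (tw_homog _ hf) (smZ hr) -!sps_scalerAr -!sps_scalerAl -!sps_scalerAr.
  rewrite (smM hl) (smM hr) !mulrA; congr (_ ^+ _ *: _).
  by case: (r); case: (q); case: (ab_par a b).
apply: (pairing_morph (E := fun u => (-1) ^+ (r && q) *: (El (f1 * g1) * Er u))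
    (F := f2) (G := g2) (O := O)) => [u v|c u|s t a b].
+ by rewrite (smD hr) mulrDr scalerDr.
+ by rewrite (smZ hr) -sps_scalerAr !scalerA mulrC.
rewrite twM !(sdM (hO2 _)) -!(sm_tw hl) -!(sm_tw hr) !rr !rl !mul0r !add0r.
have pab : gpar (rgen (s, (a, b)) : gens m n (T + T)%type) = ab_par a b by [].
have pba : gpar (rgen (t, (b, a)) : gens m n (T + T)%type) = ab_par a b.
  by rewrite /gpar /= addbC.
rewrite pab pba tw_tw addbb twF.
rewrite (tw_homog _ hg) (smZ hl).
have h1 : shomog r (El g1) := sm_homog K2 erefl erefl hl hg.
have h2 : shomog (q (+) ab_par a b) (Er (O (s, (a, b)) (tw (ab_par a b) f2))).
  apply: (sm_homog K2 erefl erefl hr).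
  exact: (sd_homog K2 erefl erefl (hO (s, (a, b))) (shomog_tw (ab_par a b) hf)).
rewrite -!sps_scalerAl -!sps_scalerAr -!mulrA [Er _ * (_ * _)]mulrA (supercomm _ h1).
rewrite (tw_homog _ h2) -!sps_scalerAr -!sps_scalerAl -!sps_scalerAr scalerA -signr_addb.
rewrite (smM hl) (smM hr) !mulrA; congr (_ ^+ _ *: _).
by case: (r); case: (q); case: (ab_par a b).
Qed.

End TensorOne.

Lemma tens_brW (q r : bool) f1 f2 g1 g2 : shomog q f2 -> shomog r g1 ->
  brW wsum (tl f1 * tr f2) (tl g1 * tr g2) =
    (-1) ^+ (r && q) *: (tl (brW W f1 g1) * tr (f2 * g2))
    + (-1) ^+ (r && q) *: (tl (f1 * g1) * tr (brW W f2 g2)).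
Proof.
move=> hf hg; have hl := tl_smorph K2 m n T; have hr := tr_smorph K2 m n T.
have e (O : gens m n T -> A -> A) (O2 : gens m n (T + T)%type -> A2 -> A2) hO hO2 ll rr rl lr :=
  @tens_brO O O2 _ _ hl hr hO hO2 ll rr rl lr q r f1 f2 g1 g2 hf hg.
rewrite brWE.
rewrite (e Rop Rop (fun x => Rop_deriv K2 x) (fun x => Rop_deriv K2 x) (tl_Rop K2 (T := T))
  (tr_Rop K2 (T := T)) (tl_Rop0 K2 (T := T)) (tr_Rop0 K2 (T := T))).
rewrite (e Lop Lop (fun x => Lop_deriv K2 x) (fun x => Lop_deriv K2 x) (tl_Lop K2 (T := T))
  (tr_Lop K2 (T := T)) (tl_Lop0 K2 (T := T)) (tr_Lop0 K2 (T := T))).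
rewrite !brWE (addmB (smD hl)) (addmB (smD hr)) mulrBl mulrBr !scalerBr.
by rewrite opprD addrACA.
Qed.

End TensorSquare.

(** * The axioms of a Poisson-Lie superbracket *)

Section PoissonLieSuperbracket.
Variables (K : numFieldType) (m n : nat).
Local Notation K2 := (@num_tors K).
Local Notation SL T := (SL K m n T).
Local Notation fps T := (fps K m n T).
Variable ka : K.
Local Notation w0 := (@w0 K m n ka).
Local Notation br := (brS w0).

Lemma brS_linl (T : finType) (W : weight K m n T) e : wsym W e -> wcentral W ->
  forall c u v w, brS W (c *: u + v) w = c *: brS W u w + brS W v w.
Proof.
move=> hs hc c u v w; rewrite -[u]repK -[v]repK -[w]repK -clsZE -clsD !(brS_cls _ _ hs hc).
by rewrite -clsZE -clsD brW_linl.
Qed.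

Lemma brS_linr (T : finType) (W : weight K m n T) e : wsym W e -> wcentral W ->
  forall c u v w, brS W u (c *: v + w) = c *: brS W u v + brS W u w.
Proof.
move=> hs hc c u v w; rewrite -[u]repK -[v]repK -[w]repK -clsZE -clsD !(brS_cls _ _ hs hc).
by rewrite -clsZE -clsD brW_linr.
Qed.

Lemma coproduct_cls (T : finType) (f : fps T) : coproduct (cls f) = cls (cop f).
Proof. by apply: (qmap_cls (smD (cop_smorph K2 m n T))) => u; apply: cop_ideal. Qed.

Lemma tens_cls (T : finType) (f g : fps T) : tens (cls f) (cls g) = cls (tl f * tr g).
Proof.
rewrite clsME; congr (_ * _).
  by apply: (qmap_cls (smD (tl_smorph K2 m n T))) => u; apply: tl_ideal.
by apply: (qmap_cls (smD (tr_smorph K2 m n T))) => u; apply: tr_ideal.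
Qed.

Lemma brS_tensor (T : finType) (W : weight K m n T) e : wsym W e -> wcentral W ->
  tensor_bracket (brS W) (brS (wsum W)).
Proof.
move=> hs hc; have hs2 := wsum_sym hs; have hc2 := wsum_central hc; split.
- by split; [apply: brS_linl hs2 hc2|apply: brS_linr hs2 hc2].
(* A bracket lowers the order by at most one. *)
- move=> F k; exists k.+1 => _ [g hg ->]; exists (brW (wsum W) (rep F) g); first exact: brW_orderr hg.
  by rewrite -{1}[F]repK (brS_cls _ _ hs2 hc2).
- move=> F k; exists k.+1 => _ [g hg ->]; exists (brW (wsum W) g (rep F)); first exact: brW_orderl hg.
  by rewrite -{1}[F]repK (brS_cls _ _ hs2 hc2).
move=> q r f1 f2 g1 g2 [u2 hu ->] [v1 hv ->]; rewrite -[f1]repK -[g2]repK.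
rewrite !(brS_cls _ _ hs hc) -!clsME !tens_cls (brS_cls _ _ hs2 hc2) (tens_brW W _ _ hu hv).
by rewrite clsD !clsZE !mulnb.
Qed.

Lemma brS_poisson_lie : poisson_lie br.
Proof.
have hs := @w0_sym K m n ka; have hc := @w0_central K m n ka.
split.
- exact: brS_linl hs hc.
- exact: brS_linr hs hc.
- move=> q r _ _ [f hf ->] [g hg ->]; exists (brW w0 f g); first exact: brW_homog.
  exact: brS_cls hs hc.
- move=> q r e _ _ _ [f hf ->] [g hg ->] [h hh ->].
  by rewrite !(brS_cls _ _ hs hc) -!clsZE -!clsD !mulnb w0_jacobi // cls0.
- move=> q r _ _ [f hf ->] [g hg ->].
  by rewrite !(brS_cls _ _ hs hc) -clsZE -clsN mulnb (br_anti hs hf hg).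
- move=> q r e _ _ _ [f hf ->] [g hg ->] [h hh ->].
  rewrite -(clsME g h) !(brS_cls _ _ hs hc) -!clsME -clsZE -clsD mulnb (sdM (brW_deriv w0 hf)).
  by rewrite (tw_homog _ hg) -sps_scalerAl.
exists (brS (wsum w0)); first exact: brS_tensor hs hc.
move=> f g; rewrite -[f]repK -[g]repK (brS_cls _ _ hs hc) !coproduct_cls cop_brW.
by rewrite (brS_cls _ _ (wsum_sym hs) (wsum_central hc)).
Qed.

End PoissonLieSuperbracket.

(** * Compatibility with the star map *)

Section StarBracket.
Variables (K : numClosedFieldType) (m n : nat).
Local Notation K2 := (@num_tors K).
Local Notation ip := (@ipar m n).
Local Notation A := (fps K m n bool).
Implicit Types (f g : A).

Lemma star_pairing (O : gens m n bool -> A -> A) (W : weight K m n bool) f g :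
  (forall t a b f, O (t, (a, b)) (star0 f) =
    - ((-1) ^+ ((ip a (+) ip b) && ip a) *: star0 (O (~~ t, (b, a)) f))) ->
  (forall s t a b, (-1) ^+ ab_par a b * W (~~ s) (~~ t) b a = (W s t a b)^*) ->
  brO O W (star0 f) (star0 g) = star0 (brO O W f g).
Proof.
move=> hO hW; have hs := star_smorph K m n.
rewrite /brO (addm_sum (smD hs)) (reindex_inj negb_inj) /=; apply: eq_bigr => s _.
rewrite (addm_sum (smD hs)) (reindex_inj negb_inj) /=; apply: eq_bigr => t _.
rewrite (addm_sum (smD hs)) exchange_big /=; apply: eq_bigr => a _.
rewrite (addm_sum (smD hs)); apply: eq_bigr => b _.
rewrite (smZ hs) (smM hs) -hW -(sm_tw hs) !hO !negbK mulrN mulNr opprK.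
rewrite -sps_scalerAl -sps_scalerAr !scalerA [ab_par b a]addbC -/(ab_par a b).
congr (_ *: _); rewrite [RHS]mulrC -signr_addb; congr (_ * _ ^+ _).
by rewrite /ab_par; case: (ip a); case: (ip b).
Qed.

Lemma star_brW (W : weight K m n bool) f g :
  (forall s t a b, (-1) ^+ ab_par a b * W (~~ s) (~~ t) b a = (W s t a b)^*) ->
  brW W (star0 f) (star0 g) = star0 (brW W f g).
Proof.
move=> hW; have hs := star_smorph K m n.
by rewrite !brWE (star_pairing f g (@Rop_star K m n) hW) (star_pairing f g (@Lop_star K m n) hW) (addmB (smD hs)).
Qed.

(** Exchanging the copies and transposing the unit reverses both s - t and the index sign; an
    imaginary [ka] restores the sign under conjugation. *)
Lemma w0_conj (ka : K) : ka^* = - ka -> forall s t a b,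
  (-1) ^+ ab_par a b * @w0 K m n ka (~~ s) (~~ t) b a = (w0 ka s t a b)^*.
Proof.
move=> hk s t a b; rewrite /w0 /om0 !rmorphM !rmorphB !rmorphD rmorphN /= hk !conjC_nat.
rewrite conj_sign /index_sign /ab_par mulrA -signr_addb -addbA addbb addbF.
by case: s; case: t; rewrite /=; ring.
Qed.

Lemma star_brS (ka : K) : ka^* = - ka -> forall u v : SL K m n bool,
  brS (w0 ka) (qmap (@star0 K m n) u) (qmap (@star0 K m n) v) = qmap (@star0 K m n) (brS (w0 ka) u v).
Proof.
move=> hk u v; have hs := star_smorph K m n; rewrite -[u]repK -[v]repK.
have q f : qmap (@star0 K m n) (cls f) = cls (star0 f).
  by apply: (qmap_cls (smD hs)) => g; apply: star_ideal.
rewrite (q (rep u)) (q (rep v)) !(brS_cls _ _ (@w0_sym K m n ka) (@w0_central K m n ka)) q.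
by rewrite (star_brW _ _ (w0_conj hk)).
Qed.

End StarBracket.

(** * The bracket in terms of a basis of the double *)

Section TensorFactors.
Variables (K : numFieldType) (m n : nat) (T : finType).
Local Notation K2 := (@num_tors K).
Local Notation A := (fps K m n T).
Local Notation A2 := (fps K m n (T + T)%type).
Local Notation p := (@gpar m n T).
Local Notation p2 := (@gpar m n (T + T)%type).
Implicit Types (f : A) (F : A2) (mu nu : mexp (gens m n T)).
Local Notation sl T := (@sl_ideal K m n T).

Lemma monD mu nu : mon p (mu + nu) = (-1) ^+ msign p mu nu *: (mon p mu * mon p nu) :> A.
Proof. by rewrite monM scalerA -signr_addb addbb scale1r. Qed.

Lemma tl_mon mu : tl (mon p mu : A) = mon p2 (mjoin mu 0).
Proof.
have hl := tl_smorph K2 m n T; elim/mexp_ind: mu => [|g mu IH]; first by rewrite mon0 (sm1 hl) mjoin0 mon0.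
have -> : mjoin (mgen g + mu) 0 = mjoin (mgen g) 0 + mjoin mu 0 :> mexp (gens m n (T + T)%type).
  by rewrite mjoinD addr0.
rewrite monD (smZ hl) (smM hl) IH -sgen_mon /tl (ssubst_sgen K2); last 2 first.
- by move=> x; apply: sorder_sgen.
- by move=> x; apply: (shomog_sgen (inl x.1 : (T + T)%type, x.2)).
rewrite -/(lgen g) sgen_mon mgen_l monM scalerA -signr_addb msign_join msignm0 mpar0 /=.
by rewrite !addbF addbb scale1r.
Qed.

Lemma tr_mon mu : tr (mon p mu : A) = mon p2 (mjoin 0 mu).
Proof.
have hr := tr_smorph K2 m n T; elim/mexp_ind: mu => [|g mu IH]; first by rewrite mon0 (sm1 hr) mjoin0 mon0.
have -> : mjoin 0 (mgen g + mu) = mjoin 0 (mgen g) + mjoin 0 mu :> mexp (gens m n (T + T)%type).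
  by rewrite mjoinD addr0.
rewrite monD (smZ hr) (smM hr) IH -sgen_mon /tr (ssubst_sgen K2); last 2 first.
- by move=> x; apply: sorder_sgen.
- by move=> x; apply: (shomog_sgen (inr x.1 : (T + T)%type, x.2)).
rewrite -/(rgen g) sgen_mon mgen_r monM scalerA -signr_addb msign_join msignm0 mpar0 /= andbF.
by rewrite !addbF addbb scale1r.
Qed.

Lemma ct_ext (c : nat) (E : A -> A2) (D : A2 -> A) (D1 : A -> A) : smorph id E ->
  clin c D -> clin c D1 -> (forall mu, D (E (mon p mu)) = D1 (mon p mu)) -> forall f, D (E f) = D1 f.
Proof.
move=> hE hD hD1 h; apply: (@mon_ext _ _ _ _ _ c id (D \o E) D1) => //.
- by move=> f g /=; rewrite (smD hE) (clD hD).
- exact: (clD hD1).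
- by move=> a f /=; rewrite (smZ hE) (clZ hD).
- exact: (clZ hD1).
- by move=> k f hf; apply: (cl_order hD); apply: (sm_order hE).
- exact: (cl_order hD1).
Qed.

Lemma clin_coef (a : mexp (gens m n T)) : clin (mdeg a) (fun f => coef f a *: (1 : A)).
Proof.
split=> [f g|c f|k f hf]; first by rewrite scoefD scalerDl.
  by rewrite scoefZ scalerA.
by case: k hf => [|k] hf; [exact: sorder_0|rewrite hf ?scale0r ?addSn ?ltnS ?leq_addl].
Qed.

Lemma coef_mon_adm mu (a : mexp (gens m n T)) : admissible p a ->
  coef (mon p mu : A) a = (mu == a)%:R.
Proof.
move=> ha; have [hm|hm] := boolP (admissible p mu); first by rewrite coef_mon // eq_sym.
by rewrite mon_nadm // scoef0; case: eqP hm => // ->; rewrite ha.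
Qed.

Lemma ctl_tl (a : mexp (gens m n T)) f : admissible p a -> ctl a (tl f) = coef f a *: (1 : A).
Proof.
move=> ha; apply: (ct_ext (tl_smorph K2 m n T) (clin_ctl _ a) (clin_coef a)) => mu.
rewrite tl_mon ctl_mon // coef_mon_adm // mon0.
by case: (mu == a); rewrite ?scale1r ?scale0r.
Qed.

Lemma ctr_tr (a : mexp (gens m n T)) f : admissible p a -> ctr a (tr f) = coef f a *: (1 : A).
Proof.
move=> ha; apply: (ct_ext (tr_smorph K2 m n T) (clin_ctr _ a) (clin_coef a)) => mu.
rewrite tr_mon ctr_mon // coef_mon_adm // mon0.
by case: (mu == a); rewrite ?scale1r ?scale0r.
Qed.

Lemma ctl_tr (a : mexp (gens m n T)) f : admissible p a -> ctl a (tr f) = (a == 0)%:R *: f.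
Proof.
move=> ha; have h : clin (mdeg a) (fun f : A => (a == 0)%:R *: f).
  split=> [u v|c u|k u hu]; [by rewrite scalerDr|by rewrite !scalerA mulrC|].
  by apply: sorderZ; apply: sorderW hu; apply: leq_addr.
apply: (ct_ext (tr_smorph K2 m n T) (clin_ctl _ a) h) => mu.
by rewrite tr_mon ctl_mon // eq_sym; case: (a == 0); rewrite ?scale1r ?scale0r.
Qed.

Lemma ctr_tl (a : mexp (gens m n T)) f : admissible p a -> ctr a (tl f) = (a == 0)%:R *: f.
Proof.
move=> ha; have h : clin (mdeg a) (fun f : A => (a == 0)%:R *: f).
  split=> [u v|c u|k u hu]; [by rewrite scalerDr|by rewrite !scalerA mulrC|].
  by apply: sorderZ; apply: sorderW hu; apply: leq_addr.
apply: (ct_ext (tl_smorph K2 m n T) (clin_ctr _ a) h) => mu.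
by rewrite tl_mon ctr_mon // eq_sym; case: (a == 0); rewrite ?scale1r ?scale0r.
Qed.

(** The twists [U] and [V] allow left and right derivations at once, as contraction of the left
    factor is of the first kind and of the right factor of the second. *)
Lemma twisted_ideal (D E : A2 -> A) (U V : A -> A) : smorph id E -> {morph D : F H / F + H} ->
  D 1 = 0 ->
  (forall F H, D (F * H) = D F * U (E H) + V (E F) * D H) ->
  (forall f, f \in sl T -> U f \in sl T) -> (forall f, f \in sl T -> V f \in sl T) ->
  (forall t, E (sd K m n t - 1) \in sl T) -> (forall t, D (sd K m n t) \in sl T) ->
  forall F, F \in sl (T + T)%type -> D F \in sl T.
Proof.
move=> hE hD D1 DM hU hV hE0 hD0 F hF; suff [] : E F \in sl T /\ D F \in sl T by [].
move: F hF; apply: sl_ideal_ind => [|t]; last by rewrite (addmB hD) D1 subr0.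
split=> [|u v [u0 u1] [v0 v1]|a u [u0 u1]|a u [u0 u1]].
- by rewrite (addm0 hD) (addm0 (smD hE)) !rpred0.
- by rewrite (addmB hD) (addmB (smD hE)) !rpredB.
- rewrite DM (smM hE); split; first exact: sl_mull.
  by rewrite rpredD // ?sl_mull ?hU.
- rewrite DM (smM hE); split; first exact: sl_mulr.
  by rewrite rpredD // ?sl_mulr ?hV.
Qed.

End TensorFactors.

(** * The operators nabla on the quotient in terms of matrix units *)

Section Nabla.
Variables (K : numFieldType) (m n : nat).
Local Notation K2 := (@num_tors K).
Local Notation ip := (@ipar m n).
Local Notation A := (fps K m n bool).
Local Notation A2 := (fps K m n (bool + bool)%type).
Local Notation p := (@gpar m n bool).
Local Notation V := (gl2 K m n).
Local Notation I := 'I_(m + n).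
Local Notation sl T := (@sl_ideal K m n T).
Implicit Types (f : A) (h k : V) (t : bool) (i j : I).

Definition hsel h t : 'M[K]_(m + n) := if t then h.2 else h.1.

Definition along (T' : finType) (O : gens m n bool -> fps K m n T' -> A) h (F : fps K m n T') : A :=
  \sum_t \sum_i \sum_j hsel h t i j *: O (t, (i, j)) F.

Lemma hselP a h k t i j : hsel (a *: h + k) t i j = a * hsel h t i j + hsel k t i j.
Proof. by case: t; rewrite /hsel /= !mxE. Qed.

Lemma linear_partE h f : linear_part h f =
  \sum_t \sum_i \sum_j hsel h t i j * coef f (mgen (t, (i, j))).
Proof.
rewrite big_bool /= addrC -big_split; apply: eq_bigr => i _.
by rewrite -big_split.
Qed.

Lemma supertraceE (M : 'M[K]_(m + n)) : supertrace M = \sum_i (-1) ^+ ip i * M i i.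
Proof.
rewrite big_split_ord /supertrace /mxtrace -sumrN; congr (_ + _);
  apply: eq_bigr => i _; rewrite !mxE /ipar /=.
  by rewrite leqNgt ltn_ord mul1r.
by rewrite leq_addr mulN1r.
Qed.

(** The eigenvalue of sdet along h is a supertrace; its vanishing is what lets the contractions with
    h descend. *)
Lemma hsel_stw h u : h \in dd K m n ->
  \sum_t \sum_i \sum_j hsel h t i j * stw K (t, (i, j)) u = 0.
Proof.
move=> /mem_dd hd; transitivity (supertrace (hsel h u)); last by case: u; case: hd.
rewrite supertraceE (bigD1 u) //= [X in _ + X]big1 ?addr0 => [|t /negbTE ne]; last first.
  by rewrite big1 // => i _; rewrite big1 // => j _; rewrite /stw /= ne mulr0.
apply: eq_bigr => i _; rewrite (bigD1 i) //= big1 ?addr0 => [|j]; last first.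
  by rewrite /stw /= eq_sym => /negbTE ->; rewrite andbF mulr0.
by rewrite /stw /= !eqxx mulrC.
Qed.

Lemma hsel_homog b h t i j : gl2_homog b h -> ip i (+) ip j != b -> hsel h t i j = 0.
Proof. by case=> h1 h2 ne; case: t; rewrite /hsel ?h1 ?h2. Qed.

Lemma along_contractl h F : h \in dd K m n ->
  series p (fun nu => delta h (cls (series p (fun mu => coef F (mjoin mu nu)))))
  = along (fun g => ctl (mgen g)) h F.
Proof.
move=> hd; apply/spsP=> nu; have [ad|nad] := boolP (admissible p nu); last by rewrite !scoef_nadm.
rewrite coef_seriesE // delta_cls // linear_partE scoef_sum; apply: eq_bigr => t _.
rewrite scoef_sum; apply: eq_bigr => i _; rewrite scoef_sum; apply: eq_bigr => j _.
by rewrite scoefZ coef_ctl coef_seriesE // admissible_mgen.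
Qed.

Lemma along_contractr h F : h \in dd K m n ->
  series p (fun mu => delta h (cls (series p (fun nu => coef F (mjoin mu nu)))))
  = along (fun g => ctr (mgen g)) h F.
Proof.
move=> hd; apply/spsP=> nu; have [ad|nad] := boolP (admissible p nu); last by rewrite !scoef_nadm.
rewrite coef_seriesE // delta_cls // linear_partE scoef_sum; apply: eq_bigr => t _.
rewrite scoef_sum; apply: eq_bigr => i _; rewrite scoef_sum; apply: eq_bigr => j _.
by rewrite scoefZ coef_ctr coef_seriesE // admissible_mgen.
Qed.

Lemma along_sum (T1 T2 T3 : finType) (O : gens m n bool -> fps K m n T1 -> A)
  (O1 : gens m n bool -> fps K m n T2 -> A) (O2 : gens m n bool -> fps K m n T3 -> A) h F1 F2 F3 :
  (forall t i j, hsel h t i j *: O (t, (i, j)) F1 =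
     hsel h t i j *: O1 (t, (i, j)) F2 + hsel h t i j *: O2 (t, (i, j)) F3) ->
  along O h F1 = along O1 h F2 + along O2 h F3.
Proof.
move=> e; rewrite /along -big_split; apply: eq_bigr => t _; rewrite -big_split.
by apply: eq_bigr => i _; rewrite -big_split; apply: eq_bigr => j _; rewrite /= e.
Qed.

Lemma along_mull (T' : finType) (O : gens m n bool -> fps K m n T' -> A) h (u : A) (F : fps K m n T') :
  along (fun g (F' : fps K m n T') => u * O g F') h F = u * along O h F.
Proof.
rewrite /along mulr_sumr; apply: eq_bigr => t _; rewrite mulr_sumr; apply: eq_bigr => i _.
by rewrite mulr_sumr; apply: eq_bigr => j _; rewrite -sps_scalerAr.
Qed.

Lemma along_mulr (T' : finType) (O : gens m n bool -> fps K m n T' -> A) h (u : A) (F : fps K m n T') :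
  along (fun g (F' : fps K m n T') => O g F' * u) h F = along O h F * u.
Proof.
rewrite /along mulr_suml; apply: eq_bigr => t _; rewrite mulr_suml; apply: eq_bigr => i _.
by rewrite mulr_suml; apply: eq_bigr => j _; rewrite -sps_scalerAl.
Qed.

Lemma alongD (T' : finType) (O : gens m n bool -> fps K m n T' -> A) h :
  (forall g, {morph O g : u v / u + v}) -> {morph along O h : u v / u + v}.
Proof. by move=> hO F G; apply: along_sum => t i j; rewrite hO scalerDr. Qed.

Lemma eq_along (T' T'' : finType) (O : gens m n bool -> fps K m n T' -> A)
  (O' : gens m n bool -> fps K m n T'' -> A) h (F : fps K m n T') (F' : fps K m n T'') :
  (forall t i j, hsel h t i j *: O (t, (i, j)) F = hsel h t i j *: O' (t, (i, j)) F') ->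
  along O h F = along O' h F'.
Proof. by move=> e; do 3 (apply: eq_bigr => ? _); apply: e. Qed.

Lemma along_ctl_ideal b h F : h \in dd K m n -> gl2_homog b h ->
  F \in sl (bool + bool)%type -> along (fun g => ctl (mgen g)) h F \in sl bool.
Proof.
move=> hd hb; move: F; apply: (@twisted_ideal K m n bool _ (ctl 0) id (tw b)) => //.
- exact: ctl0_smorph.
- by apply: alongD => g; apply: ctlD.
- rewrite /along big1 // => t _; rewrite big1 // => i _; rewrite big1 // => j _.
  by rewrite (sd1 (ctl0_smorph K m n bool) (ctl_deriv K (t, (i, j)))) scaler0.
- move=> F H; rewrite -along_mull -along_mulr; apply: along_sum => t i j.
  rewrite (sdM (ctl_deriv K (t, (i, j)))) scalerDr; congr (_ + _).
  (* Entries of the wrong parity vanish as h is homogeneous, so one and the same twist serves all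
     terms. *)
  have [<-|ne] := eqVneq (ip i (+) ip j) b; first by [].
  by rewrite (hsel_homog t hb ne) !scale0r.
- by move=> f; apply: tw_ideal.
- case=> t; rewrite (addmB (@ctlD _ _ _ _ _)) (sm1 (ctl0_smorph K m n bool)).
    by rewrite -tl_sd ctl_tl ?admissible0 // coef_sd0 scale1r subrr rpred0.
  by rewrite -tr_sd ctl_tr ?admissible0 // eqxx scale1r sd_in.
case=> u; [rewrite -tl_sd|rewrite -tr_sd].
  rewrite (_ : along _ _ _ = (\sum_t \sum_i \sum_j hsel h t i j * stw K (t, (i, j)) u) *: (1 : A)).
    by rewrite hsel_stw // scale0r rpred0.
  rewrite scaler_suml; apply: eq_bigr => t _; rewrite scaler_suml; apply: eq_bigr => i _.
  by rewrite scaler_suml; apply: eq_bigr => j _; rewrite ctl_tl ?admissible_mgen // coef_sd1 scalerA.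
rewrite /along big1 ?rpred0 // => t _; rewrite big1 // => i _; rewrite big1 // => j _.
by rewrite ctl_tr ?admissible_mgen // (negbTE (mgen_neq0 _)) scale0r scaler0.
Qed.

Lemma along_ctr_ideal b h F : h \in dd K m n -> gl2_homog b h ->
  F \in sl (bool + bool)%type -> along (fun g => ctr (mgen g)) h F \in sl bool.
Proof.
move=> hd hb; move: F; apply: (@twisted_ideal K m n bool _ (ctr 0) (tw b) id) => //.
- exact: ctr0_smorph.
- by apply: alongD => g; apply: ctrD.
- rewrite /along big1 // => t _; rewrite big1 // => i _; rewrite big1 // => j _.
  by rewrite ctr1 (negbTE (mgen_neq0 _)) scaler0.
- move=> F H; rewrite -along_mull -along_mulr; apply: along_sum => t i j.
  rewrite ctr_deriv scalerDr; congr (_ + _).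
  have [<-|ne] := eqVneq (ip i (+) ip j) b; first by [].
  by rewrite (hsel_homog t hb ne) !scale0r.
- by move=> f; apply: tw_ideal.
- case=> t; rewrite (addmB (@ctrD _ _ _ _ _)) (sm1 (ctr0_smorph K m n bool)).
    by rewrite -tl_sd ctr_tl ?admissible0 // eqxx scale1r sd_in.
  by rewrite -tr_sd ctr_tr ?admissible0 // coef_sd0 scale1r subrr rpred0.
case=> u; [rewrite -tl_sd|rewrite -tr_sd].
  rewrite /along big1 ?rpred0 // => t _; rewrite big1 // => i _; rewrite big1 // => j _.
  by rewrite ctr_tl ?admissible_mgen // (negbTE (mgen_neq0 _)) scale0r scaler0.
rewrite (_ : along _ _ _ = (\sum_t \sum_i \sum_j hsel h t i j * stw K (t, (i, j)) u) *: (1 : A)).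
  by rewrite hsel_stw // scale0r rpred0.
rewrite scaler_suml; apply: eq_bigr => t _; rewrite scaler_suml; apply: eq_bigr => i _.
by rewrite scaler_suml; apply: eq_bigr => j _; rewrite ctr_tr ?admissible_mgen // coef_sd1 scalerA.
Qed.

Lemma nablaR_cls b h f : h \in dd K m n -> gl2_homog b h ->
  nablaR h (cls f) = cls (along Lop h f).
Proof.
move=> hd hb; rewrite /nablaR coproduct_cls /contractl.
rewrite (_ : (fun F => series _ _) = along (fun g => ctl (mgen g)) h); last first.
  by apply/funext=> F; apply: along_contractl.
rewrite qmap_cls; last by move=> F; apply: along_ctl_ideal hd hb.
  by congr cls; apply: eq_along => t i j; rewrite unlock.
by apply: alongD => g; apply: ctlD.
Qed.

(** The sign (-1)^(|h|(|f|+1)) is the one built into [Rop]: a twist of the argument and a global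
    sign. *)
Lemma nablaL_cls b h f : h \in dd K m n -> gl2_homog b h ->
  nablaL b h (cls f) = cls (along Rop h f).
Proof.
move=> hd hb; rewrite /nablaL.
have e q : contractr (delta h) (coproduct (part q (cls f)))
    = cls (along (fun g => ctr (mgen g)) h (cop (spart q f))).
  rewrite part_cls coproduct_cls /contractr.
  rewrite (_ : (fun F => series _ _) = along (fun g => ctr (mgen g)) h); last first.
    by apply/funext=> F; apply: along_contractr.
  rewrite qmap_cls //; last by move=> F; apply: along_ctr_ideal hd hb.
  by apply: alongD => g; apply: ctrD.
rewrite big_bool /= !e -!clsZE -clsD; congr cls.
have hc := cop_smorph K2 m n bool.
have z (c : K) F : c *: along (fun g => ctr (mgen g)) h F = along (fun g F => c *: ctr (mgen g) F) h F.
  rewrite /along; do 3 (rewrite scaler_sumr; apply: eq_bigr => ? _).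
  by rewrite !scalerA mulrC.
rewrite !z; symmetry; apply: along_sum => t i j.
have [hp|ne] := eqVneq (ip i (+) ip j) b; last by rewrite (hsel_homog t hb ne) !scale0r addr0.
rewrite -scalerDr; congr (_ *: _); rewrite unlock.
have -> : p (t, (i, j)) = b := hp.
rewrite tw_spart (smD hc) ctrD (smZ hc) ctrZ scalerDr scalerA addrC.
by case: b {hb hp}; rewrite /= ?expr0 ?expr1 ?scale1r ?mulr1 ?expr2 ?mulN1r ?opprK ?scale1r.
Qed.

End Nabla.

Section Splitting.
Variables (K : numFieldType) (m n : nat).
Local Notation dd := (dd K m n).
Local Notation gg := (gg K m n).
Local Notation bb := (bb K m n).
Lemma Rdd_decomp (X : gl2 K m n) : X \in dd -> exists x y,
  [/\ x \in bb, y \in gg, X = x + y & Rdd X = x - y].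
Proof.
move=> hX; exists (daddv_pi bb gg X), (daddv_pi gg bb X).
have e1 : (bb :&: gg = 0)%VS by rewrite capvC; apply: gg_bb_direct.
have e2 : X \in (bb + gg)%VS by rewrite addvC ggDbb.
have h1 := memv_pi bb gg X.
have h2 := memv_pi gg bb X.
have h3 := daddv_pi_add e1 e2.
split; [exact: h1|exact: h2|by symmetry; exact: h3|].
by [].
Qed.
End Splitting.

(** * Dual bases of the double and the r-matrix *)

Section Double.
Variables (R : realType) (m n : nat) (neq_mn : m <> n).
Local Notation C := (R[i]).
Local Notation V := (gl2 C m n).
Local Notation dd := (dd C m n).
Local Notation ip := (@ipar m n).
Local Notation I := 'I_(m + n).
Implicit Types (s t u v : bool) (i j c d : I) (X Y : V).

Definition sg2 t : C := if t then 'i / 2 else - ('i / 2).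
Definition dmn : C := m%:R - n%:R.

Lemma sg2_neq0 t : sg2 t != 0.
Proof.
have h : 'i / 2 != 0 :> C by rewrite mulf_neq0 ?neq0Ci // invr_neq0 // pnatr_eq0.
by rewrite /sg2; case: t; rewrite ?oppr_eq0.
Qed.

Lemma dmn_neq0 : dmn != 0.
Proof. by rewrite /dmn subr_eq0 eqr_nat; apply/eqP. Qed.

Lemma sum_signs : \sum_i (-1) ^+ ip i = dmn.
Proof.
rewrite big_split_ord /dmn; congr (_ + _).
  rewrite (eq_bigr (fun=> 1)) ?sumr_const ?card_ord // => i _.
  by rewrite /ipar /= leqNgt ltn_ord.
rewrite (eq_bigr (fun=> -1)) ?sumr_const ?card_ord ?mulNrn // => i _.
by rewrite /ipar /= leq_addr.
Qed.

Lemma scalE X Y : scal X Y =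
  \sum_t sg2 t * \sum_i \sum_j (-1) ^+ ip i * (hsel X t i j * hsel Y t j i).
Proof.
rewrite /scal big_bool /= addrC; congr (_ * _ + _ * _);
  by rewrite supertraceE; apply: eq_bigr => i _; rewrite mxE mulr_sumr.
Qed.

(** The matrix unit minus the multiple of the identity with the same supertrace; the identity has
    supertrace m - n, whence the hypothesis that m and n differ. *)
Definition proj_E t i j : V :=
  let M := \matrix_(c, d) (((c == i) && (d == j))%:R - (i == j)%:R * (-1) ^+ ip i * (c == d)%:R / dmn)
  in if t then (0, M) else (M, 0).

Lemma hsel_proj_E t i j u c d : hsel (proj_E t i j) u c d = (t == u)%:R *
  (((c == i) && (d == j))%:R - (i == j)%:R * (-1) ^+ ip i * (c == d)%:R / dmn).
Proof. by case: t; case: u; rewrite /hsel /proj_E /= !mxE ?mul1r ?mul0r. Qed.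

Lemma str_hsel X : X \in dd <-> forall t, supertrace (hsel X t) = 0.
Proof.
split=> [/mem_dd[h1 h2] []|h] //; apply/mem_dd; split; [exact: (h false)|exact: (h true)].
Qed.

Lemma sum_pick i (F : I -> C) : \sum_c (c == i)%:R * F c = F i.
Proof. by rewrite (bigD1 i) //= eqxx mul1r big1 ?addr0 // => c /negbTE ->; rewrite mul0r. Qed.

Lemma proj_E_dd t i j : proj_E t i j \in dd.
Proof.
apply/str_hsel => u; rewrite supertraceE.
have e c : (-1) ^+ ip c * hsel (proj_E t i j) u c c = (t == u)%:R *
    ((c == i)%:R * ((i == j)%:R * (-1) ^+ ip i) - (-1) ^+ ip c * ((i == j)%:R * (-1) ^+ ip i / dmn)).
  rewrite hsel_proj_E eqxx; case: (eqVneq c i) => [->|_] /=; ring.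
rewrite (eq_bigr _ (fun c _ => e c)) -mulr_sumr sumrB sum_pick -mulr_suml sum_signs.
by rewrite [dmn * _]mulrC divfK ?dmn_neq0 // subrr mulr0.
Qed.

Lemma scal_proj_E t i j Y : Y \in dd -> scal (proj_E t i j) Y = sg2 t * ((-1) ^+ ip i * hsel Y t j i).
Proof.
move=> /str_hsel hY; rewrite scalE (bigD1 t) //= [X in _ + X]big1 ?addr0; last first.
  move=> u /negbTE ne; rewrite big1 ?mulr0 // => c _; rewrite big1 // => d _.
  by rewrite hsel_proj_E eq_sym ne !mul0r mulr0.
congr (_ * _).
have e c d : (-1) ^+ ip c * (hsel (proj_E t i j) t c d * hsel Y t d c) =
    (d == j)%:R * ((c == i)%:R * ((-1) ^+ ip i * hsel Y t j i))
    - (d == c)%:R * ((-1) ^+ ip c * hsel Y t c c * ((i == j)%:R * (-1) ^+ ip i / dmn)).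
  rewrite hsel_proj_E eqxx [c == d]eq_sym.
  by case: (eqVneq d c) => [->|_]; case: (eqVneq c i) => [->|_]; case: (eqVneq _ j) => [->|_] /=; ring.
under eq_bigr => c _ do rewrite (eq_bigr _ (fun d _ => e c d)) sumrB !sum_pick.
by rewrite sumrB sum_pick -mulr_suml -supertraceE hY mul0r subr0.
Qed.

Lemma hsel_sum k (F : 'I_k -> V) t i j : hsel (\sum_a F a) t i j = \sum_a hsel (F a) t i j.
Proof.
apply: (big_morph (fun X => hsel X t i j)) => [X Y|]; last by case: t; rewrite /hsel /= !mxE.
by have := hselP 1 X Y t i j; rewrite scale1r mul1r.
Qed.

Lemma scalP a X Y Z : scal (a *: X + Y) Z = a * scal X Z + scal Y Z.
Proof.
rewrite !scalE mulr_sumr -big_split; apply: eq_bigr => t _; rewrite /= mulrCA -mulrDr; congr (_ * _).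
rewrite mulr_sumr -big_split; apply: eq_bigr => i _; rewrite /= mulr_sumr -big_split.
by apply: eq_bigr => j _; rewrite hselP /=; ring.
Qed.

Lemma scal_sum k (F : 'I_k -> V) (co : 'I_k -> C) Z :
  scal (\sum_a co a *: F a) Z = \sum_a co a * scal (F a) Z.
Proof.
have z : scal 0 Z = 0 by rewrite -[X in scal X _](addNr 0) -[- 0]scaleN1r scalP mulN1r addNr.
elim/big_rec2: _ => [//|a x X _ e]; by rewrite scalP e.
Qed.

Section Basis.
Variables (k : nat) (h hhat : k.-tuple V).
Hypotheses (h_basis : basis_of dd h) (hhat_dd : forall a, tnth hhat a \in dd).
Hypothesis hhat_dual : forall a b, scal (tnth h a) (tnth hhat b) = (a == b)%:R.

Lemma basis_dd a : tnth h a \in dd.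
Proof. by apply: (basis_mem h_basis); apply: mem_tnth. Qed.

Lemma dual_expand Y : Y \in dd -> Y = \sum_a scal Y (tnth hhat a) *: tnth h a.
Proof.
move=> hY; have e := coord_basis h_basis hY.
have c a : coord h a Y = scal Y (tnth hhat a).
  rewrite {2}e scal_sum (bigD1 a) //= -tnth_nth hhat_dual eqxx mulr1 big1 ?addr0 //.
  by move=> b /negbTE ne; rewrite -tnth_nth hhat_dual ne mulr0.
by rewrite {1}e; apply: eq_bigr => a _; rewrite c -tnth_nth.
Qed.

(** Pairing with a projected unit extracts a single entry, so expanding that unit in the basis gives
    the canonical element of the scalar product, entry by entry. *)
Lemma completeness t i j u c d :
  \sum_a hsel (tnth hhat a) t j i * hsel (tnth h a) u c d =
  (sg2 t)^-1 * (-1) ^+ ip i * hsel (proj_E t i j) u c d.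
Proof.
rewrite {1}(dual_expand (proj_E_dd t i j)) hsel_sum mulr_sumr; apply: eq_bigr => a _.
have -> : scal (proj_E t i j) (tnth hhat a) *: tnth h a = scal (proj_E t i j) (tnth hhat a) *: tnth h a + 0.
  by rewrite addr0.
rewrite hselP scal_proj_E // [hsel 0 _ _ _](_ : _ = 0) ?addr0; last by case: u; rewrite /hsel /= mxE.
have sq : (-1) ^+ ip i * (-1) ^+ ip i = 1 :> C by rewrite -signr_addb addbb.
transitivity ((sg2 t)^-1 * sg2 t * ((-1) ^+ ip i * (-1) ^+ ip i)
    * (hsel (tnth hhat a) t j i * hsel (tnth h a) u c d)); last by ring.
by rewrite sq mulVf ?sg2_neq0 // !mul1r.
Qed.

End Basis.

(* (Rdd X)_v = sum_t rcoef v t c d X_t, entry by entry. *)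
Definition rcoef v t c d : C :=
  if v == t then (if v then (c < d)%N%:R - (d < c)%N%:R else (d < c)%N%:R - (c < d)%N%:R)
  else - (c == d)%:R - 2 * (if v then (c < d)%N%:R else (d < c)%N%:R).

Lemma hsel_Rdd X v c d : X \in dd -> hsel (Rdd X) v c d = \sum_t rcoef v t c d * hsel X t c d.
Proof.
move=> hX; have [x [y [hx hy eX eR]]] := Rdd_decomp hX.
have [_ e1] := mem_gg _ hy; have [_ h1 h2 h3] := mem_bb _ hx.
have ex t : hsel X t c d = hsel x t c d + y.1 c d.
  by rewrite eX; case: t; rewrite /hsel /= mxE // -e1.
have er : hsel (Rdd X) v c d = hsel x v c d - y.1 c d.
  by rewrite eR; case: v; rewrite /hsel /= !mxE // -e1.
under eq_bigr do rewrite ex.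
(* Above the diagonal the y part of x vanishes, below it the z part, and on it the two parts are
   opposite; each case determines x and y from the two entries of X. *)
rewrite er big_bool /rcoef /= -(inj_eq val_inj) /=.
case: (ltngtP c d) => [lt|lt|/val_inj e].
- have z : x.1 c d = 0 by apply: h1.
  by case: v {er}; rewrite /hsel /= z; ring.
- have z : x.2 c d = 0 by apply: h2.
  by case: v {er}; rewrite /hsel /= z; ring.
have z : x.2 c d = - x.1 c d.
  by apply/eqP; rewrite -addr_eq0 addrC e; apply/eqP/h3.
by case: v {er}; rewrite /hsel /= z; ring.
Qed.

(** The scalar 2i comes from inverting the coefficients -i/2 and i/2 of the scalar product; its
    factor 2 meets the 1/2 in front of the bracket. *)
Lemma rcoef_w0 u v c d : rcoef v u d c * ((sg2 u)^-1 * (-1) ^+ ip c) = 2 * w0 'i u v c d.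
Proof.
have e : (sg2 u)^-1 = 'i * 2 * (-1) ^+ u.
  have e2 : sg2 u * ('i * 2 * (-1) ^+ u) = 1.
    transitivity ('i * 'i * (2^-1 * 2) * (-1) ^+ u * (if u then 1 else -1) : C).
      by rewrite /sg2; case: (u); ring.
    rewrite -expr2 sqrCi mulVf ?pnatr_eq0 //; case: (u); rewrite ?expr0 ?expr1; ring.
  by apply: (mulfI (sg2_neq0 u)); rewrite e2 mulfV ?sg2_neq0.
rewrite e /w0 /om0 /rcoef /index_sign -(inj_eq val_inj) /=.
case: (ltngtP c d) => _; case: u {e}; case: v; rewrite /= ?expr0 ?expr1; ring.
Qed.

Section RMatrix.
Variables (k : nat) (h hhat : k.-tuple V) (par : 'I_k -> bool).
Hypotheses (h_basis : basis_of dd h) (h_homog : forall a, gl2_homog (par a) (tnth h a)).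
Hypotheses (hhat_dd : forall a, tnth hhat a \in dd).
Hypothesis hhat_dual : forall a b, scal (tnth h a) (tnth hhat b) = (a == b)%:R.

(** The canonical element with [Rdd] applied to its second leg: a multiple of the pair of opposite
    units, minus a purely diagonal correction from the projection. *)
Lemma tensor_Rdd u c d v i j :
  \sum_a hsel (tnth h a) u c d * hsel (Rdd (tnth hhat a)) v i j =
  rcoef v u i j * ((sg2 u)^-1 * (-1) ^+ ip j) *
    (((c == j) && (d == i))%:R - (j == i)%:R * (-1) ^+ ip j * (c == d)%:R / dmn).
Proof.
transitivity (\sum_t rcoef v t i j * \sum_a hsel (tnth hhat a) t i j * hsel (tnth h a) u c d).
  under [RHS]eq_bigr do rewrite mulr_sumr; rewrite exchange_big /=.
  apply: eq_bigr => a _; rewrite hsel_Rdd // mulr_sumr; apply: eq_bigr => t _; ring.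
rewrite (bigD1 u) //= [X in _ + X]big1 ?addr0; last first.
  move=> t /negbTE ne; rewrite (completeness h_basis hhat_dd hhat_dual) hsel_proj_E ne.
  by rewrite mul0r !mulr0.
by rewrite (completeness h_basis hhat_dd hhat_dual) hsel_proj_E eqxx mul1r mulrA.
Qed.

End RMatrix.

End Double.

(** * The bracket of the theorem as a bracket with standard weight *)

Section BracketFormula.
Variables (R : realType) (m n : nat) (neq_mn : m <> n).
Local Notation C := (R[i]).
Local Notation V := (gl2 C m n).
Local Notation dd := (dd C m n).
Local Notation ip := (@ipar m n).
Local Notation I := 'I_(m + n).
Local Notation A := (fps C m n bool).
Local Notation gT := (gens m n bool).
Local Notation K2 := (@num_tors C).
Implicit Types (f g : A) (x y : gT).

Definition hx (X : V) x : C := hsel X x.1 x.2.1 x.2.2.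

Lemma alongE (O : gT -> A -> A) X f : along O X f = \sum_x hx X x *: O x f.
Proof.
rewrite /along; under eq_bigr do rewrite pair_bigA.
by rewrite pair_bigA; apply: eq_bigr => -[t [i j]].
Qed.

Lemma big_gens (F : gT -> A) : \sum_x F x = \sum_s \sum_a \sum_b F (s, (a, b)).
Proof.
under [RHS]eq_bigr do rewrite pair_bigA.
by rewrite pair_bigA; apply: eq_bigr => -[t [i j]].
Qed.

Lemma brO_gens (O : gT -> A -> A) W f g : brO O W f g = \sum_x \sum_y
  (((x.2.1 == y.2.2) && (x.2.2 == y.2.1))%:R * W x.1 y.1 x.2.1 x.2.2) *:
    (O x (tw (@gpar m n bool x) f) * O y g).
Proof.
rewrite big_gens /brO; apply: eq_bigr => s _.
rewrite exchange_big /=; apply: eq_bigr => a _; rewrite exchange_big /=; apply: eq_bigr => b _.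
rewrite big_gens /=; apply: eq_bigr => t _.
rewrite (bigD1 b) //= [X in _ + X]big1 ?addr0 => [|c]; last first.
  rewrite eq_sym => /negbTE ne; rewrite big1 // => d _.
  by rewrite ne andbF mul0r scale0r.
rewrite (bigD1 a) //= !eqxx mul1r big1 ?addr0 // => d.
by rewrite eq_sym => /negbTE ne; rewrite ne mul0r scale0r.
Qed.

Lemma diag_gens (O O' : gT -> A -> A) (co : bool -> bool -> C) f g : \sum_x \sum_y
  (((x.2.1 == x.2.2) && (y.2.1 == y.2.2))%:R * co x.1 y.1) *: (O x f * O' y g) =
  \sum_u \sum_v co u v *: ((\sum_c O (u, (c, c)) f) * (\sum_d O' (v, (d, d)) g)).
Proof.
have e (F : gT -> A) : \sum_x (x.2.1 == x.2.2)%:R *: F x = \sum_u \sum_c F (u, (c, c)).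
  rewrite big_gens; apply: eq_bigr => u _; apply: eq_bigr => c _.
  rewrite (bigD1 c) //= eqxx scale1r big1 ?addr0 // => d.
  by rewrite eq_sym => /negbTE ->; rewrite scale0r.
transitivity (\sum_x (x.2.1 == x.2.2)%:R *: \sum_y (y.2.1 == y.2.2)%:R *: (co x.1 y.1 *: (O x f * O' y g))).
  apply: eq_bigr => x _; rewrite scaler_sumr; apply: eq_bigr => y _.
  by rewrite !scalerA -natrM mulnb.
under eq_bigr do rewrite e.
rewrite e; apply: eq_bigr => u _; rewrite exchange_big; apply: eq_bigr => v _ /=.
rewrite mulr_suml scaler_sumr; apply: eq_bigr => c _; rewrite mulr_sumr scaler_sumr.
by apply: eq_bigr.
Qed.

Variables (k : nat) (h hhat : k.-tuple V) (par : 'I_k -> bool).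
Hypotheses (h_basis : basis_of dd h) (h_homog : forall a, gl2_homog (par a) (tnth h a)).
Hypotheses (hhat_dd : forall a, tnth hhat a \in dd).
Hypothesis hhat_dual : forall a b, scal (tnth h a) (tnth hhat b) = (a == b)%:R.

Lemma along_lin (O : gT -> A -> A) (co : 'I_k -> C) (F : 'I_k -> V) g :
  along O (\sum_b co b *: F b) g = \sum_b co b *: along O (F b) g.
Proof.
rewrite alongE; under [RHS]eq_bigr do rewrite alongE scaler_sumr.
rewrite exchange_big /=; apply: eq_bigr => x _; rewrite /hx hsel_sum scaler_suml.
apply: eq_bigr => b _; have := hselP (co b) (F b) 0 x.1 x.2.1 x.2.2.
rewrite addr0 => ->; rewrite [hsel 0 _ _ _](_ : _ = 0) ?addr0 ?scalerA //.
by case: (x.1); rewrite /hsel /= mxE.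
Qed.

(** The coefficient of the diagonal correction: on diagonal entries [Rdd] acts only by exchanging
    the copies, with a sign. *)
Definition kappa u v : C := (sg2 R u)^-1 / dmn R m n * (v != u)%:R.

Lemma rcoef_diag u v (c : I) : rcoef R v u c c = - (v != u)%:R.
Proof. by rewrite /rcoef ltnn eqxx; case: (v); case: (u); rewrite /=; ring. Qed.

(** Applied to both families of fields. The correction involves them only through sums over diagonal
    units, hence is the same for both. *)
Lemma frame (O : gT -> A -> A) f g : (forall x, sderiv id (@gpar m n bool x) 1 id (O x)) ->
  \sum_(q : bool) \sum_(a < k) \sum_(b < k)
    ((-1) ^+ (q * par a)%N * scal (Rdd (tnth hhat a)) (tnth hhat b)) *:
      (along O (tnth h a) (spart q f) * along O (tnth h b) g)
  = (2 : C) *: brO O (w0 'i) f g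
    + \sum_u \sum_v kappa u v *: ((\sum_c O (u, (c, c)) f) * (\sum_d O (v, (d, d)) g)).
Proof.
move=> hO; pose Ot x f := O x (tw (@gpar m n bool x) f).
have parts a : \sum_(q : bool) (-1) ^+ (q * par a)%N *: along O (tnth h a) (spart q f)
    = along Ot (tnth h a) f.
  rewrite big_bool /= mul0n mul1n expr0 scale1r addrC; symmetry.
  have z (c : C) u : c *: along O (tnth h a) u = along (fun x u => c *: O x u) (tnth h a) u.
    by rewrite !alongE scaler_sumr; apply: eq_bigr => x _; rewrite !scalerA mulrC.
  rewrite z; apply: along_sum => t i j; rewrite /Ot.
  have [hp|ne] := eqVneq (ip i (+) ip j) (par a).
    have -> : @gpar m n bool (t, (i, j)) = par a := hp.
    by rewrite tw_spart (sdD (hO _)) (sdZ (hO _)) scalerDr.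
  by rewrite (hsel_homog t (h_homog a) ne) !scale0r addr0.
have hR a : Rdd (tnth hhat a) \in dd.
  have [x [y [/mem_bb[hx' _ _ _] /mem_gg[hy _] _ ->]]] := Rdd_decomp (hhat_dd a).
  by apply: rpredB.
rewrite exchange_big /=.
(* The sum over b rebuilds [Rdd (tnth hhat a)] from its coordinates, which are its scalar products
   with the dual basis; the sum over q turns the sign into a twist. *)
transitivity (\sum_(a < k) along Ot (tnth h a) f * along O (Rdd (tnth hhat a)) g).
  apply: eq_bigr => a _; rewrite -parts mulr_suml; apply: eq_bigr => q _.
  rewrite (dual_expand h_basis hhat_dual (hR a)) along_lin mulr_sumr; apply: eq_bigr => b _.
  by rewrite -(dual_expand h_basis hhat_dual (hR a)) -sps_scalerAl -sps_scalerAr scalerA.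
transitivity (\sum_x \sum_y (\sum_(a < k) hx (tnth h a) x * hx (Rdd (tnth hhat a)) y) *: (Ot x f * O y g)).
  under [RHS]eq_bigr do (under eq_bigr do rewrite scaler_suml; rewrite exchange_big /=).
  rewrite exchange_big /=; apply: eq_bigr => a _; rewrite !alongE mulr_suml; apply: eq_bigr => x _.
  by rewrite mulr_sumr; apply: eq_bigr => y _; rewrite -sps_scalerAl -sps_scalerAr scalerA.
have e2 x u : @gpar m n bool x = false -> Ot x u = O x u by move=> e; rewrite /Ot e twF.
rewrite brO_gens scaler_sumr.
transitivity (\sum_u \sum_v kappa u v *: ((\sum_c Ot (u, (c, c)) f) * (\sum_d O (v, (d, d)) g)) +
  \sum_x (2 : C) *: (\sum_y (((x.2.1 == y.2.2) && (x.2.2 == y.2.1))%:R * w0 'i x.1 y.1 x.2.1 x.2.2) *: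
    (Ot x f * O y g))); last first.
  rewrite addrC; congr (_ + _).
  apply: eq_bigr => u _; apply: eq_bigr => v _.
  rewrite (_ : \sum_c Ot (u, (c, c)) f = \sum_c O (u, (c, c)) f) //.
  by apply: eq_bigr => c _; apply: e2; rewrite /gpar /= addbb.
rewrite -diag_gens -big_split; apply: eq_bigr => x _ /=; rewrite scaler_sumr -big_split.
apply: eq_bigr => y _ /=; rewrite scalerA -scalerDl; congr (_ *: _).
rewrite /hx (tensor_Rdd neq_mn h_basis hhat_dd hhat_dual).
move: x y => [u [c d]] [v [i j]] /=; rewrite mulrBr [RHS]addrC; congr (_ + _).
  case: (altP andP) => [[/eqP e4 /eqP e5]|_]; last by rewrite mulr0 mul0r mulr0.
  by rewrite -e4 -e5 mulr1 mul1r; apply: rcoef_w0.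
rewrite [i == j]eq_sym; case: (eqVneq j i) => [->|_]; last by rewrite andbF !mul0r mulr0 oppr0.
case: (eqVneq c d) => [_|_]; last by rewrite mulr0 !mul0r mulr0 oppr0.
have sq : (-1) ^+ ip i * (-1) ^+ ip i = 1 :> C by rewrite -signr_addb addbb.
rewrite rcoef_diag /kappa !mul1r mulr1.
transitivity ((sg2 R u)^-1 / dmn R m n * (v != u)%:R * ((-1) ^+ ip i * (-1) ^+ ip i)); first by ring.
by rewrite sq mulr1.
Qed.

Lemma bracketE : bracket h hhat par = brS (w0 'i).
Proof.
apply/funext=> u; apply/funext=> v; rewrite -[u]repK -[v]repK; move: (rep u) (rep v) => f g.
rewrite (brS_cls _ _ (@w0_sym C m n 'i) (@w0_central C m n 'i)) /bracket.
have e q a b : (nablaL (par a) (tnth h a) (part q (cls f)) * nablaL (par b) (tnth h b) (cls g)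
     - nablaR (tnth h a) (part q (cls f)) * nablaR (tnth h b) (cls g)) =
   cls (along Rop (tnth h a) (spart q f) * along Rop (tnth h b) g
     - along Lop (tnth h a) (spart q f) * along Lop (tnth h b) g).
  have hd c := basis_dd h_basis c.
  rewrite part_cls !(nablaL_cls _ (hd _) (h_homog _)).
  by rewrite (nablaR_cls _ (hd a) (h_homog a)) (nablaR_cls _ (hd b) (h_homog b)) clsB !clsME.
transitivity (cls ((2^-1 : C) *: \sum_(q : bool) \sum_(a < k) \sum_(b < k)
    ((-1) ^+ (q * par a)%N * scal (Rdd (tnth hhat a)) (tnth hhat b)) *:
      (along Rop (tnth h a) (spart q f) * along Rop (tnth h b) g
     - along Lop (tnth h a) (spart q f) * along Lop (tnth h b) g))).
  rewrite clsZE; congr (_ *: _); rewrite cls_sum; apply: eq_bigr => q _.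
  rewrite cls_sum; apply: eq_bigr => a _; rewrite cls_sum; apply: eq_bigr => b _.
  by rewrite clsZE e.
congr cls.
under eq_bigr do (under eq_bigr do (under eq_bigr do rewrite scalerBr; rewrite sumrB); rewrite sumrB).
rewrite sumrB (frame f g (fun x => Rop_deriv K2 x)) (frame f g (fun x => Lop_deriv K2 x)).
have -> : \sum_u0 \sum_v0 kappa u0 v0 *: ((\sum_c Rop (u0, (c, c)) f) * (\sum_d Rop (v0, (d, d)) g))
    = \sum_u0 \sum_v0 kappa u0 v0 *: ((\sum_c Lop (u0, (c, c)) f) * (\sum_d Lop (v0, (d, d)) g)).
  by do 2 (apply: eq_bigr => ? _); rewrite !euler_LR.
(* The Euler terms cancel and the factor 1/2 of the bracket absorbs the 2 in [frame]. *)
rewrite opprD addrACA subrr addr0 -scalerBr scalerA mulVf ?pnatr_eq0 // scale1r.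
by rewrite -brWE.
Qed.

End BracketFormula.

Theorem theorem3p1 (R : realType) (m n : nat) (neq_mn : m <> n)
    (k : nat) (h hhat : k.-tuple (gl2 R[i] m n)) (par : 'I_k -> bool)
    (h_basis : basis_of (dd R[i] m n) h)
    (h_homog : forall a, gl2_homog (par a) (tnth h a))
    (hhat_dd : forall a, tnth hhat a \in dd R[i] m n)
    (hhat_dual : forall a b, scal (tnth h a) (tnth hhat b) = (a == b)%:R) :
  [/\ poisson_lie (bracket h hhat par),
      poisson_ideal (bracket h hhat par) (@idealI R[i] m n) /\
      poisson_ideal (bracket h hhat par) (@idealJ R[i] m n) &
      forall f g, bracket h hhat par (star f) (star g)
                    = star (bracket h hhat par f g)].
Proof.
rewrite (bracketE neq_mn h_basis h_homog hhat_dd hhat_dual); split.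
- exact: brS_poisson_lie.
- by split; [apply: poisson_idealI|apply: poisson_idealJ].
- by apply: star_brS; apply: conjCi.
Qed.
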